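(* Fix $k\in\mathbb N\cup\{\infty\}$ (with $k\geq 1$) and let $Q\in\mathcal A_k$. For $R>0$ let $N_Q(R)$ denote the number of real zeros of $Q$ on $[0,R]$. For any positive integer $m$ with $m\le k$, there are bounded functions $\theta_m^Q,\lambda_m^Q:[0,\infty)\to\mathbb R$ such that $$s_m[N_Q(R)]=R\,\theta_m^Q(R)+\lambda_m^Q(R).$$ Furthermore, there exist finite constants $\theta_{m,\infty}^Q$, $\lambda_{m,\infty}^Q$ and a function $\psi\in\Psi_k$, independent of $R$, such that, as $R\to\infty$, $$\theta_m^Q(R)=\theta_{m,\infty}^Q+O\Big(\int_R^\infty\psi(x)x^{m-2}\,dx\Big),\qquad \lambda_m^Q(R)=\lambda_{m,\infty}^Q+O\Big(\int_R^\infty\psi(x)x^{m-1}\,dx\Big).$$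
   Context: $s_m[X]$ is the $m$th cumulant of $X$. A real Gaussian analytic function (real GAF) is $Q(z)=\sum_{j\ge0}\omega_jq_j(z)$, $z\in\mathbb C$, where $\omega_j$ are i.i.d. standard real Gaussians and $q_j$ are analytic functions on $\mathbb C$, real-valued on $\mathbb R$, such that $\sum_j|q_j(z)|^2<\infty$ uniformly on compact subsets of $\mathbb C$. Linear functionals: for $\mathbf z=(x_1,y_1,\dots,x_k,y_k)\in\mathbb R^{2k}$, $\boldsymbol\xi=(\xi_1,\dots,\xi_k)\in\mathbb R^k$ and $I\subset\{1,\dots,k\}$, $L_I^{\mathbf z}Q(\boldsymbol\xi_I)=\sum_{j\in I}[x_jQ(\xi_j)+y_jQ'(\xi_j)]$, where $\boldsymbol\xi_I=(\xi_i)_{i\in I}$. For nonempty $I,J$, $d(\boldsymbol\xi_I,\boldsymbol\xi_J)=\inf_{i\in I,j\in J}|\xi_i-\xi_j|$. $\Psi_k$ is the set of non-increasing functions $\psi:[0,\infty)\to[0,\infty)$ with $\int_0^\infty\psi(x)x^{k-1}dx<\infty$; $\Psi_\infty=\bigcap_{k\ge1}\Psi_k$. $Q$ is $2k$-nondegenerate if for any distinct real points $\zeta_1,\dots,\zeta_r$ and positive integers $m_1,\dots,m_r$ with $m_1+\dots+m_r\le 2k$, no nontrivial real linear combination of the random variables $Q^{(l)}(\zeta_i)$, $1\le i\le r$, $0\le l<m_i$, vanishes almost surely. For a positive integer $k$, $\mathcal A_k$ is the set of real GAFs $Q$ such that: (H1) $Q$ is $2k$-nondegenerate. (H2) For each $x\in\mathbb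 R$ there is a deterministic function $Q_x:\mathbb R\to(0,\infty)$ such that $\mathbb E[Q_x(t)Q(t+x)Q_x(s)Q(s+x)]=\mathbb E[Q(t)Q(s)]$ for all $t,s\in\mathbb R$. (H3) There exist finite positive constants $c_k,\tau_k$ and a function $\psi\in\Psi_k$ such that for all $\mathbf z\in\mathbb R^{2k}$, $\boldsymbol\xi\in\mathbb R^k$ and every partition $\{1,\dots,k\}=I\cup J$ into disjoint nonempty sets with $d:=d(\boldsymbol\xi_I,\boldsymbol\xi_J)\ge2\tau_k$, $$\big|\mathbb E[L_I^{\mathbf z}Q(\boldsymbol\xi_I)L_J^{\mathbf z}Q(\boldsymbol\xi_J)]\big|\le c_k\psi(d-\tau_k)\big(\mathbb E[|L_I^{\mathbf z}Q(\boldsymbol\xi_I)|^2]+\mathbb E[|L_J^{\mathbf z}Q(\boldsymbol\xi_J)|^2]\big).$$ $\mathcal A_\infty=\bigcap_{k\ge1}\mathcal A_k$. *)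

(* Defs.v *)
From HB Require Import structures.
From mathcomp Require Import all_boot all_order all_algebra.
From mathcomp Require Import complex.
From mathcomp Require Import all_classical all_reals all_analysis.

Set Implicit Arguments.
Unset Strict Implicit.
Unset Printing Implicit Defensive.

Import Order.TTheory GRing.Theory Num.Theory.
Import numFieldNormedType.Exports.
Import ComplexField.

Local Open Scope complex_scope.
Local Open Scope classical_set_scope.
Local Open Scope ring_scope.

Section probability_notions.
Context (d : measure_display) (T : measurableType d) (R : realType)
  (P : probability T R).

Definition mutually_independent (X : nat -> T -> R) : Prop :=
  forall (s : seq nat) (A : nat -> set R), uniq s ->
    (forall j, measurable (A j)) ->
    P (\bigcap_(j in [set` s]) (X j @^-1` A j)) =
    (\prod_(j <- s) P (X j @^-1` A j))%E.

(* s_m[X] through the moment-cumulant formula (the sum runs over the set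
   partitions of {1, ..., m}); it is meaningful when E[|X|^m] < +oo. *)
Definition cumulant (m : nat) (X : T -> \bar R) : R :=
  \sum_(p : {set {set 'I_m}} | finset.partition p (finset.setT : {set 'I_m}))
    (-1) ^+ #|p|.-1 * (#|p|.-1)`!%:R *
    \prod_(B in p) fine (\int[P]_w (X w ^+ #|B|)%E)%E.

(* [(R[i])^o] is the complex plane with its normed topology; [derivable _ z 1]
   over it is complex differentiability at [z]. *)
Record real_gaf := RealGAF {
  gaf_coef : nat -> {RV P >-> R};
  gaf_fun : nat -> R[i] -> R[i];
  gaf_indep : mutually_independent (fun j => gaf_coef j : T -> R);
  gaf_normal : forall (j : nat) (A : set R), measurable A ->
    distribution P (gaf_coef j) A = normal_prob (0 : R) 1 A;
  gaf_entire : forall (j : nat) (z : R[i]),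
    derivable (gaf_fun j : (R[i])^o -> (R[i])^o) z 1;
  gaf_real : forall (j : nat) (x : R), complex.Im (gaf_fun j x%:C) = 0;
  gaf_unif : exists S : (R[i])^o -> R,
    forall K : set (R[i])^o, compact K ->
      {uniform K, (fun (n : nat) (z : (R[i])^o) =>
         \sum_(j < n) Normc.normc (gaf_fun j z) ^+ 2) @ \oo --> S}
}.

(* The random series converges almost surely, simultaneously for all z; on the
   exceptional null event [lim] takes an arbitrary value. *)
Definition gaf (Q : real_gaf) (w : T) (z : R[i]) : R[i] :=
  lim ((fun n : nat =>
    (\sum_(j < n) (gaf_coef Q j w)%:C * gaf_fun Q j z : (R[i])^o)) @ \oo).

Definition gafR (Q : real_gaf) (w : T) (x : R) : R := complex.Re (gaf Q w x%:C).

Definition real_zeros (Q : real_gaf) (r : R) (w : T) : \bar R :=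
  counting [set x : R | 0 <= x <= r /\ gafR Q w x = 0].

Definition linfun_on (Q : real_gaf) (k : nat) (x y xi : 'I_k -> R)
    (I : {set 'I_k}) (w : T) : R :=
  \sum_(j in I) (x j * gafR Q w (xi j) + y j * derive1 (gafR Q w) (xi j)).

Definition index_dist (k : nat) (xi : 'I_k -> R) (I J : {set 'I_k}) : R :=
  inf [set `|xi i - xi j| | i in [set` I] & j in [set` J]].

Definition Psi_fin (k : nat) (psi : R -> R) : Prop :=
  [/\ forall x : R, 0 <= x -> 0 <= psi x,
      forall x y : R, 0 <= x -> x <= y -> psi y <= psi x &
      (\int[lebesgue_measure]_(x in `[0%R, +oo[) (psi x * x ^+ k.-1)%:E
         < +oo)%E].

Definition nondegenerate_gaf (n : nat) (Q : real_gaf) : Prop :=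
  forall (r : nat) (zeta : 'I_r -> R) (m : 'I_r -> nat),
    injective zeta -> (forall i, (0 < m i)%N) -> (\sum_i m i <= n)%N ->
    forall c : 'I_r -> nat -> R,
      (exists i l, (l < m i)%N /\ c i l != 0) ->
      ~ {ae P, forall w,
           \sum_i \sum_(l < m i) c i l * derive1n l (gafR Q w) (zeta i) = 0}.

Definition stationary_up_to_factor (Q : real_gaf) : Prop :=
  forall x : R, exists Qx : R -> R,
    (forall t, 0 < Qx t) /\
    forall t s : R,
      ('E_P[fun w => (Qx t * gafR Q w (t + x) * (Qx s * gafR Q w (s + x)))%R])%E =
      ('E_P[fun w => (gafR Q w t * gafR Q w s)%R])%E.

Definition clustering (k : nat) (Q : real_gaf) : Prop :=
  exists (c tau : R) (psi : R -> R),
    [/\ 0 < c, 0 < tau, Psi_fin k psi &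
      forall (x y xi : 'I_k -> R) (I J : {set 'I_k}),
        I != finset.set0 -> J != finset.set0 ->
        I :&: J = finset.set0 -> I :|: J = finset.setT ->
        2 * tau <= index_dist xi I J ->
        (`| 'E_P[fun w => (linfun_on Q x y xi I w * linfun_on Q x y xi J w)%R] |
         <= (c * psi (index_dist xi I J - tau))%:E *
            ('E_P[fun w => (`|linfun_on Q x y xi I w| ^+ 2)%R] +
             'E_P[fun w => (`|linfun_on Q x y xi J w| ^+ 2)%R]))%E].

Definition class_A_fin (k : nat) (Q : real_gaf) : Prop :=
  [/\ nondegenerate_gaf (2 * k) Q, stationary_up_to_factor Q & clustering k Q].

(* Indices in N u {oo} are encoded by [option nat], with [None] for oo. *)
Definition Psi (k : option nat) (psi : R -> R) : Prop :=
  if k is Some n then Psi_fin n psi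
  else forall n : nat, (0 < n)%N -> Psi_fin n psi.

Definition class_A (k : option nat) (Q : real_gaf) : Prop :=
  if k is Some n then class_A_fin n Q
  else forall n : nat, (0 < n)%N -> class_A_fin n Q.

Definition le_index (m : nat) (k : option nat) : Prop :=
  if k is Some n then (m <= n)%N else True.

End probability_notions.

Definition bounded_nonneg (R : realType) (f : R -> R) : Prop :=
  exists M : R, forall r : R, 0 <= r -> `|f r| <= M.

(* [m] may be 1, so the exponent is an integer. *)
Definition tail_integral (R : realType) (psi : R -> R) (e : int) (r : R) : R :=
  \int[lebesgue_measure]_(x in `[r, +oo[) (psi x * x ^ e).

(* The Landau notations of landau.v need a canonical [filter_on] structure,
   which [pinfty_nbhs] does not have. *)
Definition bigO_at_infinity (R : realType) (f g : R -> R) : Prop :=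
  exists C : R, \forall r \near +oo_R, `|f r| <= C * `|g r|.

(* Main.v *)
(* Kac's formula with a Cauchy kernel writes joint zero counts of far apart intervals through jets
   whose covariance is, by clustering, close to block diagonal, so joint moments nearly factor. Cutting
   [0, r+a+b] into a, m pieces of r/m, b and expanding the m-th cumulant kappa, every term that meets
   both ends misses some piece, hence the second difference of kappa is small. Summing second
   differences gives kappa(r) = r theta + lambda + o(1); psi is the envelope of these differences. *)
From HB Require Import structures.
Require Import Defs.
From mathcomp Require Import all_boot all_order all_algebra.
From mathcomp Require complex.
From mathcomp Require Import all_classical all_reals all_analysis.
From mathcomp Require Import measurable_realfun ring lra.
Set Implicit Arguments.
Unset Strict Implicit.
Unset Printing Implicit Defensive.
Import Order.TTheory GRing.Theory Num.Theory.
Import numFieldNormedType.Exports.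

Local Open Scope classical_set_scope.
Local Open Scope ring_scope.

Local Notation mfun := (measurable_fun setT).
Local Notation mR := measurableTypeR.

(** Clustering controls covariance forms only up to a relative error, while zero counts are
    discontinuous functionals of the path. Relative errors are what Gaussian laws tolerate: if A <=
    B <= L A as quadratic forms, the expectation of a product of nonnegative test functions under A
    is at most a factor sqrt L per coordinate times that under B. Each coordinate is one jet
    component, so the loss does not depend on where the points lie, and no determinant of the jets
    has to be bounded below. Laws are known only through characteristic functions, which admits
    degenerate vectors; the test functions are limits of trigonometric polynomials. Integrability of
    powers of the zero count comes from a Jensen type bound for entire series. Stationarity of the
    counts comes from void probabilities, since the deterministic positive factor in the covariance
    identity does not move zeros. The final psi is built from the cumulants themselves because for k
    = oo clustering offers a different function at each level, while a single one has to belong to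
    every class. *)

Definition bmeas d (T : measurableType d) (R : realType)
    (f : T -> R) : Prop :=
  mfun f /\ exists M : R, forall w, `|f w| <= M.

(** The phase [b] lets one real identity carry both the real and the imaginary part of the
    characteristic function. This is how i.i.d. standard normals are used once the almost sure
    convergence of the random series is settled. *)
Definition std_normal_sums d (T : measurableType d) (R : realType) (P : probability T R) (X : nat -> T -> R) :=
  forall n (c : nat -> R) b, \int[P]_w cos (\sum_(j < n) c j * X j w + b) =
    expR (- ((\sum_(j < n) c j ^+ 2) / 2)) * cos b.

(** * Expectations of bounded measurable functions *)

Section bounded_expectation.
Context d (T : measurableType d) (R : realType)
  (P : probability T R).
Implicit Types f g : T -> R.

Lemma bmeas_integrable f : bmeas f -> P.-integrable setT (EFin \o f).
Proof.
move=> [mf [M hM]]. apply: (@le_integrable _ _ _ P setT measurableT _ (EFin \o cst `|M|)).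
- exact/measurable_EFinP.
- move=> w _ /=; rewrite lee_fin normr_id. exact: le_trans (hM w) (ler_norm _).
- exact: finite_measure_integrable_cst.
Qed.

Lemma bmeas_cst c : bmeas (fun _ : T => c : R).
Proof. by split; [exact: measurable_cst|exists `|c|]. Qed.

Lemma bmeasD f g : bmeas f -> bmeas g -> bmeas (fun w => f w + g w).
Proof.
move=> [mf [M hM]] [mg [N hN]]; split; first exact: measurable_funD. by exists (M + N) => w; rewrite (le_trans (ler_normD _ _))// lerD.
Qed.

Lemma bmeasM f g : bmeas f -> bmeas g -> bmeas (fun w => f w * g w).
Proof.
move=> [mf [M hM]] [mg [N hN]]; split; first exact: measurable_funM. by exists (M * N) => w; rewrite normrM ler_pM.
Qed.

Lemma bmeasZ c f : bmeas f -> bmeas (fun w => c * f w).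
Proof. by move=> ?; apply: bmeasM => //; exact: bmeas_cst. Qed.

Lemma bmeasN f : bmeas f -> bmeas (fun w => - f w).
Proof.
move=> [mf [M hM]]; split; first exact: measurableT_comp. by exists M => w; rewrite normrN.
Qed.

Lemma bmeasB f g : bmeas f -> bmeas g -> bmeas (fun w => f w - g w).
Proof. by move=> ? ?; apply: bmeasD => //; exact: bmeasN. Qed.

Lemma bmeas_cos f : mfun f -> bmeas (fun w => cos (f w)).
Proof.
move=> mf; split; first by apply: measurableT_comp => //; apply: continuous_measurable_fun; exact: continuous_cos.
by exists 1 => w; rewrite ler_norml cos_geN1 cos_le1.
Qed.

Lemma bmeas_cos_affine (Z : T -> R) c b : mfun Z -> bmeas (fun w => cos (c * Z w + b)).
Proof. by move=> mZ; apply: bmeas_cos; apply: measurable_funD => //; exact: measurable_funM. Qed.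

Lemma ExD f g : bmeas f -> bmeas g ->
  \int[P]_w (f w + g w) = \int[P]_w f w + \int[P]_w g w.
Proof. by move=> /bmeas_integrable ? /bmeas_integrable ?; rewrite RintegralD. Qed.

Lemma ExZ c f : bmeas f -> \int[P]_w (c * f w) = c * \int[P]_w f w.
Proof. by move=> /bmeas_integrable ?; rewrite RintegralZl. Qed.

Lemma Ex_cst c : \int[P]_w (c : R) = c.
Proof. by rewrite Rintegral_cst//= [X in fine X](@probability_setT _ _ _ P) mulr1. Qed.

Lemma Ex_fin f : bmeas f -> (\int[P]_w (f w)%:E = (\int[P]_w f w)%:E)%E.
Proof. by move=> /bmeas_integrable /(integrable_fin_num measurableT) h; rewrite fineK. Qed.

Lemma le_Ex f g : bmeas f -> bmeas g -> (forall w, f w <= g w) ->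
  \int[P]_w f w <= \int[P]_w g w.
Proof. by move=> /bmeas_integrable ? /bmeas_integrable ? fg; apply: le_Rintegral. Qed.

Lemma Ex_bounded_cvg (F : nat -> T -> R) f (M : R) :
  (forall n, mfun (F n)) ->
  (forall n w, `|F n w| <= M) ->
  (forall w, F n w @[n --> \oo] --> f w) ->
  bmeas f /\ \int[P]_w F n w @[n --> \oo] --> \int[P]_w f w.
Proof.
move=> mF hM cF. have mf : mfun f.
  by apply: (@measurable_fun_cvg _ _ _ _ F) => //= w _; exact: cF.
have bf w : `|f w| <= M.
  have : `|F n w| @[n --> \oo] --> `|f w| by apply: cvg_norm; exact: cF. move=> /cvgP h. have e : limn (fun n => `|F n w|) = `|f w|.
    by apply/cvg_lim => //; apply: cvg_norm; exact: cF.
  by rewrite -e; apply: limr_le => //; near=> n; exact: hM.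
split; first by split => //; exists M. have [_ _] := @dominated_convergence _ _ _ P setT measurableT (fun n => EFin \o F n) (EFin \o f) (EFin \o cst M)
  (fun n => (measurable_EFinP _ _).2 (mF n)) ((measurable_EFinP _ _).2 mf)
  (aeW _ (fun w _ => cvg_EFin (nearW _ (fun n => erefl : EFin (F n w) \is a fin_num)) (cF w))) (finite_measure_integrable_cst P M measurableT)
  (aeW _ (fun w n _ => hM n w)).
move=> h; rewrite /Rintegral. apply: fine_cvg; rewrite fineK //. have /bmeas_integrable hf : bmeas f by split=> //; exists M.
exact: (integrable_fin_num measurableT hf).
Unshelve. all: end_near. Qed.

End bounded_expectation.

(** * Equality of laws tested through characteristic functions *)

Section transfer.
Context (R : realType) d1 d2 (T1 : measurableType d1)
  (T2 : measurableType d2) (P1 : probability T1 R) (P2 : probability T2 R)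
  (A : Type) (X : A -> T1 -> R) (Y : A -> T2 -> R).
Hypothesis mX : forall a, mfun (X a).
Hypothesis mY : forall a, mfun (Y a).

(** [H1] and [H2] act as densities: the signed measures they define have the same finite-dimensional
    characteristic functions. The family [t] is arbitrary, repetitions included, so that a point can
    always be adjoined. *)
Definition good (H1 : T1 -> R) (H2 : T2 -> R) : Prop :=
  [/\ bmeas H1, bmeas H2 & forall (J : finType) (t : J -> A) (c : J -> R) (b : R),
    \int[P1]_w (H1 w * cos (\sum_j c j * X (t j) w + b)) =
    \int[P2]_w (H2 w * cos (\sum_j c j * Y (t j) w + b))].

(* Pairs of bounded functionals of the two processes that keep the tested characteristic
   functions equal; they form an algebra closed under bounded limits. *)
Definition same_law (U1 : T1 -> R) (U2 : T2 -> R) : Prop :=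
  [/\ bmeas U1, bmeas U2 & forall H1 H2, good H1 H2 ->
    good (fun w => U1 w * H1 w) (fun w => U2 w * H2 w)].

Let bcos d (T : measurableType d) (Z : A -> T -> R) (J : finType) (t : J -> A) (c : J -> R) b :
  (forall a, mfun (Z a)) -> bmeas (fun w => cos (\sum_j c j * Z (t j) w + b)).
Proof.
move=> mZ; apply: bmeas_cos; apply: measurable_funD => //. by apply: measurable_sum => i; apply: measurable_funM.
Qed.

Lemma same_law_cst c : same_law (fun=> c) (fun=> c).
Proof.
split; [exact: bmeas_cst|exact: bmeas_cst|move=> H1 H2 [b1 b2 e]]. split; [exact: bmeasZ|exact: bmeasZ|move=> J t c' b].
under eq_Rintegral do rewrite -mulrA; under [RHS]eq_Rintegral do rewrite -mulrA. by rewrite !ExZ ?e//; apply: bmeasM => //; exact: bcos.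
Qed.

Lemma same_lawM U1 U2 V1 V2 : same_law U1 U2 -> same_law V1 V2 ->
  same_law (fun w => U1 w * V1 w) (fun w => U2 w * V2 w).
Proof.
move=> [bU1 bU2 hU] [bV1 bV2 hV]; split; [exact: bmeasM|exact: bmeasM|]. move=> H1 H2 /hV/hU; have e (S : Type) (h k l : S -> R) :
    (fun w => h w * (k w * l w)) = (fun w => h w * k w * l w) by apply/funext => w; rewrite mulrA.
by rewrite !e.
Qed.

Lemma same_lawD U1 U2 V1 V2 : same_law U1 U2 -> same_law V1 V2 ->
  same_law (fun w => U1 w + V1 w) (fun w => U2 w + V2 w).
Proof.
move=> [bU1 bU2 hU] [bV1 bV2 hV]; split; [exact: bmeasD|exact: bmeasD|]. move=> H1 H2 h; have [bu1 bu2 eu] := hU _ _ h; have [bv1 bv2 ev] := hV _ _ h.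
have e (S : Type) (p q l : S -> R) : (fun w => (p w + q w) * l w) = (fun w => p w * l w + q w * l w).
  by apply/funext => w; rewrite mulrDl.
rewrite !e; split; [exact: bmeasD|exact: bmeasD|move=> J t c b]. under eq_Rintegral do rewrite mulrDl; under [RHS]eq_Rintegral do rewrite mulrDl.
by rewrite !ExD ?eu ?ev//; apply: bmeasM => //; exact: bcos.
Qed.

Lemma same_law_lim (U1 : nat -> T1 -> R) (U2 : nat -> T2 -> R) V1 V2 M :
  (forall n, same_law (U1 n) (U2 n)) ->
  (forall n w, `|U1 n w| <= M) -> (forall n w, `|U2 n w| <= M) ->
  (forall w, U1 n w @[n --> \oo] --> V1 w) -> (forall w, U2 n w @[n --> \oo] --> V2 w) ->
  same_law V1 V2.
Proof.
move=> hU hM1 hM2 c1 c2. have m1 n : mfun (U1 n) by have [[]] := hU n. have m2 n : mfun (U2 n) by have [_ []] := hU n.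
have [bV1 _] := Ex_bounded_cvg P1 m1 hM1 c1; have [bV2 _] := Ex_bounded_cvg P2 m2 hM2 c2.
split => // H1 H2 h; have [b1 b2 _] := h; split; [exact: bmeasM|exact: bmeasM|move=> J t c b].
have key d (T : measurableType d) (P : probability T R) (Z : A -> T -> R) (U : nat -> T -> R) (V H : T -> R) :
   (forall a, mfun (Z a)) -> (forall n, mfun (U n)) -> (forall n w, `|U n w| <= M) -> (forall w, U n w @[n --> \oo] --> V w) -> bmeas H ->
   \int[P]_w (U n w * H w * cos (\sum_i c i * Z (t i) w + b)) @[n --> \oo] --> \int[P]_w (V w * H w * cos (\sum_i c i * Z (t i) w + b)).
  move=> mZ mU hM cU bH; have [mH [N hN]] := bH. apply: (proj2 (@Ex_bounded_cvg _ _ _ P _ _ (M * N * 1) _ _ _)).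
  - by move=> n; apply: measurable_funM; [exact: measurable_funM|have [] := bcos t c b mZ].
  - move=> n w; rewrite !normrM ler_pM// ?mulr_ge0//; first by rewrite ler_pM. by rewrite ler_norml cos_geN1 cos_le1.
  - move=> w; apply: cvgM; last exact: cvg_cst. by apply: cvgM; [exact: cU|exact: cvg_cst].
have k1 := key _ _ P1 X U1 V1 H1 mX m1 hM1 c1 b1; have k2 := key _ _ P2 Y U2 V2 H2 mY m2 hM2 c2 b2. apply: (cvg_unique _ k1) => //.
rewrite (_ : (fun n => _) = (fun n => \int[P2]_w (U2 n w * H2 w * cos (\sum_i c i * Y (t i) w + b))))//.
by apply/funext => n; have [_ _ /(_ _ _ h)[_ _]] := hU n; exact.
Qed.

(** A product of two cosines is half the sum of the cosines of the sum and of the difference of the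
    angles, so multiplying a weight by a cosine only adjoins one more point to the tested linear
    combination; that point is [None] in [option J]. *)
Lemma same_law_cos a z b0 : same_law (fun w => cos (z * X a w + b0)) (fun w => cos (z * Y a w + b0)).
Proof.
have bc1 d (T : measurableType d) (Z : A -> T -> R) : (forall a, mfun (Z a)) -> bmeas (fun w => cos (z * Z a w + b0)).
  by move=> mZ; exact: bmeas_cos_affine.
split; [exact: bc1|exact: bc1|move=> H1 H2 [b1 b2 e]]. split; [apply: bmeasM => //; exact: bc1|apply: bmeasM => //; exact: bc1|move=> J t c b].
pose t' (j : option J) := if j is Some j then t j else a. pose c' (y : R) (j : option J) := if j is Some j then c j else y.
have key d (T : measurableType d) (P : probability T R) (Z : A -> T -> R) (H : T -> R) : (forall a, mfun (Z a)) -> bmeas H ->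
   \int[P]_w (cos (z * Z a w + b0) * H w * cos (\sum_j c j * Z (t j) w + b)) = 2^-1 * (\int[P]_w (H w * cos (\sum_j c' z j * Z (t' j) w + (b + b0))) +
   \int[P]_w (H w * cos (\sum_j c' (- z) j * Z (t' j) w + (b - b0)))).
  move=> mZ bH; have bHc y b' := bmeasM bH (bcos t' (c' y) b' mZ). rewrite -ExD// -ExZ; last exact: bmeasD. apply: eq_Rintegral => w _.
  have se y : \sum_j c' y j * Z (t' j) w = y * Z a w + \sum_j c j * Z (t j) w.
    rewrite (bigD1 None)//= (reindex_omap Some id)/=; last by case. by congr (_ + _); apply: eq_bigl => j; rewrite eqxx.
  rewrite !se; set s := \sum_j _; set q := z * _. rewrite (_ : q + s + (b + b0) = (s + b) + (q + b0)); last by ring.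
  rewrite (_ : - z * Z a w + s + (b - b0) = (s + b) - (q + b0)); last by rewrite /q; ring. by move: (s + b) (q + b0) => A' B; rewrite cosD cosB; field.
by rewrite !key// !e.
Qed.

Lemma same_law_prod (I : Type) (r : seq I) (U1 : I -> T1 -> R) (U2 : I -> T2 -> R) :
  (forall j, same_law (U1 j) (U2 j)) ->
  same_law (fun w => \prod_(j <- r) U1 j w) (fun w => \prod_(j <- r) U2 j w).
Proof.
move=> h; elim: r => [|j r IH].
  by under eq_fun do rewrite big_nil; under [X in same_law _ X]eq_fun do rewrite big_nil; exact: same_law_cst.
under eq_fun do rewrite big_cons; under [X in same_law _ X]eq_fun do rewrite big_cons. exact: same_lawM.
Qed.

Lemma same_law_sum (I : Type) (r : seq I) (U1 : I -> T1 -> R) (U2 : I -> T2 -> R) :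
  (forall j, same_law (U1 j) (U2 j)) ->
  same_law (fun w => \sum_(j <- r) U1 j w) (fun w => \sum_(j <- r) U2 j w).
Proof.
move=> h; elim: r => [|j r IH].
  by under eq_fun do rewrite big_nil; under [X in same_law _ X]eq_fun do rewrite big_nil; exact: same_law_cst.
under eq_fun do rewrite big_cons; under [X in same_law _ X]eq_fun do rewrite big_cons. exact: same_lawD.
Qed.

Lemma same_lawX U1 U2 m : same_law U1 U2 -> same_law (fun w => U1 w ^+ m) (fun w => U2 w ^+ m).
Proof.
move=> h; elim: m => [|m IH]; first exact: same_law_cst. under eq_fun do rewrite exprS; under [X in same_law _ X]eq_fun do rewrite exprS. exact: same_lawM.
Qed.

Lemma same_law_eq U1 U2 : good (fun=> 1) (fun=> 1) -> same_law U1 U2 ->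
  \int[P1]_w U1 w = \int[P2]_w U2 w.
Proof.
move=> h [_ _ /(_ _ _ h)] [_ _ /(_ void (of_void A) (fun=> 0) 0)]. under eq_Rintegral do rewrite big1// addr0 cos0 !mulr1.
by under [X in _ = X -> _]eq_Rintegral do rewrite big1// addr0 cos0 !mulr1.
Qed.

Definition transferable (a : A) (f : R -> R) := same_law (fun w => f (X a w)) (fun w => f (Y a w)).

Lemma transferable_cst a c : transferable a (fun _ => c).
Proof. exact: same_law_cst. Qed.

Lemma transferableD a f g : transferable a f -> transferable a g -> transferable a (fun x => f x + g x).
Proof. exact: same_lawD. Qed.

Lemma transferableM a f g : transferable a f -> transferable a g -> transferable a (fun x => f x * g x).
Proof. exact: same_lawM. Qed.

Lemma transferable_lim a (F : nat -> R -> R) f M :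
  (forall n, transferable a (F n)) -> (forall n x, `|F n x| <= M) ->
  (forall x, F n x @[n --> \oo] --> f x) -> transferable a f.
Proof. by move=> tF hM cF; apply: (same_law_lim (M := M) tF) => *; [exact: hM|exact: hM|exact: cF|exact: cF]. Qed.

Lemma transferable_sin a z : transferable a (fun x => sin (z * x)).
Proof.
have := same_law_cos a z (- (pi / 2)); rewrite /transferable. by under eq_fun do rewrite cosBpihalf; under [X in same_law _ X]eq_fun do rewrite cosBpihalf.
Qed.

End transfer.

(** * Bounded approximations of the identity and of the absolute value *)

Section elementary_limits.
Context {R : realType}.

(** The Stone-Weierstrass iteration, whose polynomials approach |s| from below on [-1, 1]. Being
    polynomials, they stay in the algebra of transferable functions. *)
Fixpoint abs_approx (k : nat) (s : R) : R :=
  if k is j.+1 then abs_approx j s + (s ^+ 2 - abs_approx j s ^+ 2) / 2 else 0.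

Lemma abs_approx_bounds k (s : R) : `|s| <= 1 ->
  0 <= abs_approx k s <= `|s| /\
  `|s| - abs_approx k s <= (1 - `|s| / 2) ^+ k * `|s|.
Proof.
move=> s1; elim: k => [|k [/andP[p0 ps] ih]] /=.
  by split; [rewrite lexx normr_ge0|rewrite expr0 mul1r subr0].
have -> : s ^+ 2 = `|s| ^+ 2 by rewrite real_normK// num_real. move: p0 ps ih; have := normr_ge0 s; move: (abs_approx k s) s1. move: `|s| => t p t1 t0 p0 pt ih.
have h : t - (p + (t ^+ 2 - p ^+ 2) / 2) = (t - p) * (1 - (t + p) / 2) by field. split.
  apply/andP; split; last by rewrite -subr_ge0 h mulr_ge0 ?subr_ge0//; lra. rewrite addr_ge0// divr_ge0// subr_ge0 ler_sqr ?nnegrE//.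
have q0 : 0 <= 1 - (t + p) / 2 by lra. rewrite h exprS -mulrA [leRHS]mulrC; apply: ler_pM => //; first by rewrite subr_ge0. by lra.
Qed.

Lemma cvg_abs_approx (s : R) : `|s| <= 1 -> abs_approx k s @[k --> \oo] --> `|s|.
Proof.
move=> s1. have [->|s0] := eqVneq s 0.
  rewrite normr0 (_ : (fun _ => _) = (fun=> 0)); first exact: cvg_cst. apply/funext => k. have [] := @abs_approx_bounds k 0 _; first by rewrite normr0.
  by rewrite normr0 => /le_anti.
have s0' : 0 < `|s| by rewrite normr_gt0. apply: (@squeeze_cvgr _ _ _ _ (fun k => `|s| - (1 - `|s| / 2) ^+ k * `|s|) (fun=> `|s|)).
- near=> k; have [/andP[_ ->]] := abs_approx_bounds k s1. by rewrite andbT => ?; lra.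
- rewrite -[X in _ --> X](subr0 `|s|); apply: cvgB; first exact: cvg_cst. rewrite -(mul0r `|s|); apply: cvgM; last exact: cvg_cst.
  apply: cvg_expr; rewrite ger0_norm; lra.
- exact: cvg_cst.
Unshelve. all: end_near. Qed.

Lemma sin_le_id (x : R) : `|sin x| <= `|x|.
Proof.
wlog x0 : x / 0 <= x.
  move=> h; have [|/ltW] := leP 0 x; first exact: h. by rewrite -oppr_ge0 => /h; rewrite sinN !normrN.
move: x0; rewrite le_eqVlt => /predU1P[<-|x0]; first by rewrite sin0 normr0. have [c _ e] : exists2 c, c \in `[0, x] & sin x - sin 0 = cos c * (x - 0).
  exact: (@MVT_segment R (@sin R) (@cos R) 0 x (ltW x0) (fun y _ => is_derive_sin y) (continuous_subspaceT (@continuous_sin R))).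
move: e; rewrite sin0 !subr0 => ->; rewrite normrM ler_piMl//. by rewrite ler_norml cos_geN1 cos_le1.
Qed.

(** Bounded stand-ins for the identity: the transfer of laws covers bounded functions only, so |x|
    and x^2 enter through n sin(x/n), which moreover never exceeds |x| in absolute value. *)
Lemma cvg_nsin (y : R) : n.+1%:R * sin (n.+1%:R^-1 * y) @[n --> \oo] --> y.
Proof.
have [->|y0] := eqVneq y 0.
  by under eq_fun do rewrite mulr0 sin0 mulr0; exact: cvg_cst.
have d : h^-1 *: (sin (h + 0) - sin 0) @[h --> 0^'] --> (1 : R).
  have [/cvg_ex[l hl]] := @is_derive_sin R 0; rewrite cos0 => e. have hl' := cvg_lim (@norm_hausdorff _ _) hl.
  rewrite /derive/= in e; rewrite e in hl'; rewrite hl'. by move: hl; under eq_fun do rewrite /= scaler1.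
have h : (forall n, n.+1%:R^-1 * y != 0) /\ n.+1%:R^-1 * y @[n --> \oo] --> (0 : R).
  split; first by move=> n; rewrite mulf_neq0// invr_eq0 pnatr_eq0. rewrite -(mul0r y); apply: cvgM; last exact: cvg_cst. exact: cvg_harmonic.
move/cvgr_dnbhsP: d => /(_ _ h) {}h. have {}h : y * ((n.+1%:R^-1 * y)^-1 *: (sin (n.+1%:R^-1 * y + 0) - sin 0)) @[n --> \oo] --> y.
  by rewrite -[X in _ --> X]mulr1; apply: cvgM => //; exact: cvg_cst.
apply: cvg_trans h; apply: near_eq_cvg; near=> n. rewrite addr0 sin0 subr0 /GRing.scale/= invfM invrK. by field.
Unshelve. all: end_near. Qed.

End elementary_limits.

(** * Transfer of the kernels of Kac's formula *)

Section kernels.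
Context (R : realType) d1 d2 (T1 : measurableType d1)
  (T2 : measurableType d2) (P1 : probability T1 R) (P2 : probability T2 R)
  (I : Type) (X : I -> T1 -> R) (Y : I -> T2 -> R).
Hypothesis mX : forall i, mfun (X i).
Hypothesis mY : forall i, mfun (Y i).
Notation transferable := (transferable P1 P2 X Y).

Lemma transferable_abssin i (n : nat) :
  transferable i (fun x => n.+1%:R * `|sin (n.+1%:R^-1 * x)|).
Proof.
apply: transferableM => //; first exact: transferable_cst. apply: (transferable_lim mX mY (M := 1) (F := fun k x => abs_approx k (sin (n.+1%:R^-1 * x)))).
- elim=> [|k ih] /=; first exact: transferable_cst. apply: transferableD => //. have ts := transferable_sin P1 P2 mX mY i (n.+1%:R^-1).
  apply: transferableM => //; last exact: transferable_cst. apply: transferableD => //; first by apply: transferableM. under eq_fun do rewrite -mulN1r.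
  apply: transferableM => //; first exact: transferable_cst. exact: transferableM.
- move=> k x; have s1 : `|sin (n.+1%:R^-1 * x)| <= 1 by rewrite ler_norml sin_geN1 sin_le1. have [/andP[h1 h2] _] := abs_approx_bounds k s1.
  by rewrite ger0_norm// (le_trans h2).
- by move=> x; apply: cvg_abs_approx; rewrite ler_norml sin_geN1 sin_le1.
Qed.

(** Two limits are nested: x is replaced by n sin(x/n), and the resulting bounded rational function
    is expanded into a geometric series whose partial sums are polynomials in the sine. *)
Lemma transferable_cauchy i (h : R) : 0 < h ->
  transferable i (fun x => (1 + (x / h) ^+ 2)^-1).
Proof.
move=> h0. apply: (transferable_lim mX mY (M := 1) (F := fun n x => (1 + (n.+1%:R * sin (n.+1%:R^-1 * x) / h) ^+ 2)^-1)).
- move=> n; set a : R := (n.+1%:R / h) ^+ 2. have a0 : 0 <= a by exact: sqr_ge0. pose u (x : R) := (sin (n.+1%:R^-1 * x)) ^+ 2. have u01 x : 0 <= u x <= 1.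
    rewrite sqr_ge0/= /u; have := sin_geN1 (n.+1%:R^-1 * x); have := sin_le1 (n.+1%:R^-1 * x); nra.
  (* Since 1 + a u = (1 + a)(1 - y), the reciprocal is a geometric series in [y], and 0 <= y < 1
     holds however large [a] is. *)
  pose y x := a * (1 - u x) / (1 + a). have y01 x : 0 <= y x < 1.
    have /andP[u0 u1] := u01 x. have au := mulr_ge0 a0 u0; have a1 : 0 < 1 + a by lra. have v0 : 0 <= 1 - u x by lra.
    have p0 : 0 <= a * (1 - u x) by exact: mulr_ge0. have q0 : 0 <= 1 + a by lra. rewrite /y; apply/andP; split; first exact: divr_ge0.
    by rewrite ltr_pdivrMr// mul1r mulrBr; lra.
  apply: (transferable_lim mX mY (M := 1) (F := fun k x => (1 + a)^-1 * \sum_(0 <= l < k) y x ^+ l)).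
  + move=> k; apply: transferableM => //; first exact: transferable_cst. have tu : transferable i u by apply: transferableM => //; exact: transferable_sin.
    have ty : transferable i y.
      apply: transferableM => //; last exact: transferable_cst. apply: transferableM => //; first exact: transferable_cst.
      apply: transferableD => //; first exact: transferable_cst. under eq_fun do rewrite -mulN1r. by apply: transferableM => //; exact: transferable_cst.
    have tyl l : transferable i (fun x => y x ^+ l).
      elim: l => [|l ih]; first by under eq_fun do rewrite expr0; exact: transferable_cst. by under eq_fun do rewrite exprS; exact: transferableM.
    elim: k => [|k ih].
      by under eq_fun do rewrite big_nil; exact: transferable_cst.
    by under eq_fun do rewrite big_nat_recr//=; exact: transferableD.
  + move=> k x; have /andP[y0 y1] := y01 x. have yk : (1 - y x) * \sum_(0 <= l < k) y x ^+ l <= 1.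
      rewrite big_mkord. have -> : (1 - y x) * \sum_(i < k) y x ^+ i = 1 - y x ^+ k.
        elim: (k) => [|j ih]; first by rewrite big_ord0 mulr0 expr0 subrr. by rewrite big_ord_recr/= mulrDr ih exprS; ring.
      by rewrite lerBlDr lerDl exprn_ge0.
    have s0 : 0 <= \sum_(0 <= l < k) y x ^+ l by apply: sumr_ge0 => l _; exact: exprn_ge0. have /andP[u0 u1] := u01 x.
    rewrite ger0_norm ?mulr_ge0 ?invr_ge0 ?addr_ge0//. apply: le_trans yk; apply: ler_wpM2r => //.
    have -> : 1 - y x = (1 + a * u x) / (1 + a) by rewrite /y; field; lra. by rewrite -[leLHS]mul1r ler_wpM2r ?invr_ge0 ?addr_ge0// lerDl mulr_ge0.
  + move=> x; have /andP[y0 y1] := y01 x; have /andP[u0 u1] := u01 x.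
    have -> : (1 + (n.+1%:R * sin (n.+1%:R^-1 * x) / h) ^+ 2)^-1 = (1 + a)^-1 * (1 / (1 - y x)).
      have -> : (n.+1%:R * sin (n.+1%:R^-1 * x) / h) ^+ 2 = a * u x.
        by rewrite /a /u !expr_div_n exprMn mulrAC.
      by rewrite /y; field; nra.
    apply: cvgM; first exact: cvg_cst. have := @cvg_geometric_series R 1 (y x); rewrite ger0_norm// => /(_ y1).
    rewrite (_ : series _ = (fun k => \sum_(0 <= l < k) y x ^+ l))//. by apply/funext => k; rewrite /series/=; apply: eq_bigr => l _; rewrite mul1r.
- move=> n x; rewrite ger0_norm ?invr_ge0 ?addr_ge0 ?sqr_ge0// invf_le1.
    by rewrite lerDl sqr_ge0.
  by rewrite ltr_pwDl ?sqr_ge0.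
- move=> x; apply: cvgV; first by rewrite gt_eqF// ltr_pwDl ?sqr_ge0. apply: cvgD; first exact: cvg_cst.
  have c : n.+1%:R * sin (n.+1%:R^-1 * x) / h @[n --> \oo] --> x / h.
    by apply: cvgM; [exact: cvg_nsin|exact: cvg_cst].
  by under eq_fun do rewrite expr2; rewrite expr2; exact: cvgM.
Qed.

End kernels.

(** * Integrals of continuous functions over segments *)

Section interval_integrals.
Context {R : realType}.
Notation mu := (@lebesgue_measure R).
Implicit Types (f g : R -> R) (a b c : R).

Lemma continuous_itv_integrable f a b : continuous f ->
  mu.-integrable `[a, b] (EFin \o f).
Proof.
move=> cf; apply: continuous_compact_integrable; first exact: segment_compact. exact: continuous_subspaceT.
Qed.

Lemma RintD f g a b : continuous f -> continuous g ->
  \int[mu]_(x in `[a, b]) (f x + g x) =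
  \int[mu]_(x in `[a, b]) f x + \int[mu]_(x in `[a, b]) g x.
Proof. by move=> cf cg; rewrite RintegralD//; exact: continuous_itv_integrable. Qed.

Lemma RintB f g a b : continuous f -> continuous g ->
  \int[mu]_(x in `[a, b]) (f x - g x) =
  \int[mu]_(x in `[a, b]) f x - \int[mu]_(x in `[a, b]) g x.
Proof. by move=> cf cg; rewrite RintegralB//; exact: continuous_itv_integrable. Qed.

Lemma RintZ f a b c : continuous f ->
  \int[mu]_(x in `[a, b]) (c * f x) = c * \int[mu]_(x in `[a, b]) f x.
Proof. by move=> cf; rewrite RintegralZl//; exact: continuous_itv_integrable. Qed.

Lemma Rint_cst a b c : a <= b -> \int[mu]_(x in `[a, b]) c = c * (b - a).
Proof.
move=> ab; rewrite Rintegral_cst//=; congr (_ * _). by rewrite lebesgue_measure_itv/= lte_fin; case: (ltgtP a b) ab => //= -> _; rewrite subrr.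
Qed.

Lemma Rint_bound f a b M : a <= b -> continuous f ->
  (forall x : R, a <= x <= b -> `|f x| <= M) ->
  `|\int[mu]_(x in `[a, b]) f x| <= M * (b - a).
Proof.
move=> ab cf fM. have fi := @continuous_itv_integrable f a b cf. apply: (le_trans (le_normr_Rintegral _ fi)) => //.
rewrite -Rint_cst//; apply: le_Rintegral => //.
- apply: continuous_itv_integrable => x; apply: continuous_comp; first exact: cf. exact: norm_continuous.
- by apply: continuous_itv_integrable => x; exact: cvg_cst.
Qed.

Lemma Rint_split f a b c : a <= c -> c <= b -> continuous f ->
  \int[mu]_(x in `[a, b]) f x =
  \int[mu]_(x in `[a, c]) f x + \int[mu]_(x in `[c, b]) f x.
Proof.
move=> ac cb cf. have fi u v := @continuous_itv_integrable f u v cf. have mf : mfun f by exact: continuous_measurable_fun.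
rewrite -(@Rintegral_itv_obnd_cbnd _ c (BRight b)); last first.
  by apply: integrableS (fi c b) => //; exact: subset_itv_oc_cc.
rewrite -Rintegral_setU//=.
- congr Rintegral; apply/seteqP; split => x /=; rewrite !in_itv/=; move: (lexx x); lra.
- by rewrite -itv_bndbnd_setU ?bnd_simp.
- by apply/disj_setPS => x /= []; rewrite !in_itv/=; lra.
Qed.

Lemma derivable_LRcontinuous (F : R -> R) a b :
  (forall x : R, derivable F x 1) -> derivable_oo_LRcontinuous F a b.
Proof.
move=> dF; have cF : continuous F.
  by move=> x; apply: differentiable_continuous; exact/derivable1_diffP.
split; first by move=> x _.
- exact/cvg_at_right_filter/cF.
- exact/cvg_at_left_filter/cF.
Qed.

Lemma Rint_ftc (F f : R -> R) a b : a <= b -> (forall x : R, is_derive x (1 : R) F (f x)) ->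
  continuous f -> \int[mu]_(x in `[a, b]) f x = F b - F a.
Proof.
rewrite le_eqVlt => /predU1P[<- _ _|ab dF cf].
  by rewrite set_itv1 Rintegral_set1 subrr.
rewrite /Rintegral (@continuous_FTC2 _ f F)//.
- exact: continuous_subspaceT.
- by apply: derivable_LRcontinuous => x; exact: (@ex_derive _ _ _ _ _ _ _ (dF x)).
- by move=> x _; rewrite derive1E; exact: (@derive_val _ _ _ _ _ _ _ (dF x)).
Qed.

Lemma is_derive_continuous (F f : R -> R) : (forall x : R, is_derive x (1 : R) F (f x)) ->
  continuous F.
Proof.
move=> dF x; apply: differentiable_continuous; apply/derivable1_diffP. exact: (@ex_derive _ _ _ _ _ _ _ (dF x)).
Qed.

Lemma lipschitz_of_deriv (F f : R -> R) M a b : (forall x : R, is_derive x (1 : R) F (f x)) ->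
  (forall x : R, a <= x <= b -> `|f x| <= M) -> a <= b -> `|F b - F a| <= M * (b - a).
Proof.
move=> dF fM ab. have cF := is_derive_continuous dF. have [c cab ->] := @MVT_segment R F f a b ab (fun y _ => dF y) (continuous_subspaceT cF).
rewrite normrM (ger0_norm (_ : 0 <= b - a)) ?subr_ge0// ler_wpM2r ?subr_ge0//. by apply: fM; move: cab; rewrite in_itv.
Qed.

End interval_integrals.

(** * The normal law: scaling of densities and characteristic function *)

Section normal_expectation.
Context {R : realType}.
Notation mu := (@lebesgue_measure R).

Lemma ge0_integral_normal_prob (m s : R) (f : R -> \bar R) : s != 0 ->
  mfun f -> (forall x, 0 <= f x)%E ->
  (\int[normal_prob m s]_x f x = \int[mu]_x (f x * (normal_pdf m s x)%:E))%E.
Proof.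
move=> s0 mf f0. have numu : normal_prob m s `<< mu by exact: normal_prob_dominates. have mpdf : mfun (fun x => (normal_pdf m s x)%:E).
  by apply/measurable_EFinP; exact: measurable_normal_pdf.
rewrite -(Radon_Nikodym_SigmaFinite.change_of_variables numu)//. apply: ge0_ae_eq_integral => //.
- apply: emeasurable_funM => //; apply: measurable_int. exact: Radon_Nikodym_SigmaFinite.f_integrable.
- exact: emeasurable_funM.
- by move=> x _; rewrite mule_ge0// Radon_Nikodym_SigmaFinite.f_ge0.
- by move=> x _; rewrite mule_ge0// lee_fin normal_pdf_ge0.
suff : ae_eq mu setT (Radon_Nikodym_SigmaFinite.f (normal_prob m s) mu) (fun x => (normal_pdf m s x)%:E).
  by apply: filterS => x h _; rewrite h.
apply: integral_ae_eq => //; first exact: Radon_Nikodym_SigmaFinite.f_integrable. by move=> E _ mE; rewrite -Radon_Nikodym_SigmaFinite.f_integral.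
Qed.

(** The density with standard deviation s is pointwise at most t/s times the one with standard
    deviation t >= s. This one-dimensional inequality is the source of the factor in the Gaussian
    comparison. *)
Lemma normal_prob_scale_le (s t : R) (f : R -> \bar R) : 0 < s -> s <= t ->
  mfun f -> (forall x, 0 <= f x)%E ->
  (\int[normal_prob 0 s]_x f x <= (t / s)%:E * \int[normal_prob 0 t]_x f x)%E.
Proof.
move=> s0 st mf f0; have t0 := lt_le_trans s0 st. rewrite !ge0_integral_normal_prob ?gt_eqF//. have mpdf u : mfun (fun x => (normal_pdf (0 : R) u x)%:E).
  by apply/measurable_EFinP; exact: measurable_normal_pdf.
rewrite -ge0_integralZl//; last 3 first.
- by apply: emeasurable_funM => //; exact: mpdf.
- by move=> x _; rewrite mule_ge0// lee_fin normal_pdf_ge0.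
- by rewrite lee_fin divr_ge0// ltW.
apply: ge0_le_integral => //.
- by move=> x _; rewrite mule_ge0// lee_fin normal_pdf_ge0.
- by apply: emeasurable_funM => //; exact: mpdf.
- by apply: emeasurable_funM => //; apply: emeasurable_funM => //; exact: mpdf.
- move=> x _; rewrite muleCA; apply: lee_wpmul2l => //. rewrite -EFinM lee_fin !normal_pdfE ?gt_eqF//. rewrite /normal_peak /normal_fun subr0.
  have sq (u : R) : 0 < u -> Num.sqrt (u ^+ 2 * pi *+ 2) = u * Num.sqrt (pi *+ 2).
    by move=> u0; rewrite -mulrnAr sqrtrM ?sqr_ge0// sqrtr_sqr gtr0_norm.
  rewrite !sq// !invfM [leRHS]mulrA. have -> : t / s * (t^-1 * (Num.sqrt (pi *+ 2))^-1) = s^-1 * (Num.sqrt (pi *+ 2))^-1.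
    by field; rewrite !gt_eqF// sqrtr_gt0 pmulrn_lgt0// pi_gt0.
  rewrite ler_wpM2l ?mulr_ge0 ?invr_ge0 ?sqrtr_ge0 ?(ltW s0)//. rewrite ler_expR !mulNr lerN2 ler_wpM2l ?sqr_ge0// lef_pV2 ?posrE ?pmulrn_lgt0 ?exprn_gt0//.
  by rewrite lerMn2r/= ler_sqr ?nnegrE ?(ltW s0) ?(ltW t0).
Qed.

Let cM (f g : R -> R) : continuous f -> continuous g -> continuous (fun x => f x * g x).
Proof. by move=> cf cg x; apply: cvgM; [exact: cf|exact: cg]. Qed.

Let cc (a b : R) : continuous (fun x => cos (a * x + b)).
Proof.
move=> x; apply: continuous_comp; last exact: continuous_cos. by apply: cvgD; [apply: cvgM; [exact: cvg_cst|exact: cvg_id]|exact: cvg_cst].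
Qed.

(** Differentiation under the integral and integration by parts give g' = - s^2 a g plus a boundary
    term for the truncated transform g(a). Hence the derivative of g(a) exp(s^2 a^2 / 2) consists of
    the boundary term alone, which is proportional to the density at [A]. The mean value theorem
    bounds the increment from 0 to [c], and this bound vanishes as [A] grows. *)
Lemma normal_cos_on (s A c b0 : R) : 0 < s -> 0 < A ->
  `| \int[mu]_(x in `[- A, A]) (cos (c * x + b0) * normal_pdf 0 s x) * expR (s ^+ 2 * c ^+ 2 / 2) -
     cos b0 * \int[mu]_(x in `[- A, A]) normal_pdf 0 s x | <=
  2 * s ^+ 2 * normal_pdf 0 s A * `|c| * expR (s ^+ 2 * c ^+ 2 / 2).
Proof.
move=> s0 A0. wlog c0 : c b0 / 0 <= c.
  move=> h; have [|c0] := leP 0 c; first exact: h. have := h (- c) (- b0); rewrite oppr_ge0 (ltW c0) => /(_ isT). rewrite sqrrN normrN cosN.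
  by under eq_Rintegral do rewrite mulNr -opprD cosN.
set p := normal_pdf 0 s. have pE x : p x = normal_peak s * expR (- x ^+ 2 / (s ^+ 2 *+ 2)).
  by rewrite /p normal_pdfE ?gt_eqF// /normal_fun subr0.
have cp : continuous p by apply: continuous_normal_pdf; rewrite gt_eqF. have p0 x : 0 <= p x by exact: normal_pdf_ge0.
have dp (x : R) : is_derive x (1 : R) p (- (x / s ^+ 2) * p x).
  have -> : p = (fun x => normal_peak s * expR (- x ^+ 2 / (s ^+ 2 *+ 2))).
    by apply/funext => y; rewrite pE.
  apply: is_derive_eq. by rewrite /GRing.scale/=; field; rewrite gt_eqF.
have cs (a : R) : continuous (fun x => sin (a * x + b0)).
  move=> x; apply: continuous_comp; last exact: continuous_sin. by apply: cvgD; [apply: cvgM; [exact: cvg_cst|exact: cvg_id]|exact: cvg_cst].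
pose g (a : R) := \int[mu]_(x in `[- A, A]) (cos (a * x + b0) * p x). pose g' (a : R) := s ^+ 2 * ((sin (a * A + b0) - sin (a * - A + b0)) * p A - a * g a).
have byparts a : \int[mu]_(x in `[- A, A]) (- x * sin (a * x + b0) * p x) = g' a.
  have cl : continuous (fun x : R => - (x / s ^+ 2)).
    by move=> x; apply: cvgN; apply: cvgM; [exact: cvg_id|exact: cvg_cst].
  have cF : continuous (fun x : R => sin (a * x + b0) * (- (x / s ^+ 2) * p x) + p x * (cos (a * x + b0) * a)).
    move=> x; apply: cvgD.
      by apply: (@cM _ (fun x => _ * p x)) => //; exact: cM.
    by apply: (@cM p) => //; apply: (@cM _ (fun=> a)) => //; move=> y; exact: cvg_cst.
  have cG : continuous (fun x : R => a * (cos (a * x + b0) * p x)).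
    by apply: (@cM (fun=> a)); [move=> y; exact: cvg_cst|exact: cM].
  have -> : \int[mu]_(x in `[- A, A]) (- x * sin (a * x + b0) * p x) =
     s ^+ 2 * \int[mu]_(x in `[- A, A]) ((sin (a * x + b0) * (- (x / s ^+ 2) * p x) + p x * (cos (a * x + b0) * a)) - a * (cos (a * x + b0) * p x)).
    rewrite -RintZ.
      by apply: eq_Rintegral => x _; field; rewrite gt_eqF.
    by move=> x; apply: cvgB; [exact: cF|exact: cG].
  rewrite /g'; congr (_ * _). rewrite RintB// RintZ; last exact: cM. congr (_ - _). have dF (x : R) : is_derive x (1 : R) (fun x => sin (a * x + b0) * p x)
      (sin (a * x + b0) * (- (x / s ^+ 2) * p x) + p x * (cos (a * x + b0) * a)).
    by apply: is_derive_eq; rewrite /GRing.scale/=; ring.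
  rewrite (Rint_ftc _ dF)//; last by lra. rewrite (_ : p (- A) = p A); first by ring. by rewrite !pE sqrrN.
have dg (a : R) : is_derive a (1 : R) g (g' a).
  have dpar (b x : R) : is_derive b (1 : R) (fun b => cos (b * x + b0) * p x) (- x * sin (b * x + b0) * p x).
    by apply: is_derive_eq; rewrite /GRing.scale/=; ring.
  have pE' (b x : R) : partial1of2 (fun b x => cos (b * x + b0) * p x) b x = - x * sin (b * x + b0) * p x.
    by rewrite partial1of2E; exact: (@derive_val _ _ _ _ _ _ _ (dpar b x)).
  have aI : `]a - 1, a + 1[%classic a by rewrite /= in_itv/=; lra. have iG : mu.-integrable `[- A, A] (EFin \o (fun=> A * normal_peak s)).
    by apply: continuous_itv_integrable => x; exact: cvg_cst.
  have ifx (b : R) : mu.-integrable `[- A, A] (EFin \o (fun x => cos (b * x + b0) * p x)).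
    by apply: continuous_itv_integrable; exact: cM.
  have G0 (y : R) : 0 <= A * normal_peak s by rewrite mulr_ge0 ?normal_peak_ge0// ltW. have der (b x : R) : `]a - 1, a + 1[%classic b -> `[- A, A]%classic x ->
      derivable (fun b : R => cos (b * x + b0) * p x) b 1.
    by move=> _ _; exact: (@ex_derive _ _ _ _ _ _ _ (dpar b x)).
  have dom (b x : R) : `]a - 1, a + 1[%classic b -> `[- A, A]%classic x -> `|partial1of2 (fun b x => cos (b * x + b0) * p x) b x| <= A * normal_peak s.
    move=> _ /=; rewrite in_itv/= => /andP[x1 x2]; rewrite pE' !normrM normrN (ger0_norm (p0 x)).
    apply: ler_pM; rewrite ?mulr_ge0//; last by apply: normal_pdf_ub; rewrite gt_eqF. rewrite -[leRHS]mulr1; apply: ler_pM => //; first by rewrite ler_norml x1.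
    by rewrite ler_norml sin_geN1 sin_le1.
  have mB : measurable (`[- A, A]%classic : set R) by [].
  have h1 := @derivable_under_integral R _ (mR R) mu (fun b x => cos (b * x + b0) * p x) _ mB _ _ _ aI (fun b _ => ifx b) der _ G0 iG dom.
  have h2 := @differentiation_under_integral R _ (mR R) mu (fun b x => cos (b * x + b0) * p x) _ mB _ _ _ aI (fun b _ => ifx b) der _ G0 iG dom.
  apply: DeriveDef => //; rewrite -derive1E h2 -byparts. by apply: eq_Rintegral => x _; rewrite pE'.
pose e (a : R) := expR (s ^+ 2 * a ^+ 2 / 2).
have dh (a : R) : is_derive a (1 : R) (fun a => g a * e a) (s ^+ 2 * ((sin (a * A + b0) - sin (a * - A + b0)) * p A) * e a).
  have de : is_derive a (1:R) e (s ^+ 2 * a * e a).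
    by rewrite /e; apply: is_derive_eq; rewrite /GRing.scale/=; field.
  apply: is_derive_eq; rewrite /GRing.scale/= /g'; ring.
have := @lipschitz_of_deriv R _ _ (s ^+ 2 * (2 * p A) * e c) 0 c dh _ c0. rewrite subr0. have -> : g 0 * e 0 = cos b0 * \int[mu]_(x in `[- A, A]) p x.
  rewrite /e expr0n mulr0 mul0r expR0 mulr1 /g -RintZ//. by apply: eq_Rintegral => x _; rewrite mul0r add0r.
move=> h. have -> : 2 * s ^+ 2 * p A * `|c| * e c = s ^+ 2 * (2 * p A) * e c * c.
  by rewrite ger0_norm//; ring.
apply: h => x /andP[x0 xc]. set D := sin _ - sin _. have hD : `|D| <= 2.
  have := sin_geN1 (x * A + b0); have := sin_le1 (x * A + b0). have := sin_geN1 (x * - A + b0); have := sin_le1 (x * - A + b0).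
  by move=> *; rewrite /D ler_norml; lra.
have -> : s ^+ 2 * (D * p A) * e x = s ^+ 2 * p A * e x * D by ring. have -> : s ^+ 2 * (2 * p A) * e c = s ^+ 2 * p A * e c * 2 by ring.
have q0 : 0 <= s ^+ 2 * p A by rewrite mulr_ge0 ?sqr_ge0. have q1 : 0 <= s ^+ 2 * p A * e x by rewrite mulr_ge0 ?expR_ge0.
rewrite normrM (ger0_norm q1); apply: ler_pM => //. rewrite ler_wpM2l// /e ler_expR ler_wpM2r// ler_wpM2l ?sqr_ge0// ler_sqr ?nnegrE//.
Qed.

Lemma normal_cos (s c b : R) : 0 < s ->
  \int[normal_prob 0 s]_x cos (c * x + b) = expR (- (s ^+ 2 * c ^+ 2 / 2)) * cos b.
Proof.
move=> s0. pose N : probability _ R := normal_prob 0 s. pose p := normal_pdf 0 s. have mp : mfun p by exact: measurable_normal_pdf.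
have cp : continuous p by apply: continuous_normal_pdf; rewrite gt_eqF. have trunc (h : R -> R) : bmeas (h : mR R -> R) -> (forall x, 0 <= h x) ->
    \int[mu]_(x in `[- n.+1%:R, n.+1%:R]) (h x * p x) @[n --> \oo] --> \int[N]_x h x.
  move=> [mh [M hM]] h0. pose F (n : nat) (x : R) := \1_(`[- n.+1%:R, n.+1%:R]) x * h x.
  have mF n : mfun (F n) by apply: measurable_funM => //; exact: measurable_indic.
  have e n : \int[mu]_(x in `[- n.+1%:R, n.+1%:R]) (h x * p x) = \int[N]_x F n x.
    rewrite /Rintegral ge0_integral_normal_prob ?gt_eqF//; last 2 first.
    - exact/measurable_EFinP.
    - by move=> x; rewrite lee_fin mulr_ge0.
    rewrite integral_mkcond; congr fine; apply: eq_integral => x _. by rewrite patchE /F indicE; case: ifPn; rewrite ?mul1r ?mul0r ?mul0e.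
  under eq_fun do rewrite e. apply: (proj2 (@Ex_bounded_cvg _ _ _ N F h M _ _ _)) => //.
  - move=> n x; rewrite normrM -[leRHS]mul1r ler_pM//. by rewrite indicE; case: (_ \in _); rewrite ?normr1 ?normr0.
  - move=> x; apply: cvg_near_cst; near=> n. rewrite /F indicE mem_set ?mul1r//= in_itv/= -ler_norml. have : `|x| <= n%:R by near: n; exact: nbhs_infty_ger.
    by move=> /le_trans; apply; rewrite ler_nat.
pose e := expR (s ^+ 2 * c ^+ 2 / 2). have bc : bmeas (fun x : mR R => cos (c * x + b)).
  by exact: bmeas_cos_affine.
have b1 := @bmeas_cst _ (mR R) R 1. have cvg1 : \int[mu]_(x in `[- n.+1%:R, n.+1%:R]) p x @[n --> \oo] --> (1 : R).
  have := trunc _ b1 (fun=> ler01). rewrite Ex_cst. rewrite (_ : (fun n => _) = (fun n => \int[mu]_(x in `[- n.+1%:R, n.+1%:R]) p x))//.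
  by apply/funext => n; apply: eq_Rintegral => x _; rewrite mul1r.
have cvg2 : \int[mu]_(x in `[- n.+1%:R, n.+1%:R]) (cos (c * x + b) * p x) @[n --> \oo] --> \int[N]_x cos (c * x + b).
  (* The density formula is established for nonnegative integrands, hence the shift by 1. *)
  have h0 x : 0 <= cos (c * x + b) + 1 by rewrite -lerBlDr add0r cos_geN1. have := trunc _ (bmeasD bc b1) h0. rewrite ExD// Ex_cst => h.
  rewrite -[X in _ --> X](addrK 1). have -> : (fun n => \int[mu]_(x in `[- n.+1%:R, n.+1%:R]) (cos (c * x + b) * p x)) =
     (fun n => \int[mu]_(x in `[- n.+1%:R, n.+1%:R]) ((cos (c * x + b) + 1) * p x) - \int[mu]_(x in `[- n.+1%:R, n.+1%:R]) p x).
    apply/funext => n; rewrite -RintB//; last first.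
      apply: (@cM (fun x => cos (c * x + b) + 1)) => // x. by apply: cvgD; [exact: cc|exact: cvg_cst].
    by apply: eq_Rintegral => x _; rewrite mulrDl mul1r addrK.
  exact: cvgB.
have lim0 : p n.+1%:R @[n --> \oo] --> (0 : R).
  apply: (@squeeze_cvgr _ _ _ _ (fun=> 0) (fun n => normal_peak s * (2 * s ^+ 2) * n.+1%:R^-1)).
  - near=> n; rewrite normal_pdf_ge0/= /p normal_pdfE ?gt_eqF// /normal_fun subr0 -mulrA. rewrite ler_wpM2l ?normal_peak_ge0// mulNr expRN.
    set y := n.+1%:R ^+ 2 / _. have n0 : (0 : R) < n.+1%:R by rewrite ltr0n. have y0 : n.+1%:R / (2 * s ^+ 2) <= y.
      have -> : y = n.+1%:R ^+ 2 / (2 * s ^+ 2) by rewrite /y mulr_natl. apply: ler_wpM2r; first by rewrite invr_ge0 mulr_ge0 ?sqr_ge0.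
      by rewrite expr2 ler_peMr ?ler1n// ltW.
    have -> : 2 * s ^+ 2 / n.+1%:R = (n.+1%:R / (2 * s ^+ 2))^-1 by rewrite invf_div. rewrite lef_pV2 ?posrE ?expR_gt0 ?divr_gt0 ?mulr_gt0 ?exprn_gt0//.
    by apply: (le_trans y0); apply: le_trans (expR_ge1Dx y); rewrite lerDr.
  - exact: cvg_cst.
  - rewrite -(mulr0 (normal_peak s * (2 * s ^+ 2))); apply: cvgM; first exact: cvg_cst. exact: cvg_harmonic.
have e0 : 0 < e by exact: expR_gt0. suff : \int[N]_x cos (c * x + b) * e = cos b.
  by move=> <-; rewrite expRN mulrC mulfK// gt_eqF.
apply/eqP; rewrite -subr_eq0 -normr_le0. have c1 : `|\int[mu]_(x in `[- n.+1%:R, n.+1%:R]) (cos (c * x + b) * p x) * e -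
   cos b * \int[mu]_(x in `[- n.+1%:R, n.+1%:R]) p x| @[n --> \oo] --> `|\int[N]_x cos (c * x + b) * e - cos b|.
  apply: cvg_norm; apply: cvgB; first by apply: cvgM => //; exact: cvg_cst. by rewrite -[X in _ --> X]mulr1; apply: cvgM => //; exact: cvg_cst.
have c2 : 2 * s ^+ 2 * p n.+1%:R * `|c| * e @[n --> \oo] --> (0 : R).
  rewrite -[X in _ --> X](mul0r e) -(mul0r `|c|) -(mulr0 (2 * s ^+ 2)). by do 3 (apply: cvgM; try exact: cvg_cst).
apply: (ler_cvg_to c1 c2); near=> n. by apply: normal_cos_on => //; rewrite ltr0n.
Unshelve. all: end_near. Qed.

End normal_expectation.

(** * Fubini for bounded functions *)

Section product_expectation.
Context d1 d2 (T1 : measurableType d1) (T2 : measurableType d2)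
  (R : realType) (P1 : probability T1 R) (P2 : probability T2 R).

Lemma bmeas_section (f : T1 * T2 -> R) x : bmeas f -> bmeas (fun y => f (x, y)).
Proof.
move=> [mf [M hM]]; split; last by exists M. exact: (measurableT_comp mf (measurable_pair1 x)).
Qed.

Lemma Ex_prod (f : T1 * T2 -> R) : bmeas f ->
  bmeas (fun x => \int[P2]_y f (x, y)) /\
  \int[(P1 \x P2)%E]_z f z = \int[P1]_x \int[P2]_y f (x, y).
Proof.
move=> bf; have [mf [M hM]] := bf. have fi := bmeas_integrable (P1 \x P2)%E bf. have e x : fubini_F P2 (EFin \o f) x = (\int[P2]_y f (x, y))%:E.
  by rewrite /fubini_F/= Ex_fin//; exact: bmeas_section.
have bF : bmeas (fun x => \int[P2]_y f (x, y)).
  split.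
    apply/measurable_EFinP. rewrite [X in measurable_fun _ X](_ : _ = fubini_F P2 (EFin \o f)).
      exact: measurable_fubini_F fi.
    by apply/funext => x; rewrite e.
  exists M => x; have bx := bmeas_section x bf. have := le_normr_Rintegral measurableT (bmeas_integrable P2 bx).
  move=> /le_trans; apply; rewrite -[leRHS](Ex_cst P2). apply: le_Ex => //; last exact: bmeas_cst.
  case: bx => mx [M' hM']; split; first exact: measurableT_comp. by exists M' => w; rewrite normr_id.
split=> //. rewrite {1}/Rintegral -integral12_prod_meas1// /Rintegral. by congr fine; apply: eq_integral => x _; rewrite e.
Qed.

End product_expectation.

(** * Positive semidefinite forms as sums of squares *)

Section sum_of_squares.
Context (R : realType) (I : finType).
Implicit Types (A B : I -> I -> R) (c : I -> R).

Definition qform A c : R := \sum_i \sum_j c i * c j * A i j.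

Lemma qform_sum A (us : seq (I -> R)) :
  (forall i j, A i j = \sum_(u <- us) u i * u j) ->
  forall c, qform A c = \sum_(u <- us) (\sum_i c i * u i) ^+ 2.
Proof.
move=> h c; rewrite /qform. under eq_bigr => i _ do under eq_bigr => j _ do rewrite h mulr_sumr. under eq_bigr => i _ do rewrite exchange_big/=.
rewrite exchange_big/=; apply: eq_bigr => u _. rewrite expr2 mulr_suml; apply: eq_bigr => i _. by rewrite mulr_sumr; apply: eq_bigr => j _; ring.
Qed.

Lemma qform_add_delta A c (i0 : I) t : (forall i j, A i j = A j i) ->
  qform A (fun i => c i + (if i == i0 then t else 0)) =
  qform A c + t * (\sum_j c j * A i0 j) *+ 2 + t ^+ 2 * A i0 i0.
Proof.
move=> sA; rewrite /qform. have e i : \sum_j (c i + (if i == i0 then t else 0)) * (c j + (if j == i0 then t else 0)) * A i j =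
   \sum_j c i * c j * A i j + c i * t * A i i0 + (if i == i0 then t * (\sum_j c j * A i0 j) + t ^+ 2 * A i0 i0 else 0).
  transitivity (\sum_j (c i * c j * A i j + (c i + (if i == i0 then t else 0)) * (if j == i0 then t else 0) * A i j
     + (if i == i0 then t else 0) * (c j * A i j))).
    by apply: eq_bigr => j _; ring.
  rewrite !big_split/= -mulr_sumr -addrA. have -> : \sum_j (c i + (if i == i0 then t else 0)) * (if j == i0 then t else 0) * A i j =
     (c i + (if i == i0 then t else 0)) * t * A i i0.
    rewrite (bigD1 i0)//= eqxx big1 ?addr0// => j /negbTE ->; ring.
  by rewrite -addrA; congr (_ + _); case: eqVneq => [->|_]; ring.
under eq_bigr do rewrite e. rewrite !big_split/= -big_mkcond big_pred1_eq. have -> : \sum_i c i * t * A i i0 = t * \sum_j c j * A i0 j.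
  by rewrite mulr_sumr; apply: eq_bigr => j _; rewrite sA; ring.
ring.
Qed.

(** Lagrange reduction: each step eliminates one index by subtracting the square built from its row.
    The number of squares is exactly [#|I|], with zero vectors for vanishing pivots, because it
    becomes the exponent in [gaussian_comparison]. *)
Lemma psd_sum_of_squares A : (forall i j, A i j = A j i) ->
  (forall c, 0 <= qform A c) ->
  exists us : seq (I -> R), size us = #|I| /\
    forall i j, A i j = \sum_(u <- us) u i * u j.
Proof.
move=> sA pA. suff H n : forall (S : {set I}) B, #|S| = n -> (forall i j, B i j = B j i) ->
   (forall c, 0 <= qform B c) -> (forall i j, i \notin S -> B i j = 0) -> exists us : seq (I -> R), size us = n /\ forall i j, B i j = \sum_(u <- us) u i * u j.
  apply: (H _ finset.setT) => //; first by rewrite cardsT. by move=> i j; rewrite finset.in_setT.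
elim: n => [|n ih] S B cS sB pB zB.
  exists [::]; split => // i j; rewrite big_nil zB//. by move/eqP: cS; rewrite cards_eq0 => /eqP ->; rewrite finset.in_set0.
have [i0 i0S] : exists i0, i0 \in S by apply/set0Pn; rewrite -card_gt0 cS. have c0 : qform B (fun=> 0) = 0.
  by rewrite /qform big1// => i _; rewrite big1// => j _; rewrite !mul0r.
have a0 : 0 <= B i0 i0.
  have := pB (fun i => 0 + (if i == i0 then 1 else 0)). rewrite qform_add_delta// c0 big1 ?mulr0 ?mul0rn ?expr1n ?mul1r ?add0r//. by move=> j _; rewrite mul0r.
have minq c t : 0 <= qform B c + t * (\sum_j c j * B i0 j) *+ 2 + t ^+ 2 * B i0 i0.
  by rewrite -qform_add_delta.
have cS' : #|S :\ i0| = n by move: cS; rewrite (cardsD1 i0) i0S => -[]. have [b0|b0] := eqVneq (B i0 i0) 0.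
  have z0 c : \sum_j c j * B i0 j = 0.
    (* With a zero pivot the form is affine along [i0]; this multiple would bring its value to
       -1. *)
    apply/eqP/negPn/negP => s0. have := minq c (- (qform B c + 1) / (\sum_j c j * B i0 j) / 2). rewrite b0 mulr0 addr0. set s := \sum_j _; set q := qform _ _.
    have -> : (- (q + 1) / s / 2 * s) *+ 2 = - (q + 1) by rewrite -mulr_natr; field. by lra.
  have zr j : B i0 j = 0.
    have := z0 (fun l => if l == j then 1 else 0). rewrite (bigD1 j)//= eqxx mul1r big1 ?addr0// => l /negbTE ->; exact: mul0r.
  have [us [su hu]] := ih (S :\ i0) B cS' sB pB (fun i j => ltac:( by rewrite in_setD1 negb_and negbK => /orP[/eqP ->|/zB ->])).
  exists ((fun=> 0) :: us); split; first by rewrite /= su. by move=> i j; rewrite big_cons mul0r add0r.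
have b1 : 0 < B i0 i0 by rewrite lt_neqAle eq_sym b0. pose u i := B i0 i / Num.sqrt (B i0 i0). have uu i j : u i * u j = B i0 i * B i0 j / B i0 i0.
  rewrite /u mulrACA -invfM -expr2 sqr_sqrtr//.
pose B' i j := B i j - u i * u j. have qB' c : qform B' c = qform B c - (\sum_j c j * B i0 j) ^+ 2 / B i0 i0.
  rewrite /qform expr2 mulr_suml mulr_suml -sumrB; apply: eq_bigr => i _. rewrite mulr_sumr mulr_suml -sumrB; apply: eq_bigr => j _. by rewrite /B' uu; field.
have [|||us [su hu]] := ih (S :\ i0) B' cS'.
- by move=> i j; rewrite /B' sB mulrC.
- move=> c; rewrite qB'. have := minq c (- (\sum_j c j * B i0 j) / B i0 i0). set s := \sum_j _; set q := qform _ _.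
  suff -> : q + (- s / B i0 i0 * s) *+ 2 + (- s / B i0 i0) ^+ 2 * B i0 i0 = q - s ^+ 2 / B i0 i0 by []. by rewrite -mulr_natr; field.
- move=> i j; rewrite in_setD1 negb_and negbK /B' uu => /orP[/eqP ->|iS].
    by field.
  by rewrite (zB _ j iS) sB (zB _ i0 iS) !mul0r subrr.
- exists (u :: us); split; first by rewrite /= su. by move=> i j; rewrite big_cons -hu /B' addrC subrK.
Qed.

End sum_of_squares.

(** A centered Gaussian vector described by its characteristic function rather than by a density, so
    that the form may be degenerate. *)
Definition gaussian_vector d (T : measurableType d)
    (R : realType) (P : probability T R) (I : finType) (X : I -> T -> R)
    (A : I -> I -> R) : Prop :=
  (forall i, mfun (X i)) /\
  forall (c : I -> R) b, \int[P]_w cos (\sum_i c i * X i w + b) =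
    expR (- (qform A c / 2)) * cos b.

(** The quantification over all pairs of processes makes one test function usable in every
    comparison, including those with auxiliary normals and with independent copies. *)
Definition admissible (R : realType) (f : R -> R) : Prop :=
  (forall x, 0 <= f x) /\
  forall d1 d2 (T1 : measurableType d1) (T2 : measurableType d2)
  (P1 : probability T1 R) (P2 : probability T2 R)
  (I : Type) (X : I -> T1 -> R) (Y : I -> T2 -> R),
  (forall i, mfun (X i)) -> (forall i, mfun (Y i)) ->
  forall i, transferable P1 P2 X Y i f.

(** * Admissible test functions *)

Section admissible_kernels.
Context {R : realType}.

(** Transferability for the identity process on the line, under a Dirac mass, says in particular
    that [f] itself is bounded and measurable. *)
Lemma admissible_bmeas (f : R -> R) : admissible f -> bmeas (f : mR R -> R).
Proof.
move=> [_ /(_ _ _ _ _ (dirac (0 : mR R)) (dirac (0 : mR R)))].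
by move=> /(_ unit (fun _ => id) (fun _ => id) (fun _ => @measurable_id _ _ setT) (fun _ => @measurable_id _ _ setT) tt) [].
Qed.

Lemma admissible_measurable (f : R -> R) : admissible f -> mfun f.
Proof. by move=> /admissible_bmeas[]. Qed.

Lemma admissible_bounded (f : R -> R) : admissible f -> exists M, forall x, `|f x| <= M.
Proof. by move=> /admissible_bmeas[]. Qed.

Lemma admissible_abssin (n : nat) :
  admissible (fun x : R => n.+1%:R * `|sin (n.+1%:R^-1 * x)|).
Proof.
split; first by move=> x; rewrite mulr_ge0. by move=> d1 d2 T1 T2 P1 P2 I X Y mX mY i; exact: transferable_abssin.
Qed.

Lemma admissible_cauchy (h : R) : 0 < h ->
  admissible (fun x => h / pi / (h ^+ 2 + x ^+ 2)).
Proof.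
move=> h0; split.
  by move=> x; rewrite !divr_ge0 ?pi_ge0 ?addr_ge0 ?sqr_ge0// ltW.
move=> d1 d2 T1 T2 P1 P2 I X Y mX mY i. have -> : (fun x => h / pi / (h ^+ 2 + x ^+ 2)) = (fun x => (h * pi)^-1 * (1 + (x / h) ^+ 2)^-1).
  apply/funext => x; have p0 := pi_gt0 R. have : 0 < h ^+ 2 + x ^+ 2 by rewrite ltr_pwDl ?sqr_ge0// exprn_gt0. move=> hx; have h0' : h != 0 by rewrite gt_eqF.
  have p0' : (pi : R) != 0 by rewrite gt_eqF. have -> : 1 + (x / h) ^+ 2 = (h ^+ 2 + x ^+ 2) / h ^+ 2 by field.
  have gen (p S : R) : p != 0 -> S != 0 -> h / p / S = (h * p)^-1 / (S / h ^+ 2).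
    by move=> p1 S1; field; rewrite ?h0' ?p1 ?S1.
  by apply: gen => //; exact: lt0r_neq0.
apply: transferableM => //; first exact: transferable_cst. exact: transferable_cauchy.
Qed.

End admissible_kernels.

(** * Comparison of Gaussian expectations under comparable covariances *)

Section gaussian_comparison.
Context (R : realType) d (T : measurableType d)
  (P : probability T R) (W : nat -> T -> R).
Hypothesis mW : forall j, mfun (W j).
Hypothesis hW : std_normal_sums P W.

Section transfer_gaussian.
Context d1 d2 (T1 : measurableType d1) (T2 : measurableType d2)
  (P1 : probability T1 R) (P2 : probability T2 R) (I : finType)
  (X : I -> T1 -> R) (Y : I -> T2 -> R).

(** A tested family may repeat indices; collecting the coefficients of equal indices brings it back
    to the characteristic functions of the two vectors, which depend on the quadratic forms only. *)
Lemma gaussian_transfer (A B : I -> I -> R) (f : I -> R -> R) :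
  gaussian_vector P1 X A -> gaussian_vector P2 Y B ->
  (forall c, qform A c = qform B c) -> (forall i, admissible (f i)) ->
  \int[P1]_w (\prod_i f i (X i w)) = \int[P2]_w (\prod_i f i (Y i w)).
Proof.
move=> [mX hX] [mY hY] AB af; apply: (same_law_eq (X := X) (Y := Y)).
  split; [exact: bmeas_cst|exact: bmeas_cst|move=> J t c b]. pose c' i := \sum_(j | t j == i) c j.
  have e (S : Type) (Z : I -> S -> R) w : \sum_j c j * Z (t j) w = \sum_i c' i * Z i w.
    rewrite (partition_big t xpredT)//=; apply: eq_bigr => i _. by rewrite mulr_suml; apply: eq_bigr => j /eqP ->.
  under eq_Rintegral do rewrite mul1r e; under [RHS]eq_Rintegral do rewrite mul1r e. by rewrite hX hY AB.
by apply: (same_law_prod mX mY) => i; have [_] := af i; exact.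
Qed.

End transfer_gaussian.

Section realization.
Context (I : finType).
Implicit Types (ws us : seq (I -> R)) (f : I -> R -> R).

Definition realize ws (i : I) (w : T) : R :=
  \sum_(l < size ws) nth (fun=> 0) ws l i * W l w.

Definition gram ws (i j : I) : R := \sum_(u <- ws) u i * u j.

Lemma measurable_realize ws i : mfun (realize ws i).
Proof. by apply: measurable_sum => l; exact: measurable_funM. Qed.

Lemma realize_gaussian ws : gaussian_vector P (realize ws) (gram ws).
Proof.
split; first exact: measurable_realize. move=> c b; rewrite (qform_sum (us := ws))//. have -> : \sum_(u <- ws) (\sum_i c i * u i) ^+ 2 =
    \sum_(l < size ws) (\sum_i c i * nth (fun=> 0) ws l i) ^+ 2.
  by rewrite (big_nth (fun=> 0)) big_mkord.
rewrite -(hW _ (fun l => \sum_i c i * nth (fun=> 0) ws l i)). apply: eq_Rintegral => w _; congr (cos (_ + b)).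
rewrite /realize; under eq_bigr => i _ do rewrite mulr_sumr. rewrite exchange_big/=; apply: eq_bigr => l _.
by rewrite mulr_suml; apply: eq_bigr => i _; rewrite mulrA.
Qed.

Lemma bmeas_prod d' (T' : measurableType d') (X : I -> T' -> R) f :
  (forall i, mfun (X i)) -> (forall i, admissible (f i)) ->
  bmeas (fun w => \prod_i f i (X i w)).
Proof.
move=> mX af; elim: (index_enum I) => [|i s ih].
  by under eq_fun do rewrite big_nil; exact: bmeas_cst.
under eq_fun do rewrite big_cons; apply: bmeasM => //; split.
  by apply: measurableT_comp => //; exact: admissible_measurable.
by have [M hM] := admissible_bounded (af i); exists M.
Qed.

Notation N s := (normal_prob (0 : R) s : probability (mR R) R).

(** One direction is singled out and its normal is placed on a separate factor of a product space,
    with standard deviation [s]. The effect of changing [s] can then be read off the density of a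
    single real normal. *)
Lemma realize_cons_gaussian ws (u : I -> R) s : 0 < s ->
  gaussian_vector (P \x N s)%E (fun i z => realize ws i z.1 + u i * z.2)
    (gram ((fun i => s * u i) :: ws)).
Proof.
move=> s0; have mZ i : mfun (fun z : T * mR R => realize ws i z.1 + u i * z.2).
  apply: measurable_funD; first exact: measurableT_comp (measurable_realize ws i) measurable_fst. by apply: measurable_funM => //; exact: measurable_snd.
split=> // c b. have bm : bmeas (fun z : T * mR R => cos (\sum_i c i * (realize ws i z.1 + u i * z.2) + b)).
  apply: bmeas_cos; apply: measurable_funD => //; apply: measurable_sum => i. by apply: measurable_funM => //; exact: mZ.
rewrite (proj2 (Ex_prod P (N s) bm)) /=. have inner x : \int[N s]_y cos (\sum_i c i * (realize ws i x + u i * y) + b) =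
    expR (- (s ^+ 2 * (\sum_i c i * u i) ^+ 2 / 2)) * cos (\sum_i c i * realize ws i x + b).
  rewrite -normal_cos//; apply: eq_Rintegral => y _; congr cos. rewrite mulr_suml addrA -big_split/=; congr (_ + _); apply: eq_bigr => i _; ring.
under eq_Rintegral do rewrite inner. have [_ hr] := realize_gaussian ws. rewrite ExZ; last first.
  apply: bmeas_cos; apply: measurable_funD => //; apply: measurable_sum => i. by apply: measurable_funM => //; exact: measurable_realize.
rewrite hr mulrA -expRD; congr (expR _ * _). have qg (l : seq (I -> R)) : qform (gram l) c = \sum_(u <- l) (\sum_i c i * u i) ^+ 2.
  exact: qform_sum.
rewrite !qg big_cons. have -> : \sum_i c i * (s * u i) = s * \sum_i c i * u i.
  by rewrite mulr_sumr; apply: eq_bigr => i _; ring.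
by rewrite exprMn; field.
Qed.

Lemma Ex_normal_scale_le (F : T * mR R -> R) (s t : R) : 0 < s -> s <= t ->
  bmeas F -> (forall z, 0 <= F z) ->
  \int[(P \x N s)%E]_z F z <= t / s * \int[(P \x N t)%E]_z F z.
Proof.
move=> s0 st bF F0. have [bs es] := Ex_prod P (N s) bF; have [bt et] := Ex_prod P (N t) bF. rewrite [leLHS]es [X in _ * X]et.
rewrite -(ExZ P _ bt); apply: le_Ex bs (bmeasZ _ bt) _ => x. have bx := bmeas_section x bF.
rewrite -lee_fin EFinM -[X in (X <= _)%E](Ex_fin (N s) bx) -[X in (_ <= _ * X)%E](Ex_fin (N t) bx).
apply: normal_prob_scale_le => //; first by case: bx => mx _; exact/measurable_EFinP. by move=> y; rewrite lee_fin.
Qed.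

Lemma realize_scale ws (u : I -> R) f (s t : R) : 0 < s -> s <= t ->
  (forall i, admissible (f i)) ->
  \int[P]_w (\prod_i f i (realize ((fun i => s * u i) :: ws) i w)) <=
  t / s * \int[P]_w (\prod_i f i (realize ((fun i => t * u i) :: ws) i w)).
Proof.
move=> s0 st af; have t0 := lt_le_trans s0 st. rewrite !(gaussian_transfer (realize_gaussian _) (realize_cons_gaussian ws u _) (fun=> erefl) af)//.
have mZ i : mfun (fun z : T * mR R => realize ws i z.1 + u i * z.2).
  by have [h _] := realize_cons_gaussian ws u s0; exact: h.
apply: Ex_normal_scale_le => //; first exact: bmeas_prod. by move=> z; rewrite prodr_ge0// => i _; case: (af i).
Qed.

Lemma realize_scale_seq us ws f (s t : R) : 0 < s -> s <= t ->
  (forall i, admissible (f i)) ->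
  \int[P]_w (\prod_i f i (realize ([seq (fun i => s * u i) | u <- us] ++ ws) i w)) <=
  (t / s) ^+ size us *
  \int[P]_w (\prod_i f i (realize ([seq (fun i => t * u i) | u <- us] ++ ws) i w)).
Proof.
move=> s0 st af; elim: us ws => [|u us ih] ws; first by rewrite /= expr0 mul1r. have ts : 0 <= t / s by rewrite divr_ge0 ?(ltW s0) ?(le_trans (ltW s0)).
rewrite !map_cons !cat_cons. apply: (le_trans (realize_scale _ _ s0 st af)). have -> : size (u :: us) = (size us).+1 by [].
(* The law depends on the Gram matrix only, so the direction just treated may be moved behind the
   remaining ones. *)
rewrite exprS -(mulrA (t / s)); apply: ler_wpM2l => //. have pe (x : I -> R) (a b : seq (I -> R)) : \int[P]_w (\prod_i f i (realize (x :: a ++ b) i w)) =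
    \int[P]_w (\prod_i f i (realize (a ++ x :: b) i w)).
  apply: (gaussian_transfer (realize_gaussian _) (realize_gaussian _)) => // c. rewrite /qform; apply: eq_bigr => i _; apply: eq_bigr => j _; congr (_ * _).
  by rewrite /gram big_cons !big_cat/= big_cons addrCA.
by rewrite !pe; exact: ih.
Qed.

End realization.

(** Put D = B - A and k = L - 1. The hypotheses make D and V = A - D/k positive semidefinite, and A
    = D/k + V while B = (1 + 1/k) D + V. With D a sum of [#|I|] squares, A is turned into B by
    stretching [#|I|] directions from [s] = sqrt(1/k) to [t] = sqrt(1 + 1/k), at a cost of t/s =
    sqrt L each. *)
Lemma gaussian_comparison d1 d2 (T1 : measurableType d1)
    (T2 : measurableType d2) (P1 : probability T1 R) (P2 : probability T2 R)
    (I : finType) (X : I -> T1 -> R) (Y : I -> T2 -> R) (A B : I -> I -> R)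
    (f : I -> R -> R) (L : R) : 1 < L ->
  gaussian_vector P1 X A -> gaussian_vector P2 Y B ->
  (forall i j, A i j = A j i) -> (forall i j, B i j = B j i) ->
  (forall c, qform A c <= qform B c) ->
  (forall c, qform B c <= L * qform A c) -> (forall i, admissible (f i)) ->
  \int[P1]_w (\prod_i f i (X i w)) <=
  Num.sqrt L ^+ #|I| * \int[P2]_w (\prod_i f i (Y i w)).
Proof.
move=> L1 gX gY sA sB AB BA af. pose D i j := B i j - A i j; pose k := L - 1. have k0 : 0 < k by rewrite subr_gt0. have qlin (a b : R) (A1 A2 : I -> I -> R) c :
    qform (fun i j => a * A1 i j + b * A2 i j) c = a * qform A1 c + b * qform A2 c.
  rewrite /qform !mulr_sumr -big_split/=; apply: eq_bigr => i _. by rewrite !mulr_sumr -big_split/=; apply: eq_bigr => j _; ring.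
have qD c : qform D c = qform B c - qform A c.
  rewrite (_ : D = fun i j => 1 * B i j + (-1) * A i j); first by rewrite qlin; ring. by apply/funext => i; apply/funext => j; rewrite /D; ring.
have [us [su hu]] := @psd_sum_of_squares R I D (fun i j => ltac:(by rewrite /D sA sB)) (fun c => ltac:(by rewrite qD subr_ge0)).
pose V i j := 1 * A i j + (- k^-1) * D i j. have qV c : qform V c = qform A c - k^-1 * qform D c by rewrite qlin; ring.
have [vs [sv hv]] := @psd_sum_of_squares R I V (fun i j => ltac:(by rewrite /V /D sA sB))
  (fun c => ltac:(rewrite qV qD subr_ge0 ler_pdivrMl//; have := BA c; rewrite /k; lra)).
pose s := Num.sqrt k^-1; pose t := Num.sqrt (1 + k^-1). have s0 : 0 < s by rewrite sqrtr_gt0 invr_gt0.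
have st : s <= t by rewrite ler_sqrt ?lerDr// addr_ge0// invr_ge0 ltW.
have gE a i j : gram ([seq (fun i => a * u i) | u <- us] ++ vs) i j = a ^+ 2 * D i j + V i j.
  rewrite /gram big_cat/= big_map hu hv mulr_sumr; congr (_ + _). by apply: eq_bigr => u _; ring.
have qg a c : qform (gram ([seq (fun i => a * u i) | u <- us] ++ vs)) c = a ^+ 2 * qform D c + qform V c.
  rewrite -[qform V c]mul1r -qlin /qform; apply: eq_bigr => i _; apply: eq_bigr => j _. by rewrite gE mul1r.
have -> : \int[P1]_w (\prod_i f i (X i w)) = \int[P]_w (\prod_i f i (realize ([seq (fun i => s * u i) | u <- us] ++ vs) i w)).
  apply: (gaussian_transfer gX (realize_gaussian _)) => // c. by rewrite qg qV sqr_sqrtr ?invr_ge0 ?(ltW k0)//; ring.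
have -> : \int[P2]_w (\prod_i f i (Y i w)) = \int[P]_w (\prod_i f i (realize ([seq (fun i => t * u i) | u <- us] ++ vs) i w)).
  apply: (gaussian_transfer gY (realize_gaussian _)) => // c. by rewrite qg qV sqr_sqrtr ?addr_ge0 ?invr_ge0 ?(ltW k0)// qD; ring.
have -> : Num.sqrt L = t / s.
  rewrite /t /s -sqrtrV ?invr_ge0 ?(ltW k0)// invrK -sqrtrM ?addr_ge0 ?invr_ge0 ?(ltW k0)//. by congr Num.sqrt; rewrite /k; field; rewrite gt_eqF.
by rewrite -su; exact: realize_scale_seq.
Qed.

End gaussian_comparison.

(** * Independence and linear combinations of independent normals *)

Section independence.
Context d (T : measurableType d) (R : realType)
  (P : probability T R).

(** As functions of A, the probability of A and F together and the product of their probabilities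
    are finite measures. Agreeing on a pi-system that contains the whole space, they agree on the
    generated sigma-algebra. *)
Lemma indep_extend (G : set (set T)) (F : set T) :
  G `<=` measurable -> setI_closed G -> G setT -> measurable F ->
  (forall A, G A -> P (A `&` F) = (P A * P F)%E) ->
  forall A, <<s G >> A -> P (A `&` F) = (P A * P F)%E.
Proof.
move=> Gm GI GT mF h A GA. have f0 : 0 <= fine (P F) by rewrite fine_ge0. pose m2 := mscale (NngNum f0) P. have e2 B : m2 B = (P B * P F)%E.
  by rewrite /m2 /mscale/= fineK ?fin_num_measure// muleC.
rewrite -e2. have := @g_sigma_algebra_measure_unique _ R T G Gm (fun=> setT) (fun=> GT) _ (mrestr P mF) m2 GI _ _ A GA; apply.
- by rewrite bigcup_const//; exists 0%N.
- by move=> B GB; transitivity (P B * P F)%E; [exact: h|rewrite -e2].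
- by move=> _; rewrite -[X in (X < _)%E]/(P (setT `&` F)) setTI; apply: (le_lt_trans (probability_le1 P mF)); exact: ltry.
Qed.

Lemma Ex_indep (S Y : T -> R) (f : R * R -> R) :
  mfun S -> mfun Y ->
  (forall A B : set R, measurable A -> measurable B ->
    P (S @^-1` A `&` Y @^-1` B) = (P (S @^-1` A) * P (Y @^-1` B))%E) ->
  bmeas (f : mR R * mR R -> R) ->
  \int[P]_w f (S w, Y w) = \int[P]_w (\int[P]_w' f (S w, Y w')).
Proof.
move=> mS mY ind bf; have [mf [M hM]] := bf. pose Sf : T -> mR R := S; pose Yf : T -> mR R := Y. have mSf : mfun Sf by []. have mYf : mfun Yf by [].
pose SX : {RV P >-> mR R} := HB.pack Sf (isMeasurableFun.Build _ _ _ _ Sf mSf). pose YX : {RV P >-> mR R} := HB.pack Yf (isMeasurableFun.Build _ _ _ _ Yf mYf).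
have mSY : mfun (fun w => (S w, Y w) : mR R * mR R).
  exact: measurable_fun_pair.
pose SYf w := (S w, Y w) : mR R * mR R. pose SYX : {RV P >-> (mR R * mR R)%type} := HB.pack SYf (isMeasurableFun.Build _ _ _ _ SYf mSY).
pose m1 : probability (mR R) R := distribution P SX. pose m2 : probability (mR R) R := distribution P YX.
pose m12 : probability (mR R * mR R)%type R := distribution P SYX. have e12 X : measurable X -> (m1 \x m2)%E X = m12 X.
  by apply: product_measure_unique => A B mA mB; exact: ind.
have push d' (T' : measurableType d') (Z : {RV P >-> T'}) (g : T' -> R) : bmeas g -> \int[distribution P Z]_y g y = \int[P]_w g (Z w).
  move=> bg; rewrite /Rintegral integral_distribution//; first exact/measurable_EFinP/bg.1. have [mg [N hN]] := bg.
  apply: (bmeas_integrable P (f := g \o Z)); split; first exact: measurableT_comp. by exists N => w; exact: hN.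
rewrite -(push _ _ SYX f bf). have -> : \int[distribution P SYX]_y f y = \int[(m1 \x m2)%E]_z f z.
  rewrite /Rintegral; congr fine; apply: eq_measure_integral => X mX _. by rewrite -[LHS]/(m12 X) -e12.
have [b1 ->] := Ex_prod m1 m2 bf. rewrite (push _ _ SX (fun x => \int[m2]_y f (x, y)))//.
apply: eq_Rintegral => w _; rewrite (push _ _ YX (fun y => f (S w, y)))//. exact: bmeas_section.
Qed.

Variable X : nat -> T -> R.
Hypothesis mX : forall j, mfun (X j).
Hypothesis indepX : mutually_independent P X.

Definition rects (s : seq nat) : set (set T) :=
  [set E | exists A : nat -> set R, (forall j, measurable (A j)) /\
    E = \bigcap_(j in [set` s]) (X j @^-1` A j)].

Lemma rects_measurable s : rects s `<=` measurable.
Proof.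
move=> E [A [mA ->]]; apply: bigcap_measurableType => // j _. by rewrite -[X in measurable X]setTI; exact: mX.
Qed.

Lemma rects_setI s : setI_closed (rects s).
Proof.
move=> E F [A [mA ->]] [B [mB ->]]; exists (fun j => A j `&` B j). split; first by move=> j; exact: measurableI.
by rewrite -bigcapI; apply: eq_bigcapr => j _; rewrite preimage_setI.
Qed.

Lemma rects_setT s : rects s setT.
Proof.
exists (fun=> setT); split => //. by apply/seteqP; split => // w _ j _.
Qed.

(** Independence is given on finite rectangles; it is extended to the generated sigma-algebras one
    index list at a time. *)
Lemma indep_sigma s t E F : uniq (s ++ t) -> <<s rects s >> E -> <<s rects t >> F ->
  P (E `&` F) = (P E * P F)%E.
Proof.
move=> ust sE tF. have mst r A : <<s rects r >> A -> measurable A.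
  apply: smallest_sub; first exact: sigma_algebra_measurable. exact: rects_measurable.
have us : uniq s by move: ust; rewrite cat_uniq => /and3P[]. have ut : uniq t by move: ust; rewrite cat_uniq => /and3P[].
apply: (indep_extend (@rects_measurable s) (@rects_setI s) (@rects_setT s) (mst _ _ tF) _ sE). move=> A rA. rewrite setIC muleC.
apply: (indep_extend (@rects_measurable t) (@rects_setI t) (@rects_setT t) (rects_measurable rA) _ tF). move=> B [BB [mB eB]]; case: rA => AA [mA eA].
pose C j := if j \in s then AA j else BB j. have mC j : measurable (C j) by rewrite /C; case: ifP.
have -> : B `&` A = \bigcap_(j in [set` s ++ t]) (X j @^-1` C j).
  rewrite eA eB; apply/seteqP; split => w.
    move=> [hB hA] j /=; rewrite mem_cat /C => /orP[js|jt].
      by rewrite js; exact: hA.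
    case: ifPn => [js|_]; [exact: hA|exact: hB].
  move=> h; split => j /= jr.
    have := h j; rewrite /= mem_cat jr orbT => /(_ isT); rewrite /C. case: ifPn => // js.
    move: ust; rewrite cat_uniq => /and3P[_ /hasPn/(_ j jr)]; by rewrite /= js.
  by have := h j; rewrite /= mem_cat jr => /(_ isT); rewrite /C jr.
rewrite indepX// big_cat/= eA eB !indepX// muleC; congr (_ * _)%E.
  rewrite !big_seq; apply: eq_bigr => j jt; rewrite /C ifF//. apply/negbTE/negP => js; move: ust; rewrite cat_uniq => /and3P[_ /hasPn/(_ j jt)].
  by rewrite /= js.
by rewrite !big_seq; apply: eq_bigr => j js; rewrite /C js.
Qed.

Lemma rects_lin s (a : nat -> R) : forall A : set R, measurable A ->
  <<s rects s >> ((fun w => \sum_(j <- s) a j * X j w) @^-1` A).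
Proof.
move=> A mA. have mXs j : j \in s -> mfun (X j : g_sigma_algebraType (rects s) -> R).
  move=> js _ B mB; rewrite setTI; apply: sub_sigma_algebra. exists (fun i => if i == j then B else setT); split; first by move=> i; case: ifP.
  apply/seteqP; split => w.
    by move=> Bw i _ /=; case: eqVneq => // ->.
  by move=> /(_ j js) /=; rewrite eqxx.
have : mfun ((fun w => \sum_(j <- s) a j * X j w) : g_sigma_algebraType (rects s) -> R).
  under eq_fun do rewrite big_seq. rewrite (_ : (fun w => _) = (fun w => \sum_(j <- s) (if j \in s then a j * X j w else 0))); last first.
    by apply/funext => w; rewrite -big_mkcond.
  have mh j : mfun ((fun w => if j \in s then a j * X j w else 0) : g_sigma_algebraType (rects s) -> R).
    have [js|js] := boolP (j \in s); last exact: measurable_cst. by apply: measurable_funM => //; exact: mXs.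
  exact: measurable_sum.
by move=> /(_ measurableT A mA); rewrite setTI.
Qed.

Hypothesis normalX : forall j (A : set R), measurable A -> P (X j @^-1` A) = normal_prob 0 1 A.

(** Induction on [n]: with the first terms frozen, the last normal contributes its own
    characteristic function, a factor that does not involve the phase. *)
Lemma normal_sum_cos (c : nat -> R) n b :
  \int[P]_w cos (\sum_(j < n) c j * X j w + b) =
  expR (- ((\sum_(j < n) c j ^+ 2) / 2)) * cos b.
Proof.
elim: n b => [|n ih] b.
  rewrite big_ord0 mul0r oppr0 expR0 mul1r -[RHS](Ex_cst P). by apply: eq_Rintegral => w _; rewrite big_ord0 add0r.
pose S w := \sum_(j < n) c j * X j w.
have SE w : S w = \sum_(j <- iota 0 n) c j * X j w by rewrite /S -(big_mkord xpredT (fun j => c j * X j w)) /index_iota subn0.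
have mS : mfun S by apply: measurable_sum => j; exact: measurable_funM. have mf : mfun (fun z : mR R * mR R => z.1 + c n * z.2 + b).
  apply: measurable_funD => //; apply: measurable_funD; first exact: measurable_fst. by apply: measurable_funM => //; exact: measurable_snd.
have := @Ex_indep S (X n) (fun z => cos (z.1 + c n * z.2 + b)) mS (mX n) _ (bmeas_cos mf). move=> /(_ _)/= e.
transitivity (\int[P]_w cos (S w + c n * X n w + b)).
  by apply: eq_Rintegral => w _; rewrite big_ord_recr.
rewrite e; last first.
  move=> A B mA mB; apply: (@indep_sigma (iota 0 n) [:: n]).
  - by rewrite -[[:: n]]/(iota n 1) -[X in iota X 1]add0n -iotaD iota_uniq.
  - by have := @rects_lin (iota 0 n) c A mA; under eq_fun do rewrite -SE.
  - have := @rects_lin [:: n] (fun=> 1) B mB. by under eq_fun do rewrite big_seq1 mul1r.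
have inner w : \int[P]_w' cos (S w + c n * X n w' + b) = expR (- (c n ^+ 2 / 2)) * cos (S w + b).
  pose Nf : T -> mR R := X n. have mNf : mfun Nf by exact: mX. pose NX : {RV P >-> mR R} := HB.pack Nf (isMeasurableFun.Build _ _ _ _ Nf mNf).
  have := @normal_cos R 1 (c n) (S w + b) ltr01; rewrite expr1n mul1r => <-. have bc : bmeas (fun y : mR R => cos (c n * y + (S w + b))).
    by exact: bmeas_cos_affine.
  transitivity (\int[distribution P NX]_y cos (c n * y + (S w + b))).
    rewrite /Rintegral integral_distribution//; last 2 first.
    - by apply/measurable_EFinP; case: bc.
    - apply: (bmeas_integrable P (f := fun w' => cos (c n * X n w' + (S w + b)))). by exact: bmeas_cos_affine.
    by congr fine; apply: eq_integral => w' _; congr (EFin (cos _)); change (S w + c n * X n w' + b = c n * X n w' + (S w + b)); ring.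
  rewrite /Rintegral; congr fine. pose NP : probability (mR R) R := normal_prob 0 1. pose D : probability (mR R) R := distribution P NX.
  change (\int[D]_x (cos (c n * x + (S w + b)))%:E = \int[NP]_x (cos (c n * x + (S w + b)))%:E)%E. apply: eq_measure_integral => A mA _. exact: normalX.
under eq_Rintegral do rewrite inner. rewrite ExZ ?ih; last by apply: bmeas_cos; exact: measurable_funD.
by rewrite mulrA -expRD big_ord_recr/=; congr (expR _ * _); field.
Qed.

End independence.

(** * Joint cumulants as sums over set partitions *)

Section joint_cumulants.
Import mathcomp.boot.fintype mathcomp.boot.finset.
Context (R : realFieldType) (I : finType).
Implicit Types (mu nu : {set I} -> R) (S A B C D : {set I}) (p : {set {set I}}).

Definition cumulant_weight n : R := (-1) ^+ n.-1 * (n.-1)`!%:R.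

Definition joint_cumulant mu S : R :=
  \sum_(p : {set {set I}} | partition p S) cumulant_weight #|p| * \prod_(B in p) mu B.

Lemma cumulant_weightS n : (0 < n)%N ->
  cumulant_weight n.+1 + n%:R * cumulant_weight n = 0.
Proof.
case: n => // n _; rewrite /cumulant_weight /= factS exprS natrM. by ring.
Qed.

Lemma partition_card_gt0 p S s0 : s0 \in S -> partition p S -> (0 < #|p|)%N.
Proof.
move=> sS pS; rewrite card_gt0; apply: contraTneq pS => ->. by rewrite /partition /cover big_set0 eq_sym; case: eqP sS => // ->; rewrite inE.
Qed.

Lemma partition_avoid p S s0 : s0 \in S -> partition p S ->
  #|[set D in p | s0 \notin D]| = #|p|.-1.
Proof.
move=> sS pS; have tp := partition_trivIset pS. have cp : s0 \in cover p by rewrite (cover_partition pS). rewrite [in RHS](cardsD1 (pblock p s0)) pblock_mem//=.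
apply: eq_card => D; rewrite !inE andbC; case: (boolP (D \in p)) => Dp; rewrite ?andbF// !andbT. apply/idP/idP => [|].
  by apply: contra => /eqP ->; rewrite mem_pblock.
by apply: contra => s0D; rewrite (def_pblock tp Dp s0D).
Qed.

(** A pair formed by a block B containing [s0], other than S, and a partition of B is the same as a
    partition p of S with one marked block S minus B that avoids [s0]. There are [#|p|.-1] possible
    marks, so [cumulant_weightS] cancels the contribution of every partition with at least two
    blocks, and the one-block partition gives [mu S]. *)
Lemma joint_cumulant_rec mu S s0 : s0 \in S -> mu set0 = 1 ->
  \sum_(B : {set I} | (B \subset S) && (s0 \in B)) joint_cumulant mu B * mu (S :\: B) = mu S.
Proof.
move=> sS mu0. rewrite (bigD1 S)/=; last by rewrite subxx. rewrite setDv mu0 mulr1. have -> : \sum_(B : {set I} | (B \subset S) && (s0 \in B) && (B != S))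
     joint_cumulant mu B * mu (S :\: B) =
   \sum_(p : {set {set I}} | partition p S) \sum_(D : {set I} | (D \in p) && (s0 \notin D)) cumulant_weight #|p|.-1 * \prod_(B in p) mu B.
  under eq_bigr do rewrite /joint_cumulant mulr_suml. rewrite !pair_big_dep/=. have DDS D : D \subset S -> S :\: (S :\: D) = D.
    by move=> DS; rewrite setDDr setDv set0U; apply/setIidPr.
  rewrite (reindex_onto (fun x : {set {set I}} * {set I} => (S :\: x.2, x.1 :\ x.2))
     (fun y : {set I} * {set {set I}} => ((S :\: y.1) |: y.2, S :\: y.1))) /=; last first.
    move=> [B p] /= /andP[/andP[/andP[BS sB] BnS] pB]. rewrite DDS//; congr (_, _); rewrite setU1K//. apply/negP => Dp; have /subsetP/= h := partitionS pB Dp.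
    have /set0Pn[x xD] := partition_neq0 pB Dp. by have := h _ xD; move: xD; rewrite inE => /andP[/negbTE ->].
  have cond p D : partition p S -> D \in p -> D \subset S by exact: partitionS. apply: eq_big => [[p D]|[p D]] /=.
    apply/idP/idP.
      move=> /andP[/andP[/andP[/andP[_ sSD] SDS] pSD] /eqP[e1 e2]]. have DS : D \subset S by rewrite -e2 subsetDl. have Dp : D \in p by rewrite -e1 e2 setU11.
      have sD : s0 \notin D by move: sSD; rewrite inE sS andbT. have D0 : D != set0 by apply: contraNneq SDS => ->; rewrite setD0. rewrite Dp sD !andbT.
      have := partitionU1 pSD D0; rewrite setD1K//. have -> : D :|: S :\: D = S.
        by apply/setP => x; rewrite !inE; case: (boolP (x \in D)) => //= xD; rewrite (subsetP DS).
      by apply; rewrite -setI_eq0; apply/eqP/setP => x; rewrite !inE; case: (x \in D).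
    move=> /andP[pS /andP[Dp sD]]. have DS := cond _ _ pS Dp; have D0 := partition_neq0 pS Dp.
    rewrite DDS// setD1K// eqxx andbT (partitionD1 pS Dp) subsetDl inE sS sD/= andbT. apply: contra D0 => /eqP SDS; rewrite -subset0; apply/subsetP => x xD.
    by have := subsetP DS _ xD; rewrite -SDS inE xD.
  move=> /andP[/andP[/andP[/andP[_ sSD] SDS] pSD] /eqP[e1 e2]]. have Dp : D \in p by rewrite -e1 e2 setU11. rewrite e2 -mulrA; congr (cumulant_weight _ * _).
    by rewrite (cardsD1 D p) Dp.
  by rewrite mulrC (big_setD1 D Dp).
rewrite /joint_cumulant -big_split/=. transitivity (\sum_(p : {set {set I}} | partition p S) (if p == [set S] then mu S else 0)).
  apply: eq_bigr => p pS. have -> (x : R) : \sum_(D in p | s0 \notin D) x = x *+ #|[set D in p | s0 \notin D]|.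
    by rewrite -sumr_const; apply: eq_bigl => D; rewrite inE.
  rewrite (partition_avoid sS pS) -mulr_natl mulrA -mulrDl. have p0 := partition_card_gt0 sS pS. case: eqVneq => [->|pnS].
    by rewrite cards1 big_set1 /cumulant_weight/= expr0 fact0 mul0r addr0 !mul1r.
  have p1 : (1 < #|p|)%N.
    rewrite ltn_neqAle p0 andbT eq_sym; apply: contra pnS => /cards1P[D pD]. have := cover_partition pS; rewrite pD /cover big_set1 => ->; exact: eqxx.
  rewrite -[in cumulant_weight #|p|](prednK p0) cumulant_weightS ?mul0r//. by rewrite -ltnS prednK.
rewrite (bigD1 [set S])/=; last first.
  rewrite /partition /cover big_set1 eqxx trivIset1 inE/= eq_sym. by apply/set0Pn; exists s0.
by rewrite eqxx big1 ?addr0// => p /andP[_ /negbTE ->].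
Qed.

(** Independent groups have no mixed cumulants. In the recursion rooted at a point of S in A, the
    proper mixed blocks vanish by induction, and the blocks inside A already sum to [mu S] by the
    recursion for the part of S in A; what is left is the cumulant of S itself. *)
Lemma joint_cumulant_factor mu (al be : {set I} -> R) A S :
  al set0 = 1 -> be set0 = 1 ->
  (forall C, mu C = al (C :&: A) * be (C :\: A)) ->
  S :&: A != set0 -> S :\: A != set0 -> joint_cumulant mu S = 0.
Proof.
move=> al0 be0 muE. have mu0 : mu set0 = 1 by rewrite muE set0I set0D al0 be0 mulr1. have [n] := ubnP #|S|; elim: n S => // n ih S; rewrite ltnS => cS SA SB.
have /set0Pn[s0] := SA; rewrite inE => /andP[sS sA]. have := joint_cumulant_rec sS mu0. rewrite (bigD1 S) ?subxx//= setDv mu0 mulr1.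
rewrite (bigID (fun B => B \subset A))/= [X in _ + (_ + X)]big1 ?addr0; last first.
  move=> B /andP[/andP[/andP[BS sB] BnS] BA]. rewrite ih ?mul0r//.
  - apply: leq_trans cS; apply: proper_card; rewrite properEneq BnS BS//.
  - by apply/set0Pn; exists s0; rewrite inE sB sA.
  - by rewrite setD_eq0.
have -> : \sum_(B : {set I} | (B \subset S) && (s0 \in B) && (B != S) && (B \subset A)) joint_cumulant mu B * mu (S :\: B) = be (S :\: A) * mu (S :&: A).
  rewrite -(@joint_cumulant_rec mu (S :&: A) s0) ?inE ?sS ?sA// mulr_sumr. apply: eq_big => B.
    rewrite subsetI; case: (boolP (B \subset A)) => BA; rewrite ?andbF//= !andbT. case: (boolP (B == S)) => [/eqP BeS|]; rewrite ?andbT ?andbF//.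
    by have := BA; rewrite BeS -setD_eq0 (negbTE SB).
  move=> /andP[/andP[/andP[BS sB] BnS] BA]. rewrite mulrCA; congr (_ * _); rewrite !muE. have e1 : (S :\: B) :&: A = (S :&: A :\: B) :&: A.
    by apply/setP => x; rewrite !inE; case: (x \in A); rewrite ?andbF ?andbT.
  have e2 : (S :\: B) :\: A = S :\: A.
    apply/setP => x; rewrite !inE; case: (boolP (x \in A)) => //= xA. by case: (boolP (x \in B)) => //= /(subsetP BA); rewrite (negbTE xA).
  have e3 : (S :&: A :\: B) :\: A = set0.
    by apply/setP => x; rewrite !inE; case: (x \in A); rewrite ?andbF.
  by rewrite -e1 e2 e3 be0 mulr1 mulrC.
rewrite !muE -setIA setIid. have -> : (S :&: A) :\: A = set0 by apply/setP => x; rewrite !inE; case: (x \in A); rewrite ?andbF.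
rewrite be0 mulr1 mulrC => /eqP; rewrite -subr_eq0 addrK => /eqP; exact.
Qed.

Lemma prod_perturbation (T : finType) (P : {set T}) (f g : T -> R) (M dl : R) :
  1 <= M -> 0 <= dl -> (forall x, x \in P -> `|f x| <= M) -> (forall x, x \in P -> `|g x| <= M) ->
  (forall x, x \in P -> `|f x - g x| <= dl * M) ->
  `|\prod_(x in P) f x - \prod_(x in P) g x| <= dl * (#|P|%:R * M ^+ #|P|).
Proof.
move=> M1 d0 fM gM fg. have M0 : 0 <= M by apply: le_trans M1. rewrite -!big_enum/= cardE.
have : forall x, x \in enum P -> x \in P by move=> x; rewrite mem_enum. elim: (enum P) => [|x s ih] h; first by rewrite !big_nil subrr normr0 mul0r mulr0.
rewrite !big_cons [size _]/=. have xP : x \in P by apply: h; rewrite inE eqxx. have hs y : y \in s -> y \in P by move=> ys; apply: h; rewrite inE ys orbT.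
set F := \prod_(i <- s) f i; set G := \prod_(i <- s) g i. have FM : `|F| <= M ^+ size s.
  rewrite /F; elim: (s) hs => [|y t iht] ht; first by rewrite big_nil normr1. rewrite big_cons normrM exprS ler_pM ?fM ?iht ?ht ?inE ?eqxx//.
  by move=> z zt; apply: ht; rewrite inE zt orbT.
have -> : f x * F - g x * G = (f x - g x) * F + g x * (F - G) by ring. apply: (le_trans (ler_normD _ _)); rewrite !normrM.
have -> : dl * ((size s).+1%:R * M ^+ (size s).+1) = dl * M * M ^+ size s + M * (dl * ((size s)%:R * M ^+ size s)) by rewrite exprS -natr1; ring.
apply: lerD; apply: ler_pM => //; [exact: fg|exact: gM|exact: ih].
Qed.

Lemma joint_cumulant_perturbation mu nu S (M dl : R) :
  1 <= M -> 0 <= dl -> (forall C, `|mu C| <= M) -> (forall C, `|nu C| <= M) ->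
  (forall C, `|mu C - nu C| <= dl * M) ->
  `|joint_cumulant mu S - joint_cumulant nu S| <=
  dl * \sum_(p : {set {set I}} | partition p S) `|cumulant_weight #|p| | * (#|p|%:R * M ^+ #|p|).
Proof.
move=> M1 d0 muM nuM mn; rewrite /joint_cumulant -sumrB mulr_sumr. apply: (le_trans (ler_norm_sum _ _ _)); apply: ler_sum => p _.
rewrite -mulrBr normrM mulrCA ler_wpM2l//. by apply: prod_perturbation.
Qed.

(** Each index lies in exactly one block, so every partition collects the same factor. *)
Lemma joint_cumulant_scale mu (s : I -> R) S :
  joint_cumulant (fun C => \prod_(i in C) s i * mu C) S =
  \prod_(i in S) s i * joint_cumulant mu S.
Proof.
rewrite /joint_cumulant mulr_sumr; apply: eq_bigr => p pS. rewrite big_split/= mulrCA; congr (_ * _).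
by rewrite -(big_trivIset _ (partition_trivIset pS))/= (cover_partition pS).
Qed.

(** Only the block containing [i0] changes, and it enters each product once. *)
Lemma joint_cumulant_additive mu mu1 mu2 S i0 : i0 \in S ->
  (forall C, i0 \notin C -> mu C = mu1 C /\ mu C = mu2 C) ->
  (forall C, i0 \in C -> mu C = mu1 C + mu2 C) ->
  joint_cumulant mu S = joint_cumulant mu1 S + joint_cumulant mu2 S.
Proof.
move=> iS h1 h2; rewrite /joint_cumulant -big_split/=; apply: eq_bigr => p pS. have tp := partition_trivIset pS.
have ci : i0 \in cover p by rewrite (cover_partition pS). have Dp := pblock_mem ci. rewrite -mulrDr; congr (_ * _).
rewrite (bigD1 (pblock p i0))//= (bigD1 (pblock p i0) (F := mu1))//= (bigD1 (pblock p i0) (F := mu2))//=. rewrite h2 ?mem_pblock// mulrDl.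
by congr (_ + _); congr (_ * _); apply: eq_bigr => B /andP[Bp BD]; apply h1; apply: contra BD => iB; rewrite (def_pblock tp Bp iB).
Qed.

End joint_cumulants.

(** * Second moments of Gaussian variables *)

Section gaussian_moments.
Context d (T : measurableType d) (R : realType)
  (P : probability T R).

Lemma sqr_nsin_le (n : nat) (x : R) : (n.+1%:R * sin (n.+1%:R^-1 * x)) ^+ 2 <= x ^+ 2.
Proof.
have n0 : (0 : R) < n.+1%:R by rewrite ltr0n. rewrite -[leLHS]real_normK ?num_real// -[leRHS]real_normK ?num_real//.
rewrite ler_sqr ?nnegrE// normrM gtr0_norm//. apply: (le_trans (ler_wpM2l (ltW n0) (sin_le_id _))).
by rewrite normrM gtr0_norm ?invr_gt0// mulrA mulfV ?gt_eqF// mul1r.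
Qed.

(** The square of n sin(X/n) is a combination of 1 and cos(2X/n), so its mean is explicit and tends
    to V. These squares converge to X^2, so Fatou bounds the second moment above; they stay below
    X^2, which bounds it below. *)
Lemma gaussian_second_moment (X : T -> R) (V : R) : mfun X -> 0 <= V ->
  (forall s, \int[P]_w cos (s * X w) = expR (- (s ^+ 2 * V / 2))) ->
  (\int[P]_w (X w ^+ 2)%:E = V%:E)%E.
Proof.
move=> mX V0 hX. pose g (n : nat) w := (n.+1%:R * sin (n.+1%:R^-1 * X w)) ^+ 2. have msin n : mfun (fun w => sin (n.+1%:R^-1 * X w)).
  apply: measurableT_comp; first by apply: continuous_measurable_fun; exact: continuous_sin. exact: measurable_funM.
have mg n : mfun (g n).
  by apply: measurable_funX; apply: measurable_funM.
have mX2 : mfun (fun w => X w ^+ 2) by exact: measurable_funX. have gE n w : g n w = n.+1%:R ^+ 2 / 2 * (1 - cos (2 * n.+1%:R^-1 * X w)).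
  rewrite /g; set t := n.+1%:R^-1 * X w. have -> : 2 * n.+1%:R^-1 * X w = t + t by rewrite /t; ring. have -> : 1 - cos (t + t) = 2 * sin t ^+ 2.
    by rewrite cosD; have := cos2Dsin2 t; rewrite !expr2; lra.
  by field.
have bcos (s : R) : bmeas (fun w => cos (s * X w)) by apply: bmeas_cos; exact: measurable_funM. have b1 : bmeas (fun _ : T => 1 : R) by exact: bmeas_cst.
have ig n : (\int[P]_w (g n w)%:E = (n.+1%:R ^+ 2 / 2 * (1 - expR (- (2 * V / n.+1%:R ^+ 2))))%:E)%E.
  have bg : bmeas (g n).
    rewrite (_ : g n = fun w => n.+1%:R ^+ 2 / 2 * (1 - cos (2 * n.+1%:R^-1 * X w))).
      by apply: bmeasZ; exact: bmeasB.
    by apply/funext => w; rewrite gE.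
  rewrite Ex_fin//; congr EFin. under eq_Rintegral do rewrite gE. rewrite ExZ; last exact: bmeasB. under eq_Rintegral do rewrite -mulN1r.
  rewrite ExD//; last exact: bmeasZ. rewrite ExZ// Ex_cst hX; congr (_ * (1 + _)); rewrite mulN1r; congr (- expR (- _)).
  by have n1 : n.+1%:R != 0 :> R by []; field.
have n0 n : (0 : R) < n.+1%:R by rewrite ltr0n. have cI : (\int[P]_w (g n w)%:E)%E @[n --> \oo] --> V%:E.
  under eq_fun do rewrite ig; apply: cvg_EFin; first exact: nearW.
  apply: (@squeeze_cvgr _ _ _ _ (fun n => V / (1 + 2 * V * n.+1%:R^-1)) (fun=> V)); last exact: cvg_cst.
  - near=> n => /=. set N : R := n.+1%:R; set y := 2 * V / N ^+ 2. have N1 : 1 <= N by rewrite ler1n. have N0 : 0 < N by exact: n0.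
    have y0 : 0 <= y by rewrite divr_ge0 ?mulr_ge0 ?sqr_ge0. have VE : V = N ^+ 2 / 2 * y by rewrite /y; field; rewrite gt_eqF.
    have c0 : 0 <= N ^+ 2 / 2 by rewrite divr_ge0 ?sqr_ge0. apply/andP; split; last first.
      rewrite [leRHS]VE; apply: ler_wpM2l => //. by rewrite lerBlDl -lerBlDr; have := expR_ge1Dx (- y); lra.
    have e1 : expR (- y) <= (1 + y)^-1.
      by rewrite expRN lef_pV2 ?posrE ?expR_gt0 ?ltr_pwDl//; exact: expR_ge1Dx.
    apply: (@le_trans _ _ (N ^+ 2 / 2 * (1 - (1 + y)^-1))); last first.
      by apply: ler_wpM2l => //; lra.
    have y1 : 0 < 1 + y by lra. have -> : N ^+ 2 / 2 * (1 - (1 + y)^-1) = V / (1 + y).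
      by rewrite [in RHS]VE; field; lra.
    apply: ler_wpM2l => //; rewrite lef_pV2 ?posrE ?ltr_pwDl ?mulr_ge0 ?invr_ge0 ?sqr_ge0 ?(ltW N0)//.
    rewrite lerD2l /y ler_wpM2l ?mulr_ge0// lef_pV2 ?posrE ?exprn_gt0//. by rewrite expr2 ler_peMr// ltW.
  - rewrite -[X in _ --> X]divr1 -[X in V / X](addr0 1) -(mulr0 (2 * V)). apply: cvgM; first exact: cvg_cst.
    apply: cvgV; first by rewrite mulr0 addr0 oner_neq0. apply: cvgD; first exact: cvg_cst. by apply: cvgM; [exact: cvg_cst|exact: cvg_harmonic].
apply/eqP; rewrite eq_le; apply/andP; split.
  have /(_ (fun n w => (g n w)%:E)) := @fatou _ T R P setT measurableT. move=> /(_ (fun n => (measurable_EFinP _ _).2 (mg n))).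
  move=> /(_ (fun n w _ => ltac:(by rewrite lee_fin sqr_ge0))). rewrite (cvg_limn_einf_sup cI).1.
  apply: le_trans; rewrite le_eqVlt; apply/orP; left; apply/eqP; apply: eq_integral => w _. have c : (g n w)%:E @[n --> \oo] --> (X w ^+ 2)%:E.
    apply: cvg_EFin; first exact: nearW. rewrite expr2; under eq_fun do rewrite /= /g expr2. by apply: cvgM; exact: cvg_nsin.
  by rewrite (cvg_limn_einf_sup c).1.
have /cvg_lim <- // := cI. apply: lime_le; first by apply/cvg_ex; exists V%:E. near=> n; apply: ge0_le_integral => //.
- by move=> w _; rewrite lee_fin; exact: sqr_ge0.
- exact/measurable_EFinP.
- exact/measurable_EFinP.
- by move=> w _; rewrite lee_fin; exact: sqr_nsin_le.
Unshelve. all: end_near. Qed.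

Lemma chebyshev2 (X : T -> R) (V l : R) : mfun X -> 0 < l ->
  (\int[P]_w (X w ^+ 2)%:E = V%:E)%E ->
  (P [set w | (l < `|X w|)%R] <= (V / l ^+ 2)%:E)%E.
Proof.
move=> mX l0 hX. have mA : measurable [set w | (l < `|X w|)%R].
  rewrite (_ : [set w | _] = (fun w => `|X w|) @^-1` `]l, +oo[%classic); last first.
    by apply/seteqP; split => w /=; rewrite in_itv/= andbT.
  by rewrite -[X in measurable X]setTI; apply: measurableT_comp.
have l2 : 0 < l ^+ 2 by exact: exprn_gt0. rewrite EFinM muleC -lee_pdivrMl ?invr_gt0// invrK -hX.
rewrite -[X in P X]setIT -integral_indic// -ge0_integralZl//; last 2 first.
- by apply/measurable_EFinP; exact: measurable_indic.
- by rewrite lee_fin ltW.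
apply: ge0_le_integral => //.
- by move=> w _; rewrite mule_ge0// lee_fin ltW.
- by apply: measurable_funeM; apply/measurable_EFinP; exact: measurable_indic.
- by apply/measurable_EFinP; exact: measurable_funX.
- move=> w _; rewrite -EFinM lee_fin indicE. have [|_] := boolP (w \in _); last by rewrite mulr0 sqr_ge0.
  rewrite inE/= mulr1 => h; rewrite -[leRHS]real_normK ?num_real// ler_sqr ?nnegrE ?(ltW l0)//. exact: ltW.
Qed.

End gaussian_moments.

(** * Ottaviani's maximal inequality *)

Section ottaviani.
Context d (T : measurableType d) (R : realType)
  (P : probability T R) (X : nat -> T -> R).
Hypothesis mX : forall j, mfun (X j).
Hypothesis indepX : mutually_independent P X.
Hypothesis normalX : forall j (A : set R), measurable A -> P (X j @^-1` A) = normal_prob 0 1 A.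

Definition block (a : nat -> R) m n w := \sum_(m <= j < n) a j * X j w.

Lemma measurable_block a m n : mfun (block a m n).
Proof. by apply: measurable_sum => j; exact: measurable_funM. Qed.

Lemma block_cos a m n (s b : R) :
  \int[P]_w cos (s * block a m n w + b) =
  expR (- (s ^+ 2 * (\sum_(m <= j < n) a j ^+ 2) / 2)) * cos b.
Proof.
have := normal_sum_cos mX indepX normalX (fun j => s * (if (m <= j)%N then a j else 0)) n b.
have -> : \sum_(j < n) (s * (if (m <= j)%N then a j else 0)) ^+ 2 = s ^+ 2 * \sum_(m <= j < n) a j ^+ 2.
  rewrite big_geq_mkord mulr_sumr [RHS]big_mkcond/=; apply: eq_bigr => j _. by case: ifP => _; rewrite exprMn// expr0n mulr0.
move=> <-; apply: eq_Rintegral => w _; congr (cos (_ + b)). rewrite /block big_geq_mkord mulr_sumr big_mkcond/=; apply: eq_bigr => j _.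
by case: ifP => _; rewrite ?mulr0 ?mul0r// mulrA.
Qed.

Lemma block_second_moment a m n :
  (\int[P]_w (block a m n w ^+ 2)%:E = (\sum_(m <= j < n) a j ^+ 2)%:E)%E.
Proof.
apply: gaussian_second_moment; first exact: measurable_block.
  by apply: sumr_ge0 => j _; exact: sqr_ge0.
move=> s; have := block_cos a m n s 0; rewrite cos0 mulr1 => <-. by apply: eq_Rintegral => w _; rewrite addr0.
Qed.

Let mset (f : T -> R) (l : R) : mfun f -> measurable [set w | (l < `|f w|)%R].
Proof.
move=> mf; rewrite (_ : [set w | _] = (fun w => `|f w|) @^-1` `]l, +oo[%classic); last first.
  by apply/seteqP; split => w /=; rewrite in_itv/= andbT.
by rewrite -[X in measurable X]setTI; apply: measurableT_comp.
Qed.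

(** Split at the first [k] where the partial sum exceeds 2l. The remaining block is independent of
    this event and, by Chebyshev and 2V <= l^2, stays within l with probability at least 1/2; when
    it does, the full sum exceeds l. The maximum therefore costs at most twice the Chebyshev bound
    of one sum. *)
Lemma ottaviani_finite a m N (V l : R) : 0 < l ->
  \sum_(m <= j < N) a j ^+ 2 <= V -> 2 * V <= l ^+ 2 ->
  (P (\big[setU/set0]_(k < N.+1) [set w | (2 * l < `|block a m k w|)%R]) <= (2 * V / l ^+ 2)%:E)%E.
Proof.
move=> l0 hV hl. have l2 : 0 < l ^+ 2 by exact: exprn_gt0. have [mN|Nm] := leqP m N; last first.
  rewrite big1 ?measure0; last first.
    move=> k _; apply/seteqP; split => // w /=; rewrite /block big_geq ?normr0.
      by rewrite ltNge mulr_ge0// ltW.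
    by rewrite (leq_trans _ (ltnW Nm))// -ltnS.
  rewrite lee_fin divr_ge0 ?(ltW l2)// mulr_ge0//. by apply: le_trans hV; apply: sumr_ge0 => j _; exact: sqr_ge0.
pose E k := [set w | (2 * l < `|block a m k w|)%R]. have mE k : measurable (E k) by apply: mset; exact: measurable_block.
pose A k := E k `\` \big[setU/set0]_(i < k) E i. have mA k : measurable (A k).
  by apply: measurableD => //; exact: bigsetU_measurable.
pose B k := [set w | (`|block a k N w| <= l)%R]. have BC k : ~` B k = [set w | (l < `|block a k N w|)%R].
  by apply/seteqP; split => w /=; rewrite /B/= ltNge => /negP.
have mB k : measurable (B k).
  by rewrite -[B k]setCK BC; apply: measurableC; apply: mset; exact: measurable_block.
have UA : \big[setU/set0]_(k < N.+1) E k = \big[setU/set0]_(k < N.+1) A k.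
  exact: (bigsetU_seqDU E N.+1).
have tA : trivIset setT A by exact: trivIset_seqDU. have AB k : (k <= N)%N -> (P (A k) <= 2%:E * P (A k `&` B k))%E.
  move=> kN; have [km|mk] := ltnP k m.
    have -> : A k = set0.
      apply/seteqP; split => // w [] /=; rewrite /E/= /block big_geq ?(ltnW km)// normr0. by rewrite ltNge mulr_ge0// ltW.
    by rewrite measure0 set0I measure0 mule0.
  have -> : P (A k `&` B k) = (P (A k) * P (B k))%E.
    apply: (indep_sigma mX indepX (s := index_iota m k) (t := index_iota k N)).
    - rewrite /index_iota (_ : iota k _ = iota (m + (k - m)) (N - k)); last by rewrite subnKC. by rewrite -iotaD iota_uniq.
    - have sE i : (i <= k)%N -> <<s rects X (index_iota m k) >> (E i).
        move=> ik; have := rects_lin (X := X) (s := index_iota m k) (fun j => if (j < i)%N then a j else 0).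
        move=> /(_ ((fun x => `|x|) @^-1` `]2 * l, +oo[%classic)) h.
        have eE : E i = (fun w => \sum_(j <- index_iota m k) (if (j < i)%N then a j else 0) * X j w) @^-1` ((fun x => `|x|) @^-1` `]2 * l, +oo[%classic).
          apply/seteqP; split => w /=; rewrite in_itv/= andbT /E/= /block; rewrite (_ : \sum_(j <- index_iota m k) _ = \sum_(m <= j < i) a j * X j w)//.
            by rewrite [RHS](big_nat_widen _ _ k)// [RHS]big_mkcond/=; apply: eq_bigr => j _; case: ifP; rewrite ?mul0r.
          by rewrite [RHS](big_nat_widen _ _ k)// [RHS]big_mkcond/=; apply: eq_bigr => j _; case: ifP; rewrite ?mul0r.
        rewrite eE; apply: h. by rewrite -[X in measurable X]setTI; apply: (measurableT_comp (f := fun x : R => `|x|)).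
      have mEs i : (i <= k)%N -> measurable (E i : set (g_sigma_algebraType (rects X (index_iota m k)))).
        exact: sE.
      have : measurable (A k : set (g_sigma_algebraType (rects X (index_iota m k)))).
        apply: measurableD; first exact: mEs. by apply: bigsetU_measurable => i _; apply: mEs; exact: ltnW.
      by [].
    - have := rects_lin (X := X) (s := index_iota k N) a. have -> : B k = (fun w => \sum_(j <- index_iota k N) a j * X j w) @^-1` `[- l, l]%classic.
        by apply/seteqP; split => w /=; rewrite in_itv/= /B/= ler_norml.
      by apply; exact: measurable_itv.
  have PB : ((1 / 2)%:E <= P (B k))%E.
    have Pc : (P (~` B k) <= (1 / 2)%:E)%E.
      rewrite BC; apply: (le_trans (chebyshev2 (measurable_block a k N) l0 (block_second_moment a k N))). rewrite lee_fin ler_pdivrMr//.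
      have : \sum_(k <= j < N) a j ^+ 2 <= V.
        apply: le_trans hV; rewrite (big_cat_nat mk kN)/= lerDr. by apply: sumr_ge0 => j _; exact: sqr_ge0.
      lra.
    move: Pc; rewrite probability_setC//. have /fineK <- := fin_num_measure P _ (mB k). by rewrite -EFinB !lee_fin; lra.
  rewrite muleCA -[leLHS]mule1; apply: lee_wpmul2l => //. have Pp : P (B k) = (fine (P (B k)))%:E by rewrite fineK// fin_num_measure.
  by move: PB; rewrite Pp -EFinM !lee_fin => PB; lra.
change (P (\big[setU/set0]_(k < N.+1) E k) <= (2 * V / l ^+ 2)%:E)%E. rewrite UA measure_bigsetU//.
apply: (@le_trans _ _ (\sum_(k < N.+1) 2%:E * P (A k `&` B k))%E).
  by apply: lee_sum => k _; apply: AB; rewrite -ltnS.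
rewrite -ge0_sume_distrr//. pose AB' k := A k `&` B k. have tAB : trivIset setT AB'.
  move=> i j _ _ [w [[Ai _] [Aj _]]]; apply: tA => //; by exists w.
have mAB k : measurable (AB' k) by exact: measurableI. have -> : (\sum_(k < N.+1) P (A k `&` B k) = P (\big[setU/set0]_(k < N.+1) AB' k))%E.
  by rewrite measure_bigsetU.
rewrite -mulrA EFinM; apply: lee_wpmul2l => //. apply: (@le_trans _ _ (P [set w | (l < `|block a m N w|)%R])).
  apply: le_measure; rewrite ?inE//.
  - by apply: bigsetU_measurable => k _; exact: measurableI.
  - by apply: mset; exact: measurable_block.
  - rewrite -bigcup_mkord => w [k /= kN [[Ek _] Bk]] /=. have kN' : (k <= N)%N by rewrite -ltnS. have mk : (m <= k)%N.
      rewrite leqNgt; apply/negP => km; move: Ek; rewrite /E/= /block big_geq ?(ltnW km)// normr0. by rewrite ltNge mulr_ge0// ltW.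
    have e : block a m N w = block a m k w + block a k N w by rewrite /block (big_cat_nat mk kN'). rewrite e; move: Ek Bk; rewrite /E /B/= => h1 h2.
    have := ler_normD (block a m k w + block a k N w) (- block a k N w). rewrite addrK normrN; lra.
apply: (le_trans (chebyshev2 (measurable_block a m N) l0 (block_second_moment a m N))). by rewrite lee_fin ler_wpM2r// invr_ge0 ltW.
Qed.

Lemma ottaviani a m (V l : R) : 0 < l ->
  (forall N, \sum_(m <= j < N) a j ^+ 2 <= V) -> 2 * V <= l ^+ 2 ->
  measurable (\bigcup_k [set w | (2 * l < `|block a m k w|)%R]) /\
  (P (\bigcup_k [set w | (2 * l < `|block a m k w|)%R]) <= (2 * V / l ^+ 2)%:E)%E.
Proof.
move=> l0 hV hl. have mE k : measurable [set w | (2 * l < `|block a m k w|)%R] by apply: mset; exact: measurable_block.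
split; first by apply: bigcup_measurable => k _; exact: mE. set E := fun k => _ in mE *.
have : P (\big[setU/set0]_(k < n) E k) @[n --> \oo] --> P (\bigcup_k E k).
  have := @nondecreasing_cvg_mu _ T R P (fun n => \big[setU/set0]_(k < n) E k). rewrite (_ : \bigcup_n \big[setU/set0]_(k < n) E k = \bigcup_k E k); last first.
    apply/seteqP; split => w.
      by move=> [n _]; rewrite -bigcup_mkord => -[k _ Ek]; exists k.
    by move=> [k _ Ek]; exists k.+1 => //; rewrite -bigcup_mkord; exists k => /=.
  apply.
  - by move=> n; apply: bigsetU_measurable => k _; exact: mE.
  - by apply: bigcup_measurable => k _; exact: mE.
  - by move=> i j ij; apply/subsetPset; exact: subset_bigsetU.
move=> h; have <- := cvg_lim (@ereal_hausdorff R) h. apply: lime_le; first by apply/cvg_ex; eexists; exact: h.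
near=> n; have n0 : (0 < n)%N by near: n; exists 1%N. rewrite -(prednK n0); apply: (ottaviani_finite l0 (hV _) hl).
Unshelve. all: end_near. Qed.

End ottaviani.

Lemma borel_cantelli d (T : measurableType d) (R : realType)
    (P : {measure set T -> \bar R}) (F : nat -> set T) :
  (forall n, measurable (F n)) -> (forall n, (P (F n) <= (2 ^- n)%:E)%E) ->
  {ae P, forall w, exists n0 : nat, forall n, (n0 <= n)%N -> ~ F n w}.
Proof.
move=> mF hF; exists (lim_sup_set F); split.
- by apply: bigcap_measurable => // k _; apply: bigcup_measurable => j _; exact: mF.
- apply: lim_sup_set_cvg0 => //. have h := @cvg_geometric_eseries_half R 2 0.
  have e : eseries (fun k => ((2 : R) / (2 ^ (k + 1))%:R)%:E) = eseries (fun k => (2 ^- k : R)%:E).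
    congr eseries; apply/funext => k; congr EFin. rewrite addn1 expnS natrM natrX invfM mulrA divff// mul1r//.
  rewrite e in h. apply: (@le_lt_trans _ _ (\sum_(n <oo) (2 ^- n)%:E)%E).
    by apply: lee_nneseries => // n _; exact: hF.
  by rewrite (cvg_lim _ h)// ltry.
- move=> w /= h k _; apply: contrapT => h'. by apply: h; exists k => n kn Fn; apply: h'; exists n.
Qed.

(** * Almost sure convergence of Gaussian power series *)

Section almost_sure.
Context d (T : measurableType d) (R : realType)
  (P : probability T R) (X : nat -> T -> R).
Hypothesis mX : forall j, mfun (X j).
Hypothesis indepX : mutually_independent P X.
Hypothesis normalX : forall j (A : set R), measurable A -> P (X j @^-1` A) = normal_prob 0 1 A.

Lemma gaussian_series_cvg (a : nat -> R) (C : R) :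
  (forall N, \sum_(0 <= j < N) a j ^+ 2 <= C) ->
  {ae P, forall w, cvgn (fun J => block X a 0 J w)}.
Proof.
move=> hC. have tail (e : R) : 0 < e -> exists m, forall N, \sum_(m <= j < N) a j ^+ 2 <= e.
  move=> e0; pose s N := \sum_(0 <= j < N) a j ^+ 2. have ub : has_ubound (range s) by exists C => _ [N _ <-]; exact: hC.
  have sup : has_sup (range s) by split => //; exists (s 0%N); exists 0%N. have [_ [m _ <-] hm] := sup_adherent e0 sup.
  exists m => N; have [mN|Nm] := leqP m N; last by rewrite big_geq ?(ltnW Nm) ?ltW. have : s N <= reals.sup (range s) by apply: ub_le_sup => //; exists N.
  by rewrite /s (big_cat_nat (leq0n m) mN)/=; move: hm; rewrite /s; lra.
(* Tail variance 8^-p / 2 against the threshold 2^-p makes the maximal inequality yield 2^-p, which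
   is summable, while the allowed oscillation, twice the threshold, tends to 0. *)
have tail2 p : exists m, forall N, \sum_(m <= j < N) a j ^+ 2 <= 8 ^- p / 2.
  by apply: tail; rewrite divr_gt0// invr_gt0 exprn_gt0.
have [m hm] := choice tail2. have p2 p : (0 : R) < 2 ^- p by rewrite invr_gt0 exprn_gt0. have e84 p : (8 ^- p : R) = 2 ^- p * (2 ^- p) ^+ 2.
  by rewrite -!exprVn -exprM muln2 -addnn exprD -!exprMn; congr (_ ^+ _); field.
have ot p := ottaviani mX indepX normalX (a := a) (m := m p) (V := 8 ^- p / 2) (p2 p) (hm p). have hot p : 2 * (8 ^- p / 2) <= (2 ^- p : R) ^+ 2.
  rewrite mulrCA divff// mulr1 e84; apply: ler_piMl; first exact: sqr_ge0. by rewrite invf_le1 ?exprn_gt0// exprn_ege1// ler1n.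
have := borel_cantelli (P := P) (fun p => (ot p (hot p)).1). move=> bc; apply: filterS (bc _) => [w [p0 hp0]|p]; last first.
  apply: (le_trans (ot p (hot p)).2); rewrite lee_fin mulrCA divff// mulr1 e84. by rewrite mulfK// gt_eqF// exprn_gt0.
apply/cauchy_cvgP; apply: cauchy_exP => e e0. have [p [pp0 pe]] : exists p, (p0 <= p)%N /\ 2 * 2 ^- p < e.
  have := @cvg_expr R (2^-1); rewrite ger0_norm ?invr_ge0// invf_lt1// ltr1n => /(_ isT)/cvgrPdist_lt/(_ (e / 2)).

  rewrite divr_gt0// => /(_ isT) [N _ hN]. exists (maxn p0 N); split; first exact: leq_maxl. have := hN (maxn p0 N) (leq_maxr _ _).
  rewrite /= sub0r normrN ger0_norm; last by rewrite exprn_ge0// invr_ge0. by rewrite exprVn; lra.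
exists (block X a 0 (m p) w); exists (m p) => // N /= mN. rewrite /ball/= distrC /block (big_cat_nat (leq0n (m p)) mN)/= addrAC subrr add0r.
apply: le_lt_trans pe; rewrite leNgt; apply/negP => h. by apply: (hp0 p pp0); exists N.
Qed.

(** For each integer radius the maximal inequality bounds the n-th coefficient uniformly in the
    truncation [J]. This uniformity serves twice: for the growth of the limit coefficients, and for
    exchanging the sum over [j] with the power series. *)
Lemma gaussian_power_series_cvg (a : nat -> nat -> R) :
  (forall r : R, 0 < r -> exists C, forall n J, (\sum_(0 <= j < J) a n j ^+ 2) * r ^+ (2 * n) <= C) ->
  {ae P, forall w, (forall n, cvgn (fun J => block X (a n) 0 J w)) /\
    forall r : R, exists B, forall n J, `|block X (a n) 0 J w| * r ^+ n <= B}.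
Proof.
move=> ha. have ae1 : {ae P, forall w, forall n, cvgn (fun J => block X (a n) 0 J w)}.
  apply: ae_foralln => n; have [C hC] := ha 1 ltr01. apply: (@gaussian_series_cvg _ C) => N; have := hC n N. by rewrite expr1n mulr1.
have ae2 : {ae P, forall w, forall i : nat, exists B n0, forall n J, (n0 <= n)%N -> `|block X (a n) 0 J w| * i.+1%:R ^+ n <= B}.
  apply: ae_foralln => i; set r : R := i.+1%:R. have r0 : 0 < r by rewrite ltr0n. have [C hC] := ha (2 * r) (mulr_gt0 (ltr0Sn _ 1) r0).
  have C0 : 0 <= C by have := hC 0%N 0%N; rewrite big_geq// mul0r. have rn n : 0 < r ^+ n by exact: exprn_gt0.
  (* The variance is controlled at radius 2r and the threshold is set at radius r, so that 2V/l^2 is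
     4^-n times a constant at most 1. *)
  pose l n := (1 + 2 * C) / r ^+ n; pose V n := C / (2 * r) ^+ (2 * n). have l0 n : 0 < l n by rewrite divr_gt0//; lra.
  have hV n N : \sum_(0 <= j < N) a n j ^+ 2 <= V n.
    by rewrite ler_pdivlMr ?exprn_gt0 ?mulr_gt0.
  have VE n : 2 * V n / l n ^+ 2 = (2 * C / (1 + 2 * C) ^+ 2) * 4 ^- n.
    rewrite /V /l exprMn exprM (_ : 2 ^+ 2 = 4 :> R); last by rewrite expr2; lra. rewrite mulnC exprM; field; rewrite !gt_eqF ?exprn_gt0//; lra.
  have V1 n : 2 * V n / l n ^+ 2 <= 2 ^- n.
    rewrite VE -[leRHS]mul1r; apply: ler_pM; rewrite ?invr_ge0 ?exprn_ge0//.
    - by rewrite divr_ge0 ?sqr_ge0// mulr_ge0.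
    - by rewrite ler_pdivrMr ?mul1r ?exprn_gt0 ?expr2; nra.
    - by rewrite lef_pV2 ?posrE ?exprn_gt0// lerXn2r ?nnegrE//; lra.
  have V2 n : 2 * V n <= l n ^+ 2.
    rewrite -[leRHS]mul1r -ler_pdivrMr ?exprn_gt0//; apply: (le_trans (V1 n)). by rewrite invf_le1 ?exprn_gt0// exprn_ege1// ler1n.
  have ot n := ottaviani mX indepX normalX (a := a n) (m := 0%N) (V := V n) (l0 n) (hV n) (V2 n). have := borel_cantelli (P := P) (fun n => (ot n).1).
  move=> bc; apply: filterS (bc _) => [w [n0 hn0]|n]; last first.
    by apply: (le_trans (ot n).2); rewrite lee_fin.
  exists (2 * (1 + 2 * C)), n0 => n J nn0. rewrite -ler_pdivlMr// -mulrA leNgt; apply/negP => h. by apply: (hn0 n nn0); exists J.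
apply: filterS2 ae1 ae2 => w h1 h2; split => // r. pose i := Num.truncn `|r|. have ri : `|r| <= i.+1%:R by rewrite ltW// truncnS_gt. have [B [n0 hB]] := h2 i.
have bnd n : exists b, forall J, `|block X (a n) 0 J w| <= b.
  have /cvg_seq_bounded [M [_ hM]] := h1 n. by exists (M + 1) => J; apply: hM => //; rewrite ltrDl.
have [b hb] := choice bnd. have b0 n : 0 <= b n by apply: (le_trans _ (hb n 0%N)).
have B0 : 0 <= B by apply: (le_trans _ (hB n0 0%N (leqnn _))); rewrite mulr_ge0// exprn_ge0. exists (B + \sum_(n < n0) b n * i.+1%:R ^+ n) => n J.
have S0 : 0 <= \sum_(n < n0) b n * i.+1%:R ^+ n :> R.
  by apply: sumr_ge0 => k _; rewrite mulr_ge0// exprn_ge0.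
apply: (@le_trans _ _ (`|block X (a n) 0 J w| * i.+1%:R ^+ n)).
  apply: ler_wpM2l => //; apply: (le_trans (ler_norm _)). by rewrite normrX lerXn2r ?nnegrE.
have [nn0|n0n] := leqP n0 n; first by apply: (le_trans (hB _ _ nn0)); rewrite lerDl.
apply: (@le_trans _ _ (b n * i.+1%:R ^+ n)); first by rewrite ler_wpM2r// exprn_ge0. rewrite (bigD1 (Ordinal n0n))//= addrCA lerDl addr_ge0//.
by apply: sumr_ge0 => k _; rewrite mulr_ge0// exprn_ge0.
Qed.

End almost_sure.

(** * Entire power series and the number of their real zeros *)

Section entire_series.
Variable R : realType.
Implicit Types (c v : nat -> R) (x r : R).

Definition ent c : Prop := forall r, exists B, forall n, `|c n| * r ^+ n <= B.

Lemma geometric_summable (u : nat -> R) B : (forall n, `|u n| * 2 ^+ n <= B) ->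
  cvgn [normed series u] /\ cvgn (series u).
Proof.
move=> hu; suff h : cvgn [normed series u] by split => //; exact: normed_cvg. have hB n : `|u n| <= geometric B (2^-1) n.
  by rewrite /geometric/= exprVn -ler_pdivrMr ?invr_gt0 ?exprn_gt0// invrK.
apply: (series_le_cvg _ _ hB) => [n|n|]; first exact: normr_ge0.
  by apply: le_trans (hB n).
by apply: is_cvg_geometric_series; rewrite ger0_norm ?invr_ge0// invf_lt1// ltr1n.
Qed.

Lemma ent_norm c : ent c -> forall r, exists2 B, 0 <= B & forall n, `|c n| * `|r| ^+ n <= B.
Proof. by move=> ec r; have [B hB] := ec `|r|; exists B => //; apply: le_trans (hB 0%N); rewrite mulr_ge0. Qed.

Lemma ent_pair c v (C rho : R) : ent c -> (forall n, `|v n| <= C * rho ^+ n) ->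
  exists B, forall n, `|v n * c n| * 2 ^+ n <= B.
Proof.
move=> ec hv; have [B B0 hB] := ent_norm ec (2 * rho). exists (`|C| * B) => n; rewrite normrM. apply: (@le_trans _ _ ((`|C| * `|rho| ^+ n) * `|c n| * 2 ^+ n)).
  do 2 (apply: ler_wpM2r; rewrite ?exprn_ge0//). by apply: (le_trans (hv n)); rewrite -normrX -normrM ler_norm.
have -> : `|C| * `|rho| ^+ n * `|c n| * 2 ^+ n = `|C| * (`|c n| * `|2 * rho| ^+ n).
  by rewrite normrM exprMn [`|2|]ger0_norm//; ring.
by apply: ler_wpM2l.
Qed.

Lemma ent_pseries_cvg c x : ent c -> cvgn (pseries c x).
Proof.
move=> ec; have [|B hB] := @ent_pair c (fun n => x ^+ n) 1 `|x| ec.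
  by move=> n; rewrite mul1r normrX.
apply: (@geometric_summable (fun n => c n * x ^+ n) B _).2 => n. by rewrite mulrC [c n * _]mulrC [X in X <= _]mulrC.
Qed.

Lemma ent_diffs c : ent c -> ent (pseries_diffs c).
Proof.
move=> ec r; pose r' := 2 * `|r| + 1; have [B B0 hB] := ent_norm ec r'. have r'1 : 1 <= r' by rewrite /r' lerDr mulr_ge0.
exists (2 * B) => n; rewrite /pseries_diffs normrM [`|_.+1%:R|]ger0_norm//. apply: (@le_trans _ _ (2 * (`|c n.+1| * `|r'| ^+ n.+1))); last by apply: ler_wpM2l.
have n2 : n.+1%:R <= 2 * 2 ^+ n :> R.
  by rewrite -exprS -natrX ler_nat; exact/ltnW/ltn_expl.
apply: (@le_trans _ _ ((2 * 2 ^+ n) * `|c n.+1| * `|r| ^+ n)).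
  apply: (@le_trans _ _ (n.+1%:R * `|c n.+1| * `|r| ^+ n)).
    by apply: ler_wpM2l; rewrite ?mulr_ge0// (le_trans (ler_norm _))// normrX.
  by apply: ler_wpM2r; rewrite ?exprn_ge0//; apply: ler_wpM2r.
have -> : 2 * 2 ^+ n * `|c n.+1| * `|r| ^+ n = 2 * (`|c n.+1| * (2 * `|r|) ^+ n) by rewrite exprMn; ring. apply: ler_wpM2l => //; apply: ler_wpM2l => //.
rewrite (ger0_norm (le_trans ler01 r'1)). apply: (@le_trans _ _ (r' ^+ n)); last by rewrite exprS ler_peMl// exprn_ge0// (le_trans _ r'1).
by rewrite lerXn2r ?nnegrE ?mulr_ge0 ?(le_trans ler01 r'1)// lerDl.
Qed.

Definition psum c x := limn (pseries c x).

Lemma is_derive_psum c x : ent c -> is_derive x (1 : R) (psum c) (psum (pseries_diffs c) x).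
Proof.
move=> ec; have ed := ent_diffs ec; have edd := ent_diffs ed. apply: (@pseries_snd_diffs _ c (`|x| + 1)); try exact: ent_pseries_cvg.
by rewrite [ltRHS]ger0_norm ?addr_ge0// ltrDl.
Qed.

Lemma psum_cvg c x : ent c -> series (fun n => c n * x ^+ n) @ \oo --> psum c x.
Proof. by move=> ec; have := @ent_pseries_cvg c x ec. Qed.

Lemma psum_continuous c : ent c -> continuous (psum c).
Proof.
move=> ec x; apply: differentiable_continuous; apply/derivable1_diffP. exact: (@ex_derive _ _ _ _ _ _ _ (is_derive_psum x ec)).
Qed.

Lemma psum0 c : ent c -> psum c 0 = c 0%N.
Proof.
move=> ec; apply: cvg_lim => //. apply: cvg_near_cst; exists 1%N => // n /= n0.
rewrite /pseries/series/= -(prednK n0) big_nat_recl//= expr0 mulr1 big1 ?addr0// => i _. by rewrite exprS mul0r mulr0.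
Qed.

Definition norm_le c r M := forall N, \sum_(0 <= n < N) `|c n| * r ^+ n <= M.

Lemma cvg_le_cst (u : nat -> R) l M : u @ \oo --> l -> (forall n, u n <= M) -> l <= M.
Proof.
move=> ul uM; have /cvg_lim <- // := ul. by apply: limr_le; [apply/cvg_ex; exists l|exact: nearW].
Qed.

(* The coefficients of ([psum c x] - [psum c z]) / (x - z). *)
Definition qcoef c (z : R) n := limn (series (fun k => c (n + k).+1 * z ^+ k)).

Lemma ent_shift c m : ent c -> ent (fun k => c (m + k)%N).
Proof.
move=> ec r; have [B B0 hB] := ent_norm ec (`|r| + 1); exists B => n; apply: le_trans (hB (m + n)%N).
apply: ler_wpM2l => //; rewrite ger0_norm ?addr_ge0// exprD. apply: (@le_trans _ _ ((`|r| + 1) ^+ n)).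
  by rewrite (le_trans (ler_norm _))// normrX lerXn2r ?nnegrE ?addr_ge0// lerDl.
by rewrite ler_peMl ?exprn_ge0 ?addr_ge0// exprn_ege1// lerDr.
Qed.

Lemma qcoef_cvg c z n : ent c -> series (fun k => c (n + k).+1 * z ^+ k) @ \oo --> qcoef c z n.
Proof. by move=> ec; have := @ent_pseries_cvg (fun k => c (n.+1 + k)%N) z (ent_shift _ ec). Qed.

Lemma qcoef_rec c z n : ent c -> qcoef c z n = c n.+1 + z * qcoef c z n.+1.
Proof.
move=> ec; apply: cvg_lim => //. rewrite -cvg_shiftS. rewrite (_ : (fun N => _) = (fun N => c n.+1 + z * series (fun k => c (n.+1 + k).+1 * z ^+ k) N)).
  by apply: cvgD; [exact: cvg_cst|apply: cvgM; [exact: cvg_cst|exact: qcoef_cvg]].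
apply/funext => N; rewrite /series/= big_nat_recl//= addn0 expr0 mulr1; congr (_ + _). by rewrite mulr_sumr; apply: eq_bigr => k _; rewrite exprS addSnnS; ring.
Qed.

Lemma qcoef0 c z : ent c -> psum c z = c 0%N + z * qcoef c z 0.
Proof.
move=> ec; apply: cvg_lim => //; rewrite -cvg_shiftS. rewrite (_ : (fun N => _) = (fun N => c 0%N + z * series (fun k => c (0 + k).+1 * z ^+ k) N)).
  by apply: cvgD; [exact: cvg_cst|apply: cvgM; [exact: cvg_cst|exact: qcoef_cvg]].
apply/funext => N; rewrite /pseries /series/= big_nat_recl//= expr0 mulr1; congr (_ + _).
by rewrite mulr_sumr; apply: eq_bigr => k _; rewrite exprS add0n; ring.
Qed.

Lemma ent_abs c : ent c -> ent (fun k => `|c k|).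
Proof. by move=> ec r; have [B hB] := ec r; exists B => k; rewrite normr_id. Qed.

Lemma qcoef_norm c z r n : ent c -> `|z| <= r -> `|qcoef c z n| <= qcoef (fun k => `|c k|) r n.
Proof.
move=> ec zr; have h := qcoef_cvg (z := z) (n := n) ec. have h' := qcoef_cvg (z := r) (n := n) (ent_abs ec).
apply: (ler_cvg_to (cvg_norm h) h'); apply: nearW => N. apply: (le_trans (ler_norm_sum _ _ _)); apply: ler_sum => k _.
by rewrite normrM normrX ler_wpM2l// lerXn2r ?nnegrE// (le_trans _ zr).
Qed.

Lemma qcoef_ent c z : ent c -> ent (qcoef c z).
Proof.
move=> ec r; pose s := 2 * (`|r| + `|z| + 1); have [B B0 hB] := ent_norm ec s. have s0 : 0 <= s by rewrite mulr_ge0// !addr_ge0.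
have s1 : 1 <= s by rewrite /s; have := normr_ge0 r; have := normr_ge0 z; lra. exists (2 * B) => n. suff h : `|qcoef c z n| * `|r| ^+ n <= 2 * B.
  by apply: le_trans h; rewrite ler_wpM2l// (le_trans (ler_norm _))// normrX.
have h : `|series (fun k => c (n + k).+1 * z ^+ k) N| @[N --> \oo] --> `|qcoef c z n|.
  by apply: cvg_norm; exact: qcoef_cvg.
have h2 : `|series (fun k => c (n + k).+1 * z ^+ k) N| * `|r| ^+ n @[N --> \oo] --> `|qcoef c z n| * `|r| ^+ n by apply: cvgM; [exact: h|exact: cvg_cst].
apply: (cvg_le_cst h2) => N. apply: (@le_trans _ _ (series (geometric B 2^-1) N)); last first.
  rewrite geometric_seriesE ?lt_eqF ?invf_lt1 ?ltr1n//. rewrite (_ : 1 - 2^-1 = 2^-1 :> R); last by lra.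
  rewrite /= invrK mulrC; apply: ler_wpM2l => //; apply: ler_piMr => //.
apply: (@le_trans _ _ ((\sum_(0 <= k < N) `|c (n + k).+1 * z ^+ k|) * `|r| ^+ n)).
  by rewrite ler_wpM2r ?exprn_ge0//; exact: ler_norm_sum.
rewrite mulr_suml; apply: ler_sum => k _; rewrite /geometric/= normrM normrX exprVn ler_pdivlMr ?exprn_gt0//.
apply: le_trans (hB (n + k).+1); rewrite -!mulrA; apply: ler_wpM2l => //.
rewrite (ger0_norm s0) exprS; apply: (@le_trans _ _ (s ^+ (n + k))); last by rewrite ler_peMl ?exprn_ge0.
rewrite exprD mulrCA; apply: ler_pM; rewrite ?exprn_ge0 ?mulr_ge0 ?exprn_ge0//.
  by rewrite lerXn2r ?nnegrE// /s; have := normr_ge0 r; have := normr_ge0 z; lra.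
by rewrite -exprMn lerXn2r ?nnegrE ?mulr_ge0// /s; have := normr_ge0 r; have := normr_ge0 z; lra.
Qed.

Lemma ent_cvg0 c r : ent c -> `|c n| * r ^+ n @[n --> \oo] --> (0 : R).
Proof.
move=> ec; have h : cvgn (pseries (fun k => `|c k|) r) by apply: ent_pseries_cvg; exact: ent_abs. exact: (cvg_series_cvg_0 h).
Qed.

Lemma qcoef_psum c z x : ent c -> psum c z = 0 -> psum c x = (x - z) * psum (qcoef c z) x.
Proof.
move=> ec hz; have eq := @qcoef_ent c z ec. have q0 : c 0%N = - (z * qcoef c z 0) by apply/eqP; rewrite -addr_eq0 -qcoef0// hz.
have key N : series (fun n => c n * x ^+ n) N.+1 = (x - z) * series (fun n => qcoef c z n * x ^+ n) N.+1 - x * (qcoef c z N * x ^+ N).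
  elim: N => [|N IH]; first by rewrite /series/= !big_nat1 !expr0 q0; ring.
  rewrite [LHS]seriesSr IH [in RHS]seriesSr [qcoef c z N](qcoef_rec _ _ ec) exprS; ring.
have h1 := psum_cvg (x := x) ec; have h2 := psum_cvg (x := x) eq. have h3 : qcoef c z n * x ^+ n @[n --> \oo] --> (0 : R).
  exact: cvg_series_cvg_0 (ent_pseries_cvg (x := x) eq).
have h4 : (x - z) * series (fun n => qcoef c z n * x ^+ n) N.+1 - x * (qcoef c z N * x ^+ N) @[N --> \oo] --> (x - z) * psum (qcoef c z) x - x * 0.
  apply: cvgB; first by apply: cvgM; [exact: cvg_cst|rewrite cvg_shiftS]. by apply: cvgM; [exact: cvg_cst|exact: h3].
move: h4; rewrite mulr0 subr0; under eq_fun do rewrite -key. rewrite (cvg_shiftS (series (fun n => c n * x ^+ n))) => h4. exact: (cvg_unique _ h1 h4).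
Qed.

(** The coefficients of the quotient are dominated by the sequence [G] built from the absolute
    values at radius [r], which satisfies G_n = |c_(n+1)| + r G_(n+1). Weighting by powers of s and
    summing telescopes up to a remainder that tends to 0, so division by x - z divides the weighted
    l^1 norm by at least s - r. Iterated over the zeros, this replaces Jensen's formula. *)
Lemma qcoef_norm_le c z r s M : ent c -> `|z| <= r -> r < s -> norm_le c s M ->
  norm_le (qcoef c z) s (M / (s - r)).
Proof.
move=> ec zr rs hM N; have r0 : 0 <= r by apply: le_trans zr. have s0 : 0 < s by exact: le_lt_trans rs.
have ea := ent_abs ec; set G := qcoef (fun k => `|c k|) r. have G0 n : 0 <= G n by apply: (le_trans _ (@qcoef_norm c 0 r n ec _)); rewrite ?normr0.
apply: (@le_trans _ _ (\sum_(0 <= n < N) G n * s ^+ n)).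
  by apply: ler_sum => n _; rewrite ler_wpM2r ?exprn_ge0 ?(ltW s0)//; exact: qcoef_norm.
rewrite ler_pdivlMr ?subr_gt0//. have key n : (\sum_(0 <= k < n) G k * s ^+ k) * (s - r) <= \sum_(0 <= k < n.+1) `|c k| * s ^+ k + r * (G n * s ^+ n).
  elim: n => [|n IH].
    rewrite big_nil mul0r addr_ge0 ?mulr_ge0 ?exprn_ge0 ?(ltW s0)//. by apply: sumr_ge0 => k _; rewrite mulr_ge0 ?exprn_ge0 ?(ltW s0).
  rewrite big_nat_recr//= mulrDl big_nat_recr//=. have -> : G n = `|c n.+1| + r * G n.+1 by exact: qcoef_rec.
  rewrite (_ : r * _ = r * ((`|c n.+1| + r * G n.+1) * s ^+ n)) in IH; last first.
    by congr (_ * (_ * _)); exact: qcoef_rec.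
  by rewrite exprS; move: IH; lra.
have lim0 : G n * s ^+ n @[n --> \oo] --> (0 : R).
  have := ent_cvg0 s (@qcoef_ent _ r ea). by under eq_fun do rewrite (ger0_norm (G0 _)).
have inc n : (N <= n)%N -> (\sum_(0 <= k < N) G k * s ^+ k) * (s - r) <= M + r * (G n * s ^+ n).
  move=> Nn; apply: (@le_trans _ _ ((\sum_(0 <= k < n) G k * s ^+ k) * (s - r))).
    rewrite ler_wpM2r ?subr_ge0 ?(ltW rs)// [leRHS](big_cat_nat (leq0n N) Nn)/= lerDl. by apply: sumr_ge0 => k _; rewrite mulr_ge0 ?exprn_ge0 ?(ltW s0).
  by apply: (le_trans (key n)); rewrite lerD2r.
have lM : M + r * (G n * s ^+ n) @[n --> \oo] --> M + r * 0.
  by apply: cvgD; [exact: cvg_cst|apply: cvgM; [exact: cvg_cst|exact: lim0]].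
move: lM; rewrite mulr0 addr0 => lM. by apply: (ler_cvg_to (@cvg_cst _ _ _ \oo _) lM); exists N.
Qed.

(* Each zero divides the norm on the disc of radius 5r by at least 4r and contributes
   a factor at most r at the origin. *)
Lemma zeros_bound (s : seq R) c r M : 0 < r -> ent c -> norm_le c (5 * r) M ->
  uniq s -> (forall z, z \in s -> `|z| <= r /\ psum c z = 0) -> `|c 0%N| <= M / 4 ^+ size s.
Proof.
move=> r0; elim: s c M => [|z s IH] c M ec hM.
  move=> _ _; rewrite expr0 divr1; apply: le_trans (hM 1%N). by rewrite big_nat1 expr0 mulr1.
move=> /= /andP[zs us] hs; have [zr cz] := hs z (mem_head _ _). have r5 : r < 5 * r by lra. have hq := qcoef_norm_le ec zr r5 hM. have eq := @qcoef_ent c z ec.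
have := IH _ _ eq hq us; have -> : c 0%N = - (z * qcoef c z 0).
  by apply/eqP; rewrite -addr_eq0 -qcoef0// cz.
move=> h; rewrite normrN normrM. have {}h : `|qcoef c z 0| <= M / (5 * r - r) / 4 ^+ size s.
  apply: h => y ys; have [yr cy] := hs y (mem_behead (s := z :: s) ys). split => //; move: cy; rewrite (qcoef_psum _ ec cz) => /eqP; rewrite mulf_eq0 subr_eq0.
  by case/orP => [/eqP yz|/eqP//]; move: zs; rewrite -yz ys.
apply: (le_trans (ler_pM (normr_ge0 _) (normr_ge0 _) zr h)). have p4 : (4 : R) ^+ size s != 0 by rewrite expf_neq0.
have -> : r * (M / (5 * r - r) / 4 ^+ size s) = M / 4 ^+ (size s).+1; last by []. have -> : 5 * r - r = 4 * r by ring.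
by rewrite exprS; field; rewrite p4 gt_eqF.
Qed.

End entire_series.

(** * Limits of centered normal variables *)

Section gaussian_limit.
Context d (T : measurableType d) (R : realType)
  (P : probability T R).

Definition centered_normal (L : T -> R) (V : R) : Prop :=
  [/\ mfun L, 0 <= V & forall s b,
    \int[P]_w cos (s * L w + b) = expR (- (s ^+ 2 * V / 2)) * cos b].

(** Upper bounds on the variances pass to the limit together with normality; in this way the decay
    of the coefficient variances survives the summation over [j]. *)
Lemma centered_normal_lim (L : nat -> T -> R) (L' : T -> R) (V : nat -> R) :
  (forall k, centered_normal (L k) (V k)) -> (forall w, L k w @[k --> \oo] --> L' w) ->
  exists2 V', (forall C, (forall k, V k <= C) -> V' <= C) & centered_normal L' V'.
Proof.
move=> hL cL. have mL k : mfun (L k) by have [] := hL k. have mL' : mfun L'.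
  by apply: (measurable_fun_cvg (h := L)) => // w _; exact: cL.
have V0 k : 0 <= V k by have [] := hL k. have hE k s b : \int[P]_w cos (s * L k w + b) = expR (- (s ^+ 2 * V k / 2)) * cos b by have [] := hL k.
have cE s b : \int[P]_w cos (s * L k w + b) @[k --> \oo] --> \int[P]_w cos (s * L' w + b).
  apply: (@Ex_bounded_cvg _ _ _ P (fun k w => cos (s * L k w + b)) _ 1 _ _ _).2.
  - move=> k; by apply: (bmeas_cos_affine _ _ _).1.
  - by move=> k w; rewrite ler_norml cos_geN1 cos_le1.
  - move=> w; have h : s * L k w + b @[k --> \oo] --> s * L' w + b.
      by apply: cvgD; [apply: cvgM; [exact: cvg_cst|exact: cL]|exact: cvg_cst].
    exact: (continuous_cvg _ (@continuous_cos R _) h).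
(* The characteristic function of the limit is positive close to 0, which makes the variances converge. *)
have [n hn] : exists n : nat, 0 < \int[P]_w cos (n.+1%:R^-1 * L' w + 0).
  have h : \int[P]_w cos (n.+1%:R^-1 * L' w + 0) @[n --> \oo] --> \int[P]_w (1 : R).
    apply: (@Ex_bounded_cvg _ _ _ P (fun n w => cos (n.+1%:R^-1 * L' w + 0)) _ 1 _ _ _).2.
    - move=> n; by apply: (bmeas_cos_affine _ _ _).1.
    - by move=> n w; rewrite ler_norml cos_geN1 cos_le1.
    - move=> w; have h : n.+1%:R^-1 * L' w + 0 @[n --> \oo] --> 0 * L' w + 0.
        by apply: cvgD; [apply: cvgM; [exact: cvg_harmonic|exact: cvg_cst]|exact: cvg_cst].
      by have := continuous_cvg _ (@continuous_cos R _) h; rewrite mul0r addr0 cos0; exact.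
  rewrite Ex_cst in h; have /cvgrPdist_lt/(_ _ ltr01)[n _ /(_ n (leqnn n))] := h. by move=> /= /(le_lt_trans (ler_norm _)) hn; exists n; lra.
pose s0 : R := n.+1%:R^-1; pose e := \int[P]_w cos (s0 * L' w + 0). have s00 : 0 < s0 by rewrite invr_gt0.
have ce : expR (- (s0 ^+ 2 * V k / 2)) @[k --> \oo] --> e.
  have := cE s0 0; under eq_fun do rewrite hE. by under eq_fun do rewrite cos0 mulr1.
have cV : V k @[k --> \oo] --> - 2 / s0 ^+ 2 * ln e.
  have h : - 2 / s0 ^+ 2 * ln (expR (- (s0 ^+ 2 * V k / 2))) @[k --> \oo] --> - 2 / s0 ^+ 2 * ln e.
    apply: cvgM; first exact: cvg_cst. exact: (continuous_cvg _ (continuous_ln hn) ce).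
  rewrite (_ : V = fun k => - 2 / s0 ^+ 2 * ln (expR (- (s0 ^+ 2 * V k / 2))))//. by apply/funext => k; rewrite expRK; field; rewrite gt_eqF.
move: (- 2 / _ * _) cV => v cV; exists v.
  move=> C hC; have /cvg_lim <- // := cV; apply: limr_le; first by apply/cvg_ex; eexists; exact: cV. exact: nearW.
split => //.
  have /cvg_lim <- // := cV; apply: limr_ge; first by apply/cvg_ex; eexists; exact: cV. exact: nearW.
move=> s b; have h2 : expR (- (s ^+ 2 * V k / 2)) * cos b @[k --> \oo] --> expR (- (s ^+ 2 * v / 2)) * cos b.
  apply: cvgM; last exact: cvg_cst. have h3 : - (s ^+ 2 * V k / 2) @[k --> \oo] --> - (s ^+ 2 * v / 2).
    apply: cvgN; apply: cvgM; last exact: cvg_cst. by apply: cvgM; [exact: cvg_cst|exact: cV].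
  exact: (continuous_cvg _ (@continuous_expR R _) h3).
have h1 := cE s b; move: h1; under eq_fun do rewrite hE. by move=> h1; exact: (cvg_unique _ h1 h2).
Qed.

Lemma centered_normal_sqr L V : centered_normal L V ->
  (\int[P]_w (L w ^+ 2)%:E = V%:E)%E.
Proof.
move=> [mL V0 hL]; apply: gaussian_second_moment => // s. have := hL s 0; rewrite cos0 mulr1 => <-. by apply: eq_Rintegral => w _; rewrite addr0.
Qed.

Lemma ge0_integrable (f : T -> R) c : mfun f -> (forall w, 0 <= f w) ->
  (\int[P]_w (f w)%:E = c%:E)%E -> P.-integrable setT (EFin \o f).
Proof.
move=> mf f0 hf; apply/integrableP; split; first exact/measurable_EFinP. rewrite (_ : (\int[P]_w _)%E = c%:E) ?ltry// -hf.
by apply: eq_integral => w _ /=; rewrite ger0_norm.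
Qed.

Lemma centered_normal_integrable L L' V V' : centered_normal L V -> centered_normal L' V' ->
  P.-integrable setT (EFin \o (fun w => L w * L' w)).
Proof.
move=> hL hL'; have [mL _ _] := hL; have [mL' _ _] := hL'. have i1 := ge0_integrable (measurable_funX 2 mL) (fun w => sqr_ge0 (L w)) (centered_normal_sqr hL).
have i2 := ge0_integrable (measurable_funX 2 mL') (fun w => sqr_ge0 (L' w)) (centered_normal_sqr hL').
apply: (le_integrable measurableT _ _ (integrableD measurableT i1 i2)).
  by apply/measurable_EFinP; exact: measurable_funM.
move=> w _; change (`|L w * L' w|%:E <= `|L w ^+ 2 + L' w ^+ 2|%:E)%E; rewrite lee_fin normrM.
rewrite [leRHS]ger0_norm ?addr_ge0 ?sqr_ge0// -(real_normK (num_real (L w))) -(real_normK (num_real (L' w))).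
by have := sqr_ge0 (`|L w| - `|L' w|); rewrite sqrrB; have := sqr_ge0 (`|L w|); have := sqr_ge0 (`|L' w|); lra.
Qed.

Lemma centered_normal_gaussian (I : finType) (X : I -> T -> R) :
  (forall c : I -> R, exists V, centered_normal (fun w => \sum_i c i * X i w) V) ->
  gaussian_vector P X (fun i j => \int[P]_w (X i w * X j w)).
Proof.
move=> hX. have hi i : exists V, centered_normal (X i) V.
  have [V hV] := hX (fun j => if j == i then 1 else 0); exists V. rewrite (_ : X i = fun w => \sum_j (if j == i then 1 else 0) * X j w)//.
  apply/funext => w; rewrite (bigD1 i)//= eqxx mul1r big1 ?addr0// => j /negbTE ->. by rewrite mul0r.
split=> [i|c b]; first by have [V []] := hi i. have [V hV] := hX c; have [_ _ /(_ 1 b)] := hV. under eq_Rintegral do rewrite mul1r.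
move=> ->; congr (expR (- (_ / 2)) * _); rewrite expr1n mul1r. have := congr1 fine (centered_normal_sqr hV) => /= <-.
have int i j : P.-integrable setT (EFin \o (fun w => X i w * X j w)).
  by have [V1 h1] := hi i; have [V2 h2] := hi j; exact: centered_normal_integrable h1 h2.
have int2 i j : P.-integrable setT (EFin \o (fun w => c i * c j * (X i w * X j w))).
  have := integrableZl measurableT (c i * c j) (int i j). by apply: eq_integrable => // w _ /=.
rewrite -[fine _]/(\int[P]_w ((\sum_i c i * X i w) ^+ 2)). have -> : \int[P]_w ((\sum_i c i * X i w) ^+ 2) =
    \int[P]_w (\sum_(p : I * I) c p.1 * c p.2 * (X p.1 w * X p.2 w)).
  apply: eq_Rintegral => w _; rewrite expr2 big_distrlr/= pair_bigA/=. by apply: eq_bigr => p _; ring.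
have sumI (s : seq (I * I)) : P.-integrable setT (EFin \o (fun w => \sum_(p <- s) c p.1 * c p.2 * (X p.1 w * X p.2 w))) /\
   \int[P]_w (\sum_(p <- s) c p.1 * c p.2 * (X p.1 w * X p.2 w)) = \sum_(p <- s) c p.1 * c p.2 * \int[P]_w (X p.1 w * X p.2 w).
  elim: s => [|p s [IHi IH]].
    split.
      rewrite (_ : (fun w => \sum_(p <- [::]) _) = fun=> 0); last by apply/funext => w; rewrite big_nil.
      by apply: (@bmeas_integrable _ _ _ P (fun=> 0)); exact: bmeas_cst.
    by under eq_Rintegral do rewrite big_nil; rewrite big_nil Ex_cst.
  split.
    under eq_fun do rewrite big_cons. have := integrableD measurableT (int2 p.1 p.2) IHi. by apply: eq_integrable => // w _ /=.
  under eq_Rintegral do rewrite big_cons. by rewrite RintegralD//= IH big_cons RintegralZl.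
by rewrite (sumI _).2 /qform pair_bigA/=; apply: eq_bigr => p _.
Qed.

End gaussian_limit.

(** * Random entire series and their linear functionals *)

Section random_series.
Context d (T : measurableType d) (R : realType)
  (P : probability T R) (X : nat -> T -> R).
Hypothesis mX : forall j, mfun (X j).
Hypothesis hX : std_normal_sums P X.

Lemma block_normal (a : nat -> R) N :
  centered_normal P (fun w => block X a 0 N w) (\sum_(0 <= j < N) a j ^+ 2).
Proof.
split; first exact: measurable_block.
  by apply: sumr_ge0 => j _; exact: sqr_ge0.
move=> s b; rewrite [in RHS]big_mkord mulr_sumr. have := hX N (fun j => s * a j) b; under [X in _ = expR (- (X / 2)) * _ -> _]eq_bigr do rewrite exprMn.
move=> <-; apply: eq_Rintegral => w _; rewrite /block big_mkord mulr_sumr. by congr cos; congr (_ + _); apply: eq_bigr => j _; rewrite mulrA.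
Qed.

(** [a n j] stands for the n-th Taylor coefficient of the j-th function, so [block X (a n) 0 J]
    truncates the n-th random coefficient. Convergence and growth are imposed for every [w]:
    [gaf_realization] sets the normals to 0 on a null event, and no exceptional set has to be
    carried along. *)
Definition regular_array (a : nat -> nat -> R) : Prop :=
  [/\ forall w n, cvgn (fun J => block X (a n) 0 J w),
      forall w (r : R), exists B, forall n J, `|block X (a n) 0 J w| * r ^+ n <= B &
      forall r : R, 0 < r -> exists C, forall n J, (\sum_(0 <= j < J) a n j ^+ 2) * r ^+ (2 * n) <= C].

Lemma regular_array_diffs a : regular_array a ->
  regular_array (fun n j => n.+1%:R * a n.+1 j).
Proof.
move=> [hc hb ha]. have bE n J w : block X (fun j => n.+1%:R * a n.+1 j) 0 J w = n.+1%:R * block X (a n.+1) 0 J w.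
  by rewrite /block mulr_sumr; apply: eq_bigr => j _; rewrite mulrA.
have n2 n : n.+1%:R <= 2 ^+ n.+1 :> R by rewrite -natrX ler_nat; exact/ltnW/ltn_expl. split.
- move=> w n; under eq_fun do rewrite bE; apply: is_cvgM; [exact: is_cvg_cst|exact: hc].
- move=> w r; have [B hB] := hb w (2 * (`|r| + 1)); exists B => n J. rewrite bE normrM ger0_norm//; apply: le_trans (hB n.+1 J).
  rewrite -mulrA mulrCA; apply: ler_wpM2l => //. rewrite exprMn; apply: (@le_trans _ _ (n.+1%:R * `|r| ^+ n)).
    by rewrite ler_wpM2l// (le_trans (ler_norm _))// normrX.
  apply: ler_pM => //. apply: (@le_trans _ _ ((`|r| + 1) ^+ n)); first by rewrite lerXn2r ?nnegrE ?addr_ge0// lerDl.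
  by rewrite exprS ler_peMl ?exprn_ge0 ?addr_ge0// lerDr.
- move=> r r0; have r1 : 0 < 2 * (r + 1) by rewrite mulr_gt0// addr_gt0. have [C hC] := ha _ r1; exists C => n J.
  apply: le_trans (hC n.+1 J); under eq_bigr do rewrite exprMn. rewrite -mulr_sumr -mulrA mulrCA; apply: ler_wpM2l.
    by apply: sumr_ge0 => j _; exact: sqr_ge0.
  rewrite (mulnC 2 n) (mulnC 2 n.+1) !exprM -exprMn. rewrite lerXn2r ?nnegrE ?mulr_ge0 ?exprn_ge0 ?mulr_ge0 ?addr_ge0 ?(ltW r0)// exprMn.
  apply: ler_pM; rewrite ?exprn_ge0 ?(ltW r0)//. apply: (@le_trans _ _ ((r + 1) ^+ n)); first by rewrite lerXn2r ?nnegrE ?addr_ge0 ?(ltW r0)// lerDl.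
  by rewrite exprS ler_peMl ?exprn_ge0 ?addr_ge0 ?(ltW r0)// lerDr ltW.
Qed.

Variable a : nat -> nat -> R.
Hypothesis ra : regular_array a.

Definition coef n w := limn (fun J => block X (a n) 0 J w).

Lemma coef_cvg n w : block X (a n) 0 J w @[J --> \oo] --> coef n w.
Proof. by have [h _ _] := ra; exact: h. Qed.

Lemma coef_ent w : ent (coef ^~ w).
Proof.
move=> r; have [_ hb _] := ra; have [B hB] := hb w r; exists B => n. have h : `|block X (a n) 0 J w| * r ^+ n @[J --> \oo] --> `|coef n w| * r ^+ n.
  by apply: cvgM; [apply: cvg_norm; exact: coef_cvg|exact: cvg_cst].
by apply: (cvg_le_cst h) => J; exact: hB.
Qed.

Lemma measurable_coef n : mfun (coef n).
Proof.
apply: (measurable_fun_cvg (h := fun J w => block X (a n) 0 J w)) => [J|w _]; last exact: coef_cvg. exact: measurable_block.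
Qed.

Lemma coef_normal (r : R) : 0 < r -> exists C, forall n,
  exists2 V, V <= C / r ^+ (2 * n) & centered_normal P (coef n) V.
Proof.
move=> r0; have [_ _ ha] := ra; have [C hC] := ha r r0; exists C => n.
have [V hV nV] := centered_normal_lim (fun J => block_normal (a n) J) (fun w => @coef_cvg n w).
by exists V => //; apply: hV => J; rewrite ler_pdivlMr ?exprn_gt0.
Qed.

(** Infinite linear functionals of the random coefficients. The value and the derivative at a point
    both have this form, which yields the joint normality of jets. *)
Definition lin (v : nat -> R) w := limn (series (fun n => v n * coef n w)).

Definition exp_bounded (v : nat -> R) (C rho : R) := forall n, `|v n| <= C * rho ^+ n.

Lemma lin_cvg v C rho w : exp_bounded v C rho -> series (fun n => v n * coef n w) @ \oo --> lin v w.
Proof.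
move=> hv; have [B hB] := ent_pair (coef_ent w) hv. exact: (geometric_summable hB).2.
Qed.

Lemma lin_normal v C rho : exp_bounded v C rho -> exists V, centered_normal P (lin v) V.
Proof.
move=> hv; have hN N : exists V, centered_normal P (fun w => series (fun n => v n * coef n w) N) V.
  have h1 J : centered_normal P (fun w => \sum_(n < N) v n * block X (a n) 0 J w) (\sum_(0 <= j < J) (\sum_(n < N) v n * a n j) ^+ 2).
    have h := block_normal (fun j => \sum_(n < N) v n * a n j) J.
    rewrite (_ : (fun w => _) = (fun w => block X (fun j => \sum_(n < N) v n * a n j) 0 J w)); first exact: h.
    apply/funext => w; rewrite /block; under eq_bigr do rewrite mulr_sumr. rewrite exchange_big/=; apply: eq_bigr => j _; rewrite mulr_suml.
    by apply: eq_bigr => n _; rewrite mulrA.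
  have [|V _ hV] := centered_normal_lim h1 (L' := fun w => series (fun n => v n * coef n w) N); last by exists V.
  move=> w; rewrite /series/= big_mkord {h1}; elim: N => [|N IH].
    by rewrite big_ord0; under eq_fun do rewrite big_ord0; exact: cvg_cst.
  rewrite big_ord_recr/=; under eq_fun do rewrite big_ord_recr/=. by apply: cvgD; [exact: IH|apply: cvgM; [exact: cvg_cst|exact: coef_cvg]].
have [V hV] := choice hN. by have [V' _ nV] := centered_normal_lim hV (fun w => @lin_cvg v C rho w hv); exists V'.
Qed.

Lemma exp_bounded_comb (I : finType) (c : I -> R) (v : I -> nat -> R) C rho :
  (forall i, exp_bounded (v i) C rho) ->
  exp_bounded (fun n => \sum_i c i * v i n) (\sum_i `|c i| * C) rho.
Proof.
move=> hv n; apply: (le_trans (ler_norm_sum _ _ _)); rewrite mulr_suml; apply: ler_sum => i _. by rewrite normrM -mulrA; apply: ler_wpM2l => //; exact: hv.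
Qed.

Lemma lin_sum (I : finType) (c : I -> R) (v : I -> nat -> R) C rho w : 0 <= rho ->
  (forall i, exp_bounded (v i) C rho) ->
  lin (fun n => \sum_i c i * v i n) w = \sum_i c i * lin (v i) w.
Proof.
move=> rho0 hv; apply: cvg_lim => //. rewrite (_ : series _ = (fun N => \sum_i c i * series (fun n => v i n * coef n w) N)); last first.
  apply/funext => N; rewrite /series/=; under eq_bigr do rewrite mulr_suml. rewrite exchange_big/=; apply: eq_bigr => i _; rewrite mulr_sumr.
  by apply: eq_bigr => n _; rewrite mulrA.
elim: (index_enum I) => [|i s IH].
  by rewrite big_nil; under eq_fun do rewrite big_nil; exact: cvg_cst.
rewrite big_cons; under eq_fun do rewrite big_cons. by apply: cvgD => //; apply: cvgM; [exact: cvg_cst|exact: (lin_cvg (C := C) (rho := rho))].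
Qed.

Definition gfun w x := psum (coef ^~ w) x.
Definition gder w x := psum (pseries_diffs (coef ^~ w)) x.

Lemma gfun_lin w x : gfun w x = lin (fun n => x ^+ n) w.
Proof. by rewrite /gfun /psum /lin /pseries; congr (limn (series _)); apply/funext => n; rewrite mulrC. Qed.

Lemma gder_lin w x : gder w x = lin (fun n => n%:R * x ^+ n.-1) w.
Proof.
rewrite /gder /psum; have := @ent_pseries_cvg R _ x (ent_diffs (coef_ent w)). move=> /pseries_diffs_equiv h; symmetry; apply: cvg_lim => //.
have e : (fun i => i%:R * coef i w * x ^+ i.-1) = (fun n => n%:R * x ^+ n.-1 * coef n w).
  by apply/funext => n; ring.
by move: h; rewrite e.
Qed.

(** The rate 2(r + 1) leaves room for the factor n of the derivative, so that values and derivatives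
    obey a common bound. *)
Lemma exp_bounded_pow x r : `|x| <= r -> exp_bounded (fun n => x ^+ n) 1 (2 * (r + 1)).
Proof.
move=> xr n; rewrite mul1r normrX; have := normr_ge0 x => x0. by rewrite lerXn2r ?nnegrE//; lra.
Qed.

Lemma exp_bounded_dpow x r : `|x| <= r -> exp_bounded (fun n => n%:R * x ^+ n.-1) 1 (2 * (r + 1)).
Proof.
move=> xr n; rewrite mul1r normrM normrX ger0_norm// exprMn. have x0 := normr_ge0 x; have r0 : 0 <= r by exact: le_trans xr.
apply: ler_pM; rewrite ?exprn_ge0//.
  by rewrite -natrX ler_nat; exact/ltnW/ltn_expl.
apply: (@le_trans _ _ ((r + 1) ^+ n.-1)); first by rewrite lerXn2r ?nnegrE//; lra. by case: n => [|n]//=; rewrite exprS ler_peMl ?exprn_ge0//; lra.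
Qed.

Lemma is_derive_gfun w x : is_derive x (1 : R) (gfun w) (gder w x).
Proof. exact: is_derive_psum (coef_ent w). Qed.

Lemma continuous_gfun w : continuous (gfun w).
Proof. exact: psum_continuous (coef_ent w). Qed.

Lemma continuous_gder w : continuous (gder w).
Proof. exact: psum_continuous (ent_diffs (coef_ent w)). Qed.

Lemma measurable_random_psum (c : nat -> T -> R) : (forall n, mfun (c n)) ->
  (forall w, ent (c ^~ w)) ->
  mfun (fun z : T * mR R => psum (c ^~ z.1) z.2).
Proof.
move=> mc ec. apply: (measurable_fun_cvg (h := fun N (z : T * mR R) => series (fun n => c n z.1 * z.2 ^+ n) N)).
- move=> N; apply: measurable_sum => n; apply: measurable_funM.
    exact: measurableT_comp (mc n) measurable_fst.
  by apply: measurable_funX; exact: measurable_snd.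
- by move=> z _; exact: psum_cvg.
Qed.

Lemma measurable_gfun : mfun (fun z : T * mR R => gfun z.1 z.2).
Proof. by apply: (measurable_random_psum measurable_coef); exact: coef_ent. Qed.

Lemma measurable_gder : mfun (fun z : T * mR R => gder z.1 z.2).
Proof.
apply: (@measurable_random_psum (fun n w => pseries_diffs (coef ^~ w) n)) => [n|w].
  by apply: measurable_funM => //; exact: measurable_coef.
exact: ent_diffs (coef_ent w).
Qed.

Definition coef_norm r w : \bar R := (\sum_(n <oo) (`|coef n w| * r ^+ n)%:E)%E.

Lemma measurable_coef_norm r : 0 <= r -> mfun (coef_norm r).
Proof.
move=> r0; apply: ge0_emeasurable_sum => [n w _ _|n _]; first by rewrite lee_fin mulr_ge0// exprn_ge0. apply/measurable_EFinP; apply: measurable_funM => //.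
by apply: measurableT_comp => //; exact: measurable_coef.
Qed.

Lemma coef_norm_finite r : 0 <= r -> (\int[P]_w coef_norm r w < +oo)%E.
Proof.
move=> r0; rewrite integral_nneseries//; last 2 first.
- move=> n; apply/measurable_EFinP; apply: measurable_funM => //. by apply: measurableT_comp => //; exact: measurable_coef.
- by move=> n w _; rewrite lee_fin mulr_ge0// exprn_ge0.
(* The n-th variance is at most C / s^(2n). Applying |y| q <= 1 + (q y)^2 with q = s^n bounds the
   mean of the n-th term by (r/s)^n (1 + C), hence by (1 + C) 2^-n. *)
pose s := 2 * (r + 1); have s0 : 0 < s by rewrite mulr_gt0// ltr_wpDl. have [C hC] := coef_normal s0. have p2 n : (0 : R) < 2 ^+ n by exact: exprn_gt0.
have bound n : (\int[P]_w (`|coef n w| * r ^+ n)%:E <= ((1 + C) / (2 ^ (n + 0))%:R)%:E)%E.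
  have [V VC hV] := hC n; have sn : 0 < s ^+ n by exact: exprn_gt0. have [mL V0 _] := hV; have V2 := centered_normal_sqr hV.
  apply: (@le_trans _ _ (\int[P]_w ((r ^+ n / s ^+ n)%:E * (1%:E + (s ^+ (2 * n))%:E * (coef n w ^+ 2)%:E)))%E).
    apply: ge0_le_integral => //.
    - by move=> w _; rewrite lee_fin mulr_ge0// exprn_ge0.
    - apply/measurable_EFinP; apply: measurable_funM => //; exact: measurableT_comp.
    - apply: measurable_funeM; apply: emeasurable_funD => //; apply: measurable_funeM. by apply/measurable_EFinP; exact: measurable_funX.
    - move=> w _; change ((`|coef n w| * r ^+ n)%:E <= (r ^+ n / s ^+ n * (1 + s ^+ (2 * n) * coef n w ^+ 2))%:E)%E. rewrite lee_fin [leLHS]mulrC -!mulrA.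
      apply: ler_wpM2l; first exact: exprn_ge0. rewrite mulrC ler_pdivlMr// mulnC exprM -exprMn. have key (y q : R) : 0 <= q -> `|y| * q <= 1 + (q * y) ^+ 2.
        move=> q0; have := sqr_ge0 (`|y| * q - 1); have : 0 <= `|y| * q by rewrite mulr_ge0.
        have -> : (q * y) ^+ 2 = (`|y| * q) ^+ 2 by rewrite !exprMn real_normK ?num_real// mulrC. by rewrite sqrrB expr1n mulr1; lra.
      exact: key (ltW sn).
  have p1 w : (0 <= (s ^+ (2 * n))%:E * (coef n w ^+ 2)%:E)%E.
    by rewrite -EFinM lee_fin mulr_ge0 ?sqr_ge0// exprn_ge0// ltW.
  rewrite ge0_integralZl//; last 3 first.
  - apply: emeasurable_funD => //; apply: measurable_funeM. by apply/measurable_EFinP; exact: measurable_funX.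
  - by move=> w _; apply: adde_ge0 => //; exact: p1.
  - by rewrite lee_fin divr_ge0 ?exprn_ge0// ltW.
  rewrite ge0_integralD//; last first.
    by apply: measurable_funeM; apply/measurable_EFinP; exact: measurable_funX.
  rewrite ge0_integralZl//; last 3 first.
  - by apply/measurable_EFinP; exact: measurable_funX.
  - by move=> w _; rewrite lee_fin sqr_ge0.
  - by rewrite lee_fin exprn_ge0// ltW.
  have -> : (\int[P]__ 1 = 1%:E)%E by rewrite integral_cst// [X in (1 * X)%E]probability_setT mule1.
  rewrite V2; change ((r ^+ n / s ^+ n * (1 + s ^+ (2 * n) * V))%:E <= ((1 + C) / (2 ^ (n + 0))%:R)%:E)%E. rewrite lee_fin.
  have h1 : s ^+ (2 * n) * V <= C by rewrite mulrC -ler_pdivlMr ?exprn_gt0. have C0 : 0 <= C by apply: le_trans h1; rewrite mulr_ge0 ?exprn_ge0 ?(ltW s0).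
  rewrite mulrC addn0 natrX; apply: ler_pM => //.
  - by rewrite addr_ge0// mulr_ge0 ?exprn_ge0 ?(ltW s0).
  - by rewrite divr_ge0 ?exprn_ge0 ?(ltW s0).
  - by rewrite lerD2l.
  - rewrite ler_pdivrMr// mulrC ler_pdivlMr// -exprMn lerXn2r ?nnegrE ?mulr_ge0 ?(ltW s0)//. by rewrite /s; lra. by rewrite /s; lra.
apply: (@le_lt_trans _ _ (\sum_(n <oo) ((1 + C) / (2 ^ (n + 0))%:R)%:E)%E).
  apply: lee_nneseries => [n _ _|n _]; last exact: bound. by apply: integral_ge0 => w _; rewrite lee_fin mulr_ge0// exprn_ge0.
have e : eseries (fun n => ((1 + C) / (2 ^ (n + 0))%:R)%:E) = eseries (fun k => ((2 * (1 + C)) / (2 ^ (k + 1))%:R)%:E).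
  congr eseries; apply/funext => k; congr EFin. by rewrite addn0 addn1 expnS natrM; field; rewrite pnatr_eq0 expn_eq0.
have h := @cvg_geometric_eseries_half R (2 * (1 + C)) 0; rewrite -e in h. by rewrite (cvg_lim _ h)// ltry.
Qed.

Lemma coef_norm_le r M w : 0 <= r -> (coef_norm r w <= M%:E)%E -> norm_le (coef ^~ w) r M.
Proof.
move=> r0 h N; rewrite -lee_fin; apply: le_trans h; rewrite -sumEFin. by apply: nneseries_lim_ge => n _ _; rewrite lee_fin mulr_ge0// exprn_ge0.
Qed.

End random_series.

(** * Integrals of functions changed on a null set *)

Section null_modification.
Context d (T : measurableType d) (R : realType)
  (P : {measure set T -> \bar R}) (N : set T).
Hypotheses (mN : measurable N) (PN : P N = 0%E).
Local Open Scope ereal_scope.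
Import HBNNSimple.

Let ge0_integral_le (f g : T -> \bar R) : (forall w, 0 <= f w) -> (forall w, 0 <= g w) ->
  (forall w, ~ N w -> f w = g w) -> \int[P]_w f w <= \int[P]_w g w.
Proof.
move=> f0 g0 fg; rewrite ge0_integralTE// [leRHS]ge0_integralTE//. apply: ge_ereal_sup => _ [h hf <-].
pose h' := mul_nnsfun h (indic_nnsfun R (measurableC mN)). have e : sintegral P h = sintegral P h'.
  rewrite -!integralT_nnsfun; apply: ge0_ae_eq_integral => //.
  - exact/measurable_EFinP.
  - exact/measurable_EFinP.
  - by move=> x _; rewrite lee_fin.
  - by move=> x _; rewrite lee_fin.
  - exists N; split => // x /= /not_implyP[_]; apply: contra_notP => xN. by rewrite mindicE mem_set// mulr1.
rewrite e; apply: ereal_sup_ubound; exists h' => // x /=. rewrite mindicE; have [|] := boolP (x \in ~` N); rewrite ?inE => xN.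
  by rewrite mulr1 -fg.
by rewrite mulr0.
Qed.

(** The integral of a nonnegative function is a supremum over simple functions below it, and these
    may be cut off on [N] without changing their integrals; arbitrary integrands are therefore
    allowed. The lemma is applied to [gafR] and to [real_zeros], whose measurability is not
    established. *)
Lemma integral_null (f g : T -> \bar R) : (forall w, ~ N w -> f w = g w) ->
  \int[P]_w f w = \int[P]_w g w.
Proof.
move=> fg; rewrite integralE [RHS]integralE; congr (_ - _).
  by apply/eqP; rewrite eq_le !ge0_integral_le//; move=> w /fg e; rewrite !funeposE e.
by apply/eqP; rewrite eq_le !ge0_integral_le//; move=> w /fg e; rewrite !funenegE e.
Qed.

End null_modification.

(** * Kac's formula with the Cauchy kernel *)

Section kac_counting.
Variable R : realType.
Local Notation mu := (@lebesgue_measure R).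

(** The Cauchy density serves as approximate Dirac mass because it can be transferred between
    Gaussian laws and has the explicit primitive [cauchy_prim]. *)
Definition cauchy_kernel (h y : R) := h / pi / (h ^+ 2 + y ^+ 2).

Definition cauchy_prim (h y : R) := atan (y / h) / pi.

Lemma cauchy_kernel_ge0 h y : 0 < h -> 0 <= cauchy_kernel h y.
Proof. by move=> h0; rewrite !divr_ge0 ?pi_ge0 ?addr_ge0 ?sqr_ge0// ltW. Qed.

Lemma cauchy_prim_bound h y : `|cauchy_prim h y| <= 1 / 2.
Proof.
rewrite /cauchy_prim normrM (gtr0_norm (x := pi^-1)) ?invr_gt0 ?pi_gt0// ler_pdivrMr ?pi_gt0//.
rewrite ler_norml; have := atan_gtNpi2 (y / h); have := atan_ltpi2 (y / h); lra.
Qed.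

Lemma is_derive_cauchy_prim h y : 0 < h -> is_derive y (1 : R) (cauchy_prim h) (cauchy_kernel h y).
Proof.
move=> h0. have h1 : is_derive y (1 : R) (fun y => y / h) h^-1.
  have h' := @is_deriveZ _ _ _ id h^-1 y 1 1 (is_derive_id _ _). have -> : (fun y => y / h) = h^-1 \*: id by apply/funext => z /=; rewrite mulrC.
  by apply: is_derive_eq h' _; rewrite /GRing.scale/= mulr1.
have h2 := @is_derive1_comp R (@atan R) (fun y => y / h) y _ _ (is_derive1_atan (y / h)) h1.
have h3 : is_derive y (1 : R) (fun y => pi^-1 *: atan (y / h)) (pi^-1 *: ((1 + (y / h) ^+ 2)^-1 * h^-1)).
  exact: is_deriveZ.
have -> : cauchy_prim h = (fun y => pi^-1 *: atan (y / h)).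
  by apply/funext => z; rewrite /cauchy_prim mulrC.
apply: is_derive_eq; rewrite /cauchy_kernel /GRing.scale/=. have p0 : pi != 0 :> R by rewrite gt_eqF// pi_gt0. have hn : h != 0 by rewrite gt_eqF.
have n1 : h ^+ 2 + y ^+ 2 != 0 by rewrite gt_eqF// ltr_pwDl ?exprn_gt0// sqr_ge0. have n2 : 1 + (y / h) ^+ 2 != 0 by rewrite gt_eqF// ltr_pwDl// sqr_ge0.
have -> : 1 + (y / h) ^+ 2 = (h ^+ 2 + y ^+ 2) / h ^+ 2 by field. by move: (pi : R) p0 => p p0; field; rewrite p0 hn n1.
Qed.

Lemma cauchy_prim_cvg y : cauchy_prim n.+1%:R^-1 y @[n --> \oo] --> Num.sg y / 2.
Proof.
have p0 : pi != 0 :> R by rewrite gt_eqF// pi_gt0. have e n : cauchy_prim n.+1%:R^-1 y = atan (n.+1%:R * y) / pi.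
  by rewrite /cauchy_prim invrK [y * _]mulrC.
under eq_fun do rewrite e. have pos z : 0 < z -> atan (n.+1%:R * z) / pi @[n --> \oo] --> (1 : R) / 2.
  move=> z0; have -> : 1 / 2 = pi / 2 / pi :> R by rewrite mulrAC divff. apply: cvgM; last exact: cvg_cst.
  apply: (@cvg_comp _ _ _ (fun n : nat => n.+1%:R * z) (@atan R) _ (+oo)%R); last exact: cvgy_atan. apply/cvgryPge => A; near=> n.
  rewrite -ler_pdivrMr//; apply: (@le_trans _ _ n%:R); last by rewrite ler_nat. by near: n; exact: nbhs_infty_ger.
have [y0|y0|->] := ltgtP y 0.
- have l : - (atan (n.+1%:R * (- y)) / pi) @[n --> \oo] --> - ((1 : R) / 2).
    by apply: cvgN; apply: pos; rewrite oppr_gt0.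
  rewrite ltr0_sg// mulNr; move: l. by under eq_fun do rewrite mulrN atanN mulNr opprK.
- by rewrite gtr0_sg//; exact: pos.
- by rewrite sgr0 mul0r; under eq_fun do rewrite mulr0 atan0 mul0r; exact: cvg_cst.
Unshelve. all: end_near. Qed.

Section path.
Variables (f g : R -> R).
Hypothesis df : forall x : R, is_derive x (1 : R) f (g x).
Hypothesis cg : continuous g.

Let cf : continuous f. Proof. exact: is_derive_continuous df. Qed.

Definition kac_int h a b := \int[mu]_(x in `[a, b]) (cauchy_kernel h (f x) * `|g x|).

Let ck h : 0 < h -> continuous (fun x => cauchy_kernel h (f x)).
Proof.
move=> h0 x; apply: cvgM; first exact: cvg_cst. apply: cvgV; first by rewrite gt_eqF// ltr_pwDl ?exprn_gt0// sqr_ge0. apply: cvgD; first exact: cvg_cst.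
by rewrite expr2; under eq_fun do rewrite expr2; apply: cvgM; exact: cf.
Qed.

Lemma kac_integrand_continuous h : 0 < h -> continuous (fun x => cauchy_kernel h (f x) * `|g x|).
Proof.
move=> h0 x; apply: cvgM; first exact: ck. by apply: cvg_norm; exact: cg.
Qed.

(** A derivative without zeros between u and v has constant sign there by the intermediate value
    theorem; up to this sign the integrand is the derivative of [cauchy_prim h] along the path. *)
Lemma kac_int_piece (h u v : R) : 0 < h -> u < v -> (forall x, u < x < v -> g x != 0) ->
  kac_int h u v = `|cauchy_prim h (f v) - cauchy_prim h (f u)|.
Proof.
move=> h0 uv g0. have dG x : is_derive x (1 : R) (fun x => cauchy_prim h (f x)) (cauchy_kernel h (f x) * g x).
  exact: (@is_derive1_comp R (cauchy_prim h) f x _ _ (is_derive_cauchy_prim (f x) h0) (df x)).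
have ckg : continuous (fun x => cauchy_kernel h (f x) * g x).
  by move=> x; apply: cvgM; [exact: ck|exact: cg].
have ftc := Rint_ftc (ltW uv) dG ckg. have sgn : (forall x, u < x < v -> 0 <= g x) \/ (forall x, u < x < v -> g x <= 0).
  apply: contrapT => /not_orP [/existsNP[x /not_implyP[xu /negP]] + /existsNP[y /not_implyP[yu /negP]]]. rewrite -!ltNge => gx gy.
  have [z [zxy gz]] : exists z, (u < z < v) /\ g z = 0.
    move: xu yu => /andP[x1 x2] /andP[y1 y2]. have [xy|yx] := leP x y.
      have [|z /[!in_itv]/= /andP[z1 z2] gz] := @IVT R g x y 0 xy (continuous_subspaceT cg).
        by rewrite ge_min le_max (ltW gx) (ltW gy) orbT.
      by exists z; split => //; rewrite (lt_le_trans x1 z1) (le_lt_trans z2 y2).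
    have [|z /[!in_itv]/= /andP[z1 z2] gz] := @IVT R g y x 0 (ltW yx) (continuous_subspaceT cg).
      by rewrite ge_min le_max (ltW gx) (ltW gy) orbT.
    by exists z; split => //; rewrite (lt_le_trans y1 z1) (le_lt_trans z2 x2).
  by have := g0 z zxy; rewrite gz eqxx.
have clo (s : R) : (forall x, u < x < v -> 0 <= s * g x) -> forall x, u <= x <= v -> 0 <= s * g x.
  move=> hs; have cs : continuous (fun x => s * g x) by move=> x; apply: cvgM; [exact: cvg_cst|exact: cg].
  move=> x /andP[]; rewrite le_eqVlt => /predU1P[<- _|ux].
    have l1 : s * g x @[x --> u^'+] --> s * g u by apply: cvg_at_right_filter; exact: cs.
    have /cvg_lim <- // := l1; apply: limr_ge; first by apply/cvg_ex; eexists; exact: l1.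
    near=> y; apply: hs; apply/andP; split; near: y; [exact: nbhs_right_gt|exact: nbhs_right_lt].
  rewrite le_eqVlt => /predU1P[->|xv]; last by apply: hs; rewrite ux. have l1 : s * g x @[x --> v^'-] --> s * g v by apply: cvg_at_left_filter; exact: cs.
  have /cvg_lim <- // := l1; apply: limr_ge; first by apply/cvg_ex; eexists; exact: l1.
  near=> y; apply: hs; apply/andP; split; near: y; [exact: nbhs_left_gt|exact: nbhs_left_lt].
have pos : 0 <= kac_int h u v.
  by apply: Rintegral_ge0 => x _; rewrite mulr_ge0// cauchy_kernel_ge0.
case: sgn => sgn.
- have e : kac_int h u v = cauchy_prim h (f v) - cauchy_prim h (f u).
    rewrite -ftc; apply: eq_Rintegral => x; rewrite inE/= in_itv/= => xuv. have := clo 1 _ x xuv; rewrite mul1r => hh; rewrite ger0_norm// hh// => y yuv.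
    by rewrite mul1r; exact: sgn.
  by rewrite e ger0_norm// -e.
- have e : kac_int h u v = - (cauchy_prim h (f v) - cauchy_prim h (f u)).
    rewrite -ftc -mulN1r -RintZ//; apply: eq_Rintegral => x; rewrite inE/= in_itv/= => xuv.
    have := clo (-1) _ x xuv; rewrite mulN1r oppr_ge0 => hh; rewrite ler0_norm; first by ring. by apply: hh => y yuv; rewrite mulN1r oppr_ge0; exact: sgn.
  by rewrite -normrN e ger0_norm// -e.
Unshelve. all: end_near. Qed.

Lemma kac_int_split h a b c : 0 < h -> a <= c -> c <= b ->
  kac_int h a b = kac_int h a c + kac_int h c b.
Proof. by move=> h0 ac cb; apply: Rint_split => //; exact: kac_integrand_continuous. Qed.

Lemma path_last_le (a : R) (s : seq R) : path <%R a s -> a <= last a s.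
Proof.
elim: s a => //= v s IH a /andP[av /IH]; exact: le_trans (ltW av).
Qed.

Lemma path_gap (a v : R) (s : seq R) (x : R) : path <%R a (v :: s) -> a < x -> x < v -> x \notin v :: s.
Proof.
move=> /= /andP[_]; rewrite lt_path_sortedE => /andP[/allP vs _] ax xv. rewrite inE negb_or lt_eqF//=; apply/negP => /vs vx.
by have := lt_trans xv vx; rewrite ltxx.
Qed.

Lemma path_tail_zero (Z : R -> Prop) (a v : R) (s : seq R) : path <%R a (v :: s) ->
  (forall x, a < x < last v s -> Z x -> x \in v :: s) ->
  (forall x, a < x < v -> ~ Z x) /\ (forall x, v < x < last v s -> Z x -> x \in s).
Proof.
move=> ps hZ; have /andP[av vs] := ps. have vl := path_last_le vs. split => [x /andP[ax xv] Zx|x /andP[vx xl] Zx].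
  have := hZ x _ Zx; rewrite ax (lt_le_trans xv vl) => /(_ isT). by apply/negP; exact: path_gap ps ax xv.
have := hZ x _ Zx; rewrite (lt_trans av vx) xl => /(_ isT). by rewrite inE gt_eqF.
Qed.

(** Each monotone piece contributes at most 1 whatever [h] is. This uniformity in the kernel width
    is what dominates the Kac integrals in the limit. *)
Lemma kac_int_bound h (a : R) (s : seq R) : 0 < h -> path <%R a s ->
  (forall x, a < x < last a s -> g x = 0 -> x \in s) -> kac_int h a (last a s) <= (size s)%:R.
Proof.
move=> h0; elim: s a => [|v s IH] a /=.
  by move=> _ _; rewrite /kac_int set_itv1 Rintegral_set1.
move=> ps hZ; have [h1 h2] := path_tail_zero (s := s) (Z := fun x => g x = 0) ps hZ. have /andP[av vs] := ps.
rewrite (@kac_int_split _ _ _ v)// ?(ltW av) ?path_last_le// -[(size s).+1]addn1 addrC natrD. apply: lerD; first exact: IH.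
rewrite kac_int_piece//; last by move=> x /h1 /eqP. apply: (le_trans (ler_normB _ _)).
by have := cauchy_prim_bound h (f v); have := cauchy_prim_bound h (f a); lra.
Qed.

(** [cauchy_prim] tends to half the sign, so a piece without interior zeros yields one half for an
    endpoint where the path vanishes; by Rolle both endpoints cannot. Two neighbouring pieces thus
    count a common zero once. *)
Lemma kac_piece_cvg (u v : R) : u < v -> (forall x, u < x < v -> g x != 0) ->
  (forall x, u < x < v -> f x != 0) ->
  kac_int n.+1%:R^-1 u v @[n --> \oo] --> (((f u == 0)%:R + (f v == 0)%:R) / 2 : R).
Proof.
move=> uv g0 f0. have hn n : (0 : R) < n.+1%:R^-1 by rewrite invr_gt0. under eq_fun do rewrite (kac_int_piece (hn _) uv g0).
have l : `|cauchy_prim n.+1%:R^-1 (f v) - cauchy_prim n.+1%:R^-1 (f u)| @[n --> \oo] --> `|Num.sg (f v) / 2 - Num.sg (f u) / 2|.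
  by apply: cvg_norm; apply: cvgB; exact: cauchy_prim_cvg.
suff -> : ((f u == 0)%:R + (f v == 0)%:R) / 2 = (`|Num.sg (f v) / 2 - Num.sg (f u) / 2| : R) by exact: l.
have ivt x y : u <= x -> x < y -> y <= v -> f x * f y < 0 -> False.
  move=> ux xy yv xy0. have [|z /[!in_itv]/= /andP[z1 z2] fz] := @IVT R f x y 0 (ltW xy) (continuous_subspaceT cf).
    have [p1|p1|p1] := ltgtP (f x) 0.
    - have : 0 <= f y by have := xy0; rewrite nmulr_rlt0//; exact: ltW. by move=> p2; rewrite ge_min le_max (ltW p1) p2 orbT.
    - have : f y <= 0 by have := xy0; rewrite pmulr_rlt0//; exact: ltW. by move=> p2; rewrite ge_min le_max (ltW p1) p2 orbT.
    - by move: xy0; rewrite p1 mul0r ltxx.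
  have zu : u < z.
    rewrite lt_neqAle (le_trans ux z1) andbT; apply/eqP => zu; subst z. move: xy0; have -> : x = u by apply/eqP; rewrite eq_le ux z1. by rewrite fz mul0r ltxx.
  have zv : z < v.
    rewrite lt_neqAle (le_trans z2 yv) andbT; apply/eqP => zv; subst z. move: xy0; have -> : y = v by apply/eqP; rewrite eq_le yv z2. by rewrite fz mulr0 ltxx.
  by have := f0 z; rewrite zu zv fz eqxx => /(_ isT).
have rolle : f u = 0 -> f v = 0 -> False.
  move=> fu fv. have fuv : f u = f v by rewrite fu fv. have [c cuv dc] := Rolle uv (fun x _ => @ex_derive _ _ _ _ _ _ _ (df x)) (continuous_subspaceT cf) fuv.
  have : g c = 0 by rewrite -(@derive_val _ _ _ _ _ _ _ (df c)) -(@derive_val _ _ _ _ _ _ _ dc). by apply/eqP; apply: g0; move: cuv; rewrite in_itv.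
case: (ltgtP (f u) 0) => fu; case: (ltgtP (f v) 0) => fv; rewrite ?eqxx.
- by rewrite !ltr0_sg// subrr normr0 addr0 mul0r.
- by exfalso; apply: (ivt u v) => //; rewrite nmulr_rlt0.
- by rewrite fv sgr0 ltr0_sg// mul0r sub0r add0r normrN mulNr normrN ger0_norm.
- by exfalso; apply: (ivt u v) => //; rewrite pmulr_rlt0.
- by rewrite !gtr0_sg// subrr normr0 addr0 mul0r.
- by rewrite fv sgr0 gtr0_sg// mul0r sub0r add0r normrN ger0_norm.
- by rewrite fu sgr0 ltr0_sg// mul0r subr0 addr0 mulNr normrN ger0_norm.
- by rewrite fu sgr0 gtr0_sg// mul0r subr0 addr0 ger0_norm.
- by exfalso; exact: rolle.
Qed.

Lemma kac_int_cvg (a : R) (s : seq R) : path <%R a s ->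
  (forall x, a < x < last a s -> f x = 0 \/ g x = 0 -> x \in s) ->
  kac_int n.+1%:R^-1 a (last a s) @[n --> \oo] -->
  ((f a == 0)%:R / 2 + \sum_(x <- s) (f x == 0)%:R - (f (last a s) == 0)%:R / 2 : R).
Proof.
have hn n : (0 : R) < n.+1%:R^-1 by rewrite invr_gt0. elim: s a => [|v s IH] a.
  move=> _ _ /=; rewrite big_nil addr0 subrr. by under eq_fun do rewrite /kac_int set_itv1 Rintegral_set1; exact: cvg_cst.
move=> ps hZ; have [h1 h2] := path_tail_zero (s := s) (Z := fun x => f x = 0 \/ g x = 0) ps hZ. have /andP[av vs] := ps. have {}IH := IH v vs h2.
have hp := @kac_piece_cvg a v av _ _. have {}hp : kac_int n.+1%:R^-1 a v @[n --> \oo] --> (((f a == 0)%:R + (f v == 0)%:R) / 2 : R).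
  by apply: hp => x /h1 hx; apply/eqP => xx; apply: hx; [right|left].
have -> : (f a == 0)%:R / 2 + \sum_(x <- v :: s) (f x == 0)%:R - (f (last a (v :: s)) == 0)%:R / 2 = ((f a == 0)%:R + (f v == 0)%:R) / 2 +
  ((f v == 0)%:R / 2 + \sum_(x <- s) (f x == 0)%:R - (f (last v s) == 0)%:R / 2) :> R. by rewrite big_cons /=; lra.
under eq_fun do rewrite (@kac_int_split _ _ _ v (hn _) (ltW av) (path_last_le vs)). by apply: cvgD.
Qed.

Lemma partition_path (a b : R) (Z : seq R) : a < b ->
  exists s, [/\ path <%R a s, last a s = b, (forall x, a < x < b -> x \in Z -> x \in s),
    (forall x, x \in s -> x = b \/ (a < x < b /\ x \in Z)) & (size s <= (size Z).+1)%N].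
Proof.
move=> ab; pose s0 := sort <=%R (undup [seq x <- Z | a < x < b]). have us : uniq s0 by rewrite sort_uniq undup_uniq.
have ls : sorted <%R s0 by rewrite sort_lt_sorted undup_uniq. have ms x : (x \in s0) = (a < x < b) && (x \in Z).
  by rewrite mem_sort mem_undup mem_filter.
exists (rcons s0 b); split.
- rewrite rcons_path; apply/andP; split.
    rewrite lt_path_sortedE ls andbT; apply/allP => x; rewrite ms => /andP[/andP[]//].
  have := mem_last a s0; rewrite inE => /predU1P[->//|]; rewrite ms => /andP[/andP[]//].
- by rewrite last_rcons.
- by move=> x xab xZ; rewrite mem_rcons inE ms xab xZ orbT.
- move=> x; rewrite mem_rcons inE => /predU1P[->|]; first by left. by rewrite ms => /andP[? ?]; right.
- rewrite size_rcons size_sort ltnS (leq_trans (size_undup _))// size_filter. exact: count_size.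
Qed.

(* [Zf] and [Zg] list the zeros of [f] and of its derivative *)
Lemma kac_bound (a b h : R) (Zg : seq R) : 0 < h -> a < b ->
  (forall x, a < x < b -> g x = 0 -> x \in Zg) -> kac_int h a b <= (size Zg).+1%:R.
Proof.
move=> h0 ab hg; have [s [ps lb sZ _ ss]] := partition_path Zg ab. rewrite -lb; apply: (le_trans (kac_int_bound h0 ps _)); last by rewrite ler_nat.
by move=> x; rewrite lb => xab gx; apply: sZ => //; exact: hg.
Qed.

Lemma kac_cvg (a b : R) (Zf Zg : seq R) : a < b -> f a != 0 -> f b != 0 -> uniq Zf ->
  (forall x, (x \in Zf) = (a <= x <= b) && (f x == 0)) ->
  (forall x, a < x < b -> g x = 0 -> x \in Zg) ->
  kac_int n.+1%:R^-1 a b @[n --> \oo] --> ((size Zf)%:R : R).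
Proof.
move=> ab fa fb uZ hf hg; have [s [ps lb sZ Zs _]] := partition_path (Zf ++ Zg) ab. have := kac_int_cvg ps; rewrite lb => /(_ _).
rewrite (negbTE fa) (negbTE fb) mul0r add0r subr0 => H. suff -> : (size Zf)%:R = \sum_(x <- s) (f x == 0)%:R :> R.
  apply: H => x /andP[ax xb] fg; apply: sZ; first by rewrite ax. rewrite mem_cat; case: fg => [fx|gx]; last by rewrite hg ?orbT ?ax.
  by rewrite hf (ltW ax) (ltW xb) fx eqxx.
have -> : \sum_(x <- s) (f x == 0)%:R = (count (fun x => f x == 0) s)%:R :> R.
  by elim: (s) => [|y t IH]; rewrite ?big_nil ?big_cons //= IH natrD.
rewrite -size_filter; congr _%:R. apply/perm_size; apply: uniq_perm => //.
  by apply: filter_uniq; move: ps; rewrite lt_path_sortedE => /andP[_]; rewrite lt_sorted_uniq_le => /andP[].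
move=> x; rewrite mem_filter hf; apply/idP/idP.
  move=> /andP[/andP[ax xb] fx]; rewrite fx /=. have ax' : a < x by rewrite lt_neqAle ax andbT; apply/eqP => e; move: fx; rewrite -e (negbTE fa).
  have xb' : x < b by rewrite lt_neqAle xb andbT; apply/eqP => e; move: fx; rewrite e (negbTE fb). by apply: sZ; rewrite ?ax'// mem_cat hf ax xb fx.
move=> /andP[fx /Zs[xb|[/andP[ax xb] _]]]; first by move: fx; rewrite xb (negbTE fb). by rewrite (ltW ax) (ltW xb).
Qed.

End path.
End kac_counting.

Section growth.
Variable R : realType.

Lemma pow_le_exp (m : nat) (t : R) : 1 < t -> exists2 C, 0 < C & forall n, n%:R ^+ m <= C * t ^+ n.
Proof.
elim: m t => [|m IH] t t1.
  by exists 1 => // n; rewrite expr0 mul1r exprn_ege1// ltW.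
pose s := Num.sqrt t; have s1 : 1 < s by rewrite -sqrtr1 ltr_sqrt// (lt_trans _ t1). have [C C0 hC] := IH s s1. have bern n : n%:R <= s ^+ n / (s - 1).
  rewrite ler_pdivlMr ?subr_gt0//. elim: n => [|n IHn]; first by rewrite mul0r expr0. rewrite exprS -natr1 mulrDl mul1r.
  have : 1 <= s ^+ n by rewrite exprn_ege1// ltW. move=> h; have : (s - 1) * 1 <= (s - 1) * s ^+ n by apply: ler_wpM2l => //; rewrite subr_ge0 ltW. lra.
exists (C / (s - 1)) => [|n]; first by rewrite divr_gt0// subr_gt0. rewrite exprSr; apply: (le_trans (ler_pM _ _ (hC n) (bern n))) => //.
have st : t ^+ n = s ^+ n * s ^+ n by rewrite -exprMn -expr2 sqr_sqrtr// (le_trans _ (ltW t1)). by rewrite st le_eqVlt; apply/orP; left; apply/eqP; ring.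
Qed.

Lemma nneseries_geometric_lt (u : nat -> \bar R) (A z : R) : 0 <= z < 1 -> 0 <= A ->
  (forall n, (0 <= u n)%E) -> (forall n, (u n <= (A * z ^+ n)%:E)%E) ->
  (\sum_(n <oo) u n < +oo)%E.
Proof.
move=> /andP[z0 z1] A0 u0 hu; apply: (@le_lt_trans _ _ (A / (1 - z))%:E); last exact: ltry. apply: lime_le; first by apply: is_cvg_nneseries.
apply: nearW => n; apply: (@le_trans _ _ (\sum_(0 <= k < n) (A * z ^+ k)%:E)%E).
  by apply: lee_sum => k _.
rewrite sumEFin lee_fin. have := congr1 (fun f => f n) (@geometric_seriesE R A z _); rewrite lt_eqF// => /(_ isT).
rewrite /series/geometric/= => ->; rewrite ler_wpM2r ?invr_ge0 ?subr_ge0 ?(ltW z1)//. by rewrite ler_piMr// gerBl exprn_ge0.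
Qed.

End growth.

(** * Small ball estimate for a normal variable *)

Section small_ball.
Context d (T : measurableType d) (R : realType)
  (P : probability T R).
Local Notation mu := (@lebesgue_measure R).

Lemma normal_gaussian_moment (c : R) : 0 < c ->
  (\int[normal_prob (0 : R) 1]_z (expR (- ((c * z) ^+ 2 / 2)))%:E <= (c^-1)%:E)%E.
Proof.
move=> c0; pose s : R := (Num.sqrt (1 + c ^+ 2))^-1. have q0 : 0 < 1 + c ^+ 2 by rewrite ltr_pwDl// sqr_ge0. have s0 : 0 < s by rewrite invr_gt0 sqrtr_gt0.
have s2 : s ^+ 2 = (1 + c ^+ 2)^-1 by rewrite /s exprVn sqr_sqrtr// ltW. have me : mfun (fun z : R => (expR (- ((c * z) ^+ 2 / 2)))%:E).
  apply/measurable_EFinP; apply: measurableT_comp => //; apply: measurableT_comp => //.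
  by apply: measurable_funM => //; apply: measurable_funX; exact: measurable_funM.
rewrite ge0_integral_normal_prob ?gt_eqF//. have -> : (\int[mu]_x ((expR (- ((c * x) ^+ 2 / 2)))%:E * (normal_pdf 0 1 x)%:E) =
    \int[mu]_x (s%:E * (normal_pdf 0 s x)%:E))%E.
  apply: eq_integral => x _; rewrite -!EFinM; congr EFin. rewrite !normal_pdfE ?gt_eqF// /normal_peak /normal_fun subr0.
  have -> : Num.sqrt (s ^+ 2 * pi *+ 2) = s * Num.sqrt (pi *+ 2).
    by rewrite -mulrnAr sqrtrM ?sqr_ge0// sqrtr_sqr gtr0_norm.
  have sk (k u : R) : s * ((s * k)^-1 * u) = k^-1 * u by rewrite invfM !mulrA divff ?gt_eqF// mul1r. rewrite expr1n mul1r sk mulrCA; congr (_ * _).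
  rewrite -expRD; congr expR. rewrite -mulr_natr -[s ^+ 2 *+ 2]mulr_natr s2 exprMn; field. by rewrite gt_eqF.
rewrite ge0_integralZl//; last 3 first.
- by apply/measurable_EFinP; exact: measurable_normal_pdf.
- by move=> x _; rewrite lee_fin normal_pdf_ge0.
- by rewrite lee_fin ltW.
rewrite integral_normal_pdf// mule1 lee_fin /s lef_pV2 ?posrE ?sqrtr_gt0//. rewrite -[leLHS]ger0_norm ?(ltW c0)// -sqrtr_sqr ler_wsqrtr// lerDr//.
Qed.

(** The indicator is at most 2 exp(-(L/h)^2 / 2). This Gaussian function is an average of cosines
    over an independent standard normal, so Fubini turns its expectation into a one-dimensional
    Gaussian integral, bounded by h / sqrt V; the density of [L] does not appear. *)
Lemma small_ball (L : T -> R) (V h : R) : centered_normal P L V -> 0 < V -> 0 < h ->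
  (P [set w | (`|L w| <= h)%R] <= (2 * h / Num.sqrt V)%:E)%E.
Proof.
move=> [mL _ hL] V0 h0. pose N : probability (mR R) R := normal_prob (0 : R) 1. pose F (z : T * mR R) := cos (h^-1 * L z.1 * z.2 + 0). have bF : bmeas F.
  apply: bmeas_cos; apply: measurable_funD => //; apply: measurable_funM; last exact: measurable_snd.
  by apply: measurable_funM => //; exact: measurableT_comp mL measurable_fst.
pose F' (z : mR R * T) := cos (h^-1 * L z.2 * z.1 + 0). have bF' : bmeas F'.
  apply: bmeas_cos; apply: measurable_funD => //; apply: measurable_funM; last exact: measurable_fst.
  by apply: measurable_funM => //; exact: measurableT_comp mL measurable_snd.
pose e w := expR (- ((L w / h) ^+ 2 / 2)). have me : mfun e.
  apply: measurableT_comp => //; apply: measurableT_comp => //. by apply: measurable_funM => //; apply: measurable_funX; exact: measurable_funM.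
have be : bmeas e.
  split => //; exists 1 => w; rewrite ger0_norm ?expR_ge0// -expR0 ler_expR oppr_le0. by rewrite divr_ge0// sqr_ge0.
pose e' z := expR (- ((Num.sqrt V / h * z) ^+ 2 / 2)). have inner w : \int[N]_z F (w, z) = e w.
  rewrite /F/=; have := @normal_cos R 1 (h^-1 * L w) 0 ltr01; rewrite cos0 mulr1 expr1n mul1r => ->. by rewrite /e [h^-1 * _]mulrC.
have inner' z : \int[P]_w F' (z, w) = e' z.
  rewrite /F'/=; have := hL (h^-1 * z) 0; rewrite cos0 mulr1 => h1. rewrite /e' -[RHS](_ : expR (- ((h^-1 * z) ^+ 2 * V / 2)) = _).
    by rewrite -h1; apply: eq_Rintegral => w _; congr (cos (_ + 0)); ring.
  congr (expR (- (_ / 2))); rewrite -[in LHS](sqr_sqrtr (ltW V0)) -exprMn; congr (_ ^+ 2); ring.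
have [b1 e1] := Ex_prod P N bF; have [b2 e2] := Ex_prod N P bF'. have eqF : \int[P]_w e w = \int[N]_z e' z.
  under eq_Rintegral do rewrite -inner. under [RHS]eq_Rintegral do rewrite -inner'. rewrite /Rintegral; congr fine. have i1 := bmeas_integrable (P \x N)%E bF.
  have := @Fubini _ _ _ _ _ P N (EFin \o F) i1. move=> Fub; transitivity (\int[P]_x \int[N]_y (F (x, y))%:E)%E.
    apply: eq_integral => x _; rewrite /= Ex_fin//; exact: bmeas_section bF.
  rewrite Fub; apply: eq_integral => y _; rewrite /= -Ex_fin//; last exact: bmeas_section bF'.
have mA : measurable [set w | (`|L w| <= h)%R].
  rewrite (_ : [set w | _] = L @^-1` `[- h, h]%classic); last first.
    by apply/seteqP; split => w /=; rewrite in_itv/= ler_norml.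
  by rewrite -[X in measurable X]setTI; exact: mL.
have bnd : (P [set w | (`|L w| <= h)%R] <= \int[P]_w (2 * e w)%:E)%E.
  rewrite -[X in P X]setIT -integral_indic//; apply: ge0_le_integral => //.
  - by apply/measurable_EFinP; exact: measurable_indic.
  - by apply/measurable_EFinP; exact: measurable_funM.
  - move=> w _; rewrite lee_fin indicE; have [|_] := boolP (w \in _); last first.
      by rewrite mulr_ge0// expR_ge0.
    rewrite inE/= => Lh; have : (L w / h) ^+ 2 <= 1.
      rewrite -real_normK ?num_real// -(expr1n _ 2) lerXn2r ?nnegrE//. by rewrite normrM normfV (gtr0_norm h0) ler_pdivrMr// mul1r.
    move=> h1; have := expR_ge1Dx (- ((L w / h) ^+ 2 / 2)); rewrite /e; lra.
apply: (le_trans bnd); rewrite Ex_fin; last exact: bmeasZ. rewrite ExZ// eqF lee_fin -mulrA; apply: ler_wpM2l => //.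
have c0 : 0 < Num.sqrt V / h by rewrite divr_gt0// sqrtr_gt0. have be' : bmeas (e' : mR R -> R).
  rewrite (_ : e' = fun z => \int[P]_w F' (z, w)); first exact: b2. by apply/funext => z; rewrite inner'.
have hN : (\int[N]_z (e' z)%:E <= ((Num.sqrt V / h)^-1)%:E)%E by exact: (normal_gaussian_moment c0). by rewrite (Ex_fin N be') lee_fin invf_div in hN.
Qed.

End small_ball.

(** * Moments of the number of zeros *)

Section zero_moments.
Context d (T : measurableType d) (R : realType)
  (P : probability T R) (X : nat -> T -> R).
Hypothesis mX : forall j, mfun (X j).
Hypothesis hX : std_normal_sums P X.
Variable a : nat -> nat -> R.
Hypothesis ra : regular_array X a.
Local Notation xi := (coef X a).

(** By [zeros_bound], n zeros force |xi_0| <= N / 4^n, where N is the coefficient norm at radius 5r;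
    so either |xi_0| <= 2^-n or N > 2^n. Both events have probability O(2^-n), by the small ball
    estimate and by Markov. The sum of n^m over the events that occur is an integrable majorant,
    obtained without asking that the number of zeros be measurable. *)
Lemma zeros_moment (V r : R) (m : nat) : 0 < r -> centered_normal P (xi 0) V -> 0 < V ->
  exists D : T -> \bar R, [/\ mfun D, forall w, (1 <= D w)%E,
    (\int[P]_w D w < +oo)%E & forall w (s : seq R), uniq s ->
      (forall z, z \in s -> `|z| <= r /\ psum (xi ^~ w) z = 0) ->
      (((size s)%:R ^+ m)%:E <= D w)%E].
Proof.
move=> r0 hn V0; have r5 : 0 <= 5 * r by rewrite mulr_ge0// ltW. pose N := coef_norm X a (5 * r). have mN : mfun N by exact: (measurable_coef_norm mX ra r5).
have Nfin : (\int[P]_w N w < +oo)%E by exact: (coef_norm_finite mX hX ra r5). have N0 w : (0 <= N w)%E.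
  by apply: nneseries_ge0 => n _ _; rewrite lee_fin mulr_ge0// exprn_ge0.
have p2 n : (0 : R) < 2 ^+ n by exact: exprn_gt0. pose A n := [set w | `|xi 0 w| <= (2 ^+ n)^-1]. pose B n := [set w | ((2 ^+ n)%:E < N w)%E].
have m0 : mfun (xi 0) by exact: measurable_coef. have mA n : measurable (A n).
  rewrite (_ : A n = xi 0 @^-1` `[- (2 ^+ n)^-1, (2 ^+ n)^-1]%classic); last first.
    by apply/seteqP; split => w /=; rewrite /A/= in_itv/= ler_norml.
  by rewrite -[X in measurable X]setTI; exact: m0.
have mB n : measurable (B n).
  rewrite (_ : B n = N @^-1` `](2 ^+ n)%:E, +oo[%classic); last first.
    by apply/seteqP; split => w /=; rewrite /B/= in_itv/= andbT.
  rewrite -[X in measurable X]setTI; apply: mN => //; exact: emeasurable_itv.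
have PA n : (P (A n) <= (2 / Num.sqrt V * 2^-1 ^+ n)%:E)%E.
  have := small_ball hn V0 (h := (2 ^+ n)^-1); rewrite invr_gt0 p2 => /(_ isT). by rewrite exprVn mulrAC.
pose K := fine (\int[P]_w N w). have KE : (\int[P]_w N w = K%:E)%E.
  by rewrite fineK// ge0_fin_numE//; exact: integral_ge0.
have K0 : 0 <= K by rewrite fine_ge0//; exact: integral_ge0. have PB n : (P (B n) <= (K * 2^-1 ^+ n)%:E)%E.
  rewrite exprVn; have -> : (K * (2 ^+ n)^-1)%:E = ((2 ^+ n)^-1%:E * \int[P]_w N w)%E.
    by rewrite KE -EFinM mulrC.
  rewrite -ge0_integralZl//. rewrite -[X in P X]setIT -integral_indic//; apply: ge0_le_integral => //.
  - by apply/measurable_EFinP; exact: measurable_indic.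
  - exact: measurable_funeM.
  - move=> w _; rewrite indicE; have [|_] := boolP (w \in _); last first.
      by rewrite mule_ge0// lee_fin invr_ge0 ltW.
    by rewrite inE/= /B/= => h; rewrite lee_pdivlMl// mule1 ltW.
pose F n := A n `|` B n. have mF n : measurable (F n) by exact: measurableU. pose A' := 2 / Num.sqrt V + K. have PF n : (P (F n) <= (A' * 2^-1 ^+ n)%:E)%E.
  by apply: (le_trans (measureU2 _ _ _)) => //; rewrite mulrDl EFinD; apply: leeD; [exact: PA|exact: PB].
have A'0 : 0 <= A' by rewrite addr_ge0// divr_ge0// sqrtr_ge0. pose S (w : T) : \bar R := (\sum_(n <oo) (n%:R ^+ m * \1_(F n) w)%:E)%E.
have t0 n w : (0 <= (n%:R ^+ m * \1_(F n) w)%:E :> \bar R)%E by rewrite lee_fin mulr_ge0// exprn_ge0.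
have mt n : mfun (fun w => (n%:R ^+ m * \1_(F n) w)%:E : \bar R).
  by apply/measurable_EFinP; apply: measurable_funM => //; exact: measurable_indic.
have mS : mfun S by apply: ge0_emeasurable_sum => [n w _ _|n _]; [exact: t0|exact: mt]. have S0 w : (0 <= S w)%E by apply: nneseries_ge0 => n _ _; exact: t0.
exists (fun w => (1 + S w)%E); split.
- by apply: emeasurable_funD.
- by move=> w; rewrite leeDl.
- rewrite ge0_integralD// integral_cst// [X in (1 * X)%E]probability_setT mule1. rewrite lte_add_pinfty ?ltry//. rewrite integral_nneseries//.
  (* The power n^m is absorbed by (3/2)^n, which leaves a geometric series of ratio 3/4. *)
  have [C C0 hC] := @pow_le_exp R m (3 / 2) ltac:(lra). apply: (@nneseries_geometric_lt R _ (C * A') (3 / 4)).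
  + by lra.
  + by rewrite mulr_ge0// ltW.
  + by move=> n; apply: integral_ge0 => w _; exact: t0.
  + move=> n; have nm : 0 <= n%:R ^+ m :> R by rewrite exprn_ge0. have -> : (\int[P]_x (n%:R ^+ m * \1_(F n) x)%:E = (n%:R ^+ m)%:E * P (F n))%E.
      rewrite -[X in P X]setIT -integral_indic// -ge0_integralZl//. by apply/measurable_EFinP; exact: measurable_indic.
    apply: (@le_trans _ _ ((n%:R ^+ m)%:E * (A' * 2^-1 ^+ n)%:E)%E).
      by apply: lee_wpmul2l => //; rewrite lee_fin.
    rewrite -EFinM lee_fin. have -> : C * A' * (3 / 4) ^+ n = (C * (3 / 2) ^+ n) * (A' * 2^-1 ^+ n).
      have -> : (3 / 4 : R) = (3 / 2) * 2^-1 by lra. by rewrite exprMn; ring.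
    by apply: ler_wpM2r => //; rewrite mulr_ge0// exprn_ge0.
- move=> w s us hs. have Fs : F (size s) w.
    have [|NB] := leP (N w) (2 ^+ size s)%:E; last by right. move=> /(coef_norm_le r5) nle; left; rewrite /F /A/=.
    have := zeros_bound r0 (coef_ent ra w) nle us hs. have -> : 2 ^+ size s / 4 ^+ size s = (2 ^+ size s)^-1 :> R; last by [].
    have -> : (4 : R) ^+ size s = 2 ^+ size s * 2 ^+ size s by rewrite -exprMn; congr (_ ^+ _); lra. by rewrite invfM mulrA divff ?mul1r// gt_eqF.
  apply: (@le_trans _ _ (S w)); last by rewrite leeDr. apply: (@le_trans _ _ ((size s)%:R ^+ m * \1_(F (size s)) w)%:E).
    by rewrite indicE mem_set// mulr1.
  apply: (@le_trans _ _ (\sum_(0 <= n < (size s).+1) (n%:R ^+ m * \1_(F n) w)%:E)%E).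
    by rewrite big_nat_recr//= leeDr// sume_ge0.
  by apply: nneseries_lim_ge => n _ _; exact: t0.
Qed.

End zero_moments.

(** * Tonelli for products of Kac integrals *)

Section tonelli.
Context d (T : measurableType d) (R : realType) (P : probability T R).
Local Notation mu := (@lebesgue_measure R).
Local Open Scope ereal_scope.

Lemma tonelli_interval (A : set R) (Phi : T * mR R -> R) (G : T -> \bar R) :
  measurable A -> mfun Phi -> (forall z, (0 <= Phi z)%R) ->
  mfun G -> (forall w, 0 <= G w) ->
  \int[P]_w ((\int[mu]_(x in A) (Phi (w, x))%:E) * G w) =
  \int[mu]_(x in A) \int[P]_w ((Phi (w, x))%:E * G w) /\
  mfun (fun w => \int[mu]_(x in A) (Phi (w, x))%:E) /\
  mfun (fun x => \int[P]_w ((Phi (w, x))%:E * G w)).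
Proof.
move=> mA mPhi Phi0 mG G0. pose H (z : T * mR R) : \bar R := (Phi z * \1_A z.2)%:E * G z.1. have mi : mfun (fun z : T * mR R => (Phi z * \1_A z.2)%:E : \bar R).
  apply/measurable_EFinP; apply: measurable_funM => //. by apply: (@measurableT_comp _ _ _ _ _ _ (\1_A : mR R -> R)) => //; exact: measurable_indic.
have mH : mfun H.
  apply: emeasurable_funM; first exact: mi. exact: measurableT_comp mG measurable_fst.
have i0 z : 0 <= (Phi z * \1_A z.2)%:E :> \bar R by rewrite lee_fin mulr_ge0. have H0 z : 0 <= H z by rewrite /H mule_ge0.
have mP w : mfun (fun x : mR R => (Phi (w, x))%:E : \bar R).
  by apply/measurable_EFinP; exact: (measurableT_comp mPhi (measurable_pair1 w)).
have pE (g : mR R -> \bar R) x : (forall x, 0 <= g x) -> (g \_ A) x = (\1_A x)%:E * g x.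
  by move=> g0; rewrite /patch indicE; case: (x \in A); rewrite ?mul1e ?mul0e.
have inA w : \int[mu]_(x in A) (Phi (w, x))%:E = \int[mu]_x (Phi (w, x) * \1_A x)%:E.
  rewrite integral_mkcond; apply: eq_integral => x _. rewrite pE => [|y]; first by rewrite -EFinM mulrC. by rewrite lee_fin.
split; last split.
- have -> : \int[P]_w ((\int[mu]_(x in A) (Phi (w, x))%:E) * G w) = \int[P]_w \int[mu]_x H (w, x).
    apply: eq_integral => w _; rewrite inA /H/= -ge0_integralZr//. exact: (measurableT_comp mi (measurable_pair1 w)).
  rewrite (@fubini_tonelli _ _ _ _ _ P mu H mH H0) [RHS]integral_mkcond.
  apply: eq_integral => x _; rewrite (pE (fun x => \int[P]_w ((Phi (w, x))%:E * G w))) => [|y]; last first.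
    by apply: integral_ge0 => w _; rewrite mule_ge0// lee_fin.
  rewrite -ge0_integralZl//.
  + by apply: eq_integral => w _; rewrite /H/= EFinM muleAC muleC muleA.
  + apply: emeasurable_funM => //; apply/measurable_EFinP. exact: (measurableT_comp mPhi (measurable_pair2 x)).
  + by move=> w _; rewrite mule_ge0// lee_fin.
- under eq_fun do rewrite inA. exact: (@measurable_fun_fubini_tonelli_F _ _ T (mR R) R mu _ mi i0).
- have mK : mfun (fun z : T * mR R => (Phi z)%:E * G z.1).
    apply: emeasurable_funM; first exact/measurable_EFinP. exact: measurableT_comp mG measurable_fst.
  apply: (@measurable_fun_fubini_tonelli_G _ _ T (mR R) R P _ mK). by move=> z; rewrite mule_ge0// lee_fin.
Qed.

End tonelli.

Section tonelli_product.
Context d d' (T : measurableType d) (T' : measurableType d')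
  (R : realType) (P : probability T R) (P' : probability T' R) (I : eqType).
Variables (A : I -> set R) (Phi : I -> T * mR R -> R)
  (Phi' : I -> T' * mR R -> R) (c : R).
Hypothesis mA : forall i, measurable (A i).
Hypothesis mPhi : forall i, mfun (Phi i).
Hypothesis mPhi' : forall i, mfun (Phi' i).
Hypothesis Phi0 : forall i z, (0 <= Phi i z)%R.
Hypothesis Phi'0 : forall i z, (0 <= Phi' i z)%R.
Hypothesis c0 : 0 <= c.
Local Notation mu := (@lebesgue_measure R).
Local Open Scope ereal_scope.

Let mprod (e : measure_display) (S : measurableType e) (F : I -> S -> \bar R) l :
  (forall i, mfun (F i)) -> mfun (fun w => \prod_(i <- l) F i w).
Proof.
move=> mF; elim: l => [|i l IH]; first by under eq_fun do rewrite big_nil; exact: measurable_cst. by under eq_fun do rewrite big_cons; exact: emeasurable_funM.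
Qed.

Let prod_ge0 (S : Type) (F : I -> S -> \bar R) l w : (forall i w, 0 <= F i w) -> 0 <= \prod_(i <- l) F i w.
Proof.
move=> F0; elim: l => [|i l IH]; first by rewrite big_nil. by rewrite big_cons mule_ge0.
Qed.

(** Induction on the list: the integral of the first index is absorbed into the weight, and once the
    other indices are fixed at points, Tonelli exchanges it with the expectation. The weights [G]
    and [G'] exist for the sake of this induction. *)
Lemma tonelli_product l (G : T -> \bar R) (G' : T' -> \bar R) : uniq l ->
  mfun G -> mfun G' -> (forall w, 0 <= G w) -> (forall w, 0 <= G' w) ->
  (forall x : I -> R, (forall i, A i (x i)) ->
    \int[P]_w ((\prod_(i <- l) (Phi i (w, x i))%:E) * G w) <=
    c%:E * \int[P']_w ((\prod_(i <- l) (Phi' i (w, x i))%:E) * G' w)) ->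
  (forall i, A i !=set0) ->
  \int[P]_w ((\prod_(i <- l) \int[mu]_(x in A i) (Phi i (w, x))%:E) * G w) <=
  c%:E * \int[P']_w ((\prod_(i <- l) \int[mu]_(x in A i) (Phi' i (w, x))%:E) * G' w).
Proof.
move=> ul mG mG' G0 G'0 H A0; have [x0 hx0] := choice A0. elim: l ul G G' mG mG' G0 G'0 H => [_ G G' mG mG' G0 G'0 H|i l IH].
  by have := H x0 hx0; under eq_integral do rewrite big_nil; under [X in _ <= _ * X -> _]eq_integral do rewrite big_nil;
  under [X in _ -> X <= _]eq_integral do rewrite big_nil; under [X in _ -> _ <= _ * X]eq_integral do rewrite big_nil.
move=> /= /andP[il ul] G G' mG mG' G0 G'0 H. have t1 := @tonelli_interval _ T R P (A i) (Phi i) _ (mA i) (mPhi i) (Phi0 i).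
have t2 := @tonelli_interval _ T' R P' (A i) (Phi' i) _ (mA i) (mPhi' i) (Phi'0 i).
have mI : mfun (fun w => \int[mu]_(x in A i) (Phi i (w, x))%:E) by have [_ []] := t1 G mG G0.
have mI' : mfun (fun w => \int[mu]_(x in A i) (Phi' i (w, x))%:E) by have [_ []] := t2 G' mG' G'0.
have I0 w : 0 <= \int[mu]_(x in A i) (Phi i (w, x))%:E by apply: integral_ge0 => x _; rewrite lee_fin.
have I'0 w : 0 <= \int[mu]_(x in A i) (Phi' i (w, x))%:E by apply: integral_ge0 => x _; rewrite lee_fin.
under eq_integral do rewrite big_cons [X in X * _]muleC -muleA. under [X in _ <= _ * X]eq_integral do rewrite big_cons [X in X * _]muleC -muleA.
apply: (IH ul (fun w => _) (fun w => _)).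
- exact: emeasurable_funM.
- exact: emeasurable_funM.
- by move=> w; rewrite mule_ge0.
- by move=> w; rewrite mule_ge0.
move=> x hx. pose F w := (\prod_(j <- l) (Phi j (w, x j))%:E) * G w. pose F' w := (\prod_(j <- l) (Phi' j (w, x j))%:E) * G' w. have mF : mfun F.
  apply: emeasurable_funM => //; apply: mprod => j; apply/measurable_EFinP. exact: (measurableT_comp (mPhi j) (measurable_pair2 (x j))).
have mF' : mfun F'.
  apply: emeasurable_funM => //; apply: mprod => j; apply/measurable_EFinP. exact: (measurableT_comp (mPhi' j) (measurable_pair2 (x j))).
have F0 w : 0 <= F w.
  by rewrite mule_ge0//; apply: (prod_ge0 (F := fun j w => (Phi j (w, x j))%:E)) => j u; rewrite lee_fin.
have F'0 w : 0 <= F' w.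
  by rewrite mule_ge0//; apply: (prod_ge0 (F := fun j w => (Phi' j (w, x j))%:E)) => j u; rewrite lee_fin.
under eq_integral do rewrite muleCA -/(F _). under [X in _ <= _ * X]eq_integral do rewrite muleCA -/(F' _).
have [-> [_ m1]] := t1 F mF F0; have [-> [_ m2]] := t2 F' mF' F'0.
have n1 y : 0 <= \int[P]_w ((Phi i (w, y))%:E * F w) by apply: integral_ge0 => w _; rewrite mule_ge0// lee_fin.
have n2 y : 0 <= \int[P']_w ((Phi' i (w, y))%:E * F' w) by apply: integral_ge0 => w _; rewrite mule_ge0// lee_fin. rewrite -ge0_integralZl//; last 2 first.
- exact: mA.
- exact: (measurable_funTS m2).
apply: ge0_le_integral.
- exact: mA.
- by move=> y _; exact: n1.
- exact: (measurable_funTS m1).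
- by apply: measurable_funeM; exact: (measurable_funTS m2).
- move=> y Ay; pose x' j := if j == i then y else x j. have hx' j : A j (x' j) by rewrite /x'; case: eqP => [->|].
  have := H x' hx'; have e j : j \in l -> x' j = x j.
    by move=> jl; rewrite /x'; case: eqP jl il => [->->|].
  have xi : x' i = y by rewrite /x' eqxx. have E1 w : (\prod_(j <- i :: l) (Phi j (w, x' j))%:E) * G w = (Phi i (w, y))%:E * F w.
    rewrite big_cons xi -muleA /F; congr (_ * (_ * _)). by rewrite big_seq [RHS]big_seq; apply: eq_bigr => j jl; rewrite e.
  have E2 w : (\prod_(j <- i :: l) (Phi' j (w, x' j))%:E) * G' w = (Phi' i (w, y))%:E * F' w.
    rewrite big_cons xi -muleA /F'; congr (_ * (_ * _)). by rewrite big_seq [RHS]big_seq; apply: eq_bigr => j jl; rewrite e.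
  by under eq_integral do rewrite E1; under [X in _ <= _ * X -> _]eq_integral do rewrite E2.
Qed.

End tonelli_product.

(** * Independent copies *)

Section independent_copies.
Context d (T : measurableType d) (R : realType) (P : probability T R)
  (I : finType) (X : I -> T -> R) (A : I -> I -> R) (s : pred I).

(** Drawing the two groups of coordinates from independent copies kills the covariance between them;
    this is the block-diagonal law with which the joint law of the jets is compared. *)
Lemma gaussian_vector_copies : gaussian_vector P X A ->
  gaussian_vector (P \x P)%E (fun i (w : T * T) => if s i then X i w.1 else X i w.2)
    (fun i j => if s i == s j then A i j else 0).
Proof.
move=> [mX hX]; split.
  move=> i; case: (s i); first exact: measurableT_comp (mX i) measurable_fst. exact: measurableT_comp (mX i) measurable_snd.
move=> c b. pose c1 i := if s i then c i else 0; pose c2 i := if s i then 0 else c i. have mS c' : mfun (fun w => \sum_i c' i * X i w).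
  by apply: measurable_sum => i; exact: measurable_funM.
have sE w1 w2 : \sum_i c i * (if s i then X i w1 else X i w2) + b = \sum_i c2 i * X i w2 + (\sum_i c1 i * X i w1 + b).
  rewrite addrA -big_split/=; congr (_ + b); apply: eq_bigr => i _. by rewrite /c1 /c2; case: (s i); rewrite mul0r ?addr0 ?add0r.
have bF : bmeas (fun w : T * T => cos (\sum_i c i * (if s i then X i w.1 else X i w.2) + b)).
  apply: bmeas_cos; apply: measurable_funD => //; apply: measurable_sum => i; apply: measurable_funM => //.
  case: (s i); first exact: measurableT_comp (mX i) measurable_fst. exact: measurableT_comp (mX i) measurable_snd.
have [_ ->] := Ex_prod P P bF. under eq_Rintegral => w1 _.
  rewrite (_ : \int[P]_y _ = expR (- (qform A c2 / 2)) * cos (\sum_i c1 i * X i w1 + b)); last first.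
    by rewrite -hX; apply: eq_Rintegral => w2 _; rewrite /= sE.
  over.
rewrite ExZ; last by apply: bmeas_cos; apply: measurable_funD. rewrite hX mulrA -expRD; congr (expR _ * _).
have -> : qform (fun i j => if s i == s j then A i j else 0) c = qform A c1 + qform A c2.
  rewrite /qform -big_split/=; apply: eq_bigr => i _; rewrite -big_split/=; apply: eq_bigr => j _.
  by rewrite /c1 /c2; case: (s i); case: (s j); rewrite /= ?(mul0r, mulr0) ?addr0 ?add0r.
lra.
Qed.

Lemma gaussian_vector_scale (l : R) : gaussian_vector P X A ->
  gaussian_vector P (fun i w => l * X i w) (fun i j => l ^+ 2 * A i j).
Proof.
move=> [mX hX]; split=> [i|c b]; first exact: measurable_funM. have := hX (fun i => c i * l) b; under eq_Rintegral do under eq_bigr do rewrite -mulrA.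
move=> ->; congr (expR (- (_ / 2)) * _); rewrite /qform; apply: eq_bigr => i _; apply: eq_bigr => j _; ring.
Qed.

Lemma qform_scale (l : R) (B : I -> I -> R) c : qform (fun i j => l * B i j) c = l * qform B c.
Proof.
rewrite /qform mulr_sumr; apply: eq_bigr => i _; rewrite mulr_sumr; apply: eq_bigr => j _; ring.
Qed.

End independent_copies.

(** * Fatou and dominated convergence in the form used below *)

Section limits_of_integrals.
Context d (T : measurableType d) (R : realType) (P : probability T R).
Local Open Scope ereal_scope.

Lemma limn_einf_le (u : (\bar R)^nat) c : (forall n, u n <= c) -> limn_einf u <= c.
Proof.
move=> h; rewrite limn_einf_lim; apply: lime_le; first exact: is_cvg_einfs. apply: nearW => n; apply: le_trans (h n); apply: ereal_inf_lbound.
by exists n => //=.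
Qed.

Lemma limn_einf_mono (u v : (\bar R)^nat) : (forall n, u n <= v n) -> limn_einf u <= limn_einf v.
Proof.
move=> h; rewrite !limn_einf_lim; apply: lee_lim; [exact: is_cvg_einfs|exact: is_cvg_einfs|].
apply: nearW => n; apply: le_ereal_inf_tmp => _ [m /= nm <-]; apply: le_trans (h m). by apply: ereal_inf_lbound; exists m.
Qed.

Lemma fatou_le (D : set T) (F : nat -> T -> R) (G : T -> R) c : measurable D ->
  (forall n, mfun (F n)) -> (forall n w, (0 <= F n w)%R) ->
  (forall w, D w -> F n w @[n --> \oo] --> G w) ->
  (forall n, \int[P]_(w in D) (F n w)%:E <= c) -> \int[P]_(w in D) (G w)%:E <= c.
Proof.
move=> mD mF F0 FG hc. have -> : \int[P]_(w in D) (G w)%:E = \int[P]_(w in D) limn_einf (fun n => (F n w)%:E).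
  apply: eq_integral => w; rewrite inE => Dw; symmetry. have l : (F n w)%:E @[n --> \oo] --> (G w)%:E by apply: cvg_EFin (FG w Dw); exact: nearW.
  by have [-> _] := cvg_limn_einf_sup l.
apply: le_trans (fatou P mD _ _) _.
- by move=> n; apply: measurable_funTS; exact/measurable_EFinP.
- by move=> n w _; rewrite lee_fin.
- exact: limn_einf_le.
Qed.

Lemma dominated_cvg (D : set T) (F : nat -> T -> R) (G : T -> R) (H : T -> \bar R) : measurable D ->
  (forall n, mfun (F n)) -> (forall n w, (0 <= F n w)%R) ->
  mfun H -> (forall w, 0 <= H w) -> \int[P]_w H w < +oo ->
  (forall w, D w -> F n w @[n --> \oo] --> G w) ->
  (forall n w, D w -> (F n w)%:E <= H w) ->
  \int[P]_(w in D) (F n w)%:E @[n --> \oo] --> \int[P]_(w in D) (G w)%:E.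
Proof.
move=> mD mF F0 mH H0 iH FG FH. have [] := @dominated_convergence _ T R P D mD (fun n w => (F n w)%:E) (fun w => (G w)%:E) H.
- by move=> n; apply: measurable_funTS; exact/measurable_EFinP.
- apply/measurable_EFinP; apply: (measurable_fun_cvg (h := F)) => // n. exact: measurable_funTS.
- by apply: aeW => w Dw; apply: cvg_EFin (FG w Dw); exact: nearW.
- apply/integrableP; split; first exact: measurable_funTS. apply: le_lt_trans iH; under eq_integral do rewrite gee0_abs//. exact: ge0_subset_integral.
- by apply: aeW => w n Dw; rewrite gee0_abs ?FH// lee_fin.
- by [].
Qed.

End limits_of_integrals.

(** * Comparison of the Kac integrals of two Gaussian fields *)

Section kac_comparison.
Context (R : realType) d (T : measurableType d) (P : probability T R) (W : nat -> T -> R).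
Hypothesis mW : forall j, mfun (W j).
Hypothesis hW : std_normal_sums P W.
Context d1 d2 (T1 : measurableType d1) (T2 : measurableType d2)
  (P1 : probability T1 R) (P2 : probability T2 R) (I : finType) (L : R).
Hypothesis L1 : 1 < L.
Local Notation mu := (@lebesgue_measure R).
Local Notation ratio := (Num.sqrt L ^+ #|{: I * bool}|).

Definition comparable_covariances (J : finType) (A B : J -> J -> R) : Prop :=
  [/\ forall i j, A i j = A j i, forall i j, B i j = B j i,
      forall c, qform A c <= qform B c & forall c, qform B c <= L * qform A c].

Lemma abssin_le (n : nat) (x : R) : n.+1%:R * `|sin (n.+1%:R^-1 * x)| <= `|x|.
Proof.
have n0 : (0 : R) < n.+1%:R by []. rewrite mulrC -ler_pdivlMr//; apply: le_trans (sin_le_id _) _. by rewrite normrM gtr0_norm ?invr_gt0// mulrC.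
Qed.

Lemma abssin_cvg (x : R) : (n.+1%:R * `|sin (n.+1%:R^-1 * x)|) @[n --> \oo] --> `|x|.
Proof.
have := cvg_norm (@cvg_nsin R x); under eq_fun do rewrite normrM ger0_norm//. by move=> h; exact: h.
Qed.

Lemma measurable_cauchy_kernel (h : R) : 0 < h -> mfun (cauchy_kernel h).
Proof. by move=> h0; apply: admissible_measurable; exact: admissible_cauchy. Qed.

Lemma kac_int_EFin (f g : R -> R) (h a b : R) : 0 < h -> continuous f -> continuous g ->
  (\int[mu]_(x in `[a, b]) (cauchy_kernel h (f x) * `|g x|)%:E)%E = (kac_int f g h a b)%:E.
Proof.
move=> h0 cf cg; rewrite /kac_int /Rintegral fineK//; apply: integrable_fin_num => //.
apply: continuous_itv_integrable => x; apply: cvgM; last by apply: cvg_norm; exact: cg. apply: cvgM; first exact: cvg_cst.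
apply: cvgV; first by rewrite gt_eqF// ltr_pwDl ?exprn_gt0// sqr_ge0. apply: cvgD; first exact: cvg_cst.
by rewrite expr2; under eq_fun do rewrite expr2; apply: cvgM; exact: cf.
Qed.

Lemma measurable_kac_int d' (S : measurableType d') (PS : probability S R) (f g : S * mR R -> R) (h a b : R) :
  0 < h -> mfun f -> mfun g ->
  (forall w, continuous (fun x => f (w, x))) -> (forall w, continuous (fun x => g (w, x))) ->
  mfun (fun w => kac_int (fun x => f (w, x)) (fun x => g (w, x)) h a b).
Proof.
move=> h0 mf mg cf cg. pose F (z : S * mR R) := cauchy_kernel h (f z) * `|g z|. have mF : mfun F.
  apply: measurable_funM; first exact: measurableT_comp (measurable_cauchy_kernel h0) _. exact: measurableT_comp.
have F0 z : 0 <= F z by rewrite mulr_ge0 ?cauchy_kernel_ge0.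
have [_ [+ _]] := @tonelli_interval _ S R PS `[a, b]%classic F (cst 0%E) (measurable_itv _) mF F0 (measurable_cst _) (fun=> lexx _).
by under eq_fun do rewrite kac_int_EFin//; move/measurable_EFinP.
Qed.

(** The absolute value is not an admissible test function; it is approached from below by n
    |sin(x/n)|, with Fatou on the left-hand side and the pointwise inequality on the right-hand
    side. *)
Lemma pointwise_comparison (X : I * bool -> T1 -> R) (Y : I * bool -> T2 -> R) A B h : 0 < h ->
  gaussian_vector P1 X A -> gaussian_vector P2 Y B -> comparable_covariances A B ->
  (\int[P1]_w (\prod_i (cauchy_kernel h (X (i, false) w) * `|X (i, true) w|))%:E <=
   ratio%:E * \int[P2]_w (\prod_i (cauchy_kernel h (Y (i, false) w) * `|Y (i, true) w|))%:E)%E.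
Proof.
move=> h0 gX gY [sA sB AB BA]. pose f (n : nat) (ib : I * bool) (x : R) : R := if ib.2 then n.+1%:R * `|sin (n.+1%:R^-1 * x)| else h / pi / (h ^+ 2 + x ^+ 2).
have af n ib : admissible (f n ib).
  by case: ib => i [] /=; [exact: admissible_abssin|exact: admissible_cauchy].
have f0 n ib x : 0 <= f n ib x by have [] := af n ib. have pE (S : Type) (Z : I * bool -> S -> R) n w : \prod_ib f n ib (Z ib w) =
    \prod_i (cauchy_kernel h (Z (i, false) w) * (n.+1%:R * `|sin (n.+1%:R^-1 * Z (i, true) w)|)).
  rewrite (eq_bigr (fun ib => f n (ib.1, ib.2) (Z (ib.1, ib.2) w))); last by case. rewrite -(pair_big xpredT xpredT (fun i b => f n (i, b) (Z (i, b) w)))/=.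
  by apply: eq_bigr => i _; rewrite big_bool/= mulrC.
have c0 : 0 <= ratio by rewrite exprn_ge0 ?sqrtr_ge0. have bm (n : nat) := fun d' (T' : measurableType d') (Z : I * bool -> T' -> R) mZ =>
  bmeas_prod (X := Z) (f := f n) mZ (af n).
have [mX _] := gX; have [mY _] := gY. apply: (@fatou_le _ T1 R P1 setT (fun n w => \prod_ib f n ib (X ib w))) => //.
- by move=> n; have [] := bm n _ _ X mX.
- by move=> n w; apply: prodr_ge0.
- move=> w _; under eq_fun do rewrite pE.
  have H (l : seq I) : \prod_(i <- l) (cauchy_kernel h (X (i, false) w) * (n.+1%:R * `|sin (n.+1%:R^-1 * X (i, true) w)|))
      @[n --> \oo] --> \prod_(i <- l) (cauchy_kernel h (X (i, false) w) * `|X (i, true) w|).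
    elim: l => [|i l IH]; first by under eq_fun do rewrite big_nil; rewrite big_nil; exact: cvg_cst.
    under eq_fun do rewrite big_cons; rewrite big_cons; apply: cvgM => //; apply: cvgM; first exact: cvg_cst. exact: abssin_cvg.
  exact: H.
- move=> n; rewrite Ex_fin; last exact: bm. apply: (@le_trans _ _ (ratio * \int[P2]_w (\prod_ib f n ib (Y ib w)))%:E).
    by rewrite lee_fin; exact: (gaussian_comparison mW hW L1 gX gY sA sB AB BA (af n)).
  rewrite EFinM -Ex_fin; last exact: bm. apply: lee_wpmul2l; first by rewrite lee_fin. apply: ge0_le_integral => //.
  + by move=> w _; rewrite lee_fin prodr_ge0.
  + by apply/measurable_EFinP; have [] := bm n _ _ Y mY.
  + apply/measurable_EFinP; apply: measurable_prod => i _; apply: measurable_funM.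
      exact: measurableT_comp (measurable_cauchy_kernel h0) (mY _).
    by apply: measurableT_comp.
  + move=> w _; rewrite lee_fin pE; apply: ler_prod => i _. have ck := cauchy_kernel_ge0 (Y (i, false) w) h0.
    apply/andP; split; first by do 2!apply: mulr_ge0 => //. by apply: ler_wpM2l => //; exact: abssin_le.
Qed.

(* A random field given as pairs (path, derivative) of jointly measurable functions, with the
   limits [N] of its Kac integrals on the event [D]; only the paths' continuity is used. *)
Definition kac_field d' (S : measurableType d') (PS : probability S R) (f g : I -> S * mR R -> R)
    (a b : I -> R) (D : set S) (N : I -> S -> R) : Prop :=
  [/\ (forall i, mfun (f i)) /\ (forall i, mfun (g i)),
      (forall i w, continuous (fun x => f i (w, x))) /\ (forall i w, continuous (fun x => g i (w, x))),
      measurable D /\ PS (~` D) = 0%E &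
      forall i w, D w -> kac_int (fun x => f i (w, x)) (fun x => g i (w, x)) n.+1%:R^-1 (a i) (b i)
        @[n --> \oo] --> N i w].

(** At fixed kernel width the pointwise comparison is integrated by Tonelli. As the width tends to
    0, Fatou handles the left-hand side and dominated convergence the right-hand side, which is what
    [H] is for. In [I * bool] the flag [false] marks a value and [true] a derivative. *)
Lemma kac_comparison (f1 g1 : I -> T1 * mR R -> R) (f2 g2 : I -> T2 * mR R -> R)
    (a b : I -> R) (D1 : set T1) (D2 : set T2) (N1 : I -> T1 -> R) (N2 : I -> T2 -> R) (H : T2 -> \bar R) :
  kac_field P1 f1 g1 a b D1 N1 -> kac_field P2 f2 g2 a b D2 N2 -> (forall i, a i <= b i) ->
  (forall x : I -> R, (forall i, a i <= x i <= b i) -> exists A B,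
    [/\ gaussian_vector P1 (fun (ib : I * bool) w => (if ib.2 then g1 else f1) ib.1 (w, x ib.1)) A,
        gaussian_vector P2 (fun (ib : I * bool) w => (if ib.2 then g2 else f2) ib.1 (w, x ib.1)) B &
        comparable_covariances A B]) ->
  mfun H -> (forall w, 0 <= H w)%E -> (\int[P2]_w H w < +oo)%E ->
  (forall n w, D2 w -> ((\prod_i kac_int (fun x => f2 i (w, x)) (fun x => g2 i (w, x)) n.+1%:R^-1 (a i) (b i))%:E
     <= H w)%E) ->
  (\int[P1]_(w in D1) (\prod_i N1 i w)%:E <= ratio%:E * \int[P2]_(w in D2) (\prod_i N2 i w)%:E)%E.
Proof.
move=> k1 k2 ab hx mH H0 iH hH; have c0 : 0 <= ratio by rewrite exprn_ge0 ?sqrtr_ge0. have [_ _ [mD1 PD1] l1] := k1; have [_ _ [mD2 PD2] l2] := k2.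
pose K d' (S : measurableType d') (f g : I -> S * mR R -> R) i (n : nat) w := kac_int (fun x => f i (w, x)) (fun x => g i (w, x)) n.+1%:R^-1 (a i) (b i).
pose A i : set R := `[a i, b i]%classic. pose Ph d' (S : measurableType d') (f g : I -> S * mR R -> R) (n : nat) i z :=
  cauchy_kernel n.+1%:R^-1 (f i z) * `|g i z|.
have n0 (n : nat) : (0 : R) < n.+1%:R^-1 by []. have reg d' (S : measurableType d') (PS : probability S R) f g D N : kac_field PS f g a b D N ->
    [/\ forall i n w, (\int[mu]_(x in A i) (Ph _ S f g n i (w, x))%:E)%E = (K _ S f g i n w)%:E,
        forall n i, mfun (Ph _ S f g n i), forall n i z, 0 <= Ph _ S f g n i z, forall i n, mfun (K _ S f g i n) & forall i n w, 0 <= K _ S f g i n w].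
  move=> [[mf mg] [cf cg] _ _]. have KE i n w : (\int[mu]_(x in A i) (Ph _ S f g n i (w, x))%:E)%E = (K _ S f g i n w)%:E by exact: kac_int_EFin.
  have P0 n i z : 0 <= Ph _ S f g n i z by rewrite mulr_ge0 ?cauchy_kernel_ge0. split => //.
  - move=> n i; apply: measurable_funM; first exact: measurableT_comp (measurable_cauchy_kernel _) _. exact: measurableT_comp.
  - by move=> i n; exact: measurable_kac_int.
  - by move=> i n w; rewrite -lee_fin -KE; apply: integral_ge0 => x _; rewrite lee_fin.
have [K1E mP1 P10 mK1 K10] := reg _ _ _ _ _ _ _ k1; have [K2E mP2 P20 mK2 K20] := reg _ _ _ _ _ _ _ k2. pose K1 := K _ T1 f1 g1; pose K2 := K _ T2 f2 g2.
have key n : (\int[P1]_w (\prod_i K1 i n w)%:E <= ratio%:E * \int[P2]_w (\prod_i K2 i n w)%:E)%E.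
  have pE (S : Type) (F : I -> S -> R) w : (\prod_i F i w)%:E = ((\prod_(i <- index_enum I) (F i w)%:E) * 1)%E.
    by rewrite mule1 prodEFin.
  under eq_integral do rewrite (pE _ (fun i w => K1 i n w)); under [X in (_ <= _ * X)%E]eq_integral do rewrite (pE _ (fun i w => K2 i n w)).
  under eq_integral do under eq_bigr do rewrite -K1E. under [X in (_ <= _ * X)%E]eq_integral do under eq_bigr do rewrite -K2E.
  apply: (@tonelli_product _ _ T1 T2 R P1 P2 I A (Ph _ T1 f1 g1 n) (Ph _ T2 f2 g2 n) ratio _ _ _ _ _ _ _ (cst 1%E) (cst 1%E)) => //.
  - by move=> i; exact: measurable_itv.
  - exact: index_enum_uniq.
  - move=> x hxA; have [A' [B' [g1' g2' cAB]]] := hx x (fun i => ltac:(by have := hxA i; rewrite /A /= in_itv)).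
    have := pointwise_comparison (n0 n) g1' g2' cAB; rewrite /=. under [X in _ -> (X <= _)%E]eq_integral do rewrite mule1 prodEFin.
    by under [X in _ -> (_ <= _ * X)%E]eq_integral do rewrite mule1 prodEFin.
  - by move=> i; exists (a i); rewrite /A /= in_itv/= lexx ab.
have pl (S : Type) (K' : I -> nat -> S -> R) (N : I -> S -> R) (D : set S) : (forall i w, D w -> K' i n w @[n --> \oo] --> N i w) ->
    forall w, D w -> \prod_i K' i n w @[n --> \oo] --> \prod_i N i w.
  move=> l w Dw; elim: (index_enum I) => [|i s IH].
    by under eq_fun do rewrite big_nil; rewrite big_nil; exact: cvg_cst.
  by under eq_fun do rewrite big_cons; rewrite big_cons; apply: cvgM => //; exact: l.
have mp1 n : mfun (fun w => \prod_i K1 i n w) by apply: measurable_prod. have mp2 n : mfun (fun w => \prod_i K2 i n w) by apply: measurable_prod.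
have p10 n w : 0 <= \prod_i K1 i n w by apply: prodr_ge0. have p20 n w : 0 <= \prod_i K2 i n w by apply: prodr_ge0.
have lim2 := dominated_cvg mD2 mp2 p20 mH H0 iH (pl _ K2 N2 D2 l2) hH.
have e2 n : (\int[P2]_w (\prod_i K2 i n w)%:E = \int[P2]_(w in D2) (\prod_i K2 i n w)%:E)%E.
  rewrite [RHS]integral_mkcond; apply: (integral_null (N := ~` D2)) => //; first exact: measurableC. by move=> w /contrapT Dw; rewrite patchE mem_set.
have lc : (ratio%:E * \int[P2]_(w in D2) (\prod_i K2 i n w)%:E)%E @[n --> \oo] --> (ratio%:E * \int[P2]_(w in D2) (\prod_i N2 i w)%:E)%E by exact: cvgeZl.
have le1 n : (\int[P1]_(w in D1) (\prod_i K1 i n w)%:E <= ratio%:E * \int[P2]_(w in D2) (\prod_i K2 i n w)%:E)%E.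
  rewrite -e2; apply: le_trans (key n); apply: ge0_subset_integral => //.
    by apply/measurable_EFinP.
  by move=> w _; rewrite lee_fin.
have -> : (\int[P1]_(w in D1) (\prod_i N1 i w)%:E = \int[P1]_(w in D1) limn_einf (fun n => (\prod_i K1 i n w)%:E))%E.
  apply: eq_integral => w; rewrite inE => Dw; symmetry. have l : (\prod_i K1 i n w)%:E @[n --> \oo] --> (\prod_i N1 i w)%:E.
    by apply: cvg_EFin (pl _ K1 N1 D1 l1 w Dw); exact: nearW.
  by have [-> _] := cvg_limn_einf_sup l.
apply: le_trans (fatou P1 mD1 _ _) _.
- by move=> n; apply: measurable_funTS; exact/measurable_EFinP.
- by move=> n w _; rewrite lee_fin.
have [<- _] := cvg_limn_einf_sup lc. by apply: limn_einf_mono => n.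
Qed.

End kac_comparison.

Lemma bounded_lists_enum (T : eqType) (Z : T -> Prop) (n : nat) :
  (forall s : seq T, uniq s -> (forall z, z \in s -> Z z) -> (size s <= n)%N) ->
  exists2 s : seq T, uniq s & forall z, z \in s <-> Z z.
Proof.
move=> hn; apply: contrapT => no. have H k : exists s : seq T, [/\ uniq s, (forall z, z \in s -> Z z) & size s = k].
  elim: k => [|k [s [us hs sk]]]; first by exists [::]. have [z [Zz zs]] : exists z, Z z /\ z \notin s.
    apply: contrapT => nz; apply: no; exists s => // z; split; first exact: hs. by move=> Zz; apply: contrapT => /negP zs; apply: nz; exists z.
  exists (z :: s); split => /=; [by rewrite zs| |by rewrite sk]. by move=> y; rewrite inE => /orP[/eqP ->|/hs].
by have [s [us hs sk]] := H n.+1; have := hn s us hs; rewrite sk ltnn.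
Qed.

Lemma integral_conull d (T : measurableType d) (R : realType)
    (P : probability T R) (G : set T) (F : T -> \bar R) : measurable G -> P (~` G) = 0%E ->
  (\int[P]_(w in G) F w = \int[P]_w F w)%E.
Proof.
move=> mG PG; rewrite integral_mkcond; apply: (integral_null (N := ~` G)) => //; first exact: measurableC. by move=> w /contrapT Gw; rewrite patchE mem_set.
Qed.

Lemma integral_prod_pair d (T : measurableType d) (R : realType)
    (P : probability T R) (u v : T -> \bar R) : mfun u -> mfun v ->
  (forall w, 0 <= u w)%E -> (forall w, 0 <= v w)%E ->
  (\int[(P \x P)%E]_w (u w.1 * v w.2) = \int[P]_w u w * \int[P]_w v w)%E.
Proof.
move=> mu mv u0 v0; pose H (w : T * T) := (u w.1 * v w.2)%E. have mH : mfun H.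
  apply: emeasurable_funM; first exact: measurableT_comp mu measurable_fst. exact: measurableT_comp mv measurable_snd.
have H0 z : (0 <= H z)%E by rewrite mule_ge0. rewrite [LHS](@fubini_tonelli1 _ _ T T R P P H mH H0).
under eq_integral do rewrite /fubini_F /H/= ge0_integralZl//. by rewrite ge0_integralZr// integral_ge0.
Qed.

(** * Measurable zero counts and control of the paths *)

Section zero_counts.
Context d (T : measurableType d) (R : realType)
  (P : probability T R) (X : nat -> T -> R) (a : nat -> nat -> R).
Hypothesis mX : forall j, mfun (X j).
Hypothesis hX : std_normal_sums P X.
Hypothesis ra : regular_array X a.
Local Notation f := (gfun X a).
Local Notation g := (gder X a).

Definition kac n s t w := kac_int (f w) (g w) n.+1%:R^-1 s t.

(* A measurable version of the number of zeros of the path in [s, t]. *)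
Definition zcount s t w : R := fine (limn_esup (fun n => (kac n s t w)%:E)).

Lemma measurable_kac n s t : mfun (kac n s t).
Proof.
apply: (measurable_kac_int P (f := fun z => f z.1 z.2) (g := fun z => g z.1 z.2)) => //.
- exact: measurable_gfun.
- exact: measurable_gder.
- by move=> w; exact: continuous_gfun.
- by move=> w; exact: continuous_gder.
Qed.

Lemma measurable_zcount s t : mfun (zcount s t).
Proof.
apply: (@measurableT_comp _ _ _ _ _ _ (@fine R)) => //. apply: measurable_fun_limn_esup => n; apply/measurable_EFinP; exact: measurable_kac.
Qed.

Lemma kac_ge0 n s t w : 0 <= kac n s t w.
Proof. by apply: Rintegral_ge0 => x _; rewrite mulr_ge0 ?cauchy_kernel_ge0. Qed.

Lemma zcount_ge0 s t w : 0 <= zcount s t w.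
Proof.
apply: fine_ge0; apply: le_trans (limn_einf_sup _). have [<- _] := cvg_limn_einf_sup (cvg_cst (0 : \bar R)).
by apply: limn_einf_mono => n; rewrite lee_fin kac_ge0.
Qed.

Lemma kac_cvg_zcount s t w (l : R) : kac n s t w @[n --> \oo] --> l -> zcount s t w = l.
Proof.
move=> h; have l' : (kac n s t w)%:E @[n --> \oo] --> l%:E by apply: cvg_EFin; [exact: nearW|exact: h]. by rewrite /zcount; have [_ ->] := cvg_limn_einf_sup l'.
Qed.

Variables V0 V1 : R.
Hypothesis hV0 : centered_normal P (coef X a 0) V0.
Hypothesis V0_gt0 : 0 < V0.
Hypothesis hV1 : centered_normal P (coef X a 1) V1.
Hypothesis V1_gt0 : 0 < V1.

Definition zeros_in (h : R -> R) (s t x : R) : Prop := s <= x <= t /\ h x = 0.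

(** The scale [l] is present because the comparison multiplies one of the fields by a constant; this
    changes the Kac integrals, but neither the zeros nor the bound [k]. *)
Record path_bound (r : R) (k : R) (w : T) : Prop := PathBound {
  path_bound_ge1 : 1 <= k;
  path_bound_kac : forall l h s t : R, 0 < l -> 0 < h -> - r <= s -> s < t -> t <= r ->
    kac_int (fun x => l * f w x) (fun x => l * g w x) h s t <= k;
  path_bound_cvg : forall s t : R, - r <= s -> s < t -> t <= r -> exists Z : seq R,
    [/\ uniq Z, forall x, x \in Z <-> zeros_in (f w) s t x, (size Z)%:R <= k &
      f w s != 0 -> f w t != 0 -> forall l : R, 0 < l ->
      kac_int (fun x => l * f w x) (fun x => l * g w x) n.+1%:R^-1 s t @[n --> \oo] --> ((size Z)%:R : R)] }.

Lemma gder_psum w x : g w x = psum (coef X (fun n j => n.+1%:R * a n.+1 j) ^~ w) x.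
Proof.
congr (psum _ x); apply/funext => n; rewrite /pseries_diffs /coef.
have ->: (fun J => block X (fun j => n.+1%:R * a n.+1 j) 0 J w) = (fun J => n.+1%:R * block X (a n.+1) 0 J w).
  by apply/funext => J; rewrite /block mulr_sumr; apply: eq_bigr => j _; rewrite mulrA.
symmetry; apply: cvg_lim => //; apply: cvgM; first exact: cvg_cst. exact: coef_cvg.
Qed.

(** The moment bound is applied to the path and to its derivative, which is again such a series,
    with constant coefficient [coef X a 1]. If they have nf and ng zeros, k = max(nf, ng + 1)
    controls the path, and (ng + 1)^m <= (2 ng)^m for positive ng explains the factor 2^m in [D]. *)
Lemma good_paths r m : 0 < r -> (0 < m)%N -> exists D : T -> \bar R,
  [/\ mfun D, forall w, (0 <= D w)%E, (\int[P]_w D w < +oo)%E &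
    forall w, (D w < +oo)%E -> exists2 k, path_bound r k w & ((k ^+ m)%:E <= D w)%E].
Proof.
move=> r0 m0; have [Df [mDf Df1 Dfi hf]] := zeros_moment mX hX ra m r0 hV0 V0_gt0. have rd := regular_array_diffs ra.
have hV1' : centered_normal P (coef X (fun n j => n.+1%:R * a n.+1 j) 0) V1.
  have -> : coef X (fun n j => n.+1%:R * a n.+1 j) 0 = coef X a 1; last exact: hV1. apply/funext => w; rewrite /coef; congr (limn _); apply/funext => J.
  by rewrite /block; apply: eq_bigr => j _; rewrite mul1r.
have [Dg [mDg Dg1 Dgi hg]] := zeros_moment mX hX rd m r0 hV1' V1_gt0. have Df0 w : (0 <= Df w)%E by apply: le_trans (Df1 w); rewrite lee_fin.
have Dg0 w : (0 <= Dg w)%E by apply: le_trans (Dg1 w); rewrite lee_fin. have p2 : (0 : R) <= 2 ^+ m by rewrite exprn_ge0.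
exists (fun w => Df w + (2 ^+ m)%:E * Dg w)%E; split.
- by apply: emeasurable_funD => //; exact: measurable_funeM.
- by move=> w; rewrite adde_ge0// mule_ge0.
- rewrite ge0_integralD//; last 2 first.
  + by move=> w _; rewrite mule_ge0.
  + exact: measurable_funeM.
  by rewrite lte_add_pinfty// ge0_integralZl//; exact: lte_mul_pinfty.
move=> w Dfin. have Dfw : Df w \is a fin_num.
  rewrite ge0_fin_numE//; apply: le_lt_trans Dfin; rewrite leeDl// mule_ge0//.
have Dgw : Dg w \is a fin_num.
  rewrite ge0_fin_numE//; apply: le_lt_trans Dfin; apply: (@le_trans _ _ ((2 ^+ m)%:E * Dg w)%E).
    by rewrite -[X in (X <= _)%E]mul1e; apply: lee_wpmul2r => //; rewrite lee_fin exprn_ege1// ler1n.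
  by rewrite leeDr.
have bound (h : R -> R) (D : \bar R) : D \is a fin_num ->
    (forall s : seq R, uniq s -> (forall z, z \in s -> `|z| <= r /\ h z = 0) -> (((size s)%:R ^+ m)%:E <= D)%E) ->
    exists2 n : nat, ((n%:R ^+ m)%:E <= D)%E & forall s : seq R, uniq s -> (forall z, z \in s -> `|z| <= r /\ h z = 0) -> (size s <= n)%N.
  move=> Df' hD; have [N hN] : exists N : nat, (fine D < N%:R)%R.
    exists (Num.bound `|fine D|); apply: (le_lt_trans (ler_norm _)); exact: archi_boundP.
  have [s us hs] : exists2 s : seq R, uniq s & forall z, z \in s <-> `|z| <= r /\ h z = 0.
    apply: (bounded_lists_enum (n := N)) => s us hs; rewrite leqNgt; apply/negP => Ns.
    have := hD s us hs; rewrite -(fineK Df') lee_fin leNgt => /negP; apply; apply: (lt_le_trans hN).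
    apply: (@le_trans _ _ (size s)%:R); first by rewrite ler_nat ltnW. by rewrite -natrX ler_nat -[X in (X <= _)%N]expn1 leq_pexp2l// (leq_trans _ Ns).
  exists (size s) => [|s' us' hs']; first by apply: hD => // z /hs. by apply: uniq_leq_size => // z /hs' hz; apply/hs.
have [nf hnf hfn] := bound (f w) (Df w) Dfw (hf w).
have [ng hng hgn] := bound (g w) (Dg w) Dgw (fun s us hs => hg w s us (fun z zs => ltac:(by rewrite -gder_psum; exact: hs))). pose k : R := (maxn nf ng.+1)%:R.
have zl (h : R -> R) (n : nat) s t : - r <= s -> t <= r -> (forall s : seq R, uniq s -> (forall z, z \in s -> `|z| <= r /\ h z = 0) -> (size s <= n)%N) ->
    exists2 Z : seq R, uniq Z /\ (size Z <= n)%N & forall z, z \in Z <-> zeros_in h s t z.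
  move=> sr tr hn. have hn' (l : seq R) : uniq l -> (forall z, z \in l -> zeros_in h s t z) -> (size l <= n)%N.
    move=> ul hl; apply: hn => // z /hl [/andP[sz zt] hz]; split => //. by rewrite ler_norml (le_trans sr sz) (le_trans zt tr).
  have [Z uZ hZ] := bounded_lists_enum hn'; exists Z => //; split => //; apply: hn' => // z /hZ. by [].
have dl l x : is_derive x (1 : R) (fun x => l * f w x) (l * g w x).
  exact: (@is_deriveZ _ _ _ (f w) l x 1 (g w x) (is_derive_gfun ra w x)).
have cl l : continuous (fun x => l * g w x).
  by move=> x; apply: cvgM; [exact: cvg_cst|exact: continuous_gder].
have k1 : 1 <= k by rewrite ler1n; apply: leq_trans (leq_maxr _ _). exists k; first split => //.
- move=> l h s t l0 h0 rs st tr; have [Zg [_ sZg] hZg] := zl (g w) ng s t rs tr hgn. apply: (le_trans (kac_bound (dl l) (cl l) (Zg := Zg) h0 st _)).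
    move=> x /andP[sx xt] /eqP; rewrite mulf_eq0 (gt_eqF l0)/= => /eqP gx. by apply/hZg; rewrite /zeros_in !ltW.
  by rewrite ler_nat; apply: leq_trans (leq_maxr _ _).
- move=> s t rs st tr; have [Zf [uZf sZf] hZf] := zl (f w) nf s t rs tr hfn. have [Zg [_ sZg] hZg] := zl (g w) ng s t rs tr hgn.
  exists Zf; split => //; first by rewrite ler_nat; apply: leq_trans (leq_maxl _ _). move=> fs ft l l0; have ln : l != 0 by rewrite gt_eqF.
  apply: (kac_cvg (dl l) (cl l) (Zg := Zg)) => //; rewrite ?mulf_neq0//.
    move=> x; apply/idP/andP => [/hZf[-> ->]|[sxt]]; first by rewrite mulr0. by rewrite mulf_eq0 (negbTE ln)/= => /eqP fx; apply/hZf.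
  move=> x /andP[sx xt] /eqP; rewrite mulf_eq0 (negbTE ln)/= => /eqP gx. by apply/hZg; rewrite /zeros_in !ltW.
apply: (@le_trans _ _ ((nf%:R ^+ m)%:E + (2 ^+ m)%:E * Dg w)%E); last by apply: leeD. have [nfg|ngf] := leqP ng.+1 nf.
  by rewrite /k (maxn_idPl nfg) leeDl// mule_ge0.
rewrite /k (maxn_idPr (ltnW ngf)); apply: (@le_trans _ _ ((2 ^+ m)%:E * Dg w)%E); last first.
  by rewrite leeDr// lee_fin exprn_ge0.
have [->|ng0] := posnP ng.
  rewrite expr1n; apply: (@le_trans _ _ (1 * Dg w)%E); first by rewrite mul1e. by apply: lee_wpmul2r => //; rewrite lee_fin exprn_ege1// ler1n.
apply: (@le_trans _ _ ((2 ^+ m)%:E * (ng%:R ^+ m)%:E)%E); last exact: lee_wpmul2l.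
by rewrite -EFinM lee_fin -exprMn -natrM lerXn2r ?nnegrE// ler_nat mul2n -addnn -addn1 leq_add2l.
Qed.

Hypothesis hV : forall x, exists2 V, centered_normal P (f ^~ x) V & 0 < V.

Lemma path_nonzero_ae x : measurable [set w | f w x = 0] /\ P [set w | f w x = 0] = 0%E.
Proof.
have [V nV V0'] := hV x; have [mL _ _] := nV. have mN : measurable [set w | f w x = 0].
  by rewrite -[X in measurable X]setTI; exact: (mL measurableT [set 0] (measurable_set1 _)).
split => //; apply/eqP; rewrite eq_le measure_ge0 andbT; apply/lee_addgt0Pr => e e0; rewrite add0e. have q0 : 0 < Num.sqrt V by rewrite sqrtr_gt0.
pose h := e * Num.sqrt V / 2; have h0 : 0 < h by rewrite divr_gt0// mulr_gt0. apply: (@le_trans _ _ (P [set w | `|f w x| <= h])).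
  apply: le_measure; rewrite ?inE//.
    rewrite (_ : [set w | _] = (f ^~ x) @^-1` `[- h, h]%classic); last first.
      by apply/seteqP; split => w /=; rewrite in_itv/= ler_norml.
    by rewrite -[X in measurable X]setTI; apply: mL => //; exact: measurable_itv.
  by move=> w /= ->; rewrite normr0 ltW.
apply: (le_trans (small_ball nV V0' h0)); rewrite lee_fin /h. have qn : Num.sqrt V != 0 by rewrite gt_eqF.
by rewrite (_ : _ / _ = e)//; move: (Num.sqrt V) qn => q qn; field.
Qed.

(** The null event left out of [G] gathers the paths with infinite [D] and those vanishing at one of
    the endpoints, where Kac's integral would count one half. *)
Lemma good_set (I : finType) (s t : I -> R) (r : R) m : 0 < r -> (0 < m)%N ->
  exists (D : T -> \bar R) (G : set T),
  [/\ mfun D, forall w, (0 <= D w)%E, (\int[P]_w D w < +oo)%E,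
    measurable G /\ P (~` G) = 0%E &
    forall w, G w -> (forall i, f w (s i) != 0 /\ f w (t i) != 0) /\
      exists2 k, path_bound r k w & ((k ^+ m)%:E <= D w)%E].
Proof.
move=> r0 m0; have [D [mD D0 Di hD]] := good_paths r0 m0. pose N x := [set w | f w x = 0].
pose B := [set w | D w = +oo%E] `|` \big[setU/set0]_i (N (s i) `|` N (t i)). have mB0 : measurable [set w | D w = +oo%E].
  by rewrite -[X in measurable X]setTI; exact: (mD measurableT [set +oo%E] (emeasurable_set1 _)).
have mN x : measurable (N x) := (path_nonzero_ae x).1. have mB1 : measurable (\big[setU/set0]_i (N (s i) `|` N (t i))).
  by apply: bigsetU_measurable => i _; apply: measurableU.
have mB : measurable B by exact: measurableU. exists D, (~` B); split => //; first split; first exact: measurableC.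
- rewrite setCK; apply: null_set_setU => //.
    suff : P.-negligible [set w | D w = +oo%E] by move/(negligibleP P mB0). have iD : P.-integrable setT D.
      by apply/integrableP; split => //; under eq_integral do rewrite gee0_abs//.
    have := integrable_ae measurableT iD; apply: negligibleS => w /= Dw; apply/not_implyP; split => //. by rewrite Dw.
  have h (l : seq I) : measurable (\big[setU/set0]_(i <- l) (N (s i) `|` N (t i))) /\ P (\big[setU/set0]_(i <- l) (N (s i) `|` N (t i))) = 0%E.
    elim: l => [|i l [IH1 IH2]]; first by rewrite big_nil measure0. have m1 : measurable (N (s i) `|` N (t i)) by exact: measurableU.
    rewrite big_cons; split; first exact: measurableU. by apply: null_set_setU => //; apply: null_set_setU => //; exact: (path_nonzero_ae _).2.
  exact: (h _).2.
- move=> w Bw; split.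
    move=> i; split; apply/negP => /eqP h; apply: Bw; right; rewrite -bigcup_seq; exists i => //=; rewrite ?mem_index_enum//; [by left|by right].
  by apply: hD; rewrite ltey; apply/eqP => h; apply: Bw; left.
Qed.

Lemma zcount_good r k w s t : path_bound r k w -> - r <= s -> s < t -> t <= r ->
  f w s != 0 -> f w t != 0 -> exists Z : seq R,
    [/\ uniq Z, forall x, x \in Z <-> zeros_in (f w) s t x, (size Z)%:R <= k,
      zcount s t w = (size Z)%:R & forall l : R, 0 < l ->
      kac_int (fun x => l * f w x) (fun x => l * g w x) n.+1%:R^-1 s t @[n --> \oo] --> zcount s t w].
Proof.
move=> pb rs st tr fs ft; have [Z [uZ hZ sZ hl]] := path_bound_cvg pb rs st tr. have {}hl := hl fs ft; have e : zcount s t w = (size Z)%:R.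
  apply: kac_cvg_zcount; have := hl 1 ltr01. have -> : (fun x => 1 * f w x) = f w by apply/funext => x; rewrite mul1r.
  by have -> : (fun x => 1 * g w x) = g w by apply/funext => x; rewrite mul1r.
by exists Z; split => //; rewrite e.
Qed.

(** * Decoupling of zero counts from near block-diagonal jets *)

Section clustering.
Variables (I : finType) (s t : I -> R) (r : R).
Hypothesis r0 : 0 < r.
Hypothesis hst : forall i, [/\ - r <= s i, s i < t i & t i <= r].

Definition jet (x : I -> R) (ib : I * bool) w := (if ib.2 then g else f) w (x ib.1).
Definition jet_cov x (i j : I * bool) := \int[P]_w (jet x i w * jet x j w).
Definition split_cov (S : {set I}) x (i j : I * bool) :=
  if (i.1 \in S) == (j.1 \in S) then jet_cov x i j else 0.

Lemma jet_normal (x : I -> R) (c : I * bool -> R) :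
  exists V, centered_normal P (fun w => \sum_i c i * jet x i w) V.
Proof.
pose v (ib : I * bool) : nat -> R := fun n => if ib.2 then n%:R * x ib.1 ^+ n.-1 else x ib.1 ^+ n. pose q := \sum_i `|x i|.
have xq i : `|x i| <= q by rewrite /q (bigD1 i)//= lerDl sumr_ge0. have q0 : 0 <= q by rewrite sumr_ge0. have hv ib : exp_bounded (v ib) 1 (2 * (q + 1)).
  by case: ib => i []; [exact: exp_bounded_dpow|exact: exp_bounded_pow].
have rho : 0 < 2 * (q + 1) by lra. have [V nV] := lin_normal mX hX ra (exp_bounded_comb c hv); exists V.
rewrite (_ : (fun w => _) = lin X a (fun n => \sum_i c i * v i n))//.
apply/funext => w; rewrite (lin_sum ra c _ (ltW rho) hv); apply: eq_bigr => -[i b] _; congr (_ * _). by case: b; rewrite /jet/= ?(gder_lin ra) ?gfun_lin.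
Qed.

Lemma jet_gaussian x : gaussian_vector P (jet x) (jet_cov x).
Proof. exact: centered_normal_gaussian (jet_normal x). Qed.

Lemma jet_covC x i j : jet_cov x i j = jet_cov x j i.
Proof. by apply: eq_Rintegral => w _; rewrite mulrC. Qed.

Lemma split_covC S x i j : split_cov S x i j = split_cov S x j i.
Proof. by rewrite /split_cov eq_sym jet_covC. Qed.

Lemma prod_split (S : {set I}) (A : Type) (u : I -> A -> R) (w1 w2 : A) :
  \prod_i u i (if i \in S then w1 else w2) = (\prod_(i in S) u i w1) * \prod_(i in ~: S) u i w2.
Proof.
rewrite (bigID (fun i => i \in S))/=; congr (_ * _); first by apply: eq_bigr => i ->.
rewrite (eq_bigl (fun i => i \in ~: S)) => [|i]; last by rewrite finset.in_setC. by apply: eq_bigr => i; rewrite finset.in_setC => /negbTE ->.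
Qed.

Lemma joint_block (S : {set I}) (u : I -> T -> R) : (forall i, mfun (u i)) -> (forall i w, 0 <= u i w) ->
  (\int[(P \x P)%E]_w (\prod_i u i (if i \in S then w.1 else w.2))%:E =
   \int[P]_w (\prod_(i in S) u i w)%:E * \int[P]_w (\prod_(i in ~: S) u i w)%:E)%E.
Proof.
move=> mu u0. have mp (A : {set I}) : mfun (fun w => (\prod_(i in A) u i w)%:E).
  by apply/measurable_EFinP; under eq_fun do rewrite big_mkcond; apply: measurable_prod => i _; case: (i \in A).
have p0 (A : {set I}) w : (0 <= (\prod_(i in A) u i w)%:E)%E by rewrite lee_fin prodr_ge0.
by under eq_integral do rewrite prod_split EFinM; exact: (integral_prod_pair P (mp S) (mp (~: S)) (p0 S) (p0 (~: S))).
Qed.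

(** The hypothesis places the joint form between 1 - e and 1 + e times the block-diagonal one.
    Rescaling the independent copies by sqrt(1 + e), respectively sqrt(1 - e), gives two one-sided
    comparisons with ratio L = (1 + e)/(1 - e), and zero counts ignore the rescaling. With two jet
    components per point the factor sqrt L appears 2 [#|I|] times. *)
Lemma kac_comparison_cluster (S : {set I}) (e : R) : 0 < e -> e <= 1 / 2 ->
  (forall x, (forall i, s i <= x i <= t i) -> forall c,
     `|qform (jet_cov x) c - qform (split_cov S x) c| <= e * qform (split_cov S x) c) ->
  let E1 := (\int[P]_w (\prod_i zcount (s i) (t i) w)%:E)%E in
  let E2 := (\int[P]_w (\prod_(i in S) zcount (s i) (t i) w)%:E *
             \int[P]_w (\prod_(i in ~: S) zcount (s i) (t i) w)%:E)%E in
  (E1 <= (((1 + e) / (1 - e)) ^+ #|I|)%:E * E2)%E /\ (E2 <= (((1 + e) / (1 - e)) ^+ #|I|)%:E * E1)%E.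
Proof.
(* The exponent [#|I|.+1] is positive even when [I] is empty. *)
move=> e0 e1 hq E1 E2. have [D [G [mD D0 Di [mG PG] hG]]] := @good_set I s t r #|I|.+1 r0 (ltn0Sn _). pose L := (1 + e) / (1 - e); have e1' : 0 < 1 - e by lra.
have L1 : 1 < L by rewrite ltr_pdivlMr// mul1r; lra. have LE : Num.sqrt L ^+ #|{: I * bool}| = L ^+ #|I|.
  by rewrite card_prod card_bool mulnC exprM sqr_sqrtr// ltW// (lt_trans _ L1).
pose pick (i : I) (w : T * T) := if i \in S then w.1 else w.2. pose F1 l (i : I) (z : T * mR R) := l * f z.1 z.2.
pose G1 l (i : I) (z : T * mR R) := l * g z.1 z.2. pose F2 l (i : I) (z : (T * T) * mR R) := l * f (pick i z.1) z.2.
pose G2 l (i : I) (z : (T * T) * mR R) := l * g (pick i z.1) z.2.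
have mpick i : mfun (pick i) by rewrite /pick; case: (i \in S); [exact: measurable_fst|exact: measurable_snd].
have mpick2 i : mfun (fun z : (T * T) * mR R => (pick i z.1, z.2)).
  apply/measurable_fun_pairP; split => /=; last exact: measurable_snd. exact: measurableT_comp (mpick i) measurable_fst.
have mF1 l i : mfun (F1 l i) by apply: measurable_funM => //; exact: measurable_gfun.
have mG1 l i : mfun (G1 l i) by apply: measurable_funM => //; exact: measurable_gder. have mF2 l i : mfun (F2 l i).
  by apply: measurable_funM => //; exact: (measurableT_comp (measurable_gfun mX ra) (mpick2 i)).
have mG2 l i : mfun (G2 l i).
  by apply: measurable_funM => //; exact: (measurableT_comp (measurable_gder mX ra) (mpick2 i)).
have cf l w : continuous (fun x => l * f w x) by move=> x; apply: cvgM; [exact: cvg_cst|exact: continuous_gfun].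
have cg l w : continuous (fun x => l * g w x) by move=> x; apply: cvgM; [exact: cvg_cst|exact: continuous_gder].
have st i : s i <= t i by have [_ /ltW] := hst i. pose GG := G `*` G. have mGG : measurable GG by exact: measurableX. have PGG : (P \x P)%E (~` GG) = 0%E.
  have mC : measurable (~` G) by exact: measurableC. have h1 : (P \x P)%E (~` G `*` setT) = 0%E by rewrite [LHS]product_measure1E// [X in (X * _)%E]PG mul0e.
  have h2 : (P \x P)%E (setT `*` ~` G) = 0%E by rewrite [LHS]product_measure1E// [X in (_ * X)%E]PG mule0.
  apply: (@subset_measure0 _ _ _ (P \x P)%E _ ((~` G `*` setT) `|` (setT `*` ~` G))).
  - exact: measurableC.
  - by apply: measurableU; exact: measurableX.
  - by move=> [w1 w2] /= /not_andP[h|h]; [left|right].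
  - by apply: null_set_setU => //; exact: measurableX.
have lim l i w : 0 < l -> G w -> kac_int (fun x => l * f w x) (fun x => l * g w x) n.+1%:R^-1 (s i) (t i) @[n --> \oo] --> zcount (s i) (t i) w.
  move=> l0 /hG[hst0 [k pb _]]; have [h1 h2 h3] := hst i; have [n1 n2] := hst0 i. by have [Z [_ _ _ _]] := zcount_good pb h1 h2 h3 n1 n2; exact.
have bd l n w : 0 < l -> G w -> exists2 k, 1 <= k /\ ((k ^+ #|I|.+1)%:E <= D w)%E &
    forall i, 0 <= kac_int (fun x => l * f w x) (fun x => l * g w x) n.+1%:R^-1 (s i) (t i) <= k.
  move=> l0 /hG[hst0 [k pb kD]]; exists k; first by split => //; exact: path_bound_ge1 pb.
  move=> i; have [h1 h2 h3] := hst i; rewrite (path_bound_kac pb)// andbT. by apply: Rintegral_ge0 => x _; rewrite mulr_ge0 ?cauchy_kernel_ge0.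
have bprod (A : {set I}) (u : I -> R) k : 1 <= k -> (forall i, 0 <= u i <= k) -> \prod_(i in A) u i <= k ^+ #|I|.+1.
  move=> k1 hu; apply: (@le_trans _ _ (\prod_(i in A) k)); first by apply: ler_prod => i _. rewrite prodr_const; apply: ler_weXn2l => //.
  by apply: leqW; exact: max_card.
have g1 l x : gaussian_vector P (fun (ib : I * bool) w => (if ib.2 then G1 l else F1 l) ib.1 (w, x ib.1)) (fun i j => l ^+ 2 * jet_cov x i j).
  rewrite (_ : (fun ib w => _) = fun ib w => l * jet x ib w); first exact/gaussian_vector_scale/jet_gaussian. by apply/funext => -[i []].
have g2 l x : gaussian_vector (P \x P)%E (fun (ib : I * bool) w => (if ib.2 then G2 l else F2 l) ib.1 (w, x ib.1)) (fun i j => l ^+ 2 * split_cov S x i j).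
  rewrite (_ : (fun ib w => _) = fun ib w => l * (if ib.1 \in S then jet x ib w.1 else jet x ib w.2)).
    apply: gaussian_vector_scale. exact: (gaussian_vector_copies (fun ib : I * bool => ib.1 \in S) (jet_gaussian x)).
  by apply/funext => -[i []]; apply/funext => w; rewrite /jet /F2 /G2 /pick /=; case: (i \in S).
have E2E : E2 = (\int[(P \x P)%E]_(w in GG) (\prod_i zcount (s i) (t i) (pick i w))%:E)%E.
  rewrite integral_conull// /E2 -joint_block => //; first by move=> i; exact: measurable_zcount. by move=> i w; exact: zcount_ge0.
have E1E : E1 = (\int[P]_(w in G) (\prod_i zcount (s i) (t i) w)%:E)%E by rewrite integral_conull.
have fieldG l : 0 < l -> kac_field P (F1 l) (G1 l) s t G (fun i => zcount (s i) (t i)).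
  by move=> l0; split => //; [split => i w; [exact: cf|exact: cg]|move=> i w; exact: lim].
have fieldGG l : 0 < l -> kac_field (P \x P)%E (F2 l) (G2 l) s t GG (fun i w => zcount (s i) (t i) (pick i w)).
  move=> l0; split => //; first by split => i w; [exact: (cf l (pick i w))|exact: (cg l (pick i w))].
  by move=> i w [G1w G2w]; apply: (lim l i (pick i w)) => //; rewrite /pick; case: (i \in S).
have [l1 q1 s1] : exists2 l : R, 0 < l & l ^+ 2 = 1 + e.
  by exists (Num.sqrt (1 + e)); rewrite ?sqrtr_gt0 ?sqr_sqrtr//; lra.
have [l2 q2 s2] : exists2 l : R, 0 < l & l ^+ 2 = 1 - e.
  by exists (Num.sqrt (1 - e)); rewrite ?sqrtr_gt0 ?sqr_sqrtr//; lra.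
have LE1 : L * (1 - e) = 1 + e by rewrite /L divfK// gt_eqF. rewrite -LE E2E E1E; split.
- apply: (kac_comparison mX hX L1 (fieldG 1 ltr01) (fieldGG l1 q1) (H := fun w => (D w.1 * D w.2)%E)) => //.
  + move=> x hx; exists (fun i j => 1 ^+ 2 * jet_cov x i j), (fun i j => l1 ^+ 2 * split_cov S x i j). split => //; split.
    * by move=> i j; rewrite jet_covC.
    * by move=> i j; rewrite split_covC.
    * by move=> c; rewrite !qform_scale s1 expr1n mul1r; have := hq x hx c; rewrite ler_norml => /andP[_]; lra.
    * move=> c; rewrite !qform_scale s1 expr1n mul1r -LE1 -mulrA ler_pM2l ?(lt_trans _ L1)//. by have := hq x hx c; rewrite ler_norml => /andP[+ _]; lra.
  + apply: emeasurable_funM.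
      exact: measurableT_comp mD measurable_fst.
    exact: measurableT_comp mD measurable_snd.
  + by move=> w; rewrite mule_ge0.
  + rewrite (integral_prod_pair P mD mD D0 D0); apply: lte_mul_pinfty => //.
      exact: integral_ge0.
    by rewrite ge0_fin_numE// integral_ge0.
  + move=> n w [G1w G2w]. have [k1 [k11 kD1] hk1] := bd _ n w.1 q1 G1w; have [k2 [k21 kD2] hk2] := bd _ n w.2 q1 G2w.
    pose K i v := kac_int (fun x => l1 * f v x) (fun x => l1 * g v x) n.+1%:R^-1 (s i) (t i).
    rewrite -[X in X%:E]/(\prod_i K i (if i \in S then w.1 else w.2)) (prod_split S K) EFinM. apply: lee_pmul => //; rewrite ?lee_fin ?prodr_ge0//.
    + by move=> i _; have /andP[] := hk1 i.
    + by move=> i _; have /andP[] := hk2 i.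
    + by apply: le_trans kD1; rewrite lee_fin; exact: bprod k11 hk1.
    + by apply: le_trans kD2; rewrite lee_fin; exact: bprod k21 hk2.
- apply: (kac_comparison mX hX L1 (fieldGG l2 q2) (fieldG 1 ltr01) (H := D)) => //.
  + move=> x hx; exists (fun i j => l2 ^+ 2 * split_cov S x i j), (fun i j => 1 ^+ 2 * jet_cov x i j). split => //; split.
    * by move=> i j; rewrite split_covC.
    * by move=> i j; rewrite jet_covC.
    * by move=> c; rewrite !qform_scale s2 expr1n mul1r; have := hq x hx c; rewrite ler_norml => /andP[+ _]; lra.
    * move=> c; rewrite !qform_scale s2 expr1n mul1r mulrA LE1. by have := hq x hx c; rewrite ler_norml => /andP[_]; lra.
  + move=> n w Gw; have [k [k1 kD] hk] := bd _ n w ltr01 Gw; apply: le_trans kD; rewrite lee_fin.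
    have := bprod finset.setT _ k k1 hk; rewrite (eq_bigl xpredT)// => i; exact: finset.in_setT.
Qed.

End clustering.
End zero_counts.

(** * Void events as limits of products of kernels *)

Section void_probability.
Variable R : realType.

(** Over a grid of mesh of order n^-4, the product of these kernels tends to the indicator that the
    path has no zero. Without zeros, about n^4 factors at distance O(n^-6) from 1 have product
    tending to 1. Near a zero some grid value is O(n^-4), and its square divided by n^-6 is O(n^-2).
    The exponent 6 lies strictly between 4 and 8 for these two reasons. *)
Definition void_kernel (n : nat) (y : R) := y ^+ 2 / (n.+1%:R^-1 ^+ 6 + y ^+ 2).

Definition void_grid (u v : R) (n j : nat) : R := u + (v - u) * (j%:R / n.+1%:R ^+ 4).

Definition void_prod (F : R -> R) (u v : R) (n : nat) : R :=
  \prod_(j < (n.+1 ^ 4).+1) void_kernel n (F (void_grid u v n j)).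

Lemma void_kernel_den (n : nat) (y : R) : 0 < n.+1%:R^-1 ^+ 6 + y ^+ 2.
Proof. by rewrite ltr_pwDl ?sqr_ge0// exprn_gt0// invr_gt0. Qed.

Lemma void_kernel_bounds n y : 0 <= void_kernel n y <= 1.
Proof.
have d0 := void_kernel_den n y; rewrite /void_kernel divr_ge0 ?sqr_ge0 ?(ltW d0)//=. by rewrite ler_pdivrMr// mul1r lerDr exprn_ge0.
Qed.

Lemma void_kernelE n y : void_kernel n y = 1 - n.+1%:R^-1 ^+ 6 / (n.+1%:R^-1 ^+ 6 + y ^+ 2).
Proof.
rewrite /void_kernel; have d0 := void_kernel_den n y. move: (n.+1%:R^-1 ^+ 6) d0 => a d0; field; exact: lt0r_neq0.
Qed.

Lemma prod_ge_1Bsum (N : nat) (b : nat -> R) (e : R) : 0 <= e ->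
  (forall j, (j < N)%N -> 0 <= b j /\ 1 - e <= b j <= 1) ->
  1 - N%:R * e <= \prod_(j < N) b j <= 1.
Proof.
move=> e0; elim: N => [|N IH] hb; first by rewrite big_ord0; lra. have /andP[l u] := IH (fun j jN => hb j (ltnW jN)).
rewrite big_ord_recr/=; set p := \prod_(_ < _) _ in l u *. have p0 : 0 <= p by apply: prodr_ge0 => j _; have [] := hb j (ltnW (ltn_ord j)).
have [b1 /andP[bl bu]] := hb N (ltnSn N); apply/andP; split; last by rewrite mulr_ile1. apply: (@le_trans _ _ (p - e)); first by rewrite -natr1; lra.
have : 0 <= (1 - p) * e by rewrite mulr_ge0// subr_ge0. have : 0 <= p * (b N - (1 - e)) by rewrite mulr_ge0// subr_ge0. lra.
Qed.

Lemma void_grid_in (u v : R) n j : u < v -> (j <= n.+1 ^ 4)%N -> u <= void_grid u v n j <= v.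
Proof.
move=> uv jn; have h : (0 : R) <= (j%:R / n.+1%:R ^+ 4 : R) <= 1.
  by rewrite divr_ge0//= ler_pdivrMr ?exprn_gt0// mul1r -natrX ler_nat.
have /andP[h1 h2] := h; rewrite /void_grid; move: (_ / _) h1 h2 => y h1 h2 {h}. have : 0 <= (v - u) * y by rewrite mulr_ge0//; lra.
have : 0 <= (v - u) * (1 - y) by rewrite mulr_ge0//; lra. lra.
Qed.

Lemma void_grid_near (u v z : R) n : u < v -> u <= z <= v ->
  exists2 j, (j <= n.+1 ^ 4)%N & `|void_grid u v n j - z| <= (v - u) / n.+1%:R ^+ 4.
Proof.
move=> uv /andP[uz zv]; have N0 : (0 : R) < n.+1%:R ^+ 4 by rewrite exprn_gt0. pose y := (z - u) / (v - u) * n.+1%:R ^+ 4. have vu : 0 < v - u by lra.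
have y0 : 0 <= y by rewrite !mulr_ge0 ?invr_ge0 ?(ltW vu) ?(ltW N0)//; lra. have /andP[h1 h2] := Num.Theory.truncn_itv y0; set j := Num.truncn y in h1 h2.
exists j.
  rewrite -(ler_nat R) natrX; apply: (le_trans h1); rewrite -[leRHS]mul1r ler_pM2r//. by rewrite ler_pdivrMr// mul1r; lra.
have e : z = u + (v - u) * (y / n.+1%:R ^+ 4).
  by rewrite /y mulfK ?gt_eqF// mulrCA divff ?gt_eqF// mulr1; lra.
rewrite /void_grid [X in _ - X]e (_ : _ - _ = - ((v - u) * ((y - j%:R) / n.+1%:R ^+ 4))); last by ring.
rewrite normrN normrM (gtr0_norm vu) ler_pM2l// normrM (@gtr0_norm _ (_ ^-1)) ?invr_gt0//. rewrite -[leRHS]mul1r ler_pM2r ?invr_gt0// ger0_norm; last by lra.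
by move: h2; rewrite -addn1 natrD; lra.
Qed.

Variables (F G s : R -> R) (u v c C : R).
Hypothesis uv : u < v.
Hypothesis dF : forall x : R, is_derive x (1 : R) F (G x).
Hypothesis cG : continuous G.
Hypothesis c0 : 0 < c.
Hypothesis hs : forall x, u <= x <= v -> c <= s x <= C.

Lemma cvg_harmonic_sqz (w : nat -> R) (l K : R) : (forall n, `|w n - l| <= K / n.+1%:R) ->
  w n @[n --> \oo] --> l.
Proof.
move=> h; have k : K * n.+1%:R^-1 @[n --> \oo] --> (0 : R).
  by rewrite -[X in _ --> X](mulr0 K); apply: cvgM; [exact: cvg_cst|exact: cvg_harmonic].
apply/subr_cvg0; apply: (@squeeze_cvgr _ _ _ _ (fun n => - (K * n.+1%:R^-1)) (fun n => K * n.+1%:R^-1)) => //.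
  by apply: nearW => n; rewrite -ler_norml.
by rewrite -oppr0; exact: cvgN.
Qed.

Lemma void_cvg1 : (forall z, u <= z <= v -> F z != 0) ->
  void_prod (fun x => s x * F x) u v n @[n --> \oo] --> (1 : R).
Proof.
move=> F0; have cF : continuous F := is_derive_continuous dF.
have [z zuv hz] := @EVT_min R (fun x => `|F x|) u v (ltW uv) (continuous_subspaceT (fun x => cvg_norm (cF x))).
have mz : 0 < `|F z| by rewrite normr_gt0; apply: F0; move: zuv; rewrite in_itv. pose m := c * `|F z|; have m0 : 0 < m by rewrite mulr_gt0.
apply: (@cvg_harmonic_sqz _ _ (2 / m ^+ 2)) => n. have gridm j : (j <= n.+1 ^ 4)%N -> m <= `|s (void_grid u v n j) * F (void_grid u v n j)|.
  move=> jn; have q := void_grid_in uv jn; rewrite normrM; apply: ler_pM => //; first exact: ltW.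
    have /andP[h _] := hs q; exact: le_trans h (ler_norm _).
  by apply: hz; rewrite in_itv.
pose e : R := n.+1%:R^-1 ^+ 6 / m ^+ 2. have e0 : 0 <= e by rewrite divr_ge0 ?exprn_ge0 ?invr_ge0 ?(ltW m0).
have /andP[h1 h2] : 1 - (n.+1 ^ 4).+1%:R * e <= void_prod (fun x => s x * F x) u v n <= 1.
  apply: (prod_ge_1Bsum (b := fun j => void_kernel n (s (void_grid u v n j) * F (void_grid u v n j)))) => // j jN.
  have /andP[k0 k1] := void_kernel_bounds n (s (void_grid u v n j) * F (void_grid u v n j)).
  split => //; rewrite k1 andbT void_kernelE lerB// /e ler_wpM2l ?exprn_ge0 ?invr_ge0//. rewrite lef_pV2 ?posrE ?void_kernel_den ?exprn_gt0//.
  have q := gridm j jN; apply: (@le_trans _ _ (`|s (void_grid u v n j) * F (void_grid u v n j)| ^+ 2)).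
    by rewrite lerXn2r ?nnegrE// ltW.
  by rewrite real_normK ?num_real// lerDr exprn_ge0// invr_ge0.
rewrite ler_norml; apply/andP; split; last by apply: (@le_trans _ _ 0); [lra|rewrite !divr_ge0// exprn_ge0// ltW].
suff hN : (n.+1 ^ 4).+1%:R * e <= 2 / m ^+ 2 / n.+1%:R.
  by rewrite lerBrDr addrC; apply: le_trans h1; rewrite lerB.
have n0 : (1 : R) <= n.+1%:R by rewrite ler1n. rewrite /e -natr1 natrX; move: (n.+1%:R : R) n0 => N N1; have N0 : 0 < N by lra.
have -> : (N ^+ 4 + 1) * (N^-1 ^+ 6 / m ^+ 2) = (N ^+ 4 + 1) / N ^+ 6 / m ^+ 2.
  by rewrite exprVn mulrA.
rewrite -[leRHS]mulrA [_ * N^-1]mulrC mulrA ler_wpM2r ?invr_ge0 ?exprn_ge0 ?(ltW m0)//.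
rewrite ler_pdivrMr ?exprn_gt0// (_ : 2 / N * N ^+ 6 = 2 * N ^+ 5); last by field; rewrite gt_eqF. have : 1 <= N ^+ 5 by exact: exprn_ege1.
have : N ^+ 4 <= N ^+ 5 by apply: ler_weXn2l. lra.
Qed.

Lemma void_cvg0 z : u <= z <= v -> F z = 0 ->
  void_prod (fun x => s x * F x) u v n @[n --> \oo] --> (0 : R).
Proof.
move=> zuv Fz. have [y yuv hy] := @EVT_max R (fun x => `|G x|) u v (ltW uv) (continuous_subspaceT (fun x => cvg_norm (@cG x))).
have C0 : 0 <= C by have /andP[a b] := hs zuv; apply: le_trans b; apply: le_trans a; exact: ltW. pose M := C * (`|G y| * (v - u)).
have M0 : 0 <= M by rewrite !mulr_ge0// subr_ge0 ltW. apply: (@cvg_harmonic_sqz _ _ (M ^+ 2)) => n; rewrite subr0. have [j jn hj] := void_grid_near n uv zuv.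
set q := void_grid u v n j in hj; have quv : u <= q <= v := void_grid_in uv jn. have lip : `|F q| <= `|G y| * `|q - z|.
  have mvt a b : u <= a -> a <= b -> b <= v -> `|F b - F a| <= `|G y| * `|b - a|.
    move=> ua ab bv; have [w wab ->] := @MVT_segment R F G a b ab (fun x _ => dF x) (continuous_subspaceT (is_derive_continuous dF)).
    rewrite normrM ler_wpM2r//; apply: hy; move: wab; rewrite !in_itv/= => /andP[aw wb]. by rewrite (le_trans ua aw) (le_trans wb bv).
  have /andP[uq qv] := quv; have /andP[uz zv] := zuv. have [qz|/ltW zq] := leP q z; last by have := mvt z q uz zq qv; rewrite Fz subr0.
  by have := mvt q z uq qz zv; rewrite Fz sub0r normrN distrC.
have n0 : (1 : R) <= n.+1%:R by rewrite ler1n. have ylt : `|s q * F q| <= M / n.+1%:R ^+ 4.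
  rewrite normrM /M -!mulrA; apply: ler_pM => //.
    by have /andP[a b] := hs quv; rewrite ger0_norm// (le_trans _ a)// ltW.
  by apply: (le_trans lip); rewrite ler_wpM2l.
have p0 : 0 <= void_prod (fun x => s x * F x) u v n.
  by apply: prodr_ge0 => i _; have /andP[] := void_kernel_bounds n (s (void_grid u v n i) * F (void_grid u v n i)).
rewrite ger0_norm//; have jn' : (j < (n.+1 ^ 4).+1)%N by rewrite ltnS. apply: (@le_trans _ _ (void_kernel n (s q * F q))).
  rewrite /void_prod (bigD1 (Ordinal jn'))//= -[leRHS]mulr1 ler_wpM2l//.
    by have /andP[] := void_kernel_bounds n (s q * F q).
  by apply: prodr_ile1 => i _; exact: void_kernel_bounds.
have e0 : (0 : R) < n.+1%:R^-1 ^+ 6 by rewrite exprn_gt0// invr_gt0. apply: (@le_trans _ _ ((M / n.+1%:R ^+ 4) ^+ 2 / n.+1%:R^-1 ^+ 6)).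
  apply: (@le_trans _ _ ((s q * F q) ^+ 2 / n.+1%:R^-1 ^+ 6)).
    rewrite /void_kernel ler_wpM2l ?sqr_ge0// lef_pV2 ?posrE ?void_kernel_den//. by rewrite lerDl sqr_ge0.
  rewrite ler_pM2r ?invr_gt0// -[X in X <= _]real_normK ?num_real// lerXn2r ?nnegrE//. by rewrite divr_ge0// exprn_ge0.
move: (n.+1%:R : R) n0 => N N1; have N0 : 0 < N by lra. rewrite (_ : _ / _ = M ^+ 2 / N / N); last by field; rewrite gt_eqF.
rewrite ler_pdivrMr// -[leLHS]mulr1 ler_wpM2l// divr_ge0 ?sqr_ge0// ltW//.
Qed.

End void_probability.

Lemma admissible_void_kernel (R : realType) n : admissible (void_kernel n : R -> R).
Proof.
split; first by move=> x; have /andP[] := void_kernel_bounds n x. move=> d1 d2 T1 T2 P1 P2 I X Y mX mY i.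
have h0 : (0 : R) < n.+1%:R^-1 ^+ 3 by rewrite exprn_gt0// invr_gt0. have -> : void_kernel n = (fun x : R => 1 + (-1) * (1 + (x / n.+1%:R^-1 ^+ 3) ^+ 2)^-1).
  apply/funext => x; rewrite void_kernelE; have := void_kernel_den n x. rewrite (_ : n.+1%:R^-1 ^+ 6 = (n.+1%:R^-1 ^+ 3) ^+ 2); last by rewrite -exprM.
  move: (n.+1%:R^-1 ^+ 3) h0 => h h0 hx. have -> : 1 + (x / h) ^+ 2 = (h ^+ 2 + x ^+ 2) / h ^+ 2 by field; rewrite gt_eqF. by rewrite invf_div mulN1r.
apply: transferableD => //; first exact: transferable_cst. by apply: transferableM => //; [exact: transferable_cst|exact: transferable_cauchy].
Qed.

(** * Counting zeros by cells *)

Section cells.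
Context (R : realType).

Definition hit (F : R -> R) (u v : R) : R := `[< exists z, u <= z <= v /\ F z = 0 >]%:R.

Definition cell (u v : R) (n l : nat) : R := u + (v - u) * (l%:R / n.+1%:R).

(** Cells containing a zero are counted instead of zeros: this is a finite sum of bounded
    functionals, each of them a limit of products of kernels, so it can be transferred between
    laws. *)
Definition cell_count (F : R -> R) (u v : R) (n : nat) : R :=
  \sum_(l < n.+1) hit F (cell u v n l) (cell u v n l.+1).

Lemma list_lower_bound (E : eqType) (h : E -> R) (s : seq E) : (forall z, z \in s -> 0 < h z) ->
  exists2 g, 0 < g & forall z, z \in s -> g <= h z.
Proof.
elim: s => [|z s IH] hs; first by exists 1. have [g g0 hg] := IH (fun y ys => hs y (mem_behead (s := z :: s) ys)).
exists (Num.min g (h z)); first by rewrite lt_min g0 hs ?mem_head. move=> y; rewrite inE => /predU1P[->|/hg]; first by rewrite ge_min lexx orbT.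
by move=> gy; rewrite ge_min gy.
Qed.

Variables (F : R -> R) (u v : R) (Z : seq R).
Hypothesis uv : u < v.
Hypothesis uZ : uniq Z.
Hypothesis hZ : forall z, z \in Z <-> u <= z <= v /\ F z = 0.
Hypothesis F_cell : forall n l, (l <= n.+1)%N -> F (cell u v n l) != 0.

Let index n z := Num.truncn ((z - u) / (v - u) * n.+1%:R).

Let vu : 0 < v - u. Proof. by rewrite subr_gt0. Qed.

Let n0 (n : nat) : (0 : R) < n.+1%:R. Proof. by []. Qed.

Let cell_le n l z : (cell u v n l <= z) = (l%:R <= (z - u) / (v - u) * n.+1%:R).
Proof.
by rewrite /cell -lerBrDl [(v - u) * _]mulrC -ler_pdivlMr// ler_pdivrMr.
Qed.

Let le_cell n l z : (z <= cell u v n l) = ((z - u) / (v - u) * n.+1%:R <= l%:R).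
Proof.
by rewrite /cell -lerBlDl [(v - u) * _]mulrC -ler_pdivrMr// ler_pdivlMr.
Qed.

Let cellN n : cell u v n n.+1 = v.
Proof. by rewrite /cell divff// mulr1 addrC subrK. Qed.

Let ratio_ge0 n z : u <= z -> 0 <= (z - u) / (v - u) * n.+1%:R.
Proof. by move=> uz; rewrite mulr_ge0// divr_ge0 ?subr_ge0// ltW. Qed.

Lemma hit_cellE n l : (l < n.+1)%N -> hit F (cell u v n l) (cell u v n l.+1) = (l \in map (index n) Z)%:R.
Proof.
move=> ln; congr (_%:R); congr nat_of_bool; apply/asboolP/mapP => [[z [/andP[lz zl] Fz]]|[z zZ ->]].
  have uz : u <= z.
    apply: le_trans lz; rewrite /cell lerDl mulr_ge0 ?(ltW vu)// divr_ge0//.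
  have zv : z <= v.
    apply: (le_trans zl); rewrite -[leRHS](cellN n) /cell lerD2l ler_pM2l// ler_pM2r ?invr_gt0// ler_nat; exact: ln.
  exists z; first by apply/hZ; rewrite uz zv. have {}zl : z < cell u v n l.+1.
    by rewrite lt_neqAle zl andbT; apply: contraNneq (F_cell (l := l.+1) ln) => <-; apply/eqP.
  symmetry; apply/eqP; rewrite /index truncn_eq ?ratio_ge0// -cell_le lz /=. by rewrite ltNge -cell_le -ltNge.
have [/andP[uz zv] Fz] := (hZ z).1 zZ; exists z; split => //. have /andP[h1 h2] := truncn_itv (ratio_ge0 n uz). by rewrite cell_le le_cell h1 ltW.
Qed.

Lemma index_lt n z : z \in Z -> (index n z < n.+1)%N.
Proof.
move=> /hZ[/andP[uz zv] Fz]. have {}zv : z < v.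
  by rewrite lt_neqAle zv andbT; apply: contraNneq (F_cell (leqnn n.+1)); rewrite cellN => <-; apply/eqP.
have /andP[h1 _] := truncn_itv (ratio_ge0 n uz). rewrite -(ltr_nat R); apply: (le_lt_trans h1). by rewrite -[ltRHS]mul1r ltr_pM2r// ltr_pdivrMr// mul1r ltrD2r.
Qed.

(** Truncation reads off the cell of a zero, and this cell is unique because no zero sits on a cell
    boundary; the count is the number of distinct indices. *)
Lemma cell_countE n : cell_count F u v n = (size (undup (map (index n) Z)))%:R.
Proof.
rewrite /cell_count (eq_bigr (fun l : 'I_n.+1 => (val l \in map (index n) Z)%:R)); last first.
  by move=> l _; exact: hit_cellE.
rewrite -natr_sum; congr (_%:R); set s := map _ _. rewrite -(big_mkord xpredT (fun l => (l \in s) : nat)).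
have -> : (\sum_(0 <= l < n.+1) (l \in s) = count (mem s) (index_iota 0 n.+1))%N.
  by elim: (index_iota 0 n.+1) => [|l r IH]; [rewrite big_nil|rewrite big_cons IH].
rewrite -size_filter; apply: perm_size; apply: uniq_perm; first by rewrite filter_uniq// iota_uniq.
  exact: undup_uniq.
move=> l; rewrite mem_filter mem_undup mem_index_iota/=; case: (boolP (l \in s)) => //= /mapP[z zZ ->]. exact: index_lt.
Qed.

Lemma cell_count_le n : 0 <= cell_count F u v n <= (size Z)%:R.
Proof. by rewrite cell_countE ler0n ler_nat (leq_trans (size_undup _))// size_map. Qed.

Lemma cell_count_cvg : cell_count F u v n @[n --> \oo] --> ((size Z)%:R : R).
Proof.
have dpos (p : R * R) : p \in [seq p <- allpairs pair Z Z | p.1 != p.2] -> 0 < `|p.1 - p.2|.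
  by rewrite mem_filter => /andP[h _]; rewrite normr_gt0 subr_eq0.
(* [g] bounds from below the gaps between distinct zeros; once the mesh is finer, they occupy
   distinct cells and the count is exact. *)
have [g g0 hg] := list_lower_bound dpos. apply: cvg_near_cst; near=> n. rewrite cell_countE undup_id ?size_map// map_inj_in_uniq// => z z' zZ z'Z e.
apply/eqP; apply: contraPT (lexx g) => zz'; apply/negP; rewrite -ltNge.
have gz : g <= `|z - z'| by apply: (hg (z, z')); rewrite mem_filter zz'/=; exact: allpairs_f.
have [/andP[uz _] _] := (hZ z).1 zZ; have [/andP[uz' _] _] := (hZ z').1 z'Z.
have /andP[a1 b1] := truncn_itv (ratio_ge0 n uz); have /andP[a2 b2] := truncn_itv (ratio_ge0 n uz'). rewrite /index in e; rewrite -e in a2 b2; clear e.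
have : `|z - z'| * (n.+1%:R / (v - u)) < 1.
  rewrite -[X in _ * X]gtr0_norm ?divr_gt0// -normrM. have -> : (z - z') * (n.+1%:R / (v - u)) = (z - u) / (v - u) * n.+1%:R - (z' - u) / (v - u) * n.+1%:R.
    by field; rewrite gt_eqF.
  move: a1 b1 a2 b2; set t := Num.truncn _; clearbody t. move: (_ / _ * _) => y; move: (_ / _ * _) => y'; rewrite -natr1 => a1 b1 a2 b2.
  by rewrite ltr_norml; apply/andP; split; lra.
rewrite mulrA ltr_pdivrMr// mul1r => h. have : (v - u) / g < n.+1%:R.
  apply: (@lt_trans _ _ n%:R); last by rewrite ltr_nat. by near: n; exact: nbhs_infty_gtr.
rewrite ltr_pdivrMr// => h'; have := lt_trans h h'; rewrite mulrC ltr_pM2l// => h''. by have := lt_le_trans h'' gz; rewrite ltxx.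
Unshelve. all: end_near. Qed.

End cells.

Lemma expR_half_le (R : realType) (y z : R) : expR (- (y / 2)) <= expR (- (z / 2)) -> z <= y.
Proof. by rewrite ler_expR; lra. Qed.

Lemma scale_bounds (R : realType) (q y y' k1 k2 : R) : 0 < q -> q ^+ 2 * y' = y -> 0 < k1 ->
  k1 <= y <= k2 -> k1 <= y' <= k2 -> Num.sqrt (k1 / k2) <= q <= Num.sqrt (k2 / k1).
Proof.
move=> q0 e p1 /andP[b1 b2] /andP[b3 b4]. have p3 : 0 < y' by lra. have p4 : 0 < y by lra. have p2 : 0 < k2 by lra.
have -> : q = Num.sqrt (y / y') by rewrite -e mulfK ?gt_eqF// sqrtr_sqr gtr0_norm. rewrite !ler_wsqrtr//.
  by apply: ler_pM; rewrite ?invr_ge0 ?(ltW p3) ?(ltW p4)// lef_pV2 ?posrE.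
by apply: ler_pM; rewrite ?invr_ge0 ?(ltW p2) ?(ltW p1)// lef_pV2 ?posrE.
Qed.

(** * Stationarity of the moments of the zero counts *)

Section stationarity.
Context d (T : measurableType d) (R : realType)
  (P : probability T R) (X : nat -> T -> R) (a : nat -> nat -> R).
Hypothesis mX : forall j, mfun (X j).
Hypothesis hX : std_normal_sums P X.
Hypothesis ra : regular_array X a.
Local Notation f := (gfun X a).
Local Notation g := (gder X a).
Variables V0 V1 : R.
Hypothesis hV0 : centered_normal P (coef X a 0) V0.
Hypothesis V0_gt0 : 0 < V0.
Hypothesis hV1 : centered_normal P (coef X a 1) V1.
Hypothesis V1_gt0 : 0 < V1.
Hypothesis hV : forall x, exists2 V, centered_normal P (f ^~ x) V & 0 < V.

Variables (x0 : R) (Qx : R -> R).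
Hypothesis Qx_gt0 : forall t, 0 < Qx t.
Hypothesis hQ : forall t s, \int[P]_w (Qx t * f w (t + x0) * (Qx s * f w (s + x0))) = \int[P]_w (f w t * f w s).

Let mf x : mfun (f ^~ x).
Proof. by have [V [mL _ _]] := hV x. Qed.

(** Both processes are Gaussian with the same covariances, hence have the same finite-dimensional
    laws; the positive factor leaves the zeros of the shifted path in place. *)
Lemma shifted_process_good :
  good P P (fun t w => f w t) (fun t w => Qx t * f w (t + x0)) (fun=> 1) (fun=> 1).
Proof.
split; [exact: bmeas_cst|exact: bmeas_cst|move=> J t c b]. have gv (y k : J -> R) : gaussian_vector P (fun j w => k j * f w (y j))
    (fun i j => \int[P]_w (k i * f w (y i) * (k j * f w (y j)))).
  apply: centered_normal_gaussian => c'. have [V hV'] := jet_normal mX hX ra y (fun ib => if ib.2 then 0 else c' ib.1 * k ib.1); exists V.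
  rewrite (_ : (fun w => _) = fun w => \sum_ib (if ib.2 then 0 else c' ib.1 * k ib.1) * jet X a y ib w)//.
  apply/funext => w; rewrite -(pair_big xpredT xpredT (fun i b => (if b then 0 else c' i * k i) * jet X a y (i, b) w))/=.
  by apply: eq_bigr => i _; rewrite big_bool/= mul0r add0r /jet/= mulrA.
have [_ h1] := gv t (fun=> 1); have [_ h2] := gv (fun j => t j + x0) (fun j => Qx (t j)).
under eq_Rintegral do rewrite mul1r; under [RHS]eq_Rintegral do rewrite mul1r. have := h1 c b; under eq_Rintegral do under eq_bigr do rewrite mul1r; move=> ->.
have E : qform (fun i j => \int[P]_w (1 * f w (t i) * (1 * f w (t j)))) c =
    qform (fun i j => \int[P]_w (Qx (t i) * f w (t i + x0) * (Qx (t j) * f w (t j + x0)))) c.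
  apply: eq_bigr => i _; apply: eq_bigr => j _; congr (_ * _). by rewrite hQ; under eq_Rintegral do rewrite !mul1r.
by rewrite E -h2.
Qed.

Definition path_variance t := \int[P]_w (f w t * f w t).
Local Notation k := path_variance.

Lemma variance_charfun t : 0 < k t /\ \int[P]_w cos (f w t) = expR (- (k t / 2)).
Proof.
have [V nV V0'] := hV t; have [_ _ hc] := nV; have e : k t = V.
  have e2 : (\int[P]_w (f w t * f w t)%:E = V%:E)%E.
    by rewrite -(centered_normal_sqr nV); apply: eq_integral => w _; rewrite expr2.
  by rewrite /path_variance /Rintegral e2.
rewrite e; split => //; have := hc 1 0; rewrite cos0 mulr1 expr1n mul1r => <-. by apply: eq_Rintegral => w _; rewrite mul1r addr0.
Qed.

Lemma charfun_continuous : continuous (fun t => \int[P]_w cos (f w t)).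
Proof.
move=> t; apply/continuous_withinNx/cvgr_dnbhsP => y [_ yt]. apply: (proj2 (@Ex_bounded_cvg _ _ _ P (fun n w => cos (f w (y n))) _ 1 _ _ _)).
- by move=> n; have [] := bmeas_cos (mf (y n)).
- by move=> n w; rewrite ler_norml cos_geN1 cos_le1.
- move=> w; have h : f w (y n) @[n --> \oo] --> f w t by apply: cvg_comp yt _; exact: continuous_gfun. exact: (continuous_cvg _ (@continuous_cos R _) h).
Qed.

(** [Qx] is known only as a positive function. Its bounds come from Qx(t)^2 k(t + x0) = k(t): the
    variance k is bounded above and away from 0 on compacts because E cos f(t) = exp(-k(t)/2) is
    continuous. *)
Lemma Qx_bounded u v : u < v -> exists c C : R, 0 < c /\ forall t, u <= t <= v -> c <= Qx t <= C.
Proof.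
move=> uv; pose A := Num.min u (u + x0); pose B := Num.max v (v + x0). have Au : A <= u by rewrite ge_min lexx. have Bv : v <= B by rewrite le_max lexx.
have Aux : A <= u + x0 by rewrite ge_min lexx orbT. have Bvx : v + x0 <= B by rewrite le_max lexx orbT. have AB : A <= B by lra.
(* [t1] maximises the characteristic function and hence minimises the variance; [t2] does the
   opposite. *)
have cc := continuous_subspaceT charfun_continuous. have [t1 _ h1] := @EVT_max R _ A B AB (cc _); have [t2 _ h2] := @EVT_min R _ A B AB (cc _).
have hk t : A <= t <= B -> k t1 <= k t <= k t2.
  move=> tAB; have tI : t \in `[A, B] by rewrite in_itv. have q1 := h1 t tI; have q2 := h2 t tI. rewrite (variance_charfun t).2 (variance_charfun t1).2 in q1.
  rewrite (variance_charfun t).2 (variance_charfun t2).2 in q2. by apply/andP; split; [exact: expR_half_le q1|exact: expR_half_le q2].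
have p1 := (variance_charfun t1).1; have p2 := (variance_charfun t2).1. have hQ2 t : Qx t ^+ 2 * k (t + x0) = k t.
  rewrite /path_variance -(hQ t t) -RintegralZl.
    by apply: eq_Rintegral => w _; ring.
  - exact: measurableT.
  - by have [V nV _] := hV (t + x0); exact: (centered_normal_integrable nV nV).
exists (Num.sqrt (k t1 / k t2)), (Num.sqrt (k t2 / k t1)); split; first by rewrite sqrtr_gt0 divr_gt0. move=> t tuv; have a1 : A <= t <= B by lra.
have a2 : A <= t + x0 <= B by lra. exact: (scale_bounds (Qx_gt0 t) (hQ2 t) p1 (hk _ a1) (hk _ a2)).
Qed.

Lemma void_prod_norm (F : R -> R) u v n : `|void_prod F u v n| <= 1.
Proof.
rewrite ger0_norm; last by apply: prodr_ge0 => i _; have /andP[] := void_kernel_bounds n (F (void_grid u v n i)).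
by apply: prodr_ile1 => i _; exact: void_kernel_bounds.
Qed.

Lemma void_cvg (F G s : R -> R) (u v c C : R) : u < v -> (forall x : R, is_derive x (1 : R) F (G x)) ->
  continuous G -> 0 < c -> (forall x, u <= x <= v -> c <= s x <= C) ->
  void_prod (fun x => s x * F x) u v n @[n --> \oo] --> 1 - hit F u v.
Proof.
move=> uv dF cG c0 hs; rewrite /hit; case: asboolP => [[z [zuv Fz]]|nz].
  by rewrite subrr; exact: (void_cvg0 uv dF cG c0 hs zuv Fz).
rewrite subr0; apply: (void_cvg1 uv dF c0 hs) => z zuv; apply/eqP => Fz. by apply: nz; exists z.
Qed.

(** Both void products converge, the second because the two-sided bounds on [Qx] let the factor be
    treated as the weight [s] of [void_cvg]; the indicators inherit the equality of laws. *)
Lemma same_law_hit u v : u < v ->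
  same_law P P (fun t w => f w t) (fun t w => Qx t * f w (t + x0))
    (fun w => hit (f w) u v) (fun w => hit (f w) (u + x0) (v + x0)).
Proof.
move=> uv; have [c [C [c0 hc]]] := Qx_bounded uv. have mQ t : mfun (fun w => Qx t * f w (t + x0)) by exact: measurable_funM.
have hv : same_law P P (fun t w => f w t) (fun t w => Qx t * f w (t + x0)) (fun w => 1 - hit (f w) u v) (fun w => 1 - hit (f w) (u + x0) (v + x0)).
  apply: (same_law_lim mf mQ (M := 1) (U1 := fun n w => void_prod (f w) u v n) (U2 := fun n w => void_prod (fun t => Qx t * f w (t + x0)) u v n)).
  - move=> n; apply: (same_law_prod mf mQ _ (U1 := fun (j : 'I_(n.+1 ^ 4).+1) w => void_kernel n (f w (void_grid u v n j)))) => j.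
    by have [_] := admissible_void_kernel R n; exact.
  - by move=> n w; exact: void_prod_norm.
  - by move=> n w; exact: void_prod_norm.
  - move=> w; have -> : f w = (fun t => 1 * f w t) by apply/funext => t; rewrite mul1r. have cg0 : continuous (g w) by exact: continuous_gder.
    have := @void_cvg (f w) (g w) (fun=> 1) u v 1 1 uv (is_derive_gfun ra w) cg0 ltr01. have -> : hit (fun t => 1 * f w t) u v = hit (f w) u v.
      by congr hit; apply/funext => t; rewrite mul1r.
    by apply => x _; rewrite lexx.
  - move=> w; have dF x : is_derive x (1 : R) (fun t => f w (t + x0)) (g w (x + x0)).
      have ds : is_derive x (1 : R) (fun t => t + x0) 1.
        by have := is_deriveD (is_derive_id x (1 : R)) (is_derive_cst x0 x (1 : R)); rewrite addr0.
      by have := @is_derive1_comp R (f w) (fun t => t + x0) x _ _ (is_derive_gfun ra w (x + x0)) ds; rewrite mulr1.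
    have cG : continuous (fun x => g w (x + x0)).
      move=> x; apply: (@continuous_comp _ _ _ (fun t => t + x0) (g w)); last exact: continuous_gder. by apply: cvgD; [exact: cvg_id|exact: cvg_cst].
    have := void_cvg uv dF cG c0 hc; suff -> : hit (fun t => f w (t + x0)) u v = hit (f w) (u + x0) (v + x0) by [].
    rewrite /hit; congr (_%:R); congr nat_of_bool; apply/asboolP/asboolP => -[z [zuv fz]].
      by exists (z + x0); rewrite !lerD2r.
    by exists (z - x0); rewrite subrK lerBrDr lerBlDr.
have e (F : R -> R) p q : hit F p q = 1 + (-1) * (1 - hit F p q) by ring.
rewrite (_ : (fun w => hit (f w) u v) = fun w => 1 + (-1) * (1 - hit (f w) u v)); last by apply/funext => w.
rewrite (_ : (fun w => hit (f w) (u + x0) _) = fun w => 1 + (-1) * (1 - hit (f w) (u + x0) (v + x0))); last by apply/funext => w.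
apply: same_lawD => //; first exact: same_law_cst. by apply: same_lawM => //; exact: same_law_cst.
Qed.

Lemma same_law_cell_count u v n : u < v ->
  same_law P P (fun t w => f w t) (fun t w => Qx t * f w (t + x0))
    (fun w => cell_count (f w) u v n) (fun w => cell_count (f w) (u + x0) (v + x0) n).
Proof.
move=> uv; have mQ t : mfun (fun w => Qx t * f w (t + x0)) by exact: measurable_funM.
have cE l : cell (u + x0) (v + x0) n l = cell u v n l + x0 by rewrite /cell; ring.
apply: (same_law_sum mf mQ _ (U1 := fun (l : 'I__) w => hit (f w) (cell u v n l) (cell u v n l.+1))
  (U2 := fun (l : 'I__) w => hit (f w) (cell (u + x0) (v + x0) n l) (cell (u + x0) (v + x0) n l.+1))) => l.
rewrite !cE; apply: same_law_hit. by rewrite /cell ltrD2l ltr_pM2l ?subr_gt0// ltr_pM2r ?invr_gt0// ltr_nat.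
Qed.

(** Moments pass to the limit by domination, since a cell count never exceeds the number of zeros,
    whose m-th power is integrably bounded. *)
Lemma cell_count_moment u v m : u < v -> (0 < m)%N ->
  (forall n, mfun (fun w => cell_count (f w) u v n)) ->
  (\int[P]_w (cell_count (f w) u v n ^+ m)%:E)%E @[n --> \oo] --> (\int[P]_w (zcount X a u v w ^+ m)%:E)%E.
Proof.
move=> uv m0 mc; pose r := `|u| + `|v| + 1. have r0 : 0 < r by rewrite ltr_pwDr// addr_ge0.
have ru : - r <= u by have := ler_norm (- u); rewrite normrN /r; have := normr_ge0 v; lra.
have rv : v <= r by have := ler_norm v; rewrite /r; have := normr_ge0 u; lra.
have [D [G0 [mD D0 Di [mG0 PG0] hG]]] := good_set mX hX ra hV0 V0_gt0 hV1 V1_gt0 hV (fun=> u : R) (fun=> v : R) r0 m0 (I := unit).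
pose B := (~` G0) `|` \bigcup_n \bigcup_l [set w | f w (cell u v n l) = 0]. have mN x := (path_nonzero_ae hV x).1. have mB : measurable B.
  by apply: measurableU; [exact: measurableC|apply: bigcup_measurable => n _; apply: bigcup_measurable => l _; exact: mN].
have PB : P B = 0%E.
  apply: null_set_setU => //; first exact: measurableC.
    by apply: bigcup_measurable => n _; apply: bigcup_measurable => l _; exact: mN.
  apply/(negligibleP P); first by apply: bigcup_measurable => n _; apply: bigcup_measurable => l _; exact: mN.
  apply: negligible_bigcup => n; apply: negligible_bigcup => l; apply/(negligibleP P); first exact: mN. exact: (path_nonzero_ae hV _).2.
have mG : measurable (~` B) by exact: measurableC. have PG : P (~` (~` B)) = 0%E by rewrite setCK.
have hB w : ~ B w -> exists Z : seq R, [/\ uniq Z, (forall x, x \in Z <-> u <= x <= v /\ f w x = 0),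
    zcount X a u v w = (size Z)%:R, (((size Z)%:R ^+ m)%:E <= D w)%E & forall n l, (l <= n.+1)%N -> f w (cell u v n l) != 0].
  move=> /not_orP[/contrapT /hG[/(_ tt)[n1 n2] [kk pb kD]] nz]. have [Z [uZ hZ sZ zE _]] := zcount_good pb ru uv rv n1 n2; exists Z; split => //.
    by apply: le_trans kD; rewrite lee_fin lerXn2r ?nnegrE// (le_trans _ (path_bound_ge1 pb)).
  by move=> n l _; apply/eqP => h; apply: nz; exists n => //; exists l.
rewrite -(integral_conull _ mG PG); under eq_fun do rewrite -(integral_conull _ mG PG). apply: (dominated_cvg (H := D)) => //.
- by move=> n; exact: measurable_funX.
- by move=> n w; apply: exprn_ge0; apply: sumr_ge0 => l _; rewrite /hit ler0n.
- move=> w /hB[Z [uZ hZ -> _ nz]];  exact: (continuous_cvg _ (@exprn_continuous R m _) (cell_count_cvg uv uZ hZ nz)).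
- move=> n w /hB[Z [uZ hZ _ ZD nz]]; apply: le_trans ZD; rewrite lee_fin. by have /andP[q1 q2] := cell_count_le uv hZ nz n; rewrite lerXn2r ?nnegrE.
Qed.

Lemma zcount_moment_shift u v m : u < v -> (0 < m)%N ->
  (\int[P]_w (zcount X a u v w ^+ m)%:E = \int[P]_w (zcount X a (u + x0) (v + x0) w ^+ m)%:E)%E.
Proof.
move=> uv m0; have uv' : u + x0 < v + x0 by rewrite ltrD2r. have mQ t : mfun (fun w => Qx t * f w (t + x0)) by exact: measurable_funM.
have sl n := same_law_cell_count n uv. have c1 := cell_count_moment uv m0 (fun n => ltac:(by have [[]] := sl n)).
have c2 := cell_count_moment uv' m0 (fun n => ltac:(by have [_ []] := sl n)). have e : (fun n => \int[P]_w (cell_count (f w) u v n ^+ m)%:E)%E =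
    (fun n => \int[P]_w (cell_count (f w) (u + x0) (v + x0) n ^+ m)%:E)%E.
  apply/funext => n; have sX := same_lawX mf mQ m (sl n). have [b1 b2 _] := sX; rewrite !Ex_fin//; congr EFin. exact: (same_law_eq shifted_process_good sX).
rewrite e in c1; exact: (cvg_unique _ c1 c2).
Qed.

End stationarity.

Lemma prod_le_sum_pow (R : realType) (I : finType) (C : {set I}) (x : I -> R) : (forall i, 0 <= x i) ->
  \prod_(i in C) x i <= 1 + \sum_i x i ^+ #|I|.
Proof.
move=> x0; have [/existsP[i0 hi0]|] := boolP [exists i, 1 <= x i].
  pose j := [arg max_(i > i0) x i]%O. have hj i : x i <= x j by rewrite /j; case: arg_maxP => // k _; exact. have j1 : 1 <= x j by apply: le_trans hi0 _.
  apply: (@le_trans _ _ (\prod_(i in C) x j)); first by apply: ler_prod => i _; rewrite x0 hj.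
  rewrite prodr_const; apply: (@le_trans _ _ (x j ^+ #|I|)); first by apply: ler_weXn2l => //; exact: max_card.
  rewrite (bigD1 j)//= addrCA lerDl addr_ge0// sumr_ge0// => i _; exact: exprn_ge0.
rewrite negb_exists => /forallP h; apply: (@le_trans _ _ 1).
  by apply: prodr_ile1 => i _; rewrite x0 ltW// ltNge h.
by rewrite lerDl sumr_ge0// => i _; exact: exprn_ge0.
Qed.

(** The double sum of (x_i - x_j)(x_i^m - x_j^m) is nonnegative term by term. *)
Lemma chebyshev_sum (R : realType) (n m : nat) (x : nat -> R) : (forall i, 0 <= x i) ->
  (\sum_(i < n) x i) * (\sum_(i < n) x i ^+ m) <= n%:R * \sum_(i < n) x i ^+ m.+1.
Proof.
move=> x0; rewrite -subr_ge0. have key : 0 <= \sum_(i < n) \sum_(j < n) (x i - x j) * (x i ^+ m - x j ^+ m).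
  apply: sumr_ge0 => i _; apply: sumr_ge0 => j _. have [ij|/ltW ji] := leP (x i) (x j).
    by apply: mulr_le0; rewrite subr_le0// lerXn2r ?nnegrE.
  by apply: mulr_ge0; rewrite subr_ge0// lerXn2r ?nnegrE.
suff <- : (\sum_(i < n) \sum_(j < n) (x i - x j) * (x i ^+ m - x j ^+ m)) / 2 =
   n%:R * (\sum_(i < n) x i ^+ m.+1) - (\sum_(i < n) x i) * \sum_(i < n) x i ^+ m by rewrite divr_ge0.
have -> : \sum_(i < n) \sum_(j < n) (x i - x j) * (x i ^+ m - x j ^+ m) =
   \sum_(i < n) \sum_(j < n) (x i ^+ m.+1 + x j ^+ m.+1 - (x i * x j ^+ m + x j * x i ^+ m)).
  by apply: eq_bigr => i _; apply: eq_bigr => j _; rewrite !exprS; ring.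
under eq_bigr do rewrite sumrB !big_split/= sumr_const card_ord -mulr_sumr -mulr_suml -mulr_natl.
rewrite sumrB !big_split/= sumr_const card_ord -mulr_sumr -mulr_suml -mulr_sumr -[X in _ + X - _]mulr_natl. by field.
Qed.

Lemma power_mean (R : realType) (n m : nat) (x : nat -> R) : (forall i, 0 <= x i) ->
  (\sum_(i < n) x i) ^+ m.+1 <= n%:R ^+ m * \sum_(i < n) x i ^+ m.+1.
Proof.
move=> x0; elim: m => [|m IH]; first by rewrite expr1 expr0 mul1r; apply: ler_sum => i _; rewrite expr1.
rewrite exprS; apply: (@le_trans _ _ ((\sum_(i < n) x i) * (n%:R ^+ m * \sum_(i < n) x i ^+ m.+1))).
  by rewrite ler_wpM2l// sumr_ge0.
rewrite mulrCA [n%:R ^+ m.+1]exprSr -mulrA ler_wpM2l ?exprn_ge0//. exact: chebyshev_sum.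
Qed.

(** * Multilinearity and clustering of cumulants *)

Section moment_cumulants.
Context (R : realType) d (T : measurableType d) (P : probability T R) (I : finType).
Hypothesis I0 : (0 < #|I|)%N.
Implicit Types (Y : I -> T -> R) (Z U V : T -> R).

Definition finite_moment Z : Prop :=
  [/\ mfun Z, forall w, 0 <= Z w & (\int[P]_w (Z w ^+ #|I|)%:E < +oo)%E].

Definition joint_moment Y (C : {set I}) : R := \int[P]_w \prod_(i in C) Y i w.

Definition kappa Y : R := joint_cumulant (joint_moment Y) finset.setT.

Definition update Y (i0 : I) U (i : I) : T -> R := if i == i0 then U else Y i.

Lemma joint_moment_integrable Y (C : {set I}) : (forall i, finite_moment (Y i)) ->
  P.-integrable setT (EFin \o (fun w => \prod_(i in C) Y i w)).
Proof.
move=> hY. have mC : mfun (fun w => \prod_(i in C) Y i w).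
  by under eq_fun do rewrite big_mkcond; apply: measurable_prod => i _; case: (i \in C) => //; have [] := hY i.
have ip i : P.-integrable setT (EFin \o (fun w => Y i w ^+ #|I|)).
  have [mYi Y0 fi] := hY i; apply/integrableP; split; first by apply/measurable_EFinP; exact: measurable_funX.
  by under eq_integral do rewrite /= ger0_norm ?exprn_ge0//.
apply: (@le_integrable _ _ _ P setT measurableT _ (fun w => (1 + \sum_i Y i w ^+ #|I|)%:E)).
- exact/measurable_EFinP.
- move=> w _ /=; rewrite lee_fin ger0_norm; last by apply: prodr_ge0 => i _; have [] := hY i. have Y0 i : 0 <= Y i w by have [_ h _] := hY i.
  apply: (le_trans (prod_le_sum_pow C Y0)); exact: ler_norm.
- under eq_fun do rewrite EFinD -sumEFin; apply: integrableD => //.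
    exact: finite_measure_integrable_cst.
  by apply: integrable_sum => // i _; exact: ip.
Qed.

Lemma joint_moment_update Y i0 U V (C : {set I}) : (forall i, finite_moment (Y i)) -> finite_moment U -> finite_moment V ->
  (i0 \notin C -> joint_moment (update Y i0 (fun w => U w + V w)) C = joint_moment (update Y i0 U) C) /\
  (i0 \in C -> joint_moment (update Y i0 (fun w => U w + V w)) C =
    joint_moment (update Y i0 U) C + joint_moment (update Y i0 V) C).
Proof.
move=> hY hU hV; split => iC.
  apply: eq_Rintegral => w _; apply: eq_bigr => i iC'. by rewrite /update; case: eqP iC => // <-; rewrite iC'.
have hup W : finite_moment W -> forall i, finite_moment (update Y i0 W i).
  by move=> hW i; rewrite /update; case: ifP.
rewrite /joint_moment -RintegralD//; try exact: joint_moment_integrable (hup _ _).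
apply: eq_Rintegral => w _; rewrite (bigD1 i0)//= [X in _ = X + _](bigD1 i0)//= [X in _ = _ + X](bigD1 i0)//=.
rewrite /update eqxx mulrDl; congr (_ * _ + _ * _); by apply: eq_bigr => i /andP[_ /negbTE ->].
Qed.

Lemma kappa_update Y i0 U V : (forall i, finite_moment (Y i)) -> finite_moment U -> finite_moment V ->
  kappa (update Y i0 (fun w => U w + V w)) = kappa (update Y i0 U) + kappa (update Y i0 V).
Proof.
move=> hY hU hV; apply: (joint_cumulant_additive (i0 := i0)); first by rewrite finset.in_setT.
  move=> C iC; split; first by have [+ _] := joint_moment_update i0 C hY hU hV; exact.
  have -> : (fun w => U w + V w) = (fun w => V w + U w) by apply/funext => w; rewrite addrC. by have [+ _] := joint_moment_update i0 C hY hV hU; exact.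
by move=> C iC; have [_ +] := joint_moment_update i0 C hY hU hV; exact.
Qed.

Lemma finite_momentD U V : finite_moment U -> finite_moment V -> finite_moment (fun w => U w + V w).
Proof.
move=> [mU U0 iU] [mV V0 iV]; split; first exact: measurable_funD.
  by move=> w; rewrite addr_ge0.
have mX (W : T -> R) : mfun W -> mfun (fun w => (2 ^+ #|I|)%:E * (W w ^+ #|I|)%:E)%E.
  by move=> mW; apply: measurable_funeM; apply/measurable_EFinP; exact: measurable_funX.
apply: (@le_lt_trans _ _ (\int[P]_w ((2 ^+ #|I|)%:E * (U w ^+ #|I|)%:E + (2 ^+ #|I|)%:E * (V w ^+ #|I|)%:E))%E).
  apply: ge0_le_integral => //.
  - by move=> w _; rewrite lee_fin exprn_ge0// addr_ge0.
  - by apply/measurable_EFinP; apply: measurable_funX; exact: measurable_funD.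
  - by apply: emeasurable_funD; exact: mX.
  - move=> w _; rewrite -!EFinM -EFinD lee_fin -!exprMn. have [uv|/ltW vu] := leP (U w) (V w).
      apply: (@le_trans _ _ ((2 * V w) ^+ #|I|)); last by rewrite lerDr exprn_ge0// mulr_ge0. by rewrite lerXn2r ?nnegrE ?addr_ge0 ?mulr_ge0//; lra.
    apply: (@le_trans _ _ ((2 * U w) ^+ #|I|)); last by rewrite lerDl exprn_ge0// mulr_ge0. by rewrite lerXn2r ?nnegrE ?addr_ge0 ?mulr_ge0//; lra.
have p2 : (0 <= (2 ^+ #|I|)%:E :> \bar R)%E by rewrite lee_fin exprn_ge0. rewrite ge0_integralD//; first last.
- exact: mX.
- by move=> w _; rewrite mule_ge0// lee_fin exprn_ge0.
- exact: mX.
- by move=> w _; rewrite mule_ge0// lee_fin exprn_ge0.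
by rewrite !ge0_integralZl//; [rewrite lte_add_pinfty// lte_mul_pinfty//| | | |];
  [apply/measurable_EFinP; exact: measurable_funX|move=> w _; rewrite lee_fin exprn_ge0|
   apply/measurable_EFinP; exact: measurable_funX|move=> w _; rewrite lee_fin exprn_ge0].
Qed.

Lemma finite_moment0 : finite_moment (fun=> 0).
Proof.
split => //. by rewrite expr0n; case: #|I| I0 => // n _; rewrite integral0.
Qed.

Lemma finite_moment_sum (K : finType) (J : {pred K}) (Z : K -> T -> R) : (forall k, finite_moment (Z k)) ->
  finite_moment (fun w => \sum_(k in J) Z k w).
Proof.
move=> hZ; elim: (index_enum K) => [|k l IH].
  by under eq_fun do rewrite big_nil; exact: finite_moment0.
under eq_fun do rewrite big_cons; case: (k \in J) => //; exact: finite_momentD.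
Qed.

Lemma kappa_update0 Y i0 : (forall i, finite_moment (Y i)) -> kappa (update Y i0 (fun=> 0)) = 0.
Proof.
move=> hY; have := kappa_update i0 hY finite_moment0 finite_moment0. have -> : (fun w : T => 0 + 0) = (fun=> 0 : R) by apply/funext => w; rewrite addr0.
by move=> e; apply: (addrI (kappa (update Y i0 (fun=> 0)))); rewrite -e addr0.
Qed.

Lemma kappa_update_sum Y i0 (K : finType) (J : {pred K}) (Z : K -> T -> R) :
  (forall i, finite_moment (Y i)) -> (forall k, finite_moment (Z k)) ->
  kappa (update Y i0 (fun w => \sum_(k in J) Z k w)) = \sum_(k in J) kappa (update Y i0 (Z k)).
Proof.
move=> hY hZ; rewrite [RHS]big_mkcond. have -> : (fun w => \sum_(k in J) Z k w) = (fun w => \sum_k (if k \in J then Z k w else 0)).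
  by apply/funext => w; rewrite big_mkcond.
elim: (index_enum K) => [|k l IH].
  by under eq_fun do rewrite big_nil; rewrite big_nil; exact: kappa_update0.
rewrite big_cons -IH; under eq_fun do rewrite big_cons. have hS : finite_moment (fun w => \sum_(j <- l) (if j \in J then Z j w else 0)).
  elim: l {IH} => [|j l IHl]; first by under eq_fun do rewrite big_nil; exact: finite_moment0. under eq_fun do rewrite big_cons; apply: finite_momentD => //.
  by case: (j \in J) => //; exact: finite_moment0.
case: (k \in J); first by rewrite kappa_update. rewrite [RHS]add0r; congr (kappa (update _ _ _)); apply/funext => w; exact: add0r.
Qed.

(** The sum is expanded slot by slot, each time by additivity in one slot; [l] lists the slots that
    still hold the whole sum. *)
Lemma kappa_expansion (K : finType) (J : {pred K}) (Z : K -> T -> R) (k0 : K) :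
  (forall k, finite_moment (Z k)) ->
  kappa (fun=> fun w => \sum_(k in J) Z k w) =
  \sum_(t : {ffun I -> K} | [forall i, t i \in J]) kappa (fun i => Z (t i)).
Proof.
move=> hZ; pose S w := \sum_(k in J) Z k w. have hS : finite_moment S := finite_moment_sum J hZ. suff H (l : seq I) : uniq l -> forall t0 : {ffun I -> K},
    kappa (fun i => if i \in l then S else Z (t0 i)) =
    \sum_(t : {ffun I -> K} | [forall i, if i \in l then t i \in J else t i == t0 i]) kappa (fun i => Z (t i)).
  have := H (enum I) (enum_uniq _) [ffun=> k0]. have -> : (fun i => if i \in enum I then S else Z ([ffun=> k0] i)) = fun=> S.
    by apply/funext => i; rewrite mem_enum.
  by move=> ->; apply: eq_bigl => t; apply: eq_forallb => i; rewrite mem_enum.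
elim: l => [_ t0|i l IH /= /andP[il ul] t0].
  rewrite (big_pred1 t0) => [//|t]; apply/forallP/eqP => [h|-> i]; last by rewrite eqxx. by apply/ffunP => i; have /eqP := h i.
have -> : (fun j => if j \in i :: l then S else Z (t0 j)) = update (fun j => if j \in l then S else Z (t0 j)) i S.
  by apply/funext => j; rewrite /update inE; case: eqP.
rewrite kappa_update_sum => [|j|//]; last by case: ifP. rewrite (partition_big (fun t : {ffun I -> K} => t i) (mem J))/=; last first.
  by move=> t /forallP /(_ i); rewrite inE eqxx.
apply: eq_bigr => k kJ. pose t1 : {ffun I -> K} := [ffun j => if j == i then k else t0 j].
have -> : update (fun j => if j \in l then S else Z (t0 j)) i (Z k) = fun j => if j \in l then S else Z (t1 j).
  by apply/funext => j; rewrite /update ffunE; case: eqP => // ->; rewrite (negbTE il).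
rewrite IH//; apply: eq_bigl => t; apply/forallP/andP => [h|[/forallP h /eqP ti] j].
  have ti : t i = k by have := h i; rewrite (negbTE il) ffunE eqxx => /eqP. split; last exact/eqP.
  apply/forallP => j; have := h j; rewrite inE ffunE; have [->|_] := eqVneq j i; rewrite /= ?ti.
    by [].
  by [].
have := h j; rewrite inE ffunE; case: eqP => [->|//]; by rewrite (negbTE il) ti eqxx.
Qed.

(* If the joint moments nearly factor along A, the cumulant of the normalised variables is small. *)
Lemma kappa_clustering Y (s : I -> R) (A : {set I}) (M e : R) :
  (forall i, finite_moment (Y i)) -> (forall i, 0 < s i) -> 1 <= M -> 0 <= e ->
  (forall C : {set I}, joint_moment (fun i w => Y i w / s i) C <= M) ->
  (forall C : {set I}, `|joint_moment Y C - joint_moment Y (C :&: A) * joint_moment Y (C :\: A)| <=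
     e * (joint_moment Y C + joint_moment Y (C :&: A) * joint_moment Y (C :\: A))) ->
  finset.set0 != A -> A != finset.setT ->
  `|kappa Y| <= (\prod_i s i) * e * (2 * M ^+ 2 *
    \sum_(p : {set {set I}} | finset.partition p finset.setT) `|cumulant_weight R #|p| | * (#|p|%:R * (M ^+ 2) ^+ #|p|)).
Proof.
move=> hY s0 M1 e0 hM hcl A0 AT. pose mu' := joint_moment (fun i w => Y i w / s i). have muE (C : {set I}) : joint_moment Y C = \prod_(i in C) s i * mu' C.
  rewrite /mu' /joint_moment -RintegralZl//.
    by apply: eq_Rintegral => w _; rewrite -big_split/=; apply: eq_bigr => i _; rewrite mulrCA divff ?mulr1// gt_eqF.
  apply: joint_moment_integrable => i; have [mYi Y0 fi] := hY i; split.
  - exact: measurable_funM.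
  - by move=> w; rewrite divr_ge0// ltW.
  - under eq_integral do rewrite expr_div_n mulrC EFinM; rewrite ge0_integralZl//.
    + by apply: lte_mul_pinfty => //; rewrite lee_fin invr_ge0 exprn_ge0// ltW.
    + by apply/measurable_EFinP; exact: measurable_funX.
    + by move=> w _; rewrite lee_fin exprn_ge0.
    + by rewrite lee_fin invr_ge0 exprn_ge0// ltW.
have mu'0 (C : {set I}) : 0 <= mu' C.
  apply: Rintegral_ge0 => w _; apply: prodr_ge0 => i _; rewrite divr_ge0 ?(ltW (s0 i))//. by have [_ + _] := hY i.
have mu'1 : mu' finset.set0 = 1.
  rewrite /mu' /joint_moment; under eq_Rintegral do rewrite big_set0. by rewrite Rintegral_cst//= probability_setT mulr1.
pose nu (C : {set I}) := mu' (C :&: A) * mu' (C :\: A). have nuM (C : {set I}) : 0 <= nu C <= M ^+ 2.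
  by rewrite /nu mulr_ge0//= expr2 ler_pM.
have M2 : M <= M ^+ 2 by rewrite expr2 ler_pMr// (lt_le_trans _ M1).
have sE (C : {set I}) : \prod_(i in C) s i = \prod_(i in C :&: A) s i * \prod_(i in C :\: A) s i.
  by rewrite -(big_setID A)/=.
have diff (C : {set I}) : `|mu' C - nu C| <= 2 * e * M ^+ 2.
  have sp : 0 < \prod_(i in C) s i by apply: prodr_gt0 => i _.
  have := hcl C; rewrite !muE mulrACA -sE -mulrBr -mulrDr normrM gtr0_norm// mulrCA ler_pM2l// => h.
  apply: (le_trans h); have /andP[n1 n2] := nuM C; have := hM C; rewrite -/mu' => m1. by rewrite -mulrA mulrCA ler_wpM2l//; rewrite /nu in n2 *; lra.
rewrite /kappa (_ : joint_moment Y = fun C => \prod_(i in C) s i * mu' C); last exact/funext.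
rewrite joint_cumulant_scale normrM ger0_norm; last by apply: prodr_ge0 => i _; exact: ltW. rewrite (eq_bigl xpredT) => [|i]; last by rewrite finset.in_setT.
rewrite -mulrA ler_wpM2l//; first by apply: prodr_ge0 => i _; exact: ltW. have fac : joint_cumulant nu finset.setT = 0.
  apply: (joint_cumulant_factor (al := mu') (be := mu') (A := A)) => //.
  - by rewrite finset.setTI eq_sym.
  - by apply: contra AT => /eqP h; rewrite finset.eqEsubset finset.subsetT -finset.setD_eq0 h eqxx.
have := @joint_cumulant_perturbation R I mu' nu finset.setT (M ^+ 2) (2 * e). rewrite fac subr0 => h; apply: (le_trans (h _ _ _ _ _)).
- by rewrite (le_trans M1).
- by rewrite mulr_ge0.
- by move=> C; rewrite ger0_norm// (le_trans (hM C)).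
- by move=> C; have /andP[n1 n2] := nuM C; rewrite ger0_norm.
- exact: diff.
set S := \sum_(_ | _) _; have S0 : 0 <= S.
  by apply: sumr_ge0 => p _; rewrite !mulr_ge0// exprn_ge0// exprn_ge0// (le_trans _ M1).
rewrite (_ : e * _ = 2 * e * (M ^+ 2 * S)); last by ring. by rewrite ler_wpM2l ?mulr_ge0// ler_peMl// (le_trans M1).
Qed.

End moment_cumulants.

(** * Cumulants of an additive, stationary and clustering count *)

Section counting_field.
Context (R : realType) d (T : measurableType d) (P : probability T R)
  (m : nat) (N : R -> R -> T -> R).
Hypothesis m0 : (0 < m)%N.
Local Notation I := 'I_m.
Local Notation kap := (@kappa R d T P I).

Let I0 : (0 < #|{: I}|)%N. Proof. by rewrite card_ord. Qed.

Definition ae_eq_fun (U V : T -> R) : Prop :=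
  exists B, [/\ measurable B, P B = 0%E & forall w, ~ B w -> U w = V w].

Hypothesis N_fin : forall s t, s < t -> finite_moment P I (N s t).
Hypothesis N_add : forall s u t, s < u -> u < t -> ae_eq_fun (N s t) (fun w => N s u w + N u t w).
Hypothesis N_stat : forall s t j, s < t -> (0 < j)%N ->
  (\int[P]_w (N s t w ^+ j)%:E = \int[P]_w (N 0 (t - s) w ^+ j)%:E)%E.

Lemma ae_eq_trans U V W : ae_eq_fun U V -> ae_eq_fun V W -> ae_eq_fun U W.
Proof.
move=> [B [mB PB hB]] [C [mC PC hC]]; exists (B `|` C); split; first exact: measurableU.
  exact: null_set_setU.
by move=> w /not_orP[nB nC]; rewrite hB// hC.
Qed.

Lemma kappa_ae U V : ae_eq_fun U V -> kap (fun=> U) = kap (fun=> V).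
Proof.
move=> [B [mB PB hB]]; rewrite /kappa; congr joint_cumulant; apply/funext => C.
rewrite /joint_moment /Rintegral; congr fine; apply: (integral_null mB PB) => w nB. by rewrite (eq_bigr (fun=> V w)) => [//|i _]; exact: hB.
Qed.

Lemma kappa_shift s t : s < t -> kap (fun=> N s t) = kap (fun=> N 0 (t - s)).
Proof.
move=> st; rewrite /kappa; congr joint_cumulant; apply/funext => C. rewrite /joint_moment /Rintegral; congr fine.
under eq_integral do rewrite prodr_const; under [RHS]eq_integral do rewrite prodr_const.
by have [->|C0] := posnP #|C|; [under eq_integral do rewrite expr0|exact: N_stat].
Qed.

Lemma N_grid (g : nat -> R) i j : (i < j)%N -> (forall l, (i <= l < j)%N -> g l < g l.+1) ->
  g i < g j /\ ae_eq_fun (N (g i) (g j)) (fun w => \sum_(i <= l < j) N (g l) (g l.+1) w).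
Proof.
elim: j => // j IH; rewrite ltnS leq_eqVlt => /predU1P[<- hg|ij hg].
  have gi : g i < g i.+1 by apply: hg; rewrite leqnn ltnS leqnn. split => //; exists set0; split => // w _. by rewrite big_nat1.
have gj : g j < g j.+1 by apply: hg; rewrite (ltnW ij) ltnSn. have [gij h] := IH ij (fun l hl => hg l ltac:(by case/andP: hl => -> /ltnW)).
split; first exact: lt_trans gij gj. apply: (ae_eq_trans (N_add gij gj)); have [B [mB PB hB]] := h.
by exists B; split => // w nB; rewrite big_nat_recr ?(ltnW ij)//= hB.
Qed.

Definition unit_moment : \bar R := (\int[P]_w (N 0 1 w ^+ m)%:E)%E.

Let un0 : (0 <= unit_moment)%E.
Proof. by have [_ h _] := N_fin ltr01; apply: integral_ge0 => w _; rewrite lee_fin exprn_ge0. Qed.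

(** After a shift to the origin the interval is covered by at most 1 + l unit cells, and the power
    mean inequality compares the m-th moment of their sum with that of one cell. *)
Lemma N_moment s l : 0 < l -> (\int[P]_w (N s (s + l) w ^+ m)%:E <= ((1 + l) ^+ m)%:E * unit_moment)%E.
Proof.
move=> l0; rewrite N_stat ?ltrDl//; have -> : s + l - s = l by lra. have mX u t : u < t -> mfun (fun w => (N u t w ^+ m)%:E).
  by move=> ut; have [h _ _] := N_fin ut; apply/measurable_EFinP; exact: measurable_funX.
have N0 u t w : u < t -> 0 <= N u t w by move=> ut; have [_ h _] := N_fin ut. pose n := (Num.truncn l).+1; have /andP[tl lt] := truncn_itv (ltW l0).
have nl : n%:R <= 1 + l by rewrite /n -natr1; lra. have u01 k : k%:R < k.+1%:R :> R by rewrite ltr_nat.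
have [n0 [B [mB PB hB]]] := @N_grid (fun k => k%:R) 0 n (ltn0Sn _) (fun k _ => u01 k). have [B' [mB' PB' hB']] := N_add l0 lt.
have pm w : (\sum_(k < n) N k%:R k.+1%:R w) ^+ m <= n%:R ^+ m.-1 * \sum_(k < n) N k%:R k.+1%:R w ^+ m.
  by have := power_mean n m.-1 (fun k => N0 _ _ w (u01 k)); rewrite prednK.
apply: (@le_trans _ _ (\int[P]_w ((n%:R ^+ m.-1 * \sum_(k < n) N k%:R k.+1%:R w ^+ m)%:E))%E).
  pose G := ~` (B `|` B'); have mG : measurable G by apply: measurableC; exact: measurableU.
  have e (F : T -> \bar R) : (\int[P]_w F w = \int[P]_(w in G) F w)%E.
    rewrite [RHS]integral_mkcond; apply: (integral_null (N := B `|` B')).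
    - exact: measurableU.
    - exact: null_set_setU.
    - by move=> w nB; rewrite patchE mem_set.
  rewrite e [leRHS]e; apply: ge0_le_integral => //.
  - by move=> w _; rewrite lee_fin exprn_ge0// N0.
  - by apply: measurable_funTS; exact: mX.
  - apply: measurable_funTS; apply/measurable_EFinP; apply: measurable_funM => //. by apply: measurable_sum => k; apply/measurable_EFinP; exact: mX.
  - move=> w /not_orP[nB nB']; rewrite lee_fin. apply: le_trans (pm w). rewrite lerXn2r ?nnegrE ?N0// ?sumr_ge0// => [k _|]; first exact: N0.
    have := hB w nB; rewrite big_mkord => <-; rewrite hB'// lerDl; exact: N0.
have h k : (\int[P]_w (N k%:R k.+1%:R w ^+ m)%:E = unit_moment)%E.
  by rewrite N_stat//; have -> : k.+1%:R - k%:R = 1 :> R by rewrite -natr1; lra.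
under eq_integral do rewrite EFinM -sumEFin. rewrite ge0_integralZl//; first last.
- by move=> w _; apply: sume_ge0 => k _; rewrite lee_fin exprn_ge0// N0.
- by apply: emeasurable_sum => k _; exact: mX.
rewrite ge0_integral_sum//; first last.
- by move=> k w _; rewrite lee_fin exprn_ge0// N0.
- by move=> k; exact: mX.
under eq_bigr do rewrite h. have -> : (\sum_(k < n) unit_moment = n%:R%:E * unit_moment)%E.
  elim: (n) => [|n' IH]; first by rewrite big_ord0 mul0e. by rewrite big_ord_recr/= IH -natr1 EFinD ge0_muleDl ?lee_fin// mul1e.
rewrite muleA; apply: lee_wpmul2r => //; rewrite -EFinM lee_fin -exprSr prednK//. by rewrite lerXn2r ?nnegrE// addr_ge0// ltW.
Qed.

Lemma cumulant_expansion (g : nat -> R) (K : nat) : (forall l, (l < K)%N -> g l < g l.+1) ->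
  forall i j, (i < j)%N -> (j <= K)%N ->
  kap (fun=> N (g i) (g j)) =
  \sum_(t : {ffun I -> 'I_K} | [forall x, (i <= t x < j)%N]) kap (fun x => N (g (t x)) (g (t x).+1)).
Proof.
move=> hg i j ij jK; have K0 : (0 < K)%N by apply: leq_trans jK; apply: leq_trans ij.
have [gij h] := N_grid ij (fun l hl => hg l ltac:(by case/andP: hl => _ lj; exact: leq_trans lj jK)). rewrite (kappa_ae h).
have hZ (k : 'I_K) : finite_moment P I (N (g k) (g k.+1)) by apply: N_fin; exact: hg.
have := kappa_expansion I0 (fun k : 'I_K => (i <= k < j)%N) (Ordinal K0) hZ. rewrite /in_mem/= => <-; congr (kappa _ _); apply/funext => x; apply/funext => w.
by rewrite big_geq_mkord (big_ord_widen_cond K (fun l => i <= l)%N (fun l => N (g l) (g l.+1) w)).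
Qed.

(** One bound for all configurations of intervals: after division by [s] each count has m-th moment
    at most 2^m times [unit_moment], and a product is at most 1 plus the sum of the m-th powers. *)
Lemma scaled_moment_bound (u l s : I -> R) (C : {set I}) :
  (forall x, [/\ 0 < l x, 0 < s x & 1 + l x <= 2 * s x]) ->
  joint_moment P (fun x w => N (u x) (u x + l x) w / s x) C <= 1 + m%:R * (2 ^+ m * fine unit_moment).
Proof.
move=> hl. have fY x : finite_moment P I (N (u x) (u x + l x)) by apply: N_fin; have [] := hl x; rewrite ltrDl. have unf : unit_moment \is a fin_num.
  by have [_ _] := N_fin ltr01; rewrite ge0_fin_numE// card_ord.
have s0 x : 0 < s x by have [] := hl x. have N0 x w : 0 <= N (u x) (u x + l x) w by have [_ h _] := fY x.
have mN x : mfun (fun w => ((N (u x) (u x + l x) w / s x) ^+ m)%:E).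
  by have [h _ _] := fY x; apply/measurable_EFinP; apply: measurable_funX; exact: measurable_funM.
have p0 x w : (0 <= ((N (u x) (u x + l x) w / s x) ^+ m)%:E)%E.
  by rewrite lee_fin exprn_ge0// divr_ge0// ltW.
have hm x : (\int[P]_w ((N (u x) (u x + l x) w / s x) ^+ m)%:E <= (2 ^+ m * fine unit_moment)%:E)%E.
  have [l0 _ ls] := hl x; have := N_moment (u x) l0. under [X in _ -> (X <= _)%E]eq_integral do rewrite expr_div_n mulrC EFinM.
  rewrite ge0_integralZl//; first last.
  - by rewrite lee_fin invr_ge0 exprn_ge0// ltW.
  - by move=> w _; rewrite lee_fin exprn_ge0.
  - by have [h _ _] := fY x; apply/measurable_EFinP; exact: measurable_funX.
  move=> h; apply: (@le_trans _ _ ((s x ^+ m)^-1%:E * (((1 + l x) ^+ m)%:E * unit_moment))%E).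
    by apply: lee_wpmul2l => //; rewrite lee_fin invr_ge0 exprn_ge0// ltW.
  rewrite -[X in (_ * (_ * X) <= _)%E](fineK unf) -!EFinM lee_fin mulrA ler_wpM2r ?fine_ge0//.
  rewrite mulrC ler_pdivrMr ?exprn_gt0// -exprMn lerXn2r ?nnegrE ?addr_ge0 ?mulr_ge0// ?(ltW l0)//. exact: ltW.
have p1 w : 0 <= \prod_(x in C) (N (u x) (u x + l x) w / s x).
  by apply: prodr_ge0 => x _; rewrite divr_ge0// ltW.
rewrite -lee_fin /joint_moment /Rintegral fineK; last first.
  apply: (integrable_fin_num measurableT); apply: (joint_moment_integrable (I := I)) => x. split; first by have [h _ _] := fY x; exact: measurable_funM.
    by move=> w; rewrite divr_ge0// ltW.
  by rewrite card_ord; apply: le_lt_trans (hm x) _; rewrite ltry.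
apply: (@le_trans _ _ (\int[P]_w (1 + \sum_x ((N (u x) (u x + l x) w / s x) ^+ m)%:E))%E).
  apply: ge0_le_integral => //.
  - by move=> w _; rewrite lee_fin.
  - apply/measurable_EFinP; under eq_fun do rewrite big_mkcond; apply: measurable_prod => x _.
    by case: (x \in C) => //; have [h _ _] := fY x; exact: measurable_funM.
  - by apply: emeasurable_funD => //; apply: emeasurable_sum => x _; exact: mN.
  - move=> w _; rewrite sumEFin -EFinD lee_fin. have := prod_le_sum_pow C (x := fun x => N (u x) (u x + l x) w / s x) (fun x => divr_ge0 (N0 x w) (ltW (s0 x))).
    by rewrite card_ord.
rewrite ge0_integralD//; first last.
- by apply: emeasurable_sum => x _; exact: mN.
- by move=> w _; apply: sume_ge0 => x _.
rewrite ge0_integral_sum//.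
have i1 : (\int[P]_(w in setT) (1 : \bar R) = 1)%E by have := integral_cst P measurableT (1%E : \bar R); rewrite mul1e => ->; exact: probability_setT.
rewrite i1 EFinD; apply: leeD => //. apply: (@le_trans _ _ (\sum_(x < m) (2 ^+ m * fine unit_moment)%:E)%E); first by apply: lee_sum.
by rewrite sumEFin sumr_const card_ord mulr_natl.
Qed.

Variables (e : R -> R) (d0 : R).
Hypothesis e_ge0 : forall x, d0 <= x -> 0 <= e x.
Hypothesis N_clus : forall (s t : I -> R) (C A : {set I}) dd, (forall i, s i < t i) -> d0 <= dd ->
  (forall i j, i \in A -> j \notin A -> t i + dd <= s j) ->
  C :&: A != finset.set0 -> C :\: A != finset.set0 ->
  let J := joint_moment P (fun i => N (s i) (t i)) in
  `|J C - J (C :&: A) * J (C :\: A)| <= e dd * (J C + J (C :&: A) * J (C :\: A)).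

Definition kappa_fun r := kap (fun=> N 0 r).

Lemma kappa_fun_bounded (A : R) : exists M, forall r, 0 < r <= A -> `|kappa_fun r| <= M.
Proof.
exists (\sum_(p : {set {set I}} | finset.partition p finset.setT) `|cumulant_weight R #|p| | *
  \prod_(B in p) ((1 + A) ^+ #|B| * (1 + m%:R * (2 ^+ m * fine unit_moment)))) => r /andP[r0 rA].
have A0 : 0 < 1 + A by rewrite addr_gt0// (lt_le_trans r0). have J0 B : 0 <= joint_moment P (fun _ : I => N 0 r) B.
  by apply: Rintegral_ge0 => w _; apply: prodr_ge0 => x _; have [_ h _] := N_fin r0.
rewrite /kappa_fun /kappa /joint_cumulant; apply: (le_trans (ler_norm_sum _ _ _)); apply: ler_sum => p _.
rewrite normrM ler_wpM2l// normr_prod; apply: ler_prod => B _; rewrite normr_ge0 ger0_norm//=.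
have := @scaled_moment_bound (fun=> 0) (fun=> r) (fun=> 1 + A) B (fun=> ltac:(by split => //; lra)). rewrite add0r -ler_pdivrMl ?exprn_gt0//; apply: le_trans.
rewrite /joint_moment -RintegralZl//; last exact: (joint_moment_integrable B (fun=> N_fin r0)).
rewrite le_eqVlt; apply/orP; left; apply/eqP; apply: eq_Rintegral => w _. by rewrite big_split/= !prodr_const exprVn mulrC.
Qed.

Let grid a b r l : R := if l == 0%N then 0 else if (l <= m.+1)%N then a + l.-1%:R * (r / m%:R) else a + r + b.

Let grid_incr a b r l : 0 < a -> 0 < b -> 0 < r -> (l < m.+2)%N -> grid a b r l < grid a b r l.+1.
Proof.
move=> a0 b0 r0; have mr : (0 : R) < m%:R by rewrite ltr0n. have q0 : 0 < r / m%:R by rewrite divr_gt0. case: l => [_|l]; first by rewrite /grid /= mul0r addr0.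
rewrite ltnS leq_eqVlt => /predU1P[[->]|lm].
  by rewrite /grid /= leqnn ltnn /= mulrCA divff ?gt_eqF// mulr1 ltrDl.
rewrite /grid /= (ltnW lm) lm ltrD2l ltr_pM2r// ltr_nat//.
Qed.

(** The power is m - 2 because the two end cells have length at most 1: with counts normalised by 1
    there and by 1 + r in the middle cells, the product of the normalisers is at most (1 + r)^(m -
    2). The splitting set [A] consists of the indices to the left of the missed cell, whose length
    r/m is the separation. *)
Lemma kappa_split_small : exists2 K, 0 <= K & forall a b r (t : {ffun I -> 'I_m.+2}),
  0 < a <= 1 -> 0 < b <= 1 -> 0 < r -> d0 <= r / m%:R ->
  (exists x, t x = ord0) -> (exists x, t x = ord_max) ->
  `|kap (fun x => N (grid a b r (t x)) (grid a b r (t x).+1))| <= K * ((1 + r) ^+ m.-2 * e (r / m%:R)).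
Proof.
pose M := 1 + m%:R * (2 ^+ m * fine unit_moment). pose K := 2 * M ^+ 2 * \sum_(p : {set {set I}} | finset.partition p finset.setT)
  `|cumulant_weight R #|p| | * (#|p|%:R * (M ^+ 2) ^+ #|p|).
have M1 : 1 <= M by rewrite lerDl !mulr_ge0 ?exprn_ge0 ?fine_ge0. exists K.
  have M0 : 0 <= M by apply: le_trans M1. apply: mulr_ge0; first by rewrite mulr_ge0// exprn_ge0. apply: sumr_ge0 => p _.
  by do ?apply: mulr_ge0; rewrite ?exprn_ge0// exprn_ge0.
move=> a b r t /andP[a0 a1] /andP[b0 b1] r0 hd [x1 tx1] [x2 tx2]. have mr : (0 : R) < m%:R by rewrite ltr0n. have q0 : 0 < r / m%:R by rewrite divr_gt0.
have [j jt] : exists j, forall x, t x != j.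
  have [/forallP h|/forallPn[j /existsPn hj]] := boolP [forall j, [exists x, t x == j]]; last by exists j.
  have := leq_imset_card t (finset.setT : {set I}); rewrite cardsT card_ord. have -> : t @: finset.setT = finset.setT.
    apply/setP => k; rewrite finset.in_setT; apply/imsetP; have /existsP[x /eqP tx] := h k. by exists x; rewrite ?finset.in_setT.
  by rewrite cardsT card_ord ltnNge leqnSn.
have j0 : (0 < j)%N by rewrite lt0n; apply: contraNneq (jt x1) => h; apply/eqP; rewrite tx1; exact: val_inj. have jm : (j < m.+1)%N.
  rewrite ltn_neqAle -ltnS ltn_ord andbT; apply: contraNneq (jt x2) => h; apply/eqP; rewrite tx2; exact: val_inj.
have gi l := @grid_incr a b r l a0 b0 r0. have gmono l l' : (l <= l')%N -> (l' <= m.+2)%N -> grid a b r l <= grid a b r l'.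
  elim: l' => [|l' IH]; first by rewrite leqn0 => /eqP ->. rewrite leq_eqVlt => /predU1P[-> //|ll'] lm; apply: (le_trans (IH ll' (ltnW lm))); exact/ltW/gi.
have gj : grid a b r j.+1 = grid a b r j + r / m%:R.
  rewrite /grid /= (gtn_eqF j0) jm (ltnW jm) -addrA; congr (_ + _). by rewrite -[in LHS](prednK j0) -natr1 mulrDl mul1r.
pose A : {set I} := finset.finset (fun x : I => (t x < j)%N). pose s (x : I) : R := if (t x == ord0) || (t x == ord_max) then 1 else 1 + r.
have s0 x : 0 < s x by rewrite /s; case: ifP => // _; rewrite addr_gt0. have r1 : 1 <= 1 + r by rewrite lerDl ltW.
pose u x := grid a b r (t x); pose l x := grid a b r (t x).+1 - u x. have ul x : u x + l x = grid a b r (t x).+1 by rewrite /l addrC subrK.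
have l0 x : 0 < l x by rewrite /l subr_gt0; exact: gi. have hl x : [/\ 0 < l x, 0 < s x & 1 + l x <= 2 * s x].
  split => //; rewrite /l /u /s; have [t0|tn0] := eqVneq (t x) ord0.
    by rewrite t0 /grid /= mul0r addr0 subr0; lra.
  have [tM|tnM] := eqVneq (t x) ord_max.
    rewrite tM /grid /= leqnn ltnn /= mulrCA divff ?gt_eqF// mulr1; lra.
  have tx0 : (0 < t x)%N by rewrite lt0n; apply: contra tn0 => /eqP h; apply/eqP; exact: val_inj. have txm : (t x < m.+1)%N.
    rewrite ltn_neqAle -ltnS ltn_ord andbT; apply: contra tnM => /eqP h; apply/eqP; exact: val_inj.
  have qr : r / m%:R <= r by rewrite ler_pdivrMr// ler_peMr ?ler1n// ltW. rewrite /grid /= (gtn_eqF tx0) (ltnW txm) txm.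
  have -> : (t x)%:R = (t x).-1%:R + 1 :> R by rewrite natr1 prednK. by move: ((t x).-1%:R : R) (r / m%:R) qr => y q qr; rewrite mulrDl mul1r; lra.
have Y_fin x : finite_moment P I (N (u x) (grid a b r (t x).+1)) by apply: N_fin; exact: gi.
have J0 (C : {set I}) : 0 <= joint_moment P (fun x => N (u x) (grid a b r (t x).+1)) C.
  by apply: Rintegral_ge0 => w _; apply: prodr_ge0 => x _; have [_ h _] := Y_fin x.
have Jset0 : joint_moment P (fun x => N (u x) (grid a b r (t x).+1)) finset.set0 = 1.
  rewrite /joint_moment; under eq_Rintegral do rewrite big_set0. by rewrite Rintegral_cst//= probability_setT mulr1.
have e0 := e_ge0 hd. have := @kappa_clustering _ _ _ P I (fun x => N (u x) (grid a b r (t x).+1)) s A M (e (r / m%:R)) Y_fin s0 M1 e0.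
move=> H; apply: (le_trans (H _ _ _ _)).
- move=> C; have -> : (fun x w => N (u x) (grid a b r (t x).+1) w / s x) = (fun x w => N (u x) (u x + l x) w / s x).
    by apply/funext => x; apply/funext => w; rewrite ul.
  exact: scaled_moment_bound.
- move=> C; have [CA|CA] := eqVneq (C :&: A) finset.set0.
    have -> : C :\: A = C by rewrite -[RHS](finset.setID C A) CA finset.set0U. by rewrite CA Jset0 mul1r subrr normr0 mulr_ge0// addr_ge0.
  have [CA'|CA'] := eqVneq (C :\: A) finset.set0.
    have -> : C :&: A = C by rewrite -[RHS](finset.setID C A) CA' finset.setU0. by rewrite CA' Jset0 mulr1 subrr normr0 mulr_ge0// addr_ge0.
  apply: (N_clus (s := u) (t := fun x => grid a b r (t x).+1)) => //.
    by move=> x; exact: gi.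
  move=> x y; rewrite !finset.in_set => tx; rewrite -leqNgt leq_eqVlt => /orP[/eqP h|ty].
    by have := jt y; rewrite -val_eqE/= h eqxx.
  rewrite /u; apply: (@le_trans _ _ (grid a b r j.+1)); last by apply: gmono => //; exact: ltnW.
  by rewrite gj lerD2r; apply: gmono => //; apply: ltnW; apply: ltn_trans (jm) _.
- by rewrite eq_sym; apply/set0Pn; exists x1; rewrite finset.in_set tx1.
- apply/negP => /eqP h; have : x2 \in A by rewrite h finset.in_setT. by rewrite finset.in_set tx2 /= ltnNge ltnW.
rewrite -/K mulrC ler_wpM2l//.
  have M0 : 0 <= M by apply: le_trans M1. apply: mulr_ge0; first by rewrite mulr_ge0// exprn_ge0.
  by apply: sumr_ge0 => p _; do ?apply: mulr_ge0; rewrite ?exprn_ge0// exprn_ge0.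
rewrite ler_wpM2r//. have x12 : x2 != x1.
  by apply/eqP => h; have := tx2; rewrite h tx1 => /(congr1 val).
rewrite (bigD1 x1)//= (bigD1 x2)//= {1 2}/s tx1 tx2 !eqxx orbT !mul1r. apply: (@le_trans _ _ (\prod_(x | (x != x1) && (x != x2)) (1 + r))).
  by apply: ler_prod => x _; rewrite (ltW (s0 x))/= /s; case: ifP.
rewrite prodr_const; apply: ler_weXn2l => //. have -> : #|[pred x | (x != x1) && (x != x2)]| = #|~: finset.setU (finset.set1 x1) (finset.set1 x2)|.
  by apply: eq_card => x; rewrite !finset.inE negb_or.
by rewrite cardsCs finset.setCK card_ord cards2 eq_sym x12 subn2.
Qed.

(** Over one common grid, inclusion-exclusion leaves exactly the assignments [t] that use both end
    cells. A single index cannot use two cells, hence the factor [(1 < m)]: the bound is 0 for m =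
    1, where the truncated [m.-2] is not m - 2. *)
Lemma second_difference : exists2 K, 0 <= K & forall a b r,
  0 < a <= 1 -> 0 < b <= 1 -> 0 < r -> d0 <= r / m%:R ->
  `|kappa_fun (r + a + b) - kappa_fun (r + a) - kappa_fun (r + b) + kappa_fun r| <=
  K * ((1 < m)%N%:R * ((1 + r) ^+ m.-2 * e (r / m%:R))).
Proof.
have [K K0 hK] := kappa_split_small. exists (#|{: {ffun I -> 'I_m.+2}}|%:R * K); first by rewrite mulr_ge0.
move=> a b r ha hb r0 hd; have /andP[a0 a1] := ha; have /andP[b0 b1] := hb. have gi := @grid_incr a b r _ a0 b0 r0. have mr : (0 : R) < m%:R by rewrite ltr0n.
have g0 : grid a b r 0 = 0 by []. have g1 : grid a b r 1 = a by rewrite /grid /= mul0r addr0.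
have gm : grid a b r m.+1 = a + r by rewrite /grid /= leqnn mulrCA divff ?gt_eqF// mulr1. have gM : grid a b r m.+2 = a + r + b by rewrite /grid /= ltnn.
have ex i j (ij : (i < j)%N) (jm : (j <= m.+2)%N) : kappa_fun (grid a b r j - grid a b r i) = 
  \sum_(t : {ffun I -> 'I_m.+2} | [forall x, (i <= t x < j)%N]) kap (fun x => N (grid a b r (t x)) (grid a b r (t x).+1)).
  have [gij _] := N_grid ij (fun l hl => gi l ltac:(by case/andP: hl => _ lj; exact: leq_trans lj jm)).
  by rewrite -(cumulant_expansion gi ij jm) /kappa_fun -(kappa_shift gij).
have e1 := ex 0%N m.+2 isT (leqnn _); have e2 := ex 0%N m.+1 isT (leqnSn _). have e3 := ex 1%N m.+2 isT (leqnn _); have e4 := ex 1%N m.+1 m0 (leqnSn _).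
rewrite g0 gM (_ : a + r + b - 0 = r + a + b) in e1; last by ring. rewrite g0 gm (_ : a + r - 0 = r + a) in e2; last by ring.
rewrite g1 gM (_ : a + r + b - a = r + b) in e3; last by ring. rewrite g1 gm (_ : a + r - a = r) in e4; last by ring.
rewrite e1 e2 e3 e4 big_mkcond [X in _ - X - _ + _]big_mkcond [X in _ - X + _]big_mkcond [X in _ + X]big_mkcond/=.
rewrite -!sumrB -big_split/=; apply: (le_trans (ler_norm_sum _ _ _)). rewrite -mulrA mulr_natl -sumr_const; apply: ler_sum => t _.
have B0 : 0 <= K * ((1 < m)%N%:R * ((1 + r) ^+ m.-2 * e (r / m%:R))).
  by rewrite !mulr_ge0 ?ler0n ?exprn_ge0 ?addr_ge0 ?(ltW r0)// e_ge0.
have -> : [forall x, (0 <= t x < m.+2)%N] by apply/forallP => x /=. have [p|/forallPn[x1 hx1]] := boolP [forall x, (0 <= t x < m.+1)%N].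
  have -> : [forall x, (0 < t x < m.+2)%N] = [forall x, (0 < t x < m.+1)%N].
    by apply: eq_forallb => x; have /= -> := forallP p x; rewrite (ltn_ord (t x)).
  by rewrite subrr sub0r addNr normr0.
have -> : [forall x, (0 < t x < m.+1)%N] = false.
  by apply/negbTE/forallPn; exists x1; apply: contra hx1 => /andP[_ ->].
have [q|/forallPn[x2 hx2]] := boolP [forall x, (0 < t x < m.+2)%N].
  by rewrite subr0 subrr addr0 normr0.
have t2 : t x2 = ord0 by apply/val_inj; move: hx2; rewrite ltn_ord andbT lt0n negbK => /eqP. have t1 : t x1 = ord_max.
  by apply/val_inj; move: hx1; rewrite /= -leqNgt => h; apply/eqP; rewrite eqn_leq h andbT -ltnS.
have -> : (1 < m)%N.
  rewrite ltnNge; apply: contra_notN (_ : t x1 <> t x2) => [m1|]; last by rewrite t1 t2.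
  have z (x : 'I_m) : x = 0%N :> nat by apply/eqP; rewrite -leqn0 -ltnS; exact: leq_trans (ltn_ord x) m1. by congr (t _); apply: val_inj; rewrite /= !z.
rewrite mul1r !subr0 addr0; apply: hK => //; first by exists x2. by exists x1.
Qed.

End counting_field.

(** * Change of scale, and two facts on sequences *)

Section scaling.
Variable R : realType.
Local Notation mu := (@lebesgue_measure R).

(** The image of Lebesgue measure under multiplication by [q], times [q], agrees with Lebesgue
    measure on intervals. *)
Lemma ge0_integral_scale (q : R) (h : R -> R) : 0 < q -> mfun h -> (forall x, 0 <= h x) ->
  (\int[mu]_(x in `[0%R, +oo[) (h x)%:E = q%:E * \int[mu]_(x in `[0%R, +oo[) (h (q * x))%:E)%E.
Proof.
move=> q0 mh h0. have mq : measurable_fun [set: mR R] ((fun x => q * x) : mR R -> mR R).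
  by apply: measurable_funM.
pose phi : mR R -> mR R := fun x => q * x. have [pm pmE] : exists pm : {measure set (mR R) -> \bar R}, pm = pushforward mu phi :> (set _ -> _).
  by unshelve eexists (pushforward mu phi : {measure set (mR R) -> \bar R}).
pose nu := mscale (NngNum (ltW q0)) pm. have e (A : set R) : measurable A -> mu A = nu A.
  apply: (@lebesgue_measure_unique R nu) => //= _ [[a b]] _ <-. rewrite /nu /mscale/= pmE /pushforward. have -> : phi @^-1` `]a, b] = `]a / q, b / q]%classic.
    apply/seteqP; split => x /=; rewrite !in_itv/= ltr_pdivrMr// ler_pdivlMr// mulrC; exact.
  rewrite !lebesgue_measure_itv/= !lte_fin ltr_pM2r ?invr_gt0//. case: ifP => _; last by rewrite mule0.
  by rewrite -!EFinD -EFinM; congr EFin; field; rewrite gt_eqF.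
have mD : measurable (`[0%R, +oo[%classic : set (mR R)) by exact: measurable_itv.
have mhD : measurable_fun (`[0%R, +oo[%classic : set (mR R)) (fun x => (h x)%:E).
  by apply: measurable_funTS; exact/measurable_EFinP.
rewrite (eq_measure_integral nu); last by move=> A mA _; exact: e. rewrite /nu ge0_integral_mscale//; last by move=> x _; rewrite lee_fin.
congr (_ * _)%E; rewrite (eq_measure_integral (pushforward mu phi)); last by move=> A mA _; rewrite pmE.
rewrite ge0_integral_pushforward//; last by move=> x _; rewrite lee_fin.
congr integral; apply/seteqP; split => x /=; rewrite !in_itv/= !andbT; first by rewrite pmulr_rge0. by move=> ?; rewrite mulr_ge0// ltW.
Qed.

End scaling.

Section sequences.
Variable R : realType.

Lemma summable_steps (u v : nat -> R) : (forall j, `|u j.+1 - u j| <= v j) -> cvgn (series v) ->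
  exists2 l, u n @[n --> \oo] --> l & `|u 0%N - l| <= limn (series v).
Proof.
move=> huv cv; have v0 j : 0 <= v j by apply: le_trans (huv j). pose w j := u j.+1 - u j. have cw : cvgn (series w).
  apply: normed_cvg; apply: (series_le_cvg (v_ := v)) => //. by move=> n; exact: normr_ge0.
have tel n : series w n = u n - u 0%N by rewrite /series/= telescope_sumr. exists (limn (series w) + u 0%N).
  have h : (series w n : R) + u 0%N @[n --> \oo] --> limn (series w) + u 0%N.
    by apply: (@cvgD _ R^o); [exact: cw|exact: cvg_cst].
  have e : (fun n => series w n + u 0%N) = u by apply/funext => n; rewrite tel subrK. by rewrite e in h; exact: h.
rewrite opprD addrCA subrr addr0 normrN. have cn : `|series w n| @[n --> \oo] --> `|limn (series w)| by apply: cvg_norm; exact: cw.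
rewrite -(cvg_lim _ cn)//; apply: ler_lim.
- by apply/cvg_ex; eexists; exact: cn.
- exact: cv.
apply: nearW => n; rewrite /series /=; apply: (le_trans (ler_norm_sum _ _ _)). by apply: ler_sum => i _; exact: huv.
Qed.

Lemma arithmetic_bounded (u : nat -> R) M : (forall n, u n.+2 - u n.+1 = u n.+1 - u n) ->
  (forall n, `|u n| <= M) -> u 1%N = u 0%N.
Proof.
move=> hu hM; pose dl := u 1%N - u 0%N. have hd n : u n.+1 - u n = dl by elim: n => // n IH; rewrite hu. have un n : u n = u 0%N + n%:R * dl.
  by elim: n => [|n IH]; [rewrite mul0r addr0|rewrite -[LHS](subrK (u n)) hd IH -natr1; ring].
apply/eqP; rewrite -subr_eq0 -/dl -normr_eq0 eq_le normr_ge0 andbT leNgt; apply/negP => d0. have M0 : 0 <= M by apply: le_trans (hM 0%N).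
have := archi_boundP (divr_ge0 (addr_ge0 M0 M0) (ltW d0)); set n := Num.bound _. rewrite ltr_pdivrMr// => h. have : n%:R * `|dl| <= M + M.
  have -> : n%:R * `|dl| = `|u n - u 0%N| by rewrite un addrC addKr normrM ger0_norm. by apply: (le_trans (ler_normB _ _)); rewrite lerD.
by rewrite leNgt h.
Qed.

End sequences.

(** * Linear asymptotics from decaying second differences *)

Section second_differences.
Variable R : realType.
Local Notation mu := (@lebesgue_measure R).
Variables (f : R -> R) (m : nat).
Hypothesis m0 : (0 < m)%N.

Definition diff2 (a b r : R) := f (r + a + b) - f (r + a) - f (r + b) + f r.

Hypothesis f_bounded : forall A : R, exists M, forall r, 0 < r <= A -> `|f r| <= M.

(** Both sides carry a factor 1 + r so that the exponent m - 1 is a natural number for m = 1 as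
    well. The argument r/m - c reflects the length of a separating cell. *)
Definition diff2_rate (n : nat) : Prop := exists K c d0 psi,
  [/\ 0 <= K, 0 <= c, c <= d0, Psi_fin n psi &
   forall a b r : R, 0 < a <= 1 -> 0 < b <= 1 -> 0 < r -> d0 <= r / m%:R ->
     `|diff2 a b r| * (1 + r) <= K * ((1 + r) ^+ m.-1 * psi (r / m%:R - c))].

Variable n0 : nat.
Hypothesis mn0 : (m <= n0)%N.
Hypothesis hn0 : diff2_rate n0.

Definition envelope_set (x : R) : set R := [set y | exists a b r,
  [/\ 0 < a <= 1, 0 < b <= 1, 0 < r, x <= r & y = `|diff2 a b r| * (1 + r) / (1 + r) ^+ m.-1]].

(** The least nonincreasing bound for the second differences in the chosen normalisation. It depends
    on [f] and [m] alone and, up to constants and a change of scale, lies eventually below the [psi]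
    of every rate that [f] satisfies; one function can therefore serve all levels. *)
Definition envelope (x : R) : R := sup (envelope_set x).

(** The shift by 1 lets the value at y bound [envelope] one unit to the left of y, as comparing sums
    with integrals requires; the maximum keeps the argument nonnegative. *)
Definition envelope1 (x : R) : R := envelope (Num.max (x - 1) 0).

(** Far out the quotients are bounded by the rate, and for r < m d0 by the local bound on [f]. *)
Lemma envelope_has_sup x : has_sup (envelope_set x).
Proof.
split.
  exists (`|diff2 1 1 (Num.max x 1)| * (1 + Num.max x 1) / (1 + Num.max x 1) ^+ m.-1).
  by exists 1, 1, (Num.max x 1); rewrite ltr01 lexx le_max lexx lt_max ltr01 orbT.
have [K [c [d0 [psi [K0 c0 cd [psi0 psi1 _] hg]]]]] := hn0. have mr : (0 : R) < m%:R by rewrite ltr0n. have d00 : 0 <= d0 by exact: le_trans cd.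
have A0 : 0 < m%:R * d0 + 2 by rewrite ltr_wpDl// mulr_ge0// ltW. have [M hM] := f_bounded (m%:R * d0 + 2).
have M0 : 0 <= M by apply: le_trans (hM (m%:R * d0 + 2) _); rewrite ?A0 ?lexx. exists (K * psi 0 + 4 * M * (1 + m%:R * d0)) => y [a [b [r [ha hb r0 xr ->]]]].
have r1 : 1 <= 1 + r by rewrite lerDl ltW. have p0 : 0 < (1 + r) ^+ m.-1 by rewrite exprn_gt0// (lt_le_trans ltr01).
rewrite ler_pdivrMr//; have [dr|rd] := leP d0 (r / m%:R).
  apply: (le_trans (hg a b r ha hb r0 dr)); rewrite mulrCA [leRHS]mulrC ler_wpM2l ?(ltW p0)//.
  apply: (@le_trans _ _ (K * psi 0)); last by rewrite lerDl !mulr_ge0// addr_ge0// mulr_ge0// ltW. by rewrite ler_wpM2l// psi1// subr_ge0 (le_trans cd).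
have rm : r < m%:R * d0 by move: rd; rewrite ltr_pdivrMr// mulrC. have /andP[a0 a1] := ha; have /andP[b0 b1] := hb.
have hf z : 0 < z -> z <= r + 2 -> `|f z| <= M by move=> z0 zr; apply: hM; rewrite z0 /=; lra. have g4 : `|diff2 a b r| <= 4 * M.
  rewrite /diff2; apply: (le_trans (ler_normD _ _)); have := hf r r0 ltac:(lra). have := ler_normB (f (r + a + b) - f (r + a)) (f (r + b)).
  have := ler_normB (f (r + a + b)) (f (r + a)). have := hf (r + a + b) ltac:(lra) ltac:(lra); have := hf (r + a) ltac:(lra) ltac:(lra).
  have := hf (r + b) ltac:(lra) ltac:(lra); lra.
apply: (@le_trans _ _ (4 * M * (1 + m%:R * d0))).
  by apply: ler_pM => //; [rewrite addr_ge0// ltW|rewrite lerD2l ltW].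
have q0 : 0 <= 4 * M * (1 + m%:R * d0) by rewrite !mulr_ge0// addr_ge0// mulr_ge0// ltW.
apply: (@le_trans _ _ (4 * M * (1 + m%:R * d0) * (1 + r) ^+ m.-1)); first by rewrite ler_peMr// exprn_ege1.
by rewrite ler_wpM2r ?(ltW p0)// lerDr mulr_ge0// psi0.
Qed.

Lemma envelope_ge0 x : 0 <= envelope x.
Proof.
have [[y hy] hb] := envelope_has_sup x; apply: (@le_trans _ _ y); last exact: ub_le_sup.
by have [a [b [r [_ _ r0 _ ->]]]] := hy; rewrite divr_ge0 ?mulr_ge0 ?exprn_ge0// addr_ge0// ltW.
Qed.

Lemma envelope_le x y : x <= y -> envelope y <= envelope x.
Proof.
move=> xy; apply: le_sup.
- move=> z [a [b [r [h1 h2 h3 h4 h5]]]]; exists z; split => //. by exists a, b, r; split => //; exact: le_trans xy h4.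
- by have [] := envelope_has_sup y.
- exact: envelope_has_sup.
Qed.

Lemma envelope_bound a b r : 0 < a <= 1 -> 0 < b <= 1 -> 0 < r ->
  `|diff2 a b r| * (1 + r) <= (1 + r) ^+ m.-1 * envelope r.
Proof.
move=> ha hb r0; have p0 : 0 < (1 + r) ^+ m.-1 by rewrite exprn_gt0// addr_gt0. rewrite mulrC [leRHS]mulrC -ler_pdivrMr//.
apply: ub_le_sup; first by have [] := envelope_has_sup r. by exists a, b, r; split => //; rewrite [(1 + r) * _]mulrC.
Qed.

Lemma envelope1_ge0 x : 0 <= envelope1 x. Proof. exact: envelope_ge0. Qed.

Lemma envelope1_le x y : x <= y -> envelope1 y <= envelope1 x.
Proof. by move=> xy; apply: envelope_le; rewrite ge_max !le_max lexx lerD2r xy orbT. Qed.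

Lemma measurable_envelope1 : mfun envelope1.
Proof. by apply: nonincreasing_measurable => //; move=> x y /envelope1_le. Qed.

(** Up to [Y] the envelope is bounded; beyond, it is at most a multiple of [psi] at x/(2m), whose
    moment of order n - 1 is finite after a change of scale. Lower moments follow because [Y] is at
    least 1. *)
Lemma Psi_fin_envelope1 n n' : (n' <= n)%N -> diff2_rate n -> Psi_fin n' envelope1.
Proof.
move=> nn [K [c [d0 [psi [K0 c0 cd [psi0 psi1 ipsi] hg]]]]]; split.
- by move=> x _; exact: envelope1_ge0.
- by move=> x y _; exact: envelope1_le.
have mr : (0 : R) < m%:R by rewrite ltr0n. have d00 : 0 <= d0 by exact: le_trans cd. pose q : R := (2 * m%:R)^-1; have q0 : 0 < q by rewrite invr_gt0 mulr_gt0.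
pose p x := psi (Num.max x 0); have p0 x : 0 <= p x by apply: psi0; rewrite le_max lexx orbT. have mp : mfun p.
  apply: nonincreasing_measurable => // x y xy; apply: psi1; first by rewrite le_max lexx orbT. by rewrite ge_max !le_max xy lexx !orbT.
pose h x := p x * (Num.max x 0) ^+ n.-1. have h0 x : 0 <= h x by rewrite mulr_ge0// exprn_ge0// le_max lexx orbT. have mh : mfun h.
  by apply: measurable_funM => //; apply: measurable_funX; exact: measurable_maxr.
have hi : (\int[mu]_(x in `[0%R, +oo[) (h x)%:E < +oo)%E.
  apply: le_lt_trans ipsi; rewrite le_eqVlt; apply/orP; left; apply/eqP. apply: eq_integral => x; rewrite inE/= in_itv/= andbT => x0.
  by rewrite /h /p (max_idPl x0).
(* Beyond 1 + m d0 the rate applies to every r >= x - 1; beyond 2 + 2mc one has (x - 1)/m - c >=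
   x/(2m) = q x. *)
pose Y := Num.max (1 + m%:R * d0) (2 + 2 * m%:R * c). have Y0 : 0 <= Y by rewrite le_max addr_ge0// mulr_ge0// ltW.
have n1 : (n'.-1 <= n.-1)%N by rewrite -!subn1 leq_sub2r. pose B := envelope 0 * Y ^+ n.-1; pose K' := K * (2 * m%:R) ^+ n.-1.
have B0 : 0 <= B by rewrite mulr_ge0 ?envelope_ge0// exprn_ge0. have K'0 : 0 <= K' by rewrite mulr_ge0// exprn_ge0// mulr_ge0// ltW.
have Y1 : 1 <= Y by rewrite le_max lerDl mulr_ge0. have key x : 0 <= x -> envelope1 x * x ^+ n'.-1 <= B * \1_(`[0, Y]%classic : set R) x + K' * h (q * x).
  move=> x0; have [xY|Yx] := leP x Y.
    rewrite indicE mem_set/= ?in_itv/= ?x0// mulr1; apply: (@le_trans _ _ B).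
      apply: ler_pM; rewrite ?envelope1_ge0 ?exprn_ge0//; last first.
        by apply: (@le_trans _ _ (Y ^+ n'.-1)); [rewrite lerXn2r ?nnegrE|exact: ler_weXn2l].
      by apply: envelope_le; rewrite le_max lexx orbT.
    by rewrite lerDl mulr_ge0.
  apply: (@le_trans _ _ (envelope1 x * x ^+ n.-1)).
    by rewrite ler_wpM2l ?envelope1_ge0// ler_weXn2l// (le_trans Y1)// ltW.
  have x1 : 1 + m%:R * d0 < x by apply: le_lt_trans Yx; rewrite le_max lexx. have x2 : 2 + 2 * m%:R * c < x by apply: le_lt_trans Yx; rewrite le_max lexx orbT.
  have xm : 1 < x by apply: le_lt_trans x1; rewrite lerDl mulr_ge0// ltW. apply: (@le_trans _ _ (K' * h (q * x))); last by rewrite lerDr mulr_ge0.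
  have qx : 0 <= q * x by rewrite mulr_ge0// ltW. rewrite /h /p (max_idPl qx) exprMn /K' mulrACA [X in _ <= _ * X]mulrA.
  rewrite exprVn [_ ^+ n.-1 / _]divff ?mul1r; last by rewrite expf_neq0// mulf_neq0// gt_eqF. rewrite ler_wpM2r ?exprn_ge0//.
  have e1 : envelope1 x = envelope (x - 1) by rewrite /envelope1 (max_idPl _)// subr_ge0 ltW.
  rewrite e1; apply: sup_le_ub; first by have [] := envelope_has_sup (x - 1). move=> y [a [b [r [ha hb r0 xr ->]]]].
  have p1 : 0 < (1 + r) ^+ m.-1 by rewrite exprn_gt0// addr_gt0. have dr : d0 <= r / m%:R by rewrite ler_pdivlMr// mulrC; lra.
  rewrite ler_pdivrMr//; apply: (le_trans (hg a b r ha hb r0 dr)). rewrite mulrCA [leRHS]mulrC ler_wpM2l ?(ltW p1)// ler_wpM2l// psi1//.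
  rewrite /q invfM lerBrDr -(@ler_pM2r _ m%:R)// divfK ?gt_eqF// mulrDl. rewrite (_ : 2^-1 / m%:R * x * m%:R = x / 2); last by field; rewrite gt_eqF.
  by move: x2; lra.
have mM : mfun (fun x : R => (envelope1 x * x ^+ n'.-1)%:E).
  apply/measurable_EFinP; apply: measurable_funM; first exact: measurable_envelope1. exact: measurable_funX.
have mhq : mfun (fun x : R => h (q * x)).
  by apply: measurableT_comp => //; exact: measurable_funM.
have mI : mfun (\1_(`[0, Y]%classic : set R) : R -> R) by exact: measurable_indic.
apply: (@le_lt_trans _ _ (\int[mu]_(x in `[0%R, +oo[) ((B * \1_(`[0, Y]%classic : set R) x)%:E + (K' * h (q * x))%:E))%E).
  apply: ge0_le_integral => //.
  - by move=> x; rewrite /= in_itv/= andbT => x0; rewrite lee_fin mulr_ge0 ?envelope1_ge0 ?exprn_ge0.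
  - exact: measurable_funTS.
  - by apply: measurable_funTS; apply: emeasurable_funD; apply/measurable_EFinP; apply: measurable_funM.
  - by move=> x; rewrite /= in_itv/= andbT => x0; rewrite -EFinD lee_fin key.
rewrite ge0_integralD//; first last.
- by apply: measurable_funTS; apply/measurable_EFinP; apply: measurable_funM.
- by move=> x _; rewrite lee_fin mulr_ge0.
- by apply: measurable_funTS; apply/measurable_EFinP; apply: measurable_funM.
- by move=> x _; rewrite lee_fin mulr_ge0.
apply: lte_add_pinfty.
  under eq_integral do rewrite EFinM. rewrite ge0_integralZl//; first last.
  - by apply: measurable_funTS; exact/measurable_EFinP.
  rewrite integral_indic//; apply: lte_mul_pinfty => //.
  apply: (@le_lt_trans _ _ (mu (`[0, Y]%classic : set R))); first by apply: le_measure; rewrite ?inE//; exact: measurableI.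
  by rewrite lebesgue_measure_itv/=; case: ifP => _; rewrite ?ltry// -EFinD ltry.
under eq_integral do rewrite EFinM. rewrite ge0_integralZl//; first last.
- by move=> x _; rewrite lee_fin.
- by apply: measurable_funTS; exact/measurable_EFinP.
apply: lte_mul_pinfty => //. have := ge0_integral_scale q0 mh h0 => e; move: hi; rewrite e => hi.
rewrite ltey; apply: contraTneq hi => ->; rewrite gt0_muley ?ltxx// lte_fin//.
Qed.

Let tail_term (x : R) (j : nat) : R := (1 + x + j%:R) ^+ m.-1 * envelope (x + j%:R).

Let weight (y : R) : R := envelope1 y * y ^+ m.-1.

Let weight_ge0 y : 0 <= y -> 0 <= weight y.
Proof. by move=> y0; rewrite mulr_ge0 ?envelope1_ge0 ?exprn_ge0. Qed.

Let measurable_weight : mfun (fun y => (weight y)%:E).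
Proof.
apply/measurable_EFinP; apply: measurable_funM; first exact: measurable_envelope1. exact: measurable_funX.
Qed.

Let tail_term_ge0 x j : 1 <= x -> 0 <= tail_term x j.
Proof. by move=> x1; rewrite mulr_ge0 ?envelope_ge0// exprn_ge0// !addr_ge0// (le_trans _ x1). Qed.

(** For y in the j-th unit interval, 1 + x + j <= 2y because x >= 1, which costs the factor 2^(m -
    1), and the value of [envelope] at x + j is at most [envelope1 y]. *)
Lemma tail_term_integral x j : 1 <= x ->
  ((tail_term x j)%:E <= (2 ^+ m.-1)%:E * \int[mu]_(y in `[(x + j%:R)%R, (x + j.+1%:R)%R[) (weight y)%:E)%E.
Proof.
move=> x1; have xj : 1 <= x + j%:R by rewrite (le_trans x1)// lerDl. have l0 : 0 <= tail_term x j / 2 ^+ m.-1 by rewrite divr_ge0 ?tail_term_ge0// exprn_ge0.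
have p2 : (0 : R) < 2 ^+ m.-1 by rewrite exprn_gt0. apply: (@le_trans _ _ ((2 ^+ m.-1)%:E * (tail_term x j / 2 ^+ m.-1)%:E)%E).
  by rewrite -EFinM lee_fin mulrC divfK// gt_eqF.
apply: lee_wpmul2l; first by rewrite lee_fin ltW. have -> : (tail_term x j / 2 ^+ m.-1)%:E =
    (\int[mu]_(y in `[(x + j%:R)%R, (x + j.+1%:R)%R[) (tail_term x j / 2 ^+ m.-1)%:E)%E.
  rewrite integral_cst//= lebesgue_measure_itv/= lte_fin ltrD2l ltr_nat ltnSn -EFinD. have -> : x + j.+1%:R - (x + j%:R) = 1 by rewrite -natr1; ring.
  by rewrite mule1.
apply: ge0_le_integral => //.
- exact: measurable_funTS.
- move=> y; rewrite /= in_itv/= => /andP[xy yx]; rewrite lee_fin /weight /tail_term. have y1 : 1 <= y by exact: le_trans xy.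
  rewrite mulrAC -expr_div_n mulrC; apply: ler_pM; rewrite ?envelope_ge0//.
  + by rewrite exprn_ge0// divr_ge0// !addr_ge0// (le_trans _ x1).
  + by apply: envelope_le; rewrite ge_max; move: yx; rewrite -natr1 => yx; apply/andP; split; lra.
  + by have j0 : (0 : R) <= j%:R by []; apply: lerXn2r; rewrite ?nnegrE; lra.
Qed.

Let weight_sum_integral x N : 1 <= x ->
  (\sum_(j < N) \int[mu]_(y in `[(x + j%:R)%R, (x + j.+1%:R)%R[) (weight y)%:E <=
   \int[mu]_(y in `[x, +oo[) (weight y)%:E)%E.
Proof.
move=> x1; have -> : (\sum_(j < N) \int[mu]_(y in `[(x + j%:R)%R, (x + j.+1%:R)%R[) (weight y)%:E = \int[mu]_(y in `[x, (x + N%:R)%R[) (weight y)%:E)%E.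
  elim: N => [|N IH]; first by rewrite big_ord0 addr0 set_itvco0 integral_set0. rewrite big_ord_recr/= IH -ge0_integral_setU//=.
  - by congr integral; rewrite -itv_bndbnd_setU// bnd_simp ?lerDl// lerD2l ler_nat.
  - exact: measurable_funTS.
  - move=> y /= h; rewrite lee_fin weight_ge0//. by case: h; rewrite in_itv/= => /andP[h _]; rewrite (le_trans _ h)// ?addr_ge0// (le_trans _ x1).
  - apply: lt_disjoint => y z /=; rewrite !in_itv/= => /andP[_ h] /andP[h' _]; exact: lt_le_trans h'.
apply: ge0_subset_integral => //.
- exact: measurable_funTS.
- by move=> y; rewrite /= in_itv/= andbT => xy; rewrite lee_fin weight_ge0// (le_trans _ xy)// (le_trans _ x1).
- by move=> y /=; rewrite !in_itv/= andbT => /andP[].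
Qed.

Lemma weight_integrable x : 1 <= x -> (\int[mu]_(y in `[x, +oo[) (weight y)%:E < +oo)%E.
Proof.
move=> x1; have [_ _] := Psi_fin_envelope1 (leqnn _) hn0; apply: le_lt_trans. have x0 : 0 <= x by rewrite (le_trans _ x1).
have mW : mfun (fun y => (envelope1 y * y ^+ n0.-1)%:E).
  apply/measurable_EFinP; apply: measurable_funM; first exact: measurable_envelope1. exact: measurable_funX.
apply: (@le_trans _ _ (\int[mu]_(y in `[x, +oo[) (envelope1 y * y ^+ n0.-1)%:E)%E).
  apply: ge0_le_integral => //.
  - by move=> y; rewrite /= in_itv/= andbT => xy; rewrite lee_fin weight_ge0// (le_trans _ xy).
  - exact: measurable_funTS.
  - exact: measurable_funTS.
  - move=> y; rewrite /= in_itv/= andbT => xy; rewrite lee_fin ler_wpM2l ?envelope1_ge0//. by apply: ler_weXn2l; [exact: le_trans xy|rewrite -!subn1 leq_sub2r].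
apply: ge0_subset_integral => //.
- exact: measurable_funTS.
- by move=> y; rewrite /= in_itv/= andbT => y0; rewrite lee_fin mulr_ge0 ?envelope1_ge0 ?exprn_ge0.
- by move=> y /=; rewrite !in_itv/= !andbT; exact: le_trans.
Qed.

Lemma tail_integralE x : 1 <= x ->
  (\int[mu]_(y in `[x, +oo[) (weight y)%:E = (tail_integral envelope1 (m%:Z - 1) x)%:E)%E.
Proof.
move=> x1; rewrite /tail_integral /Rintegral. have -> : (\int[mu]_(y in `[x, +oo[) (envelope1 y * y ^ (m%:Z - 1))%:E =
    \int[mu]_(y in `[x, +oo[) (weight y)%:E)%E.
  apply: eq_integral => y _; congr (_ * _)%:E. by rewrite (_ : m%:Z - 1 = m.-1%:Z)//; case: m m0 => // m' _; rewrite -addn1 PoszD addrK addn1.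
rewrite fineK// ge0_fin_numE; first exact: weight_integrable. apply: integral_ge0 => y; rewrite /= in_itv/= andbT => xy; rewrite lee_fin weight_ge0//.
by rewrite (le_trans _ xy)// (le_trans _ x1).
Qed.

Lemma tail_integral_le1 x : 1 <= x ->
  0 <= tail_integral envelope1 (m%:Z - 1) x <= tail_integral envelope1 (m%:Z - 1) 1.
Proof.
move=> x1; have w0 (y z : R) : 1 <= y -> `[y, +oo[%classic z -> (0 <= (weight z)%:E)%E.
  by move=> y1; rewrite /= in_itv/= andbT => yz; rewrite lee_fin weight_ge0// (le_trans _ yz)// (le_trans _ y1).
rewrite -!lee_fin -!tail_integralE//; apply/andP; split; first by apply: integral_ge0 => y; exact: w0. apply: ge0_subset_integral => //.
- exact: measurable_funS measurable_weight.
- by move=> y; exact: w0.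
- by move=> y; rewrite /= !in_itv/= !andbT; exact: le_trans.
Qed.

Lemma tail_series x : 1 <= x -> cvgn (series (tail_term x)) /\
  limn (series (tail_term x)) <= 2 ^+ m.-1 * tail_integral envelope1 (m%:Z - 1) x.
Proof.
move=> x1; have p2 : (0 : R) <= 2 ^+ m.-1 by rewrite exprn_ge0. have ub N : series (tail_term x) N <= 2 ^+ m.-1 * tail_integral envelope1 (m%:Z - 1) x.
  rewrite -lee_fin EFinM -tail_integralE// /series/= big_mkord -sumEFin. apply: le_trans (lee_wpmul2l _ (weight_sum_integral N x1)); last by rewrite lee_fin.
  rewrite ge0_sume_distrr; last first.
    move=> j _; apply: integral_ge0 => y; rewrite /= in_itv/= => /andP[h _]; rewrite lee_fin weight_ge0//.
    by rewrite (le_trans _ h)// addr_ge0// (le_trans _ x1).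
  by apply: lee_sum => j _; exact: tail_term_integral.
have cv : cvgn (series (tail_term x)).
  apply: nondecreasing_is_cvgn; last by exists (2 ^+ m.-1 * tail_integral envelope1 (m%:Z - 1) x) => _ [n _ <-].
  by apply/nondecreasing_seqP => n; rewrite /series/= big_nat_recr//= lerDl tail_term_ge0.
by split => //; apply: limr_le => //; apply: nearW.
Qed.

Lemma unit_step_const (F : R -> R) : (forall x a, 1 <= x -> 0 < a <= 1 -> F (x + a) = F x) ->
  forall y, 1 <= y -> F y = F 1.
Proof.
move=> h y y1; have y0 : 0 <= y - 1 by rewrite subr_ge0. have /andP[t1 t2] := truncn_itv y0; set i := Num.truncn (y - 1) in t1 t2.
have hi k : F (1 + k%:R) = F 1.
  elim: k => [|k IH]; first by rewrite addr0. by rewrite -natr1 addrA h ?IH ?lerDl// ltr01 lexx.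
have [a0|a0] := eqVneq (y - 1 - i%:R) 0.
  by rewrite (_ : y = 1 + i%:R) ?hi//; lra.
rewrite (_ : y = (1 + i%:R) + (y - 1 - i%:R)); last by ring. rewrite h ?hi ?lerDl//; apply/andP; split.
  by rewrite lt_neqAle eq_sym a0/=; lra.
by move: t2; rewrite -natr1; lra.
Qed.

Let diff2_tail x j a b : 1 <= x -> 0 < a <= 1 -> 0 < b <= 1 ->
  `|diff2 a b (x + j%:R)| * (1 + x + j%:R) <= tail_term x j.
Proof.
move=> x1 ha hb; rewrite /tail_term -!addrA; apply: envelope_bound => //. by rewrite (lt_le_trans ltr01)// (le_trans x1)// lerDl.
Qed.

Let diff2_tail1 x j a b : 1 <= x -> 0 < a <= 1 -> 0 < b <= 1 -> `|diff2 a b (x + j%:R)| <= tail_term x j.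
Proof.
move=> x1 ha hb; apply: le_trans (diff2_tail j x1 ha hb); rewrite ler_peMr//. by rewrite -addrA lerDl addr_ge0// (le_trans _ x1).
Qed.

Let diff2_cvg0 x a b : 1 <= x -> 0 < a <= 1 -> 0 < b <= 1 -> diff2 a b (x + j%:R) @[j --> \oo] --> (0 : R).
Proof.
move=> x1 ha hb; have [cv _] := tail_series x1. have c0 := cvg_series_cvg_0 cv.
have c0' : - tail_term x j @[j --> \oo] --> (0 : R) by rewrite -oppr0; exact: (@cvgN _ R^o). apply: (squeeze_cvgr _ c0' c0); apply: nearW => j.
by rewrite -ler_norml; exact: diff2_tail1.
Qed.

Let step r := f (r + 1) - f r.

Let one01 : 0 < (1 : R) <= 1. Proof. by rewrite ltr01 lexx. Qed.

Let step_diff x j : step (x + j.+1%:R) - step (x + j%:R) = diff2 1 1 (x + j%:R).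
Proof. by rewrite /step /diff2 -natr1 !addrA; ring. Qed.

Let V x := limn (series (tail_term x)).

Let tail_term_shift x i j : tail_term (x + i%:R) j = tail_term x (i + j).
Proof. by rewrite /tail_term natrD !addrA. Qed.

Let V_shift x i : 1 <= x -> V (x + i%:R) = V x - series (tail_term x) i.
Proof.
move=> x1; have [cv _] := tail_series x1; apply: cvg_lim => //.
have -> : series (tail_term (x + i%:R)) = (fun n => series (tail_term x) (n + i) - series (tail_term x) i).
  apply/funext => n; rewrite /series/= (@big_cat_nat _ _ _ i 0 (n + i))//= ?leq_addl// addrAC subrr add0r.
  rewrite -{2}[i]add0n big_addn addnK; apply: eq_bigr => j _; by rewrite tail_term_shift addnC.
apply: (@cvgB _ R^o); last exact: cvg_cst. by rewrite (cvg_shiftn i (series (tail_term x))).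
Qed.

Let V_cvg0 x : 1 <= x -> V (x + i%:R) @[i --> \oo] --> (0 : R).
Proof.
move=> x1; have [cv _] := tail_series x1; under eq_fun do rewrite V_shift//. by rewrite -(subrr (V x)); apply: (@cvgB _ R^o); [exact: cvg_cst|exact: cv].
Qed.

(** First differences along x + j converge because their increments are summable second differences.
    The limit is the same for all x, since second differences with an arbitrary step [a] in one slot
    also tend to 0. The factor 1 + r kept in the rate yields the extra factor [j], which the
    summation by parts in [linear_asymptotics] consumes. *)
Lemma step_limit : exists th, forall x, 1 <= x ->
  forall j, j%:R * `|step (x + j%:R) - th| <= V (x + j%:R).
Proof.
have lim x : 1 <= x -> exists l, step (x + j%:R) @[j --> \oo] --> l /\ (1 + x) * `|step x - l| <= V x.
  move=> x1; have [cv _] := tail_series x1; have x0 : 0 < 1 + x by rewrite addr_gt0// (lt_le_trans _ x1).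
  have hs j : `|step (x + j.+1%:R) - step (x + j%:R)| <= (1 + x)^-1 * tail_term x j.
    rewrite step_diff ler_pdivlMl//; apply: le_trans (diff2_tail j x1 one01 one01). by rewrite mulrC ler_wpM2l// lerDl.
  have cv' : series (fun j => (1 + x)^-1 * tail_term x j) @ \oo --> (1 + x)^-1 * V x.
    have -> : series (fun j => (1 + x)^-1 * tail_term x j) = (fun n => (1 + x)^-1 * series (tail_term x) n).
      by apply/funext => n; rewrite /series/= mulr_sumr.
    by apply: cvgM; [exact: cvg_cst|exact: cv].
  have [l hl] := summable_steps (u := fun j => step (x + j%:R)) hs (cvgP _ cv'). by rewrite (cvg_lim _ cv')// addr0 ler_pdivlMl// => h; exists l.
pose th x := limn (fun j => step (x + j%:R)). have hth x : 1 <= x -> step (x + j%:R) @[j --> \oo] --> th x /\ (1 + x) * `|step x - th x| <= V x.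
  by move=> x1; have [l [hl hV]] := lim x x1; rewrite /th (cvg_lim _ hl).
have thc := @unit_step_const th _. have {}thc y : 1 <= y -> th y = th 1.
  apply: thc => x a x1 ha; have /andP[a0 _] := ha. have x1a : 1 <= x + a by rewrite (le_trans x1)// lerDl ltW.
  have [h1 _] := hth x x1; have [h2 _] := hth _ x1a. have h3 := diff2_cvg0 x1 ha one01.
  apply/eqP; rewrite -subr_eq0; apply/eqP; apply: (cvg_unique _ _ h3) => //.
  have : step (x + a + j%:R) - step (x + j%:R) @[j --> \oo] --> th (x + a) - th x by apply: (@cvgB _ R^o).
  suff -> : (fun j => step (x + a + j%:R) - step (x + j%:R)) = (fun j => diff2 a 1 (x + j%:R)) by [].
  by apply/funext => j; rewrite /step /diff2 -!addrA [a + (j%:R + 1)]addrCA [a + j%:R]addrC; ring.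
exists (th 1) => x x1 j; have xj : 1 <= x + j%:R by rewrite (le_trans x1)// lerDl.
have [_ h] := hth _ xj; rewrite thc// in h; apply: le_trans h; rewrite ler_wpM2r//. by rewrite addrA lerDr addr_ge0// (le_trans _ x1).
Qed.

(** Summation by parts: lam(x + j) - j (step(x + j) - th) has increments -(j + 1) times a second
    difference, so it converges with an error given by the weighted tail. The limit L(x) has period
    1, is bounded on [1, 2] and hence everywhere, and has vanishing second differences for every
    step in (0, 1]. Along an arithmetic progression it is affine and bounded, therefore constant. *)
Theorem linear_asymptotics : exists th L, forall x, 1 <= x ->
  `|f x - x * th - L| <= 2 ^+ m.-1 * tail_integral envelope1 (m%:Z - 1) x.
Proof.
have [th hth] := step_limit; exists th. pose lam x := f x - x * th. have lim x : 1 <= x -> exists l, lam (x + j%:R) @[j --> \oo] --> l /\ `|lam x - l| <= V x.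
  move=> x1; have [cv _] := tail_series x1; have x0 : 0 <= x by rewrite (le_trans _ x1). pose u j := lam (x + j%:R) - j%:R * (step (x + j%:R) - th).
  have hu j : `|u j.+1 - u j| <= tail_term x j.
    have -> : u j.+1 - u j = - (j.+1%:R * diff2 1 1 (x + j%:R)).
      by rewrite /u /lam -step_diff /step -!natr1 !addrA; ring.
    rewrite normrN normrM ger0_norm// mulrC; apply: le_trans (diff2_tail j x1 one01 one01). by rewrite ler_wpM2l// -natr1; lra.
  have [l hl] := summable_steps hu cv; rewrite /u mul0r subr0 addr0 => hV. exists l; split => //.
  have z : j%:R * (step (x + j%:R) - th) @[j --> \oo] --> (0 : R).
    have c0 := V_cvg0 x1; have c0' : - V (x + j%:R) @[j --> \oo] --> (0 : R) by rewrite -oppr0; exact: (@cvgN _ R^o).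
    apply: (squeeze_cvgr _ c0' c0); apply: nearW => j; rewrite -ler_norml normrM ger0_norm//. exact: hth.
  have h : u j + j%:R * (step (x + j%:R) - th) @[j --> \oo] --> l + 0 by apply: (@cvgD _ R^o).
  rewrite addr0 in h; have e : (fun j => u j + j%:R * (step (x + j%:R) - th)) = (fun j => lam (x + j%:R)).
    by apply/funext => j; rewrite /u subrK.
  by rewrite e in h.
pose L x := limn (fun j => lam (x + j%:R)). have hL x : 1 <= x -> lam (x + j%:R) @[j --> \oo] --> L x /\ `|lam x - L x| <= V x.
  by move=> x1; have [l [hl hV]] := lim x x1; rewrite /L (cvg_lim _ hl).
have Lper x : 1 <= x -> L (x + 1) = L x.
  move=> x1; have [h _] := hL x x1; apply: cvg_lim => //. have -> : (fun j => lam (x + 1 + j%:R)) = (fun j => lam (x + (j + 1)%:R)).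
    by apply/funext => j; rewrite natrD -addrA [1 + _]addrC.
  by rewrite (cvg_shiftn 1 (fun j => lam (x + j%:R))).
have [B hB] : exists B, forall y, 1 <= y -> `|L y| <= B.
  have [M hM] := f_bounded 2; have wi := weight_integrable (lexx 1). exists (M + 2 * `|th| + 2 ^+ m.-1 * tail_integral envelope1 (m%:Z - 1) 1).
  have small y : 1 <= y <= 2 -> `|L y| <= M + 2 * `|th| + 2 ^+ m.-1 * tail_integral envelope1 (m%:Z - 1) 1.
    move=> /andP[y1 y2]; have [_ hy] := hL y y1; have [_ ht] := tail_series y1.
    have tm : tail_integral envelope1 (m%:Z - 1) y <= tail_integral envelope1 (m%:Z - 1) 1.
      rewrite -lee_fin -!tail_integralE//; apply: ge0_subset_integral => //.
      - exact: measurable_funTS.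
      - by move=> z; rewrite /= in_itv/= andbT => z1; rewrite lee_fin weight_ge0// (le_trans _ z1).
      - by move=> z /=; rewrite !in_itv/= !andbT; exact: le_trans.
    have -> : L y = lam y - (lam y - L y) by ring. apply: (le_trans (ler_normB _ _)); apply: lerD.
      apply: (le_trans (ler_normB _ _)); apply: lerD; first by apply: hM; rewrite y2 (lt_le_trans ltr01).
      by rewrite normrM ger0_norm ?ler_wpM2r// (le_trans _ y1).
    apply: (le_trans hy); apply: (le_trans ht); rewrite ler_wpM2l// exprn_ge0//.
  move=> y y1; have y0 : 0 <= y - 1 by rewrite subr_ge0. have /andP[t1 t2] := truncn_itv y0; set i := Num.truncn (y - 1) in t1 t2.
  have hi k z : 1 <= z -> L (z + k%:R) = L z.
    move=> z1; elim: k => [|k IH]; first by rewrite addr0. by rewrite -natr1 addrA Lper ?IH// (le_trans z1)// lerDl.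
  have z1 : 1 <= y - i%:R by lra. rewrite (_ : y = (y - i%:R) + i%:R); last by ring. by rewrite hi//; apply: small; rewrite z1/=; move: t2; rewrite -natr1; lra.
have Lc := @unit_step_const L _. exists (L 1) => x x1; have [_ h] := hL x x1; rewrite -(Lc _ x x1).
  by apply: (le_trans h); have [_] := tail_series x1.
move=> {h x1}{}x a x1 ha; have /andP[a0 _] := ha. have := @arithmetic_bounded R (fun n => L (x + n%:R * a)) B; rewrite mul1r mul0r addr0; apply.
  move=> n; pose y := x + n%:R * a; have y1 : 1 <= y by rewrite (le_trans x1)// lerDl mulr_ge0// ltW.
  have e1 : x + n.+1%:R * a = y + a by rewrite /y -natr1; ring. have e2 : x + n.+2%:R * a = y + a + a by rewrite /y -!natr1; ring.
  have y2 : 1 <= y + a by rewrite (le_trans y1)// lerDl ltW. have y3 : 1 <= y + a + a by rewrite (le_trans y2)// lerDl ltW.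
  rewrite e1 e2; apply/eqP; rewrite -subr_eq0; apply/eqP; apply: (cvg_unique _ _ (diff2_cvg0 y1 ha ha)) => //.
  have [h1 _] := hL _ y1; have [h2 _] := hL _ y2; have [h3 _] := hL _ y3.
  have h : lam (y + a + a + j%:R) - lam (y + a + j%:R) - (lam (y + a + j%:R) - lam (y + j%:R)) @[j --> \oo] --> L (y + a + a) - L (y + a) - (L (y + a) - L y).
    by apply: (@cvgB _ R^o); apply: (@cvgB _ R^o).
  have e j : lam (y + a + a + j%:R) - lam (y + a + j%:R) - (lam (y + a + j%:R) - lam (y + j%:R)) = diff2 a a (y + j%:R).
    rewrite /lam /diff2 (_ : y + a + a + j%:R = y + j%:R + a + a); last by ring. by rewrite (_ : y + a + j%:R = y + j%:R + a); [ring|ring].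
  by move: h; under eq_fun do rewrite e.
by move=> n; apply: hB; rewrite (le_trans x1)// lerDl mulr_ge0// ltW.
Qed.

End second_differences.

Lemma pow_sub1_le (R : realType) (u : R) (p : nat) : 0 <= u -> u <= 2 ->
  (1 + u) ^+ p - 1 <= u * (p%:R * 3 ^+ p).
Proof.
move=> u0 u2; elim: p => [|p IH]; first by rewrite expr0 subrr mul0r mulr0. have h1 : (1 + u) ^+ p <= 3 ^+ p by apply: lerXn2r; rewrite ?nnegrE; lra.
have h3 : 0 <= (3 : R) ^+ p by rewrite exprn_ge0. have h4 : 0 <= p%:R * 3 ^+ p :> R by rewrite mulr_ge0.
rewrite !exprS -natr1; move: ((1 + u) ^+ p) (3 ^+ p : R) (p%:R : R) h1 h3 h4 IH => x y z h1 h3 h4 IH. have : u * x <= u * y by rewrite ler_wpM2l.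
have : 0 <= u * (z * y) by rewrite mulr_ge0. have : 0 <= u * y by rewrite mulr_ge0. lra.
Qed.

(** For e <= 1/2, (1 + e)/(1 - e) <= 1 + 4e and the power is linearised by [pow_sub1_le]; for e >
    1/2 the constant is at least 2 and the inequality is trivial. The conclusion thus holds without
    smallness of [e]. *)
Lemma comparable_diff_le (R : realType) (E1 E2 e : R) (p n : nat) : 0 <= E1 -> 0 <= E2 -> (p <= n)%N -> (0 < n)%N ->
  0 <= e -> (e <= 1 / 2 -> E1 <= ((1 + e) / (1 - e)) ^+ p * E2 /\ E2 <= ((1 + e) / (1 - e)) ^+ p * E1) ->
  `|E1 - E2| <= 4 * (n%:R * 3 ^+ n) * e * (E1 + E2).
Proof.
move=> E10 E20 pn n0 e0 h; set K := 4 * (n%:R * 3 ^+ n). have K2 : 2 <= K.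
  have : 1 <= n%:R * 3 ^+ n :> R by rewrite -[leLHS]mulr1 ler_pM ?ler1n ?exprn_ege1//; lra. by rewrite /K; lra.
have S0 : 0 <= E1 + E2 by rewrite addr_ge0. have [e1|e1] := leP e (1 / 2); last first.
  apply: (@le_trans _ _ (E1 + E2)); first by rewrite ler_norml; lra. rewrite -[leLHS]mul1r ler_wpM2r//. have : 2 * e <= K * e by rewrite ler_wpM2r. lra.
have [h1 h2] := h e1; have e1' : 0 < 1 - e by lra. pose L := ((1 + e) / (1 - e)) ^+ p. have LK : L - 1 <= K * e.
  have u4 : (1 + e) / (1 - e) <= 1 + 4 * e.
    rewrite ler_pdivrMr//; have : 0 <= e * (1 / 2 - e) by rewrite mulr_ge0// subr_ge0. lra.
  apply: (@le_trans _ _ ((1 + 4 * e) ^+ p - 1)).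
    by rewrite lerD2r lerXn2r ?nnegrE// ?divr_ge0//; lra.
  apply: (le_trans (pow_sub1_le _ _ _)); [lra|lra|]. rewrite /K -!mulrA [leRHS]mulrC -!mulrA [e * _]mulrC -mulrA mulrA [leRHS]mulrA. rewrite -mulrA -mulrA.
  have : p%:R * 3 ^+ p <= n%:R * 3 ^+ n :> R.
    by apply: ler_pM; rewrite ?exprn_ge0// ?ler_nat// ler_weXn2l//; lra.
  move=> hpn; have := ler_wpM2r e0 hpn; lra.
have {}h1 : E1 <= L * E2 by []. have {}h2 : E2 <= L * E1 by []. have k1 : (L - 1) * E1 <= K * e * E1 by rewrite ler_wpM2r.
have k2 : (L - 1) * E2 <= K * e * E2 by rewrite ler_wpM2r. have e1'' : 0 <= K * e * E1 by rewrite !mulr_ge0//; lra.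
have e2'' : 0 <= K * e * E2 by rewrite !mulr_ge0//; lra. rewrite ler_norml; move: (K * e) k1 k2 e1'' e2'' => z k1 k2 e1'' e2''. by apply/andP; split; lra.
Qed.

Lemma limit_le (R : realType) (x y z : R) : 0 <= z -> (forall t, 0 < t -> x <= y + t * z) -> x <= y.
Proof.
move=> z0 h; apply/ler_addgt0Pr => t t0. have z1 : 0 < z + 1 by lra. apply: (le_trans (h (t / (z + 1)) _)); first by rewrite divr_gt0.
rewrite lerD2l mulrAC ler_pdivrMr// ler_wpM2l ?(ltW t0)//; lra.
Qed.

Lemma Rintegral_sum d (T : measurableType d) (R : realType)
    (P : probability T R) (I : finType) (A : {pred I}) (h : I -> T -> R) :
  (forall i, P.-integrable setT (EFin \o h i)) ->
  \int[P]_w (\sum_(i in A) h i w) = \sum_(i in A) \int[P]_w h i w.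
Proof.
move=> ih; elim: (index_enum I) => [|i l IH].
  by under eq_Rintegral do rewrite big_nil; rewrite big_nil Rintegral_cst// mul0r.
under eq_Rintegral do rewrite big_cons; rewrite big_cons; case: ifP => // _. rewrite -IH RintegralD//.
rewrite (_ : _ \o _ = fun w => (\sum_(j <- l | j \in A) (EFin \o h j) w)%E).
  by apply: integrable_sum => // j _; exact: ih.
by apply/funext => w /=; rewrite sumEFin.
Qed.

(** * The zero counts form a clustering counting field *)

Section zero_field.
Context d (T : measurableType d) (R : realType)
  (P : probability T R) (X : nat -> T -> R) (a : nat -> nat -> R).
Hypothesis mX : forall j, mfun (X j).
Hypothesis hX : std_normal_sums P X.
Hypothesis ra : regular_array X a.
Local Notation f := (gfun X a).
Local Notation g := (gder X a).
Variables V0 V1 : R.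
Hypothesis hV0 : centered_normal P (coef X a 0) V0.
Hypothesis V0_gt0 : 0 < V0.
Hypothesis hV1 : centered_normal P (coef X a 1) V1.
Hypothesis V1_gt0 : 0 < V1.
Hypothesis hV : forall x, exists2 V, centered_normal P (f ^~ x) V & 0 < V.
Local Notation N := (zcount X a).
Let good I s t r m := @good_set _ _ _ _ _ _ mX hX ra _ _ hV0 V0_gt0 hV1 V1_gt0 hV I s t r m.

Lemma zcount_finite_moment m s t : s < t -> finite_moment P 'I_m (N s t).
Proof.
move=> st; split; [exact: measurable_zcount|exact: zcount_ge0|]. have r0 : 0 < 1 + `|s| + `|t| by rewrite ltr_wpDr// ltr_wpDr.
have [D [G [mD D0 Di [mG PG] hG]]] := good (fun _ : unit => s) (fun=> t) r0 (ltn0Sn #|{: 'I_m}|).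
apply: le_lt_trans Di; rewrite -(integral_conull _ mG PG) -[leRHS](integral_conull _ mG PG). apply: ge0_le_integral => //.
- by move=> w _; rewrite lee_fin exprn_ge0// zcount_ge0.
- by apply/measurable_EFinP; apply: measurable_funTS; apply: measurable_funX; exact: measurable_zcount.
- exact: measurable_funTS.
move=> w /hG[hst [k pb kD]]; apply: le_trans kD; rewrite lee_fin. have [n1 n2] := hst tt.
have rs : - (1 + `|s| + `|t|) <= s by clear hst hG; have := ler_norm (- s); rewrite normrN; have := normr_ge0 t; lra.
have tr : t <= 1 + `|s| + `|t| by clear hst hG; have := ler_norm t; have := normr_ge0 s; lra. have [Z [_ _ sZ -> _]] := zcount_good pb rs st tr n1 n2.
apply: (@le_trans _ _ (k ^+ #|{: 'I_m}|)).
  by apply: lerXn2r; rewrite ?nnegrE// (le_trans _ sZ).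
by apply: ler_weXn2l => //; exact: path_bound_ge1 pb.
Qed.

Lemma zcount_additive s u t : s < u -> u < t -> ae_eq_fun P (N s t) (fun w => N s u w + N u t w).
Proof.
move=> su ut; pose r := 1 + `|s| + `|u| + `|t|. have r0 : 0 < r by rewrite /r !ltr_wpDr.
have [D [G [mD D0 Di [mG PG] hG]]] := good (fun i : bool => if i then s else u) (fun=> t) r0 (ltn0Sn 0). exists (~` G); split => //; first exact: measurableC.
move=> w /contrapT /hG[hst [k pb kD]]. have [fs ft] := hst true; have [fu _] := hst false. have [h1 [h2 h3]] : - r <= s /\ (- r <= u /\ u <= r).
  have := ler_norm (- s); have := ler_norm u; have := ler_norm (- u); rewrite !normrN.
  by have := normr_ge0 t; have := normr_ge0 u; have := normr_ge0 s; rewrite /r; lra.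
have h4 : t <= r by have := ler_norm t; have := normr_ge0 u; have := normr_ge0 s; rewrite /r; lra.
have [Z [uZ hZ _ -> _]] := zcount_good pb h1 (lt_trans su ut) h4 fs ft. have [Z1 [uZ1 hZ1 _ -> _]] := zcount_good pb h1 su h3 fs fu.
have [Z2 [uZ2 hZ2 _ -> _]] := zcount_good pb h2 ut h4 fu ft. rewrite -natrD -size_cat; congr (_%:R); apply/perm_size/uniq_perm => //.
  rewrite cat_uniq uZ1 uZ2 andbT; apply/hasPn => z /hZ2[/andP[uz _] fz]; apply/negP => /hZ1[/andP[_ zu] _].
  by move: fu; rewrite (@le_anti _ _ u z) ?uz ?zu// fz eqxx.
move=> z; rewrite mem_cat; apply/idP/orP => [/hZ[/andP[sz zt] fz]|[/hZ1|/hZ2] [/andP[h h'] fz]].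
- by have [zu|/ltW uz] := leP z u; [left; apply/hZ1|right; apply/hZ2]; split => //; apply/andP.
- by apply/hZ; split => //; rewrite h (le_trans h')// ltW.
- by apply/hZ; split => //; rewrite h' andbT (le_trans _ h)// ltW.
Qed.

Lemma zcount_counting r : 0 < r -> exists B, [/\ measurable B, P B = 0%E &
  forall w, ~ B w -> counting [set x | 0 <= x <= r /\ f w x = 0] = (N 0 r w)%:E].
Proof.
move=> r0; have [D [G [mD D0 Di [mG PG] hG]]] := good (fun _ : unit => 0) (fun=> r) r0 (ltn0Sn 0). exists (~` G); split => //; first exact: measurableC.
move=> w /contrapT /hG[hst [k pb kD]]; have [n1 n2] := hst tt. have rr : - r <= 0 by rewrite oppr_le0 ltW.
have [Z [uZ hZ _ -> _]] := zcount_good pb rr r0 (lexx _) n1 n2. rewrite /counting (_ : [set x | _] = [set` Z]); last by apply/seteqP; split => x /= /hZ.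
rewrite asboolT; last exact: finite_seq. congr (_%:R%:E); apply/perm_size/uniq_perm => //. move=> x; apply: (etrans (in_fset_set (finite_seq Z) x)).
by apply/idP/idP; rewrite inE.
Qed.

Lemma jet_integrable (I : finType) (x : I -> R) i j :
  P.-integrable setT (EFin \o (fun w => jet X a x i w * jet X a x j w)).
Proof.
have h (k : I * bool) : exists V, centered_normal P (jet X a x k) V.
  have [V hV'] := jet_normal mX hX ra x (fun l => (l == k)%:R); exists V. rewrite (_ : jet X a x k = fun w => \sum_l (l == k)%:R * jet X a x l w)//.
  by apply/funext => w; rewrite (bigD1 k)//= eqxx mul1r big1 ?addr0// => l /negbTE ->; rewrite mul0r.
have [Vi hi] := h i; have [Vj hj] := h j; exact: centered_normal_integrable hi hj.
Qed.

Lemma jet_bilinear (I : finType) (x : I -> R) (c : I * bool -> R) (A B : {pred I * bool}) :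
  \int[P]_w ((\sum_(i in A) c i * jet X a x i w) * (\sum_(j in B) c j * jet X a x j w)) =
  \sum_(i in A) \sum_(j in B) c i * c j * jet_cov P X a x i j.
Proof.
have ij i j : P.-integrable setT (EFin \o (fun w => c i * c j * (jet X a x i w * jet X a x j w))).
  rewrite (_ : _ \o _ = fun w => ((c i * c j)%:E * (EFin \o (fun w => jet X a x i w * jet X a x j w)%R) w)%E)//.
  exact: (integrableZl measurableT _ (jet_integrable x i j)).
have isum (J : {pred I * bool}) i : P.-integrable setT (EFin \o (fun w => \sum_(j in J) c i * c j * (jet X a x i w * jet X a x j w))).
  rewrite (_ : _ \o _ = fun w => (\sum_(j in J) (EFin \o (fun w => c i * c j * (jet X a x i w * jet X a x j w))%R) w)%E).
    by apply: integrable_sum => // j _; exact: ij.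
  by apply/funext => w /=; rewrite sumEFin.
under eq_Rintegral => w _.
  rewrite mulr_suml; under eq_bigr => i _.
    rewrite mulr_sumr; under eq_bigr => j _ do rewrite mulrACA. over.
  over.
rewrite Rintegral_sum//; apply: eq_bigr => i _; rewrite Rintegral_sum//; apply: eq_bigr => j _. by rewrite RintegralZl//; exact: jet_integrable.
Qed.

Section cluster_estimate.
Variables (n : nat) (tau : R) (phi : R -> R).
Hypothesis phi_ge0 : forall x, 2 * tau <= x -> 0 <= phi x.
Hypothesis hclus : forall (I : finType) (S : {set I}) (xi x y : I -> R) (dd : R), (#|I| <= n)%N ->
  S != finset.set0 -> ~: S != finset.set0 -> 2 * tau <= dd ->
  (forall i j, i \in S -> j \in ~: S -> dd <= `|xi i - xi j|) ->
  let L (A : {set I}) w := \sum_(i in A) (x i * f w (xi i) + y i * g w (xi i)) in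
  `|\int[P]_w (L S w * L (~: S) w)| <= phi dd * (\int[P]_w (L S w * L S w) + \int[P]_w (L (~: S) w * L (~: S) w)).

(** The two forms differ by twice the cross covariance of the groups, and the block-diagonal form is
    the sum of the two variances, so the cluster hypothesis is precisely a relative bound between
    the forms. *)
Lemma split_form_close (I : finType) (S : {set I}) (xi : I -> R) (dd : R) (c : I * bool -> R) : (#|I| <= n)%N ->
  S != finset.set0 -> ~: S != finset.set0 -> 2 * tau <= dd ->
  (forall i j, i \in S -> j \in ~: S -> dd <= `|xi i - xi j|) ->
  0 <= qform (split_cov P X a S xi) c /\
  `|qform (jet_cov P X a xi) c - qform (split_cov P X a S xi) c| <= 2 * phi dd * qform (split_cov P X a S xi) c.
Proof.
move=> In S0 S1 hd hxi. have := hclus (fun i => c (i, false)) (fun i => c (i, true)) In S0 S1 hd hxi; cbv zeta.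
pose L (A : {set I}) w := \sum_(i in A) (c (i, false) * f w (xi i) + c (i, true) * g w (xi i)). rewrite -/(L S) -/(L (~: S)).
pose pr (A : {set I}) : {pred I * bool} := [pred ib | ib.1 \in A]. have LE (A : {set I}) w : L A w = \sum_(ib in pr A) c ib * jet X a xi ib w.
  rewrite /L (eq_bigr (fun i => \sum_(b : bool) c (i, b) * jet X a xi (i, b) w)); last first.
    by move=> i _; rewrite big_bool/= addrC.
  by rewrite pair_big_dep/=; apply: eq_big => [[i b]|[i b] _] //=; rewrite andbT.
have cov (A B : {set I}) : \int[P]_w (L A w * L B w) = \sum_(i in pr A) \sum_(j in pr B) c i * c j * jet_cov P X a xi i j.
  by rewrite -jet_bilinear; apply: eq_Rintegral => w _; rewrite !LE.
rewrite !cov; set SS := \sum_(i in pr S) \sum_(j in pr S) _. set ST := \sum_(i in pr S) \sum_(j in pr (~: S)) _.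
set TT := \sum_(i in pr (~: S)) \sum_(j in pr (~: S)) _. have TS : \sum_(i in pr (~: S)) \sum_(j in pr S) c i * c j * jet_cov P X a xi i j = ST.
  rewrite exchange_big/=; apply: eq_bigr => i _; apply: eq_bigr => j _. by rewrite jet_covC [c j * _]mulrC.
have split_sum (F : I * bool -> R) : \sum_i F i = \sum_(i in pr S) F i + \sum_(i in pr (~: S)) F i.
  rewrite (bigID (mem (pr S)))/=; congr (_ + _). by apply: eq_bigl => i; rewrite !inE.
have -> : qform (jet_cov P X a xi) c = SS + ST + (ST + TT).
  rewrite /qform split_sum -[in X in _ = _ + (X + _)]TS -!big_split/=. by congr (_ + _); apply: eq_bigr => i _; rewrite split_sum.
have -> : qform (split_cov P X a S xi) c = SS + TT.
  rewrite /qform split_sum; congr (_ + _); apply: eq_bigr => i; rewrite inE => iS.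
    rewrite split_sum [X in _ + X]big1 ?addr0; last first.
      by move=> j; rewrite inE finset.in_setC /split_cov iS => /negbTE ->; rewrite mulr0.
    by apply: eq_bigr => j; rewrite inE /split_cov iS => ->.
  move: iS; rewrite finset.in_setC => /negbTE iS. rewrite split_sum [X in X + _]big1 ?add0r; last first.
    by move=> j; rewrite inE /split_cov iS => ->; rewrite mulr0.
  by apply: eq_bigr => j; rewrite inE finset.in_setC /split_cov iS => /negbTE ->.
have -> : SS + ST + (ST + TT) - (SS + TT) = 2 * ST by ring. rewrite normrM normr_nat => h; split; last by rewrite -mulrA ler_wpM2l.
by rewrite /SS /TT -!cov addr_ge0//; apply: Rintegral_ge0 => w _; rewrite -expr2 sqr_ge0.
Qed.

Lemma zcount_decoupling (I : finType) (S : {set I}) (s t : I -> R) (dd : R) : (#|I| <= n)%N ->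
  S != finset.set0 -> ~: S != finset.set0 -> 2 * tau <= dd -> (forall i, s i < t i) ->
  (forall i j, i \in S -> j \in ~: S -> t i + dd <= s j) ->
  let J := joint_moment P (fun i => N (s i) (t i)) in
  `|J finset.setT - J S * J (~: S)| <=
    4 * (n%:R * 3 ^+ n) * (2 * phi dd) * (J finset.setT + J S * J (~: S)).
Proof.
move=> In S0 S1 hd st hst; cbv zeta; set J := joint_moment P _; set K := 4 * (n%:R * 3 ^+ n). have K0 : 0 <= K by rewrite !mulr_ge0.
have J0 A : 0 <= J A by apply: Rintegral_ge0 => w _; apply: prodr_ge0 => i _; exact: zcount_ge0. have n0 : (0 < n)%N.
  by apply: leq_trans In; have /finset.set0Pn[i _] := S0; apply/card_gt0P; exists i.
have JE (A : {set I}) : (\int[P]_w (\prod_(i in A) N (s i) (t i) w)%:E = (J A)%:E)%E.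
  rewrite /J /Rintegral fineK//; apply: integrable_fin_num => //. have e0 : #|{: I}| = #|{: 'I_#|{: I}|}| by rewrite card_ord.
  apply: (joint_moment_integrable (Y := fun i => N (s i) (t i))) => i. have [h1 h2 h3] := zcount_finite_moment #|{: I}| (st i); split => //.
  by move: h3; rewrite card_ord.
pose r := 1 + \sum_i (`|s i| + `|t i|). have r0 : 0 < r by rewrite ltr_wpDr// sumr_ge0// => i _; rewrite addr_ge0.
have box i : [/\ - r <= s i, s i < t i & t i <= r].
  have : `|s i| + `|t i| <= r.
    by rewrite /r (bigD1 i)//= addrCA lerDl addr_ge0// sumr_ge0// => j _; rewrite addr_ge0.
  move: (st i); have := ler_norm (- s i); have := ler_norm (t i); rewrite normrN. by have := normr_ge0 (s i); have := normr_ge0 (t i) => *; split => //; lra.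
have phi0 := phi_ge0 hd. have JJ : 0 <= J finset.setT + J S * J (~: S) by rewrite addr_ge0// mulr_ge0.
(* The Gaussian comparison wants a strictly positive error whereas [phi dd] may vanish; a positive
   [e] is added and then sent to 0. *)
apply: (limit_le (z := K * (J finset.setT + J S * J (~: S)))) => [|e e0]; first by rewrite mulr_ge0.
rewrite (_ : _ + e * _ = K * (2 * phi dd + e) * (J finset.setT + J S * J (~: S))); last by ring.
apply: (comparable_diff_le (p := #|I|)) => //; rewrite ?mulr_ge0//; first by rewrite addr_ge0 ?(ltW e0)// mulr_ge0. move=> e1.
have e2 : 0 < 2 * phi dd + e by lra. have := @kac_comparison_cluster _ _ _ _ _ _ mX hX ra _ _ hV0 V0_gt0 hV1 V1_gt0 hV I s t r r0 box S _ e2 e1. case.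
  move=> x hx c. have hS i j : i \in S -> j \in ~: S -> dd <= `|x i - x j|.
    move=> iS jS; have := hst i j iS jS; have /andP[_ h1] := hx i; have /andP[h2 _] := hx j => h3. by rewrite distrC; apply: le_trans (ler_norm _); lra.
  have [q0 hq] := split_form_close c In S0 S1 hd hS; apply: (le_trans hq). by rewrite ler_wpM2r// lerDl ltW.
have -> : (\int[P]_w (\prod_i N (s i) (t i) w)%:E = (J finset.setT)%:E)%E.
  by rewrite -JE; apply: eq_integral => w _; congr (_%:E); apply: eq_bigl => i; rewrite finset.in_setT.
by rewrite !JE -EFinM -!EFinM !lee_fin.
Qed.

(** Moments over a subset [C] become full moments once [C] is re-indexed by its enumeration, so the
    two-group decoupling applies. *)
Lemma zcount_clustering m (s t : 'I_m -> R) (C A : {set 'I_m}) (dd : R) : (m <= n)%N ->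
  (forall i, s i < t i) -> 2 * tau <= dd ->
  (forall i j, i \in A -> j \notin A -> t i + dd <= s j) ->
  C :&: A != finset.set0 -> C :\: A != finset.set0 ->
  let J := joint_moment P (fun i => N (s i) (t i)) in
  `|J C - J (C :&: A) * J (C :\: A)| <=
    4 * (n%:R * 3 ^+ n) * (2 * phi dd) * (J C + J (C :&: A) * J (C :\: A)).
Proof.
move=> mn st hd hst CA0 CA1; cbv zeta; set J := joint_moment P _.
have Cn : (#|{: 'I_#|C|}| <= n)%N by rewrite card_ord (leq_trans _ mn)// -[leqRHS](card_ord m) max_card. pose v (k : 'I_#|C|) : 'I_m := enum_val k.
pose S : {set 'I_#|C|} := finset.finset (fun k => v k \in A). have vS k : (k \in S) = (v k \in A) by rewrite finset.in_set.
have JE (B : {set 'I_m}) (S' : {set 'I_#|C|}) : (forall k, (k \in S') = (v k \in B)) -> joint_moment P (fun k => N (s (v k)) (t (v k))) S' = J (C :&: B).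
  move=> hB; apply: eq_Rintegral => w _. rewrite (eq_bigl (fun i => (i \in C) && (i \in B))); last by move=> i; rewrite finset.in_setI.
  by rewrite big_enum_val_cond; apply: eq_bigl => k; exact: hB.
have JT : joint_moment P (fun k => N (s (v k)) (t (v k))) finset.setT = J C.
  by rewrite (JE finset.setT) ?finset.setIT// => k; rewrite !finset.in_setT.
have JC : joint_moment P (fun k => N (s (v k)) (t (v k))) (~: S) = J (C :\: A).
  by rewrite (JE (~: A)) -?finset.setDE// => k; rewrite !finset.in_setC vS.
have ex (B : {set 'I_m}) (S' : {set 'I_#|C|}) : (forall k, (k \in S') = (v k \in B)) -> C :&: B != finset.set0 -> S' != finset.set0.
  move=> hB /finset.set0Pn[i]; rewrite finset.in_setI => /andP[iC iB]; apply/finset.set0Pn. by exists (enum_rank_in iC i); rewrite hB /v enum_rankK_in.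
have S0 : S != finset.set0 by exact: (ex A). have S1 : ~: S != finset.set0.
  by apply: (ex (~: A)); rewrite -?finset.setDE// => k; rewrite !finset.in_setC vS.
have := @zcount_decoupling _ S (fun k => s (v k)) (fun k => t (v k)) dd Cn S0 S1 hd (fun k => st _).
cbv zeta; rewrite JT JC (JE A S vS); apply => i j; rewrite finset.in_setC !vS; exact: hst.
Qed.

End cluster_estimate.
End zero_field.

(** * Taylor expansion from complex differentiability *)

Section complex_analysis.
Import mathcomp.real_closed.complex ComplexField.
Local Open Scope complex_scope.

(** * Goursat's theorem on rectangles, in real form *)

Section goursat.
Variable R : realType.
Local Notation mu := (@lebesgue_measure R).

Definition total_diff (u : R -> R -> R) (s0 t0 A B : R) :=
  forall e : R, 0 < e -> exists2 d : R, 0 < d & forall s t, `|s - s0| <= d -> `|t - t0| <= d ->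
    `|u s t - u s0 t0 - (A * (s - s0) + B * (t - t0))| <= e * (`|s - s0| + `|t - t0|).

(** The outward flux of the field (p, -q) through the boundary of a rectangle; it vanishes when the
    s-derivative of [p] equals the t-derivative of [q]. *)
Definition rect_int (p q : R -> R -> R) (s t h k : R) :=
  \int[mu]_(y in `[t, t + k]) (p (s + h) y - p s y) -
  \int[mu]_(x in `[s, s + h]) (q x (t + k) - q x t).

Section green.
Variables (p q : R -> R -> R).
Hypothesis cp : forall s, continuous (p s).
Hypothesis cq : forall t, continuous (q ^~ t).

Let cpB s s' : continuous (fun y => p s y - p s' y).
Proof. by move=> y; apply: cvgB; exact: cp. Qed.
Let cqB t t' : continuous (fun x => q x t - q x t').
Proof. by move=> y; apply: cvgB; exact: cq. Qed.

Lemma rect_int_split s t h k : 0 <= h -> 0 <= k ->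
  rect_int p q s t h k =
  rect_int p q s t (h / 2) (k / 2) + rect_int p q (s + h / 2) t (h / 2) (k / 2) +
  (rect_int p q s (t + k / 2) (h / 2) (k / 2) + rect_int p q (s + h / 2) (t + k / 2) (h / 2) (k / 2)).
Proof.
move=> h0 k0; rewrite /rect_int. have hh (a b : R) : a + b / 2 + b / 2 = a + b by lra. rewrite !hh. have h2 : h / 2 <= h by lra. have k2 : k / 2 <= k by lra.
have -> : \int[mu]_(y in `[t, t + k]) (p (s + h) y - p s y) = \int[mu]_(y in `[t, t + k / 2]) (p (s + h) y - p s y) +
    \int[mu]_(y in `[t + k / 2, t + k]) (p (s + h) y - p s y).
  by apply: Rint_split; [lra|lra|exact: cpB].
have -> : \int[mu]_(x in `[s, s + h]) (q x (t + k) - q x t) = \int[mu]_(x in `[s, s + h / 2]) (q x (t + k) - q x t) +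
    \int[mu]_(x in `[s + h / 2, s + h]) (q x (t + k) - q x t).
  by apply: Rint_split; [lra|lra|exact: cqB].
have e1 a b u v w : \int[mu]_(y in `[a, b]) (p u y - p v y) = \int[mu]_(y in `[a, b]) (p u y - p w y) + \int[mu]_(y in `[a, b]) (p w y - p v y).
  rewrite -RintD; [|exact: cpB|exact: cpB]. by apply: eq_Rintegral => y _; rewrite addrA subrK.
have e2 a b u v w : \int[mu]_(x in `[a, b]) (q x u - q x v) = \int[mu]_(x in `[a, b]) (q x u - q x w) + \int[mu]_(x in `[a, b]) (q x w - q x v).
  rewrite -RintD; [|exact: cqB|exact: cqB]. by apply: eq_Rintegral => y _; rewrite addrA subrK.
rewrite (e1 t _ (s + h) s (s + h / 2)) (e1 (t + k / 2) _ (s + h) s (s + h / 2)).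
rewrite (e2 s _ (t + k) t (t + k / 2)) (e2 (s + h / 2) _ (t + k) t (t + k / 2)). ring.
Qed.

Lemma rect_int_small s0 t0 A B C e d s t h k : 0 <= e -> 0 <= h -> 0 <= k ->
  (forall s t, `|s - s0| <= d -> `|t - t0| <= d ->
    `|p s t - p s0 t0 - (A * (s - s0) + B * (t - t0))| <= e * (`|s - s0| + `|t - t0|)) ->
  (forall s t, `|s - s0| <= d -> `|t - t0| <= d ->
    `|q s t - q s0 t0 - (C * (s - s0) + A * (t - t0))| <= e * (`|s - s0| + `|t - t0|)) ->
  h <= d -> k <= d -> s <= s0 <= s + h -> t <= t0 <= t + k ->
  `|rect_int p q s t h k| <= 4 * e * (h + k) ^+ 2.
Proof.
move=> e0 h0 k0 hp hq hd kd /andP[s1 s2] /andP[t1 t2]. have near_s x : s <= x <= s + h -> `|x - s0| <= h by move=> /andP[? ?]; rewrite ler_norml; lra.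
have near_t y : t <= y <= t + k -> `|y - t0| <= k by move=> /andP[? ?]; rewrite ler_norml; lra.
have es x y : s <= x <= s + h -> t <= y <= t + k -> e * (`|x - s0| + `|y - t0|) <= e * (h + k).
  by move=> hx hy; apply: ler_wpM2l => //; apply: lerD; [exact: near_s|exact: near_t].
have sh : s <= s + h <= s + h by rewrite lexx andbT; lra. have ss : s <= s <= s + h by rewrite lexx; lra.
have tk : t <= t + k <= t + k by rewrite lexx andbT; lra. have tt : t <= t <= t + k by rewrite lexx; lra.
have bp : `|\int[mu]_(y in `[t, t + k]) (p (s + h) y - p s y) - A * h * k| <= 2 * (e * (h + k)) * k.
  have -> : A * h * k = \int[mu]_(y in `[t, t + k]) (A * h).
    by rewrite Rint_cst ?lerDl//; congr (_ * _); lra.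
  have cc : continuous (fun _ : R => A * h) by move=> ?; exact: cvg_cst.
  rewrite -RintB//; have kE : 2 * (e * (h + k)) * k = 2 * (e * (h + k)) * (t + k - t) by ring.
  rewrite kE; apply: Rint_bound; [lra|by move=> y; apply: cvgB; [exact: cpB|exact: cc]|]. move=> y ty.
  have h1 := hp (s + h) y (le_trans (near_s _ sh) hd) (le_trans (near_t _ ty) kd). have h2 := hp s y (le_trans (near_s _ ss) hd) (le_trans (near_t _ ty) kd).
  have h3 := es _ _ sh ty; have h4 := es _ _ ss ty. have {h1} := le_trans h1 h3; have {h2} := le_trans h2 h4.
  by rewrite !ler_norml => /andP[? ?] /andP[? ?]; lra.
have bq : `|\int[mu]_(x in `[s, s + h]) (q x (t + k) - q x t) - A * k * h| <= 2 * (e * (h + k)) * h.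
  have -> : A * k * h = \int[mu]_(x in `[s, s + h]) (A * k).
    by rewrite Rint_cst ?lerDl//; congr (_ * _); lra.
  have cc : continuous (fun _ : R => A * k) by move=> ?; exact: cvg_cst.
  rewrite -RintB//; have hE : 2 * (e * (h + k)) * h = 2 * (e * (h + k)) * (s + h - s) by ring.
  rewrite hE; apply: Rint_bound; [lra|by move=> y; apply: cvgB; [exact: cqB|exact: cc]|]. move=> x sx.
  have h1 := hq x (t + k) (le_trans (near_s _ sx) hd) (le_trans (near_t _ tk) kd). have h2 := hq x t (le_trans (near_s _ sx) hd) (le_trans (near_t _ tt) kd).
  have h3 := es _ _ sx tk; have h4 := es _ _ sx tt. have {h1} := le_trans h1 h3; have {h2} := le_trans h2 h4.
  by rewrite !ler_norml => /andP[? ?] /andP[? ?]; lra.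
rewrite /rect_int; set I := \int[mu]_(y in _) _ in bp *; set J := \int[mu]_(x in _) _ in bq *. have -> : I - J = (I - A * h * k) - (J - A * k * h) by ring.
apply: (le_trans (ler_normB _ _)); apply: (le_trans (lerD bp bq)). have -> : 2 * (e * (h + k)) * k + 2 * (e * (h + k)) * h = 2 * e * (h + k) ^+ 2 by ring.
by apply: ler_wpM2r; [exact: sqr_ge0|lra].
Qed.

Lemma four_split (a b c d : R) : exists2 x, x \in [:: a; b; c; d] & `|a + b + (c + d)| / 4 <= `|x|.
Proof.
apply: contrapT => h. have hx x : x \in [:: a; b; c; d] -> `|x| < `|a + b + (c + d)| / 4.
  by move=> xi; rewrite ltNge; apply/negP => ?; apply: h; exists x.
have ha := hx a; have hb := hx b; have hc := hx c; have hd := hx d. rewrite !inE !eqxx ?orbT in ha hb hc hd.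
have := ler_normD (a + b) (c + d); have := ler_normD a b; have := ler_normD c d. have := ha isT; have := hb isT; have := hc isT; have := hd isT; lra.
Qed.

(** Repeated quartering keeps a quarter carrying at least a fourth of the flux, and the quarters
    shrink to a point. The coefficient [A] common to both differentials there is the Cauchy-Riemann
    equation: it cancels the linear parts, and what remains is small compared with the area. *)
Lemma goursat a c L M : 0 < L -> 0 < M ->
  (forall s t, a <= s <= a + L -> exists A B C, total_diff p s t A B /\ total_diff q s t C A) ->
  rect_int p q a c L M = 0.
Proof.
move=> L0 M0 hd; pose h n : R := L / 2 ^+ n; pose k n : R := M / 2 ^+ n. have h0 n : 0 < h n by rewrite divr_gt0// exprn_gt0.
have k0 n : 0 < k n by rewrite divr_gt0// exprn_gt0. have hS n : h n.+1 = h n / 2.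
  by rewrite /h exprS; field; have : (2 : R) ^+ n != 0 by rewrite expf_neq0.
have kS n : k n.+1 = k n / 2.
  by rewrite /k exprS; field; have : (2 : R) ^+ n != 0 by rewrite expf_neq0.
pose J n (x : R * R) := rect_int p q x.1 x.2 (h n) (k n). have step (nx : nat * (R * R)) : exists y : R * R, [/\ `|J nx.1 nx.2| / 4 <= `|J nx.1.+1 y|,
    nx.2.1 <= y.1 <= nx.2.1 + h nx.1.+1 & nx.2.2 <= y.2 <= nx.2.2 + k nx.1.+1].
  case: nx => n [s t] /=; rewrite {1}/J/= rect_int_split ?(ltW (h0 n)) ?(ltW (k0 n))//. have hn := ltW (h0 n); have kn := ltW (k0 n).
  have hn1 := ltW (h0 n.+1); have kn1 := ltW (k0 n.+1). have [x xi xh] := four_split (rect_int p q s t (h n / 2) (k n / 2))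
   (rect_int p q (s + h n / 2) t (h n / 2) (k n / 2)) (rect_int p q s (t + k n / 2) (h n / 2) (k n / 2))
   (rect_int p q (s + h n / 2) (t + k n / 2) (h n / 2) (k n / 2)).
  rewrite !inE in xi; rewrite /J hS kS. case/or4P: xi xh => /eqP -> xh; [exists (s, t)|exists (s + h n / 2, t)|
    exists (s, t + k n / 2)|exists (s + h n / 2, t + k n / 2)]; split=> //=; rewrite ?lexx ?andbT ?lerDl//; lra.
have [F hF] := choice step. pose S := fix S n := if n is m.+1 then F (m, S m) else (a, c). have SJ n : `|J 0%N (a, c)| / 4 ^+ n <= `|J n (S n)|.
  elim: n => [|n IH]; first by rewrite expr0 divr1. have [+ _ _] := hF (n, S n); apply: le_trans => /=.
  rewrite exprS invfM mulrCA mulrC; apply: ler_wpM2r => //; lra.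
have nest (f : nat -> R) (l : nat -> R) : (forall n, l n.+1 = l n / 2) -> (forall n, 0 < l n) ->
    (forall n, f n <= f n.+1 <= f n + l n.+1) -> exists x, forall n, f n <= x <= f n + l n.
  move=> lS l0 fS. have inc m n : (m <= n)%N -> f m <= f n.
    elim: n => [|n IH]; first by rewrite leqn0 => /eqP ->. rewrite leq_eqVlt ltnS => /predU1P[->//|/IH]; move=> /le_trans; apply. by case/andP: (fS n).
  have dec m n : (m <= n)%N -> f n + l n <= f m + l m.
    elim: n => [|n IH]; first by rewrite leqn0 => /eqP ->. rewrite leq_eqVlt ltnS => /predU1P[->//|/IH]; apply: le_trans.
    by case/andP: (fS n) => _; rewrite lS; lra.
  have bd m n : f m <= f n + l n.
    have [mn|/ltnW nm] := leqP m n.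
      by apply: (le_trans (inc _ _ mn)); rewrite lerDl ltW.
    by apply: le_trans (dec _ _ nm); rewrite lerDl ltW.
  exists (reals.sup (range f)) => n; apply/andP; split.
    by apply: ub_le_sup; [exists (f 0%N + l 0%N) => _ [m _ <-]; exact: bd|exists n].
  by apply: ge_sup; [exists (f 0%N); exists 0%N|move=> _ [m _ <-]; exact: bd].
have [s0 hs0] : exists x, forall n, (S n).1 <= x <= (S n).1 + h n.
  by apply: nest => // n; have [] := hF (n, S n).
have [t0 ht0] : exists x, forall n, (S n).2 <= x <= (S n).2 + k n.
  by apply: nest => // n; have [] := hF (n, S n).
have as0 : a <= s0 <= a + L by have := hs0 0%N; rewrite /h expr0 divr1. have [A [B [C [dp dq]]]] := hd s0 t0 as0.
apply/eqP; rewrite -normr_le0; apply/ler_addgt0Pl => e e0; rewrite addr0. pose e' := e / (4 * (L + M) ^+ 2).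
have LM2 : 0 < 4 * (L + M) ^+ 2 by rewrite mulr_gt0// exprn_gt0// addr_gt0. have e'0 : 0 < e' by rewrite divr_gt0.
have [d1 d10 hd1] := dp _ e'0; have [d2 d20 hd2] := dq _ e'0. pose d := Num.min d1 d2. have d0 : 0 < d by rewrite lt_min d10.
have [n [hn kn]] : exists n, h n <= d /\ k n <= d.
  have := @cvg_expr R (2^-1); rewrite ger0_norm ?invr_ge0// invf_lt1// ltr1n => /(_ isT).
  move=> /cvgrPdist_lt/(_ (d / (L + M))); rewrite divr_gt0// ?addr_gt0// => /(_ isT)[N _ hN]. exists N; have := hN N (leqnn _) => /=.
  rewrite sub0r normrN ger0_norm; last by rewrite exprn_ge0// invr_ge0. rewrite exprVn ltr_pdivlMr ?addr_gt0// mulrDr.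
  have l1 := h0 N; have l2 := k0 N; move: l1 l2; rewrite /h /k ![_ / 2 ^+ N]mulrC. by move=> ? ? ?; split; lra.
have hd1' s t : `|s - s0| <= d -> `|t - t0| <= d -> `|p s t - p s0 t0 - (A * (s - s0) + B * (t - t0))| <= e' * (`|s - s0| + `|t - t0|).
  by rewrite /d !le_min => /andP[? _] /andP[? _]; exact: hd1.
have hd2' s t : `|s - s0| <= d -> `|t - t0| <= d -> `|q s t - q s0 t0 - (C * (s - s0) + A * (t - t0))| <= e' * (`|s - s0| + `|t - t0|).
  by rewrite /d !le_min => /andP[_ ?] /andP[_ ?]; exact: hd2.
have H : `|J n (S n)| <= 4 * e' * (h n + k n) ^+ 2.
  exact: (rect_int_small (ltW e'0) (ltW (h0 n)) (ltW (k0 n)) hd1' hd2' hn kn (hs0 n) (ht0 n)).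
have := le_trans (SJ n) H. have p4 : (4 : R) ^+ n = 2 ^+ n * 2 ^+ n by rewrite -exprMn; congr (_ ^+ _); lra. have p2 : 0 < (2 : R) ^+ n by exact: exprn_gt0.
have -> : 4 * e' * (h n + k n) ^+ 2 = e / 4 ^+ n.
  rewrite /e' /h /k p4; field; rewrite !gt_eqF ?addr_gt0//.
by rewrite p4 ler_pM2r ?invr_gt0 ?mulr_gt0// /J /h /k expr0 !divr1.
Qed.

End green.
End goursat.

(** * Complex differentiability in logarithmic polar coordinates *)

Section complex_differentiation.
Variable R : realType.
Local Notation mu := (@lebesgue_measure R).
Local Notation normc := (@Normc.normc R).
Local Notation C := (R[i])^o.
Local Notation re := (@complex.Re R).
Local Notation im := (@complex.Im R).

Lemma normcE (x y : R) : normc (x +i* y) = Num.sqrt (x ^+ 2 + y ^+ 2).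
Proof. by []. Qed.

Lemma normc_ge0 (z : R[i]) : 0 <= normc z.
Proof. by case: z => x y; rewrite normcE sqrtr_ge0. Qed.

Lemma normr_Re (z : R[i]) : `|re z| <= normc z.
Proof.
by case: z => x y /=; rewrite -sqrtr_sqr ler_wsqrtr// lerDl sqr_ge0.
Qed.

Lemma normr_Im (z : R[i]) : `|im z| <= normc z.
Proof.
by case: z => x y /=; rewrite -sqrtr_sqr ler_wsqrtr// lerDr sqr_ge0.
Qed.

Lemma normc_le (z : R[i]) : normc z <= `|re z| + `|im z|.
Proof.
case: z => x y; rewrite normcE -[leRHS]ger0_norm ?addr_ge0// -sqrtr_sqr ler_wsqrtr//=. have := mulr_ge0 (normr_ge0 x) (normr_ge0 y).
by rewrite sqrrD !real_normK ?num_real//; lra.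
Qed.

Lemma normcD (z z' : R[i]) : normc (z + z') <= normc z + normc z'.
Proof. exact: le_normcD. Qed.

Lemma normcM (z z' : R[i]) : normc (z * z') = normc z * normc z'.
Proof. exact: Normc.normcM. Qed.

Lemma normcN (z : R[i]) : normc (- z) = normc z.
Proof.
by case: z => x y; change (Num.sqrt ((- x) ^+ 2 + (- y) ^+ 2) = Num.sqrt (x ^+ 2 + y ^+ 2)); rewrite !sqrrN.
Qed.

Lemma normc_real (x : R) : normc x%:C = `|x|.
Proof. by rewrite normcE expr0n/= addr0 sqrtr_sqr. Qed.

(** Differentiability restated with the real-valued modulus and real tolerances, because the norm of
    the complex plane takes its values in [R[i]]. *)
Definition cdiff (f : R[i] -> R[i]) (z D : R[i]) :=
  forall e : R, 0 < e -> exists2 d : R, 0 < d & forall w, normc (w - z) <= d ->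
    normc (f w - f z - D * (w - z)) <= e * normc (w - z).

Definition ccont (f : R[i] -> R[i]) (z : R[i]) :=
  forall e : R, 0 < e -> exists2 d : R, 0 < d & forall w, normc (w - z) <= d ->
    normc (f w - f z) <= e.

Lemma complex_ltP (z : R[i]) : 0 < z -> exists2 x : R, 0 < x & z = x%:C.
Proof.
case: z => x y; rewrite ltcE/= => /andP[/eqP yE x0]. by exists x => //; rewrite yE.
Qed.

Lemma derivable_cdiff (f : R[i] -> R[i]) (z : R[i]) :
  derivable (f : C -> C) z 1 -> exists D, cdiff f z D.
Proof.
move=> /cvg_ex[D hD]; exists D => e e0. have e0' : 0 < (e%:C : R[i]) by rewrite ltcR. move/cvgrPdist_le : hD => /(_ _ e0') [d /= /complex_ltP [d' d'0 ->]] hd.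
exists (d' / 2) => [|w wz]; first by rewrite divr_gt0. have [->|wz0] := eqVneq w z; first by rewrite !subrr mulr0 subrr !normc_real !normr0 mulr0.
have wz1 : w - z != 0 by rewrite subr_eq0. have bw : ball_ [eta Num.Def.normr] 0 d'%:C (w - z).
  rewrite /ball_/= sub0r normrN; change ((normc (w - z))%:C < d'%:C); rewrite ltcR. by apply: (le_lt_trans wz); lra.
have h := hd _ bw wz1. have {h} : `|D - (w - z)^-1 * (f w - f z)| <= e%:C.
  by move: h; rewrite /shift/= /GRing.scale/= mulr1 subrK.
rewrite -[`|_|]/((normc _)%:C) lecR => h. have -> : f w - f z - D * (w - z) = - (D - (w - z)^-1 * (f w - f z)) * (w - z).
  by field.
by rewrite normcM normcN ler_wpM2r// normc_ge0.
Qed.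

Lemma continuous_ccont (f : R[i] -> R[i]) (z : R[i]) :
  {for z, continuous (f : C -> C)} -> ccont f z.
Proof.
move=> h e e0; have e0' : 0 < (e%:C : R[i]) by rewrite ltcR. move/cvgrPdist_le : h => /(_ _ e0') [d /= /complex_ltP [d' d'0 ->]] hd.
exists (d' / 2) => [|w wz]; first by rewrite divr_gt0. have := hd w; rewrite /ball_/= -[`|_|]/((normc _)%:C) ltcR -normcN opprB => /(_ _).
have -> : normc (w - z) < d' by apply: (le_lt_trans wz); lra. by move=> /(_ isT); rewrite -[`|_|]/((normc _)%:C) lecR -normcN opprB.
Qed.

Lemma derivable_ccont (f : R[i] -> R[i]) (z : R[i]) :
  derivable (f : C -> C) z 1 -> ccont f z.
Proof.
move=> df; apply: continuous_ccont; apply: differentiable_continuous. exact/derivable1_diffP.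
Qed.

Lemma cdiff_local (f g : R[i] -> R[i]) (z D : R[i]) (r : R) : 0 < r ->
  (forall w, normc (w - z) <= r -> f w = g w) -> cdiff f z D -> cdiff g z D.
Proof.
move=> r0 fg hf e e0; have [d d0 hd] := hf e e0. exists (Num.min d r); first by rewrite lt_min d0.
move=> w; rewrite le_min => /andP[wd wr]; rewrite -!fg//; first exact: hd. by rewrite subrr normc_real normr0 ltW.
Qed.

Definition cexp (s t : R) : R[i] := (expR s * cos t) +i* (expR s * sin t).

Lemma normc_cexp s t : normc (cexp s t) = expR s.
Proof.
rewrite normcE !exprMn -mulrDr cos2Dsin2 mulr1 sqrtr_sqr ger0_norm// expR_ge0.
Qed.

Lemma cexp_neq0 s t : cexp s t != 0.
Proof.
apply/eqP => h; have := normc_cexp s t; rewrite h normc_real normr0 => /esym/eqP. by rewrite gt_eqF// expR_gt0.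
Qed.

Lemma cexpD s t s' t' : cexp (s + s') (t + t') = cexp s t * cexp s' t'.
Proof.
rewrite /cexp expRD cosD sinD; apply/eqP; rewrite eq_complex/=; apply/andP; split; apply/eqP; ring.
Qed.

Lemma derive_est (f : R -> R) (D : R) : is_derive (0 : R) (1 : R) f D ->
  forall e, 0 < e -> exists2 d : R, 0 < d & forall x, `|x| <= d -> `|f x - f 0 - D * x| <= e * `|x|.
Proof.
move=> hf e e0. have /cvg_ex[l hl] := @ex_derive _ _ _ _ _ _ _ hf. have lD : l = D by rewrite -(@derive_val _ _ _ _ _ _ _ hf); symmetry; apply/cvg_lim.
move: hl; rewrite lD => /cvgrPdist_le/(_ _ e0) [d /= d0 hd]. exists (d / 2) => [|x xd]; first by rewrite divr_gt0.
have [->|x0] := eqVneq x 0; first by rewrite subrr mulr0 subrr normr0 mulr0. have bx : ball_ [eta Num.Def.normr] 0 d x.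
  by rewrite /ball_/= sub0r normrN; apply: (le_lt_trans xd); lra.
have h := hd _ bx x0. have {h} : `|D - x^-1 * (f x - f 0)| <= e.
  by move: h; rewrite /shift/= /GRing.scale/= mulr1 addr0.
move=> h; have -> : f x - f 0 - D * x = - (D - x^-1 * (f x - f 0)) * x by field. by rewrite normrM normrN ler_wpM2r.
Qed.

Lemma cexp_est0 e : 0 < e -> exists2 d : R, 0 < d & forall x y, `|x| <= d -> `|y| <= d ->
  normc (cexp x y - 1 - (x +i* y)) <= e * (`|x| + `|y|).
Proof.
move=> e0; pose h := Num.min (e / 10) 1. have h0 : 0 < h by rewrite lt_min divr_gt0//=. have h1 : h <= 1 by rewrite ge_min lexx orbT.
have he : 10 * h <= e by have : h <= e / 10; [rewrite ge_min lexx|lra]. have [d1 d10 hd1] := derive_est (is_derive_expR 0) h0.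
have [d2 d20 hd2] := derive_est (is_derive_sin 0) h0. have [d3 d30 hd3] := derive_est (is_derive_cos 0) h0. clearbody h.
exists (Num.min (Num.min d1 d2) (Num.min d3 h)); first by rewrite !lt_min d10 d20 d30 h0.
move=> x y; rewrite !le_min => /andP[/andP[x1 x2] /andP[x3 xh]] /andP[/andP[y1 y2] /andP[y3 yh]].
have {hd1} := hd1 x x1; have {hd2} := hd2 y y2; have {hd3} := hd3 y y3. rewrite expR0 sin0 cos0 mul1r oppr0 mul0r !subr0 ?addr0 mul1r => c1 c2 c3.
have ay := normr_ge0 y; have ax := normr_ge0 x. have b1 : `|expR x * cos y - 1 - x| <= 4 * h * (`|x| + `|y|).
  have -> : expR x * cos y - 1 - x = (expR x - 1 - x) * cos y + (1 + x) * (cos y - 1) by ring. apply: (le_trans (ler_normD _ _)); rewrite !normrM.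
  have cy : `|cos y| <= 1 by exact: cos_max. have xx : `|1 + x| <= 2 by apply: (le_trans (ler_normD _ _)); rewrite normr1; lra.
  have := ler_pM (normr_ge0 _) (normr_ge0 _) c3 cy. have := ler_pM (normr_ge0 _) (normr_ge0 _) xx c1.
  have := mulr_ge0 (ltW h0) ax; have := mulr_ge0 (ltW h0) ay; lra.
have b2 : `|expR x * sin y - y| <= 5 * h * (`|x| + `|y|).
  have -> : expR x * sin y - y = (expR x - 1) * sin y + (sin y - y) by ring. apply: (le_trans (ler_normD _ _)); rewrite !normrM. have sy : `|sin y| <= 2 * `|y|.
    have := ler_normD (sin y - y) y; rewrite subrK. have := ler_wpM2r ay h1; lra.
  have ex : `|expR x - 1| <= 2 * h.
    have := ler_normD (expR x - 1 - x) x; rewrite subrK. have := ler_pM (ltW h0) ax h1 xh; lra.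
  have ex1 : `|expR x - 1| <= h * `|x| + `|x|.
    have := ler_normD (expR x - 1 - x) x; rewrite subrK; lra.
  have := ler_pM (normr_ge0 _) (normr_ge0 _) ex sy. have := mulr_ge0 (ltW h0) ax; have := mulr_ge0 (ltW h0) ay; lra.
apply: (le_trans (normc_le _)). have -> : re (cexp x y - 1 - (x +i* y)) = expR x * cos y - 1 - x by [].
have -> : im (cexp x y - 1 - (x +i* y)) = expR x * sin y - y by rewrite /= subr0. apply: (le_trans (lerD b1 b2)).
have -> : 4 * h * (`|x| + `|y|) + 5 * h * (`|x| + `|y|) = 9 * h * (`|x| + `|y|) by ring. by apply: ler_wpM2r; rewrite ?addr_ge0//; lra.
Qed.

Lemma cexp_est s0 t0 e : 0 < e -> exists2 d : R, 0 < d & forall s t, `|s - s0| <= d -> `|t - t0| <= d ->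
  normc (cexp s t - cexp s0 t0 - cexp s0 t0 * ((s - s0) +i* (t - t0))) <= e * (`|s - s0| + `|t - t0|).
Proof.
move=> e0; have E0 : 0 < expR s0 by exact: expR_gt0. have [d d0 hd] := cexp_est0 (divr_gt0 e0 E0). exists d => // s t hs ht.
have -> : cexp s t - cexp s0 t0 - cexp s0 t0 * ((s - s0) +i* (t - t0)) = cexp s0 t0 * (cexp (s - s0) (t - t0) - 1 - ((s - s0) +i* (t - t0))).
  rewrite !mulrBr mulr1 -cexpD; congr (cexp _ _ - _ - _); ring.
rewrite normcM normc_cexp; apply: (le_trans (ler_wpM2l (ltW E0) (hd _ _ hs ht))). by rewrite mulrA mulrCA divff ?gt_eqF// mulr1.
Qed.

Lemma cexp_lip s0 t0 : exists2 d : R, 0 < d & forall s t, `|s - s0| <= d -> `|t - t0| <= d ->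
  normc (cexp s t - cexp s0 t0) <= (1 + expR s0) * (`|s - s0| + `|t - t0|).
Proof.
have [d d0 hd] := cexp_est s0 t0 ltr01; exists d => // s t hs ht. have := normcD (cexp s t - cexp s0 t0 - cexp s0 t0 * ((s - s0) +i* (t - t0)))
  (cexp s0 t0 * ((s - s0) +i* (t - t0))); rewrite subrK.
move=> /le_trans; apply; rewrite mulrDl; apply: lerD; first exact: hd. rewrite normcM normc_cexp ler_wpM2l ?expR_ge0//; exact: normc_le.
Qed.

(** In the coordinates z = exp(s + it) the derivative is G = D z, so Re f has partial derivatives Re
    G and -Im G, and Im f has Im G and Re G. Circles become segments and annuli become rectangles,
    ready for [goursat]. *)
Lemma cdiff_polar (f : R[i] -> R[i]) s0 t0 D : cdiff f (cexp s0 t0) D ->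
  exists A B C, total_diff (fun s t => re (f (cexp s t))) s0 t0 A B /\
    total_diff (fun s t => im (f (cexp s t))) s0 t0 C A.
Proof.
move=> hf; set z0 := cexp s0 t0 in hf *; pose G := D * z0. suff key e : 0 < e -> exists2 d : R, 0 < d & forall s t, `|s - s0| <= d -> `|t - t0| <= d ->
    normc (f (cexp s t) - f z0 - G * ((s - s0) +i* (t - t0))) <= e * (`|s - s0| + `|t - t0|).
  exists (re G), (- im G), (im G); split=> e e0; have [d d0 hd] := key e e0; exists d => // s t hs ht; apply: le_trans (hd _ _ hs ht).
  - apply: le_trans (normr_Re _); rewrite le_eqVlt; apply/orP; left; apply/eqP; congr `|_|.
    by clear hd key; clearbody G; move: (f _) (f _) G => [? ?] [? ?] [? ?] /=; ring.
  - apply: le_trans (normr_Im _); rewrite le_eqVlt; apply/orP; left; apply/eqP; congr `|_|.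
    by clear hd key; clearbody G; move: (f _) (f _) G => [? ?] [? ?] [? ?] /=; ring.
move=> e0; pose K := 1 + expR s0; have K0 : 0 < K by rewrite addr_gt0// expR_gt0. have N0 := normc_ge0 D.
have [d1 d10 hd1] := hf (e / (2 * K)) (divr_gt0 e0 (mulr_gt0 (ltr0Sn _ 1) K0)). have N1 : 0 < 2 * (normc D + 1) by lra.
have [d2 d20 hd2] := cexp_est s0 t0 (divr_gt0 e0 N1). have [d3 d30 hd3] := cexp_lip s0 t0. have d40 : 0 < d1 / (2 * K) by rewrite divr_gt0// mulr_gt0.
exists (Num.min (Num.min d2 d3) (d1 / (2 * K))); first by rewrite !lt_min d20 d30. move=> s t; rewrite !le_min => /andP[/andP[s2 s3] s4] /andP[/andP[t2 t3] t4].
have l := hd3 s t s3 t3. have wz : normc (cexp s t - z0) <= d1.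
  apply: (le_trans l); have := ler_wpM2l (ltW K0) (lerD s4 t4). have -> : K * (d1 / (2 * K) + d1 / (2 * K)) = d1 by field; rewrite gt_eqF. by [].
have -> : f (cexp s t) - f z0 - G * ((s - s0) +i* (t - t0)) = (f (cexp s t) - f z0 - D * (cexp s t - z0)) +
    D * (cexp s t - z0 - z0 * ((s - s0) +i* (t - t0))) by rewrite /G; ring.
apply: (le_trans (normcD _ _)); rewrite normcM. have a1 := hd1 _ wz; have a2 := hd2 s t s2 t2. have X0 : 0 <= `|s - s0| + `|t - t0| by rewrite addr_ge0.
have eK : 0 <= e / (2 * K) by rewrite divr_ge0// ltW// mulr_gt0. have b1 := le_trans a1 (ler_wpM2l eK l). have b2 := ler_wpM2l N0 a2.
apply: (le_trans (lerD b1 b2)). have -> : e / (2 * K) * (K * (`|s - s0| + `|t - t0|)) = e / 2 * (`|s - s0| + `|t - t0|).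
  by field; rewrite gt_eqF.
rewrite mulrA -mulrDl; apply: ler_wpM2r => //. have -> : normc D * (e / (2 * (normc D + 1))) = e / 2 * (normc D / (normc D + 1)).
  by field; rewrite gt_eqF//; lra.
have : normc D / (normc D + 1) <= 1 by rewrite ler_pdivrMr ?mul1r//; lra. by move=> /(ler_wpM2l (ltW (divr_gt0 e0 (ltr0Sn R 1)))); lra.
Qed.

Lemma cvg_of_est (g : R -> R) (a : R) :
  (forall e : R, 0 < e -> exists2 d : R, 0 < d & forall x, `|x - a| <= d -> `|g x - g a| <= e) ->
  {for a, continuous g}.
Proof.
move=> h; apply/cvgrPdist_le => e e0; have [d d0 hd] := h e e0. by near=> x; rewrite distrC; apply: hd; rewrite distrC; near: x; apply: cvgr_dist_le.
Unshelve. all: end_near. Qed.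

Lemma ccont_polar (f : R[i] -> R[i]) s0 t0 : ccont f (cexp s0 t0) ->
  forall e : R, 0 < e -> exists2 d : R, 0 < d & forall s t, `|s - s0| <= d -> `|t - t0| <= d ->
    normc (f (cexp s t) - f (cexp s0 t0)) <= e.
Proof.
move=> hf e e0; have [d1 d10 hd1] := hf e e0. have [d2 d20 hd2] := cexp_lip s0 t0. pose K := 1 + expR s0; have K0 : 0 < K by rewrite addr_gt0// expR_gt0.
have d40 : 0 < d1 / (2 * K) by rewrite divr_gt0// mulr_gt0. exists (Num.min d2 (d1 / (2 * K))); first by rewrite lt_min d20.
move=> s t; rewrite !le_min => /andP[s2 s4] /andP[t2 t4]. apply: hd1; apply: (le_trans (hd2 _ _ s2 t2)). have := ler_wpM2l (ltW K0) (lerD s4 t4).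
by have -> : K * (d1 / (2 * K) + d1 / (2 * K)) = d1 by field; rewrite gt_eqF.
Qed.

(** Goursat on [s1, s2] x [0, 2 pi]: the sides t = 0 and t = 2 pi cancel by periodicity, which
    leaves the difference of the two circle integrals. *)
Lemma circle_mean_const (f : R[i] -> R[i]) s1 s2 : s1 < s2 ->
  (forall z, z != 0 -> ccont f z) ->
  (forall s t, s1 <= s <= s2 -> exists D, cdiff f (cexp s t) D) ->
  \int[mu]_(t in `[0, (2 * pi)]) re (f (cexp s1 t)) = \int[mu]_(t in `[0, (2 * pi)]) re (f (cexp s2 t)).
Proof.
move=> s12 cf df. pose p s t := re (f (cexp s t)); pose q s t := im (f (cexp s t)). have cp s : continuous (p s).
  move=> t; apply: cvg_of_est => e e0. have [d d0 hd] := ccont_polar (cf _ (cexp_neq0 s t)) e0; exists d => // t' ht.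
  apply: le_trans (hd s t' _ ht); last by rewrite subrr normr0 ltW. by apply: le_trans (normr_Re _); rewrite raddfB.
have cq t : continuous (q ^~ t).
  move=> s; apply: cvg_of_est => e e0. have [d d0 hd] := ccont_polar (cf _ (cexp_neq0 s t)) e0; exists d => // s' hs.
  apply: le_trans (hd s' t hs _); last by rewrite subrr normr0 ltW. by apply: le_trans (normr_Im _); rewrite raddfB.
have s210 : 0 < s2 - s1 by lra. have pi20 : 0 < 2 * pi :> R by rewrite mulr_gt0// pi_gt0. have := @goursat R p q cp cq s1 0 (s2 - s1) (2 * pi) s210 pi20.
rewrite addrC subrK => /(_ _)/esym/eqP H. have {H} := H (fun s t h => ltac:(have [D hD] := df s t h; exact: (cdiff_polar hD))).
rewrite eq_sym /rect_int add0r (addrC s1) subrK. have -> : \int[mu]_(x in `[s1, s2]) (q x (2 * pi) - q x 0) = 0.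
  rewrite -[RHS](_ : \int[mu]_(x in `[s1, s2]) 0 = 0); last by rewrite Rint_cst ?mul0r// ltW. apply: eq_Rintegral => x _; rewrite /q /cexp -[2 * pi]add0r.
  have -> : 2 * pi = pi *+ 2 :> R by rewrite mulr_natl. by rewrite cosD2pi sinD2pi subrr.
by rewrite subr0 RintB// subr_eq0 => /eqP ->.
Qed.

End complex_differentiation.

(** * Circle means and Taylor coefficients *)

Section entire.
Variable R : realType.
Local Notation mu := (@lebesgue_measure R).
Local Notation normc := (@Normc.normc R).
Local Notation C := (R[i])^o.
Local Notation re := (@complex.Re R).
Local Notation im := (@complex.Im R).

Definition square (r : R) : set (R * R) := `[- r, r] `*` `[- r, r].

Lemma compact_square r : compact (square r).
Proof. by apply: compact_setX; exact: segment_compact. Qed.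

Lemma near_pair (p0 : R * R) (d : R) : 0 < d ->
  \forall p \near p0, `|p.1 - p0.1| <= d /\ `|p.2 - p0.2| <= d.
Proof.
move=> d0; near=> p; split; rewrite distrC.
  near: p; apply: (@cvgr_dist_le _ _ _ (nbhs p0) _ (fun p : R * R => p.1) p0.1); first exact: cvg_fst. exact: d0.
near: p; apply: (@cvgr_dist_le _ _ _ (nbhs p0) _ (fun p : R * R => p.2) p0.2); first exact: cvg_snd. exact: d0.
Unshelve. all: end_near. Qed.

Lemma normcB_pair (p p0 : R * R) d : `|p.1 - p0.1| <= d / 2 -> `|p.2 - p0.2| <= d / 2 ->
  normc ((p.1 +i* p.2) - (p0.1 +i* p0.2)) <= d.
Proof. by move=> h1 h2; apply: (le_trans (normc_le _)) => /=; lra. Qed.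

Lemma compact_complex_square r : compact ((fun p : R * R => (p.1 +i* p.2 : C)) @` square r).
Proof.
apply: continuous_compact; last exact: compact_square. apply: continuous_subspaceT => p0; apply/cvgrPdist_le => e /complex_ltP [e' e0 ->].
near=> p; rewrite -[`|_|]/((normc _)%:C) lecR -normcN opprB. have [] : `|p.1 - p0.1| <= e' / 2 /\ `|p.2 - p0.2| <= e' / 2.
  by near: p; apply: near_pair; rewrite divr_gt0.
exact: normcB_pair.
Unshelve. all: end_near. Qed.

Lemma square_normc (z : R[i]) r : normc z <= r ->
  ((fun p : R * R => (p.1 +i* p.2 : C)) @` square r) z.
Proof.
move=> zr; exists (re z, im z); last by case: z zr. split; rewrite /= in_itv/= -ler_norml.
  exact: le_trans (normr_Re z) zr.
exact: le_trans (normr_Im z) zr.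
Qed.

Lemma ccont_bounded (f : R[i] -> R[i]) r : (forall z, ccont f z) ->
  exists M, forall z, normc z <= r -> normc (f z) <= M.
Proof.
move=> cf; pose h (p : R * R) := normc (f (p.1 +i* p.2)). have ch : continuous h.
  move=> p0; apply/cvgrPdist_le => e e0; have [d d0 hd] := cf (p0.1 +i* p0.2) e e0. near=> p. have [h1 h2] : `|p.1 - p0.1| <= d / 2 /\ `|p.2 - p0.2| <= d / 2.
    by near: p; apply: near_pair; rewrite divr_gt0.
  have := hd _ (normcB_pair h1 h2); apply: le_trans; rewrite /h. have a := normcD (f (p.1 +i* p.2) - f (p0.1 +i* p0.2)) (f (p0.1 +i* p0.2)).
  have b := normcD (f (p0.1 +i* p0.2) - f (p.1 +i* p.2)) (f (p.1 +i* p.2)). rewrite !subrK in a b; rewrite -[normc (f (p0.1 +i* p0.2) - _)]normcN opprB in b.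
  by rewrite ler_norml; lra.
have /compact_bounded [M [_ hM]] : compact (h @` square r).
  by apply: continuous_compact; [exact: continuous_subspaceT|exact: compact_square].
exists (M + 1) => z zr; have [p sp pz] := square_normc zr. have := hM (M + 1); rewrite ltrDl => /(_ ltr01)/(_ (h p)) H.
apply: (le_trans (ler_norm _)); rewrite -pz; apply: H; by exists p.
Unshelve. all: end_near. Qed.

Lemma scaled_lip (t r r' : R) :
  normc (r'%:C * cexp 0 t - r%:C * cexp 0 t) = `|r' - r|.
Proof. by rewrite -mulrBl -rmorphB normcM normc_real normc_cexp expR0 mulr1. Qed.

Lemma cexp_polar (s t : R) : cexp s t = (expR s)%:C * cexp 0 t.
Proof. by rewrite /cexp expR0 !mul1r; apply/eqP; rewrite eq_complex/= !mul0r subr0 addr0 !eqxx. Qed.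

Lemma continuous_circle (f : R[i] -> R[i]) s : (forall t, ccont f (cexp s t)) ->
  continuous (fun t => re (f (cexp s t))).
Proof.
move=> cf t; apply: cvg_of_est => e e0. have [d d0 hd] := ccont_polar (cf t) e0; exists d => // t' ht.
apply: le_trans (hd s t' _ ht); last by rewrite subrr normr0 ltW. by apply: le_trans (normr_Re _); rewrite raddfB.
Qed.

Lemma continuous_ray (f : R[i] -> R[i]) r : (forall z, ccont f z) ->
  continuous (fun t => re (f (r%:C * cexp 0 t))).
Proof.
move=> cf t; apply: cvg_of_est => e e0. have [d d0 hd] := cf (r%:C * cexp 0 t) e e0. pose e1 := d / (1 + `|r|); have r1 : 0 < 1 + `|r| by rewrite ltr_pwDl.
have e10 : 0 < e1 by rewrite divr_gt0. have ci : ccont (fun z => z) (cexp 0 t) by move=> x x0; exists x.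
have [d' d'0 hd'] := ccont_polar ci e10; exists d' => // t' ht. apply: (@le_trans _ _ (normc (f (r%:C * cexp 0 t') - f (r%:C * cexp 0 t)))).
  by apply: le_trans (normr_Re _); rewrite raddfB.
apply: hd; rewrite -mulrBr normcM normc_real. have := hd' 0 t' _ ht; rewrite subrr normr0 => /(_ (ltW d'0)) h.
apply: (@le_trans _ _ ((1 + `|r|) * e1)); last by rewrite mulrC divfK// gt_eqF. by apply: ler_pM => //; [exact: normc_ge0|rewrite lerDr].
Qed.

Definition circle_mean (f : R[i] -> R[i]) (r : R) :=
  \int[mu]_(t in `[0, (2 * pi)]) re (f (r%:C * cexp 0 t)).

Lemma circle_mean_continuous (f : R[i] -> R[i]) : (forall z, ccont f z) ->
  continuous (circle_mean f).
Proof.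
move=> cf r; have [M hM] := ccont_bounded (`|r| + 1) cf. have := @continuity_under_integral R _ _ mu (fun r t => re (f (r%:C * cexp 0 t)))
  `[0, (2 * pi)]%classic (measurable_itv _) (r - 1) (r + 1) _ _ (fun=> M) _ _.
move=> /(_ _ _ _ _ r) H; apply: H => /=.
- by move=> x _; apply: continuous_itv_integrable; exact: continuous_ray.
- apply: aeW => t _ x _; apply: cvg_of_est => e e0. have [d d0 hd] := cf (x%:C * cexp 0 t) e e0; exists d => // x' hx.
  apply: (@le_trans _ _ (normc (f (x'%:C * cexp 0 t) - f (x%:C * cexp 0 t)))).
    by apply: le_trans (normr_Re _); rewrite raddfB.
  by apply: hd; rewrite scaled_lip.
- by apply: continuous_itv_integrable => ?; exact: cvg_cst.
- move=> x /=; rewrite in_itv/= => /andP[x1 x2]; apply: aeW => t _. apply: (le_trans (normr_Re _)); apply: hM; rewrite normcM normc_cexp expR0 mulr1 normc_real.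
  have : `|x - r| <= 1 by rewrite ler_norml; lra. by have := ler_normD (x - r) r; rewrite subrK; lra.
- by apply/mem_set => /=; rewrite in_itv/=; apply/andP; split; lra.
Qed.

(** The mean is constant on either side of the radius of the exceptional point, continuous, and 0 at
    radius 0. An exceptional point is tolerated because the lemma is meant for a difference
    quotient, shown only to be continuous at its base point. *)
Lemma circle_mean0 (f : R[i] -> R[i]) (z0 : R[i]) (r : R) : (forall z, ccont f z) ->
  (forall z, z != z0 -> exists D, cdiff f z D) -> f 0 = 0 -> 0 <= r -> circle_mean f r = 0.
Proof.
move=> cf df f0 r0; pose rho := normc z0. have rho0 : 0 <= rho by exact: normc_ge0. have c0 : circle_mean f 0 = 0.
  rewrite /circle_mean -[RHS](_ : \int[mu]_(x in `[0, (2 * pi)]) 0 = 0); last first.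
    by rewrite Rint_cst ?mul0r// mulr_ge0// pi_ge0.
  by apply: eq_Rintegral => t _; rewrite mul0r f0.
have const a b : 0 < a -> a <= b -> b < rho \/ rho < a -> circle_mean f a = circle_mean f b.
  move=> a0; rewrite le_eqVlt => /predU1P[->//|ab hab]. have b0 : 0 < b by exact: lt_trans ab.
  have := @circle_mean_const R f (ln a) (ln b); rewrite ltr_ln ?posrE// ab => /(_ isT). move=> /(_ (fun z _ => cf z)) H.
  have ea c : 0 < c -> circle_mean f c = \int[mu]_(t in `[0, (2 * pi)]) re (f (cexp (ln c) t)).
    by move=> c0'; apply: eq_Rintegral => t _; rewrite [cexp (ln c) t]cexp_polar lnK.
  rewrite (ea a a0) (ea b b0); apply: H => s t /andP[s1 s2]; apply: df; apply/eqP => h. have e : expR s = rho by rewrite -(normc_cexp s t) h.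
  have l1 : a <= rho by rewrite -e -(lnK (x := a)) ?posrE// ler_expR. have l2 : rho <= b by rewrite -e -(lnK (x := b)) ?posrE// ler_expR. by case: hab; lra.
have cts := circle_mean_continuous cf.
(* by continuity, a value taken on a one-sided interval is taken at its end *)
have ext a b c : a < b -> (forall x, a < x < b -> circle_mean f x = c) -> circle_mean f a = c /\ circle_mean f b = c.
  move=> ab h; split.
    have l1 : circle_mean f x @[x --> a^'+] --> circle_mean f a.
      by apply: cvg_at_right_filter; exact: cts.
    have l2 : circle_mean f x @[x --> a^'+] --> c.
      apply: cvg_near_cst. by near=> x; rewrite h//; apply/andP; split; near: x; [exact: nbhs_right_gt|exact: nbhs_right_lt].
    exact: (cvg_unique _ l1 l2).
  have l1 : circle_mean f x @[x --> b^'-] --> circle_mean f b.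
    by apply: cvg_at_left_filter; exact: cts.
  have l2 : circle_mean f x @[x --> b^'-] --> c.
    apply: cvg_near_cst. by near=> x; rewrite h//; apply/andP; split; near: x; [exact: nbhs_left_gt|exact: nbhs_left_lt].
  exact: (cvg_unique _ l1 l2).
have below x : 0 < x -> x < rho -> circle_mean f x = 0.
  move=> x0 xr; have [] := @ext 0 x (circle_mean f x) x0.
    by move=> y /andP[y0 yx]; apply: const => //; [exact: ltW|left].
  by rewrite c0 => <-.
have atrho : circle_mean f rho = 0.
  have [->//|nr] := eqVneq rho 0. have rp : 0 < rho by rewrite lt_def nr.
  by have [] := @ext 0 rho 0 rp (fun y h => ltac:(by case/andP: h => ? ?; exact: below)).
have [rr|rr|->//] := ltgtP r rho.
  by move: r0; rewrite le_eqVlt => /predU1P[<-//|r0]; exact: below.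
have [h _] := @ext rho r (circle_mean f r) rr (fun y h => ltac:( case/andP: h => h1 h2; apply: const; [exact: le_lt_trans h1|exact: ltW|by right])).
by rewrite -h.
Unshelve. all: end_near. Qed.

Section power_series.
Variable f : R[i] -> R[i].
Hypothesis df : forall z, derivable (f : C -> C) z 1.
Hypothesis fR : forall x : R, im (f x%:C) = 0.

(** Cauchy's coefficient formula on the unit circle. Keeping the real part loses nothing: [f] is
    real on the real line, so its Taylor coefficients are real. *)
Definition taylor_coef (n : nat) :=
  (2 * pi)^-1 * \int[mu]_(t in `[0, (2 * pi)]) re (f (cexp 0 t) / cexp 0 t ^+ n).

Let derivable_pow (n : nat) z : z != 0 -> derivable ((fun z => (z ^+ n)^-1) : C -> C) z 1.
Proof.
move=> z0; apply: derivableV; first by rewrite expf_neq0. elim: n => [|n IH].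
  rewrite (_ : (fun z : C => z ^+ 0) = fun=> 1); last by apply/funext => w; rewrite expr0. exact: derivable_cst.
rewrite (_ : (fun z : C => z ^+ n.+1) = fun z => z * z ^+ n); last by apply/funext => w; rewrite exprS. exact: (derivableM (@derivable_id _ _ z 1) IH).
Qed.

Lemma circle_mean_pow (g : R[i] -> R[i]) n s1 s2 : (forall z, derivable (g : C -> C) z 1) ->
  \int[mu]_(t in `[0, (2 * pi)]) re (g (cexp s1 t) / cexp s1 t ^+ n) =
  \int[mu]_(t in `[0, (2 * pi)]) re (g (cexp s2 t) / cexp s2 t ^+ n).
Proof.
move=> dg. have dgn z : z != 0 -> derivable ((fun z => g z / z ^+ n) : C -> C) z 1.
  by move=> z0; apply: (derivableM (dg z)); exact: derivable_pow.
wlog : s1 s2 / s1 < s2.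
  by move=> h; have [/h ->//|/h ->//|->//] := ltgtP s1 s2.
move=> s12; apply: (@circle_mean_const R (fun z => g z / z ^+ n)) => //.
- by move=> z z0; apply: derivable_ccont; exact: dgn.
- by move=> s t _; apply: derivable_cdiff; apply: dgn; exact: cexp_neq0.
Qed.

Lemma cexpX (s t : R) n : cexp s t ^+ n = (expR s ^+ n)%:C * cexp 0 t ^+ n.
Proof. by rewrite cexp_polar exprMn rmorphXn. Qed.

Lemma Re_real_mul (x : R) (z : R[i]) : re (x%:C * z) = x * re z.
Proof. by case: z => a b /=; rewrite mul0r subr0. Qed.

Lemma normc_inv (z : R[i]) : normc z^-1 = (normc z)^-1.
Proof. exact: Normc.normcV. Qed.

Lemma normcX (z : R[i]) n : normc (z ^+ n) = normc z ^+ n.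
Proof. by elim: n => [|n IH]; rewrite ?expr0 ?normc_real ?normr1// !exprS normcM IH. Qed.

Let ci n s : continuous (fun t => re ((cexp s t ^+ n)^-1)).
Proof.
apply: (@continuous_circle (fun z => (z ^+ n)^-1)) => t. by apply: derivable_ccont; apply: derivable_pow; exact: cexp_neq0.
Qed.

(** On the circle of radius exp s the integral is exp(-ns) times its value on the unit circle, and
    yet it does not depend on the circle. *)
Lemma circle_int_pow n s : (0 < n)%N ->
  \int[mu]_(t in `[0, (2 * pi)]) re ((cexp s t ^+ n)^-1) = 0.
Proof.
move=> n0; set I := fun s => \int[mu]_(t in `[0, (2 * pi)]) re ((cexp s t ^+ n)^-1). have IE s' : I s' = expR s' ^- n * I 0.
  rewrite /I -RintZ; last exact: ci. apply: eq_Rintegral => t _. by rewrite cexpX invfM -[X in X * _]fmorphV Re_real_mul.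
have Ic s1 s2 : I s1 = I s2.
  have := @circle_mean_pow (fun=> 1) n s1 s2 (fun z => derivable_cst _ _ _). under eq_Rintegral do rewrite mul1r.
  by under [X in _ = X -> _]eq_Rintegral do rewrite mul1r.
have e1 : expR 1 ^+ n != 1 :> R.
  by rewrite gt_eqF// exprn_egt1 -?lt0n// -expR0 ltr_expR.
have := IE 1; rewrite (Ic 1 0) => /eqP; rewrite -subr_eq0 -{1}[I 0]mul1r -mulrBl mulf_eq0. case/orP => [|/eqP h]; last by rewrite -/(I s) (Ic s 0).
rewrite subr_eq0 => /eqP/esym/(congr1 GRing.inv); rewrite invrK invr1 => h. by rewrite h eqxx in e1.
Qed.

Lemma cdiff_ccont (g : R[i] -> R[i]) z D : cdiff g z D -> ccont g z.
Proof.
move=> hg e e0; have [d d0 hd] := hg 1 ltr01. pose N := 1 + normc D; have N0 : 0 < N by rewrite ltr_pwDl// normc_ge0.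
exists (Num.min d (e / N)) => [|w]; first by rewrite lt_min d0 divr_gt0. rewrite le_min => /andP[wd we].
have := normcD (g w - g z - D * (w - z)) (D * (w - z)); rewrite subrK => /le_trans; apply. apply: (le_trans (lerD (hd w wd) (lexx _))); rewrite normcM -mulrDl.
by move: we; rewrite ler_pdivlMr// mulrC.
Qed.

Lemma Rint_sum (J : nat) (g : nat -> R -> R) a b : a <= b -> (forall j, continuous (g j)) ->
  continuous (fun t => \sum_(j < J) g j t) /\
  \int[mu]_(t in `[a, b]) \sum_(j < J) g j t = \sum_(j < J) \int[mu]_(t in `[a, b]) g j t.
Proof.
move=> ab cg; elim: J => [|J [IHc IH]].
  split; first by under eq_fun do rewrite big_ord0; move=> ?; exact: cvg_cst. by under eq_Rintegral do rewrite big_ord0; rewrite Rint_cst// mul0r big_ord0.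
split.
  by under eq_fun do rewrite big_ord_recr/=; move=> t; apply: cvgD; [exact: IHc|exact: cg].
under eq_Rintegral do rewrite big_ord_recr/=. by rewrite RintD// IH big_ord_recr.
Qed.

Let pi20 : 0 < 2 * pi :> R. Proof. by rewrite mulr_gt0// pi_gt0. Qed.

Lemma derivable_sub (g : R[i] -> R[i]) (a z : R[i]) :
  derivable (g : C -> C) z 1 -> derivable ((fun z => g z - a) : C -> C) z 1.
Proof. by move=> dg; exact: (@derivableB _ _ _ (g : C -> C) (fun=> a) z 1 dg (derivable_cst _ _ _)). Qed.

Lemma derivable_sub_cst (a : R[i]) z : derivable ((fun z => f z - a) : C -> C) z 1.
Proof. exact: (@derivable_sub f a z (@df z)). Qed.

Lemma continuous_scaled_circle n s :
  continuous (fun t => re (f (cexp s t) / cexp s t ^+ n)).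
Proof.
apply: (@continuous_circle (fun z => f z / z ^+ n)) => t; apply: derivable_ccont. by apply: (derivableM (@df _)); apply: derivable_pow; exact: cexp_neq0.
Qed.

(** With a = f(x), let A_N be the circle integral, at radius r = |x| + 1, of the real part of (f(w)
    - a) (x/w)^N w/(w - x). Since w/(w - x) = 1 + x/(w - x), A_N - A_(N+1) is x^N times the N-th
    coefficient integral of f - a. [circle_mean0] applied to z (f(z) - a)/(z - x) gives A_0 = 0, so
    the partial sums telescope to -A_N, which is of order (|x|/r)^N. *)
Lemma taylor_cvg (x : R) : series (fun n => taylor_coef n * x ^+ n) @ \oo --> re (f x%:C).
Proof.
pose r := `|x| + 1; have r0 : 0 < r by rewrite /r ltr_wpDl. have xr : `|x| < r by rewrite /r ltrDl. pose s := ln r; have es : expR s = r by rewrite lnK.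
pose a := re (f x%:C). have fx : f x%:C = a%:C.
  by rewrite /a; have := fR x; case: (f _) => u v /= ->.
have wx w : normc w = r -> w != x%:C.
  by move=> h; apply/eqP => wE; move: xr; rewrite -h wE normc_real ltxx.
have [D hD] := derivable_cdiff (@df x%:C). pose K0 (z : R[i]) := z * (f z - a%:C) * (z - x%:C)^-1. pose K z := if z == x%:C then x%:C * D else K0 z.
have did z : derivable ((fun z => z) : C -> C) z 1 by exact: derivable_id. have dinv z : z != x%:C -> derivable ((fun z => (z - x%:C)^-1) : C -> C) z 1.
  move=> zx; have nz : z - x%:C != 0 by rewrite subr_eq0. exact: (@derivableV _ _ (fun z : C => z - x%:C) z 1 nz (@derivable_sub (fun z => z) x%:C z (did z))).
have dK z : z != x%:C -> exists D, cdiff K z D.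
  move=> zx. have [D' hD'] : exists D, cdiff K0 z D.
    apply: derivable_cdiff; apply: derivableM; last exact: dinv. by apply: derivableM; [exact: did|exact: derivable_sub_cst].
  have zx0 : 0 < normc (z - x%:C).
    rewrite lt_def normc_ge0 andbT; apply/eqP => /Normc.eq0_normc/eqP; rewrite subr_eq0. by rewrite (negbTE zx).
  exists D'; apply: (cdiff_local (r := normc (z - x%:C) / 2) _ _ hD'); first by rewrite divr_gt0. move=> w wz; rewrite /K; case: eqP => // wE; exfalso.
  by move: wz; rewrite wE -normcN opprB; lra.
have cK z : ccont K z.
  have [->|/dK[D' /cdiff_ccont//]] := eqVneq z x%:C. move=> e e0; pose e' := e / (2 * r). have e'0 : 0 < e' by rewrite divr_gt0// mulr_gt0.
  have [d d0 hd] := hD e' e'0. pose N := 1 + normc D; have N0 : 0 < N by rewrite ltr_pwDl// normc_ge0. exists (Num.min (Num.min d 1) (e / (2 * N))).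
    by rewrite !lt_min d0 ltr01 divr_gt0// mulr_gt0.
  move=> w; rewrite !le_min => /andP[/andP[wd w1] we]. rewrite /K eqxx; case: eqVneq => [_|wx']; first by rewrite subrr normc_real normr0 ltW.
  have wx0 : w - x%:C != 0 by rewrite subr_eq0. have n0 : 0 < normc (w - x%:C).
    by rewrite lt_def normc_ge0 andbT; apply/eqP => /Normc.eq0_normc/eqP; rewrite (negbTE wx0).
  have -> : K0 w - x%:C * D = w * ((f w - f x%:C - D * (w - x%:C)) / (w - x%:C)) + (w - x%:C) * D.
    by rewrite /K0 fx; field.
  apply: (le_trans (normcD _ _)); rewrite !normcM normc_inv. have b1 : normc (f w - f x%:C - D * (w - x%:C)) / normc (w - x%:C) <= e'.
    by rewrite ler_pdivrMr//; exact: hd.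
  have b2 : normc w <= r.
    by have := normcD (w - x%:C) x%:C; rewrite subrK normc_real /r; lra.
  have b3 : normc (w - x%:C) * normc D <= e / 2.
    have : e / (2 * N) * N = e / 2 by field; rewrite gt_eqF. move=> <-; apply: ler_pM => //; rewrite ?normc_ge0// /N; lra.
  have b4 : normc w * (normc (f w - f x%:C - D * (w - x%:C)) / normc (w - x%:C)) <= e / 2.
    have : r * e' = e / 2 by rewrite /e'; field; rewrite gt_eqF. by move=> <-; apply: ler_pM => //; rewrite ?divr_ge0 ?normc_ge0.
  by lra.
have K00 : K 0 = 0.
  rewrite /K; case: eqP => [<-|_]; by rewrite /K0 ?mul0r.
pose G N (z : R[i]) := (f z - a%:C) * ((x%:C) ^+ N * (z ^+ N)^-1) * (z * (z - x%:C)^-1). have cG N : continuous (fun t => re (G N (cexp s t))).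
  apply: continuous_circle => t; apply: derivable_ccont. have nx : cexp s t != x%:C by apply: wx; rewrite normc_cexp.
  apply: derivableM; last by apply: derivableM; [exact: did|exact: dinv]. apply: derivableM; first exact: derivable_sub_cst.
  by apply: derivableM; [exact: derivable_cst|apply: derivable_pow; exact: cexp_neq0].
pose A N := \int[mu]_(t in `[0, (2 * pi)]) re (G N (cexp s t)). have A0 : A 0%N = 0.
  have := @circle_mean0 K x%:C r cK dK K00 (ltW r0); rewrite /circle_mean => <-. apply: eq_Rintegral => t _; rewrite -es -cexp_polar /K.
  have /negbTE -> : cexp s t != x%:C by apply: wx; rewrite normc_cexp. by congr re; rewrite /G /K0 !expr0 invr1 !mulr1 mulrCA mulrA.
pose c n := \int[mu]_(t in `[0, (2 * pi)]) re ((f (cexp s t) - a%:C) * (cexp s t ^+ n)^-1).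
have cc n : continuous (fun t => re ((f (cexp s t) - a%:C) * (cexp s t ^+ n)^-1)).
  apply: (@continuous_circle (fun z => (f z - a%:C) * (z ^+ n)^-1)) => t; apply: derivable_ccont.
  by apply: (derivableM (@derivable_sub_cst _ _)); apply: derivable_pow; exact: cexp_neq0.
have AS N : A N = x ^+ N * c N + A N.+1.
  rewrite /A /c -RintZ// -RintD//; last by move=> t; apply: cvgM; [exact: cvg_cst|exact: cc]. apply: eq_Rintegral => t _; set w := cexp s t.
  have w0 : w != 0 by exact: cexp_neq0. have wx0 : w - x%:C != 0 by rewrite subr_eq0; apply: wx; rewrite normc_cexp.
  rewrite -Re_real_mul -raddfD; congr re; rewrite /G rmorphXn !exprS. have wN : w ^+ N != 0 by rewrite expf_neq0. by field; rewrite w0 wx0 wN.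
have sumA N : \sum_(n < N) x ^+ n * c n = - A N.
  elim: N => [|N IH]; first by rewrite big_ord0 A0 oppr0. by rewrite big_ord_recr/= IH [A N]AS; ring.
have cE n : c n = 2 * pi * (taylor_coef n - (n == 0)%:R * a).
  have -> : c n = \int[mu]_(t in `[0, (2 * pi)]) re (f (cexp s t) / cexp s t ^+ n) - a * \int[mu]_(t in `[0, (2 * pi)]) re ((cexp s t ^+ n)^-1).
    rewrite -RintZ; last exact: ci. rewrite -RintB; [|exact: continuous_scaled_circle|by move=> t; apply: cvgM; [exact: cvg_cst|exact: ci]].
    by apply: eq_Rintegral => t _; rewrite -Re_real_mul -raddfB mulrBl.
  rewrite (circle_mean_pow n s 0 df) /taylor_coef. have tE (u I b : R) : u != 0 -> u * (u^-1 * I - b) = I - u * b by move=> u0; field.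
  rewrite tE; last by rewrite gt_eqF. congr (_ - _). case: n => [|n]; last by rewrite circle_int_pow//= mul0r !mulr0.
  under eq_Rintegral do rewrite expr0 invr1/=. by rewrite Rint_cst ?(ltW pi20)//= mul1r subr0 mul1r mulrC.
have [M hM] := ccont_bounded r (fun z => derivable_ccont (@derivable_sub_cst a%:C z)).
have M0 : 0 <= M by apply: le_trans (normc_ge0 _) (hM 0 _); rewrite normc_real normr0 ltW. have AN N : `|A N| <= 2 * pi * (M * r) * (`|x| / r) ^+ N.
  have -> : 2 * pi * (M * r) * (`|x| / r) ^+ N = (M * r * (`|x| / r) ^+ N) * (2 * pi - 0) by ring. apply: Rint_bound; [exact: ltW|exact: cG|move=> t _].
  apply: (le_trans (normr_Re _)); rewrite /G !normcM !normc_inv !normcX normc_real normc_cexp es. have n1 : 1 <= normc (cexp s t - x%:C).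
    have := normcD (cexp s t - x%:C) x%:C; rewrite subrK normc_cexp es normc_real /r; lra.
  have n2 : r / normc (cexp s t - x%:C) <= r.
    by rewrite ler_pdivrMr ?(lt_le_trans ltr01)// ler_peMr// ltW.
  have -> : M * r * (`|x| / r) ^+ N = M * (`|x| ^+ N / r ^+ N) * r.
    by rewrite expr_div_n; ring.
  have q0 : 0 <= `|x| ^+ N / r ^+ N by rewrite divr_ge0 ?exprn_ge0 ?(ltW r0). apply: ler_pM => //.
  - by rewrite mulr_ge0 ?normc_ge0.
  - by rewrite divr_ge0 ?normc_ge0 ?(ltW r0).
  - by apply: ler_wpM2r => //; apply: hM; rewrite normc_cexp es.
have xr1 : `| `|x| / r| < 1 by rewrite ger0_norm ?divr_ge0 ?(ltW r0)// ltr_pdivrMr// mul1r.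
have main N : `|series (fun n => taylor_coef n * x ^+ n) N.+1 - a| <= (M * r) * (`|x| / r) ^+ N.+1.
  have <- : - A N.+1 / (2 * pi) = series (fun n => taylor_coef n * x ^+ n) N.+1 - a.
    apply: (@mulIf _ (2 * pi)); first by rewrite gt_eqF. rewrite divfK ?gt_eqF// -sumA.
    rewrite /series/= big_mkord mulrBl mulr_suml big_ord_recl/= [in RHS]big_ord_recl/= !expr0 cE/=.
    rewrite [X in _ + X](_ : _ = \sum_(i < N) taylor_coef (bump 0 i) * x ^+ bump 0 i * (2 * pi)).
      ring.
    by apply: eq_bigr => i _; rewrite cE/= mul0r subr0; ring.
  rewrite normrM normrN normfV (gtr0_norm pi20) ler_pdivrMr//. by apply: (le_trans (AN _)); rewrite le_eqVlt; apply/orP; left; apply/eqP; ring.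
rewrite -/a -cvg_shiftS; apply/cvgrPdist_le => e e0. have := @cvg_geometric R (M * r) (`|x| / r) xr1; rewrite -cvg_shiftS => /cvgrPdist_le/(_ _ e0).
apply: filterS => N; rewrite sub0r normrN => h. rewrite distrC; apply: (le_trans (main N)); apply: le_trans h; exact: ler_norm.
Qed.

End power_series.

(** Bessel's inequality in linear form: if m is the circle average of g = r^n Re(q / w^n), then 2 m
    g - m^2 <= g^2 <= |q|^2 pointwise, and the left-hand side averages to m^2. The bound on the sum
    of squares over a circle thus becomes decay of the coefficient variances. *)
Lemma taylor_sum_bound (q : nat -> R[i] -> R[i]) (r B : R) (J n : nat) : 0 < r ->
  (forall j z, derivable (q j : C -> C) z 1) ->
  (forall z, normc z = r -> \sum_(j < J) normc (q j z) ^+ 2 <= B) ->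
  (\sum_(j < J) taylor_coef (q j) n ^+ 2) * r ^+ (2 * n) <= B.
Proof.
move=> r0 dq hB; pose s := ln r; have es : expR s = r by rewrite lnK. have pi20 : 0 < 2 * pi :> R by rewrite mulr_gt0// pi_gt0.
pose g j t := r ^+ n * re (q j (cexp s t) / cexp s t ^+ n). have cg j : continuous (g j).
  by move=> t; apply: cvgM; [exact: cvg_cst|exact: (continuous_scaled_circle (dq j))].
pose m j := r ^+ n * taylor_coef (q j) n. have mE j : \int[mu]_(t in `[0, (2 * pi)]) g j t = 2 * pi * m j.
  rewrite RintZ; last exact: (continuous_scaled_circle (dq j)). rewrite (circle_mean_pow n s 0 (dq j)) /m /taylor_coef.
  by rewrite mulrCA (mulrA (2 * pi)) divff ?gt_eqF// mul1r.
have -> : (\sum_(j < J) taylor_coef (q j) n ^+ 2) * r ^+ (2 * n) = \sum_(j < J) m j ^+ 2.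
  by rewrite mulr_suml; apply: eq_bigr => j _; rewrite /m [in RHS]exprMn -exprM mulrC (mulnC n).
pose h j t := 2 * m j * g j t - m j ^+ 2. have ch j : continuous (h j).
  by move=> t; apply: cvgB; [apply: cvgM; [exact: cvg_cst|exact: cg]|exact: cvg_cst].
have [cH HE] := @Rint_sum J h 0 (2 * pi) (ltW pi20) ch. have hE j : \int[mu]_(t in `[0, (2 * pi)]) h j t = 2 * pi * m j ^+ 2.
  rewrite RintB; [|by move=> t; apply: cvgM; [exact: cvg_cst|exact: cg]|by move=> t; exact: cvg_cst]. by rewrite RintZ// mE Rint_cst ?(ltW pi20)//; ring.
have : 0 <= \int[mu]_(t in `[0, (2 * pi)]) (B - \sum_(j < J) h j t).
  apply: Rintegral_ge0 => t _; rewrite subr_ge0. apply: (@le_trans _ _ (\sum_(j < J) normc (q j (cexp s t)) ^+ 2)); last first.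
    by apply: hB; rewrite normc_cexp.
  apply: ler_sum => j _; apply: (@le_trans _ _ (g j t ^+ 2)).
    by have := sqr_ge0 (g j t - m j); rewrite /h sqrrB; lra.
  rewrite -[leLHS]real_normK ?num_real// ler_sqr ?nnegrE ?normc_ge0//. rewrite /g normrM gtr0_norm ?exprn_gt0//.
  have := normr_Re (q j (cexp s t) / cexp s t ^+ n). rewrite normcM normc_inv normcX normc_cexp es ler_pdivlMr ?exprn_gt0//. by rewrite mulrC.
rewrite RintB//; last by move=> t; exact: cvg_cst. rewrite HE Rint_cst ?(ltW pi20)//. under eq_bigr do rewrite hE.
by rewrite -mulr_sumr subr0 mulrC -mulrBr pmulr_rge0// subr_ge0.
Qed.

End entire.

Lemma cvg_ord_sum (R : realType) (u : nat -> nat -> R) (v : nat -> R) N :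
  (forall n, u J n @[J --> \oo] --> v n) ->
  \sum_(n < N) u J n @[J --> \oo] --> \sum_(n < N) v n.
Proof.
move=> cu; elim: N => [|N IH].
  by rewrite big_ord0; under eq_fun do rewrite big_ord0; exact: cvg_cst.
rewrite big_ord_recr/=; under eq_fun do rewrite big_ord_recr/=. by apply: cvgD; [exact: IH|exact: cu].
Qed.

Lemma tannery (R : realType) (u : nat -> nat -> R) (v : nat -> R) B :
  (forall J n, `|u J n| * 2 ^+ n <= B) -> (forall n, u J n @[J --> \oo] --> v n) ->
  limn (series (u J)) @[J --> \oo] --> limn (series v).
Proof.
move=> hu cu. have hv n : `|v n| * 2 ^+ n <= B.
  have h : `|u J n| * 2 ^+ n @[J --> \oo] --> `|v n| * 2 ^+ n.
    by apply: cvgM; [apply: cvg_norm; exact: cu|exact: cvg_cst].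
  by apply: (cvg_le_cst h) => J; exact: hu.
have B0 : 0 <= B by apply: le_trans (hv 0%N); rewrite mulr_ge0. have tail (w : nat -> R) N : (forall n, `|w n| * 2 ^+ n <= B) ->
    `|limn (series w) - series w N| <= 2 * B / 2 ^+ N.
  move=> hw; have cw := (geometric_summable hw).2. have h : `|series w m - series w N| @[m --> \oo] --> `|limn (series w) - series w N|.
    by apply: cvg_norm; apply: cvgB; [exact: cw|exact: cvg_cst].
  have /cvg_lim <- // := h; apply: limr_le; first by apply/cvg_ex; eexists; exact: h.
  exists N => // m /= Nm; rewrite sub_series_geq//; apply: (le_trans (ler_norm_sum _ _ _)). apply: (@le_trans _ _ (\sum_(N <= k < m) B / 2 ^+ k)).
    by apply: ler_sum => k _; rewrite ler_pdivlMr ?exprn_gt0.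
  have e p : \sum_(N <= k < N + p) B / 2 ^+ k = 2 * B / 2 ^+ N - 2 * B / 2 ^+ (N + p).
    elim: p => [|p IH]; first by rewrite addn0 big_geq// subrr. rewrite addnS big_nat_recr ?leq_addr//= IH exprS; field. by rewrite !expf_neq0.
  by rewrite -(subnKC Nm) e gerBl divr_ge0 ?mulr_ge0 ?exprn_ge0.
apply/cvgrPdist_le => e e0. have [N hN] : exists N, 2 * B / 2 ^+ N <= e / 3.
  have := @cvg_geometric R (2 * B) (2^-1); rewrite ger0_norm ?invr_ge0// invf_lt1// ltr1n => /(_ isT).
  move=> /cvgrPdist_le/(_ (e / 3)); rewrite divr_gt0// => /(_ isT) [N _ hN]. exists N; have := hN N (leqnn _); rewrite /geometric/= sub0r normrN exprVn.
  by apply: le_trans; exact: ler_norm.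
have cS : series (u J) N @[J --> \oo] --> series v N.
  rewrite /series/= big_mkord; under eq_fun do rewrite big_mkord. exact: cvg_ord_sum.
have e3 : 0 < e / 3 by rewrite divr_gt0. move/cvgrPdist_le : cS => /(_ _ e3); apply: filterS => J hJ.
have h1 := le_trans (tail v N hv) hN; have h2 := le_trans (tail _ N (hu J)) hN. move: hJ h1 h2; rewrite !ler_norml => /andP[? ?] /andP[? ?] /andP[? ?]; lra.
Qed.

(** * The Gaussian analytic function as a random entire series *)

Section gaf_series.
Context d (T : measurableType d) (R : realType)
  (P : probability T R) (Q : real_gaf P).
Local Notation C := (R[i])^o.
Local Notation re := (@complex.Re R).
Local Notation im := (@complex.Im R).
Local Notation normc := (@Normc.normc R).
Local Notation X := (fun j => gaf_coef Q j : T -> R).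
Local Notation q := (gaf_fun Q).

Let dq j z : derivable (q j : C -> C) z 1. Proof. exact: gaf_entire. Qed.
Let qR j (x : R) : im (q j x%:C) = 0. Proof. exact: gaf_real. Qed.

Definition gaf_array n j := taylor_coef (q j) n.

(** Past some rank the partial sums are within 1 of their limit on a compact square, hence within 2
    of one fixed partial sum. *)
Lemma gaf_sum_bounded (r : R) : exists B, forall J z, normc z <= r ->
  \sum_(j < J) normc (q j z) ^+ 2 <= B.
Proof.
have [S hS] := gaf_unif Q. pose K : set C := (fun p : R * R => (p.1 +i* p.2 : C)) @` square r. have := hS K (@compact_complex_square R r).
move=> /(_ [set f : C -> R | forall z, K z -> `|S z - f z| < 1]) [].
  apply/uniform_nbhs; exists [set p : R * R | ball p.1 1 p.2]; split.
    by exists 1 => //=.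
  by move=> f hf z Kz; exact: hf.
move=> N _ hN. have bd j : exists M, forall z, normc z <= r -> normc (q j z) <= M.
  by apply: ccont_bounded => z; exact: derivable_ccont (@dq j z).
have [M hM] := choice bd. exists (\sum_(j < N) M j ^+ 2 + 2) => J z zr. have Kz : K z by exact: square_normc. pose J' := maxn J N.
have sub n m : (n <= m)%N -> \sum_(j < n) normc (q j z) ^+ 2 <= \sum_(j < m) normc (q j z) ^+ 2.
  move=> nm; rewrite -!(big_mkord xpredT (fun j => normc (q j z) ^+ 2)) (big_cat_nat (leq0n n) nm)/= lerDl. by apply: sumr_ge0 => j _; exact: sqr_ge0.
apply: (le_trans (sub _ _ (leq_maxl J N))). have h1 := hN _ (leq_maxr J N) z Kz; have h2 := hN _ (leqnn N) z Kz.
have h3 : \sum_(j < N) normc (q j z) ^+ 2 <= \sum_(j < N) M j ^+ 2.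
  apply: ler_sum => j _; rewrite lerXn2r ?nnegrE ?normc_ge0//; last exact: hM. exact: le_trans (normc_ge0 _) (hM j z zr).
by move: h1 h2 h3; rewrite /= !ltr_norml => /andP[? ?] /andP[? ?] ?; lra.
Qed.

Lemma gaf_array_bound (r : R) : 0 < r ->
  exists B, forall n J, (\sum_(0 <= j < J) gaf_array n j ^+ 2) * r ^+ (2 * n) <= B.
Proof.
move=> r0; have [B hB] := gaf_sum_bounded r; exists B => n J. rewrite big_mkord; apply: (@taylor_sum_bound R q r B J n r0 dq) => z zr. by apply: hB; rewrite zr.
Qed.

Let mX j : mfun (X j). Proof. exact: measurable_funP. Qed.

Let indepX : mutually_independent P X. Proof. exact: gaf_indep. Qed.

Let normalX j (A : set R) : measurable A -> P (X j @^-1` A) = normal_prob 0 1 A.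
Proof. by move=> mA; rewrite -(gaf_normal Q j mA). Qed.

Let cos_cvg_real (u : nat -> R) (l : R) : u @ \oo --> l ->
  lim ((fun n => ((u n)%:C : C)) @ \oo) = l%:C.
Proof.
move=> ul; apply: cvg_lim => //; apply/cvgrPdist_le => e /complex_ltP[e' e'0 ->]. move/cvgrPdist_le : ul => /(_ _ e'0); apply: filterS => n h.
by rewrite -[`|_|]/((normc _)%:C) lecR -rmorphB normc_real.
Qed.

(** The normals are set to 0 on the null event outside which all coefficients converge and decay;
    this keeps their characteristic functions and makes every path entire. Off the event, Tannery's
    theorem interchanges the sum over [j] with the power series in x, which identifies the field
    with [gfun]. *)
Lemma gaf_realization : exists2 X' : nat -> T -> R,
  [/\ forall j, mfun (X' j),
      forall n (c : nat -> R) b, \int[P]_w cos (\sum_(j < n) c j * X' j w + b) =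
         expR (- ((\sum_(j < n) c j ^+ 2) / 2)) * cos b &
      regular_array X' gaf_array] &
  exists N, [/\ measurable N, P N = 0%E & forall w, ~ N w -> forall x, gafR Q w x = gfun X' gaf_array w x].
Proof.
have [N [mN PN hN]] := gaussian_power_series_cvg mX indepX normalX gaf_array_bound. pose X' j w := X j w * \1_(~` N) w.
have XE w : ~ N w -> forall j, X' j w = X j w by move=> Nw j; rewrite /X' indicE mem_set// mulr1.
have X0 w : N w -> forall j, X' j w = 0 by move=> Nw j; rewrite /X' indicE memNset ?mulr0.
have bE w : ~ N w -> forall a m J, block X' a m J w = block X a m J w.
  by move=> Nw a m J; apply: eq_bigr => j _; rewrite XE.
have b0 w : N w -> forall a m J, block X' a m J w = 0.
  by move=> Nw a m J; rewrite /block big1// => j _; rewrite X0// mulr0.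
have good w : ~ N w -> (forall n, cvgn (fun J => block X (gaf_array n) 0 J w)) /\
    forall r : R, exists B, forall n J, `|block X (gaf_array n) 0 J w| * r ^+ n <= B.
  by move=> Nw; apply: contrapT => h; apply: Nw; exact: hN.
have mX' j : mfun (X' j).
  by apply: measurable_funM => //; apply: measurable_indic; exact: measurableC.
have ra : regular_array X' gaf_array.
  split.
  - move=> w n; have [Nw|Nw] := pselect (N w).
      by under eq_fun do rewrite b0//; exact: is_cvg_cst.
    by under eq_fun do rewrite bE//; exact: (good w Nw).1.
  - move=> w r; have [Nw|Nw] := pselect (N w).
      by exists 0 => n J; rewrite b0// normr0 mul0r.
    by have [B hB] := (good w Nw).2 r; exists B => n J; rewrite bE.
  - exact: gaf_array_bound.
exists X'; first split => //.
  move=> n c b; rewrite -(normal_sum_cos mX indepX normalX). rewrite /Rintegral; congr fine; apply: (integral_null mN PN) => w Nw.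
  by under eq_bigr do rewrite XE//.
exists N; split => // w Nw x. rewrite /gafR /gaf. have qE j : q j x%:C = (re (q j x%:C))%:C.
  by have := qR j x; case: (q j _) => u v /= ->.
have sE n : \sum_(j < n) (X j w)%:C * q j x%:C = (\sum_(j < n) X j w * re (q j x%:C))%:C.
  by rewrite rmorph_sum/=; apply: eq_bigr => j _; rewrite rmorphM/= -qE.
have h : (\sum_(j < J) X j w * re (q j x%:C)) @[J --> \oo] --> gfun X' gaf_array w x.
  have uE J : \sum_(j < J) X j w * re (q j x%:C) = limn (series (fun n => block X' (gaf_array n) 0 J w * x ^+ n)).
    symmetry; apply: cvg_lim => //. rewrite (_ : series _ = (fun N => \sum_(j < J) X j w * series (fun n => gaf_array n j * x ^+ n) N)).
      apply: (@cvg_ord_sum R (fun N j => X j w * series (fun n => gaf_array n j * x ^+ n) N) (fun j => X j w * re (q j x%:C))) => j.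
      by apply: cvgM; [exact: cvg_cst|exact: (taylor_cvg (@dq j) (@qR j))].
    apply/funext => n; rewrite /series/=; under eq_bigr do rewrite /block mulr_suml. rewrite exchange_big/= big_mkord; apply: eq_bigr => j _; rewrite mulr_sumr.
    by apply: eq_bigr => k _; rewrite XE//; ring.
  under eq_fun do rewrite uE. have [_ hb _] := ra; have [B hB] := hb w (2 * `|x|). apply: (@tannery _ _ _ B) => [J n|n].
    rewrite normrM normrX -mulrA -exprMn [`|x| * 2]mulrC; exact: hB.
  by apply: cvgM; [exact: (coef_cvg ra)|exact: cvg_cst].
under eq_fun do rewrite sE. by rewrite (cos_cvg_real h).
Qed.

End gaf_series.

End complex_analysis.

(** * The hypotheses on the field in terms of the random series *)

Section realized_gaf.
Context d (T : measurableType d) (R : realType)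
  (P : probability T R) (Q : real_gaf P) (X : nat -> T -> R) (N : set T).
Local Notation a := (gaf_array Q).
Hypothesis mX : forall j, mfun (X j).
Hypothesis hX : std_normal_sums P X.
Hypothesis ra : regular_array X a.
Hypothesis mN : measurable N.
Hypothesis PN : P N = 0%E.
Hypothesis hN : forall w, ~ N w -> forall x, gafR Q w x = gfun X a w x.
Local Notation f := (gfun X a).
Local Notation g := (gder X a).

Lemma gafR_derive w x : ~ N w -> derive1 (gafR Q w) x = g w x.
Proof.
move=> nN; have -> : gafR Q w = f w by apply/funext => y; exact: hN. by rewrite derive1E; exact: (@derive_val _ _ _ _ _ _ _ (is_derive_gfun ra w x)).
Qed.

(** Zero variance would make one derivative of the field vanish almost surely: a nontrivial
    combination at a single point with multiplicity l + 1. *)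
Lemma nondegenerate_variance n l x L V : nondegenerate_gaf n Q -> (l < n)%N -> centered_normal P L V ->
  (forall w, ~ N w -> derive1n l (gafR Q w) x = L w) -> 0 < V.
Proof.
move=> hn ln hL hD; have [mL V0 _] := hL; rewrite lt_neqAle V0 andbT; apply/eqP => V00.
apply: (hn 1%N (fun=> x) (fun=> l.+1) _ _ _ (fun _ l' => (l' == l)%:R)) => //.
- by move=> i j _; rewrite !ord1.
- by rewrite big_ord1.
- by exists ord0, l; rewrite ltnSn eqxx oner_eq0.
have := centered_normal_sqr hL; rewrite -V00 => h. have mL2 : mfun (fun w => (L w ^+ 2)%:E) by apply/measurable_EFinP; exact: measurable_funX.
have : (\int[P]_(w in setT) `|(L w ^+ 2)%:E| = 0)%E.
  by apply: etrans h; apply: eq_integral => w _ /=; rewrite ger0_norm// sqr_ge0.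
move/(ae_eq_integral_abs P measurableT mL2) => h0. have hNae : P.-negligible N by apply/negligibleP. apply: (negligibleS _ (negligibleU hNae h0)) => w /= hw.
have [Nw|nN] := pselect (N w); [by left|right => /(_ I)] => L0; apply: hw. rewrite big_ord1 (bigD1 ord_max)//= eqxx mul1r big1 ?addr0.
  by rewrite hD//; case: L0 => /eqP; rewrite sqrf_eq0 => /eqP.
by move=> i il; rewrite (_ : (i == l :> nat) = false) ?mul0r//; apply: contraNF il => /eqP e; apply/eqP/val_inj.
Qed.

Lemma gfun_normal x : exists V, centered_normal P (f ^~ x) V.
Proof.
have [V hV] := lin_normal mX hX ra (exp_bounded_pow (lexx `|x|)); exists V.
by rewrite (_ : f ^~ x = lin X a (fun n => x ^+ n))//; apply/funext => w; rewrite gfun_lin.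
Qed.

Lemma gfun_nondegenerate n x : nondegenerate_gaf n Q -> (0 < n)%N ->
  exists2 V, centered_normal P (f ^~ x) V & 0 < V.
Proof.
move=> hn n0; have [V hV] := gfun_normal x; exists V => //. by apply: (nondegenerate_variance (x := x) hn n0 hV) => w nN /=; exact: hN.
Qed.

Lemma coef_nondegenerate n l : nondegenerate_gaf n Q -> (l < n)%N -> (l < 2)%N ->
  exists2 V, centered_normal P (coef X a l) V & 0 < V.
Proof.
move=> hn ln l2; have [C hC] := coef_normal mX hX ra ltr01; have [V _ hV] := hC l; exists V => //. apply: (nondegenerate_variance (x := 0) hn ln hV) => w nN.
case: l l2 {ln hV} => [|[|//]] _ /=.
  by rewrite hN// /gfun psum0//; exact: coef_ent.
rewrite gafR_derive// /gder psum0; last exact/ent_diffs/coef_ent. by rewrite /pseries_diffs mul1r.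
Qed.

Lemma gaf_stationary : stationary_up_to_factor Q -> forall x0, exists2 Qx : R -> R, (forall t, 0 < Qx t) &
  forall t s, \int[P]_w (Qx t * f w (t + x0) * (Qx s * f w (s + x0))) = \int[P]_w (f w t * f w s).
Proof.
move=> h x0; have [Qx [Qx0 hQ]] := h x0; exists Qx => // t s. have := hQ t s; rewrite !unlock => e. rewrite /Rintegral; congr fine.
rewrite -(integral_null mN PN (f := fun w => (Qx t * gafR Q w (t + x0) * (Qx s * gafR Q w (s + x0)))%:E)); last first.
  by move=> w nN; rewrite !hN.
by rewrite e; apply: (integral_null mN PN) => w nN; rewrite !hN.
Qed.

(** [cumulant] is built from moments, and these do not change when the count is replaced, off a null
    set, by a measurable version. *)
Lemma cumulant_real_zeros m r (Z : T -> R) : 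
  (exists B, [/\ measurable B, P B = 0%E &
    forall w, ~ B w -> counting [set x | 0 <= x <= r /\ f w x = 0] = (Z w)%:E]) ->
  finite_moment P 'I_m Z ->
  (\int[P]_w (real_zeros Q r w ^+ m) < +oo)%E /\
  cumulant P m (real_zeros Q r) = kappa P (fun _ : 'I_m => Z).
Proof.
move=> [B [mB PB hB]] [mZ Z0 hZ]. have e j : (\int[P]_w (real_zeros Q r w ^+ j) = \int[P]_w (Z w ^+ j)%:E)%E.
  apply: (@integral_null _ _ _ P (N `|` B)); [exact: measurableU|exact: null_set_setU|].
  move=> w /not_orP[nN nB]; rewrite EFin_expe; congr (_ ^+ j)%E; rewrite /real_zeros -hB//.
  by congr (counting _); apply/seteqP; split => x /= [h h']; split => //; rewrite -h' hN.
split; first by rewrite e; move: hZ; rewrite card_ord. rewrite /cumulant /kappa /joint_cumulant; apply: eq_bigr => p _; congr (_ * _).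
apply: eq_bigr => C _; rewrite e /joint_moment /Rintegral; congr fine. by apply: eq_integral => w _; rewrite prodr_const.
Qed.

(** The hypothesis concerns exactly [n] points and their exact distance. Here any number of points
    up to [n] is allowed, by padding, and any lower bound [dd] of the distance, by monotonicity of
    [psi]. *)
Lemma gaf_clustering n : clustering n Q -> exists c tau psi,
  [/\ 0 < c, 0 < tau, Psi_fin n psi &
  forall (I : finType) (S : {set I}) (xi x y : I -> R) (dd : R), (#|I| <= n)%N ->
  S != finset.set0 -> ~: S != finset.set0 -> 2 * tau <= dd ->
  (forall i j, i \in S -> j \in ~: S -> dd <= `|xi i - xi j|) ->
  let L (A : {set I}) w := \sum_(i in A) (x i * f w (xi i) + y i * g w (xi i)) in
  `|\int[P]_w (L S w * L (~: S) w)| <=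
    c * psi (dd - tau) * (\int[P]_w (L S w * L S w) + \int[P]_w (L (~: S) w * L (~: S) w))].
Proof.
move=> [c [tau [psi [c0 tau0 hpsi hcl]]]]; exists c, tau, psi; split => //. move=> I S xi x y dd In S0 S1 hd hxi; cbv zeta. set L := fun (A : {set I}) w => _.
(* Surplus indices repeat the point [i0], which leaves the distance unchanged, and [pad] gives them
   zero coefficients. *)
have [i0 i0S] := finset.set0Pn _ S0; have [j0 j0S] := finset.set0Pn _ S1. pose e (j : 'I_n) : I := nth i0 (enum I) j.
have lt_e' i : (index i (enum I) < n)%N by apply: leq_trans In; rewrite cardE index_mem mem_enum. pose e' i : 'I_n := Ordinal (lt_e' i).
have ee' i : e (e' i) = i by rewrite /e /= nth_index// mem_enum. pose pad (u : I -> R) (j : 'I_n) : R := if j == e' (e j) then u (e j) else 0.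
pose pre (A : {set I}) : {set 'I_n} := finset.finset (fun j => e j \in A). have pre_in A j : (j \in pre A) = (e j \in A) by rewrite finset.in_set.
have LE (A : {set I}) w : ~ N w -> linfun_on Q (pad x) (pad y) (xi \o e) (pre A) w = L A w.
  move=> nN; rewrite /linfun_on /L (partition_big e (mem A))/=; last by move=> j; rewrite pre_in.
  apply: eq_bigr => i iA; rewrite (bigD1 (e' i))/=; last by rewrite pre_in ee' iA eqxx. rewrite big1 ?addr0 => [|j /andP[/andP[_ /eqP ej] je]]; last first.
    by rewrite /pad ej (negbTE je) !mul0r addr0.
  by rewrite /pad ee' eqxx hN// gafR_derive.
have preC : pre (~: S) = ~: pre S by apply/setP => j; rewrite finset.in_setC !pre_in finset.in_setC. have ne A : A != finset.set0 -> pre A != finset.set0.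
  by move=> /finset.set0Pn[i iA]; apply/finset.set0Pn; exists (e' i); rewrite pre_in ee'.
have dist : dd <= index_dist (xi \o e) (pre S) (pre (~: S)).
  apply: lb_le_inf.
    exists `|xi (e (e' i0)) - xi (e (e' j0))|; exists (e' i0); first by rewrite /= pre_in ee'. by exists (e' j0) => //=; rewrite pre_in ee'.
  by move=> _ [i /= iS [j /= jS <-]]; apply: hxi; rewrite -pre_in.
have := hcl (pad x) (pad y) (xi \o e) (pre S) (pre (~: S)) (ne _ S0) (ne _ S1).
rewrite preC finset.setICr finset.setUCr -preC => /(_ erefl erefl (le_trans hd dist)). rewrite !unlock.
have gL (A : {set I}) : exists V, centered_normal P (L A) V.
  have [V hV] := jet_normal mX hX ra xi (fun ib => if ib.1 \in A then (if ib.2 then y ib.1 else x ib.1) else 0).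
  suff e0 : (fun w => \sum_ib (if ib.1 \in A then if ib.2 then y ib.1 else x ib.1 else 0) * jet X a xi ib w) = L A.
    by exists V; rewrite -e0.
  apply/funext => w; rewrite /L [RHS]big_mkcond -(pair_big_dep xpredT (fun _ _ => true) (fun i b =>
    (if i \in A then (if b then y i else x i) else 0) * jet X a xi (i, b) w))/=.
  by apply: eq_bigr => i _; rewrite big_bool/= /jet/=; case: ifP => _; rewrite ?mul0r ?addr0// addrC.
have int2 (A B : {set I}) : P.-integrable setT (EFin \o (fun w => L A w * L B w)).
  by have [VA hA] := gL A; have [VB hB] := gL B; exact: centered_normal_integrable hA hB.
have eE (A B : {set I}) : (\int[P]_w (linfun_on Q (pad x) (pad y) (xi \o e) (pre A) w *
    linfun_on Q (pad x) (pad y) (xi \o e) (pre B) w)%:E = (\int[P]_w (L A w * L B w)%R)%:E)%E.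
  rewrite /Rintegral fineK; last by apply: integrable_fin_num => //; exact: int2. by apply: (integral_null mN PN) => w nN; rewrite !LE.
have eN A : (\int[P]_w (`|linfun_on Q (pad x) (pad y) (xi \o e) (pre A) w| ^+ 2)%:E = (\int[P]_w (L A w * L A w)%R)%:E)%E.
  by rewrite -eE; apply: eq_integral => w _; rewrite real_normK ?num_real// expr2.
rewrite eE !eN abse_EFin -EFinD -EFinM lee_fin => h; apply: (le_trans h). apply: ler_wpM2r.
  by rewrite addr_ge0//; apply: Rintegral_ge0 => w _; rewrite -expr2 sqr_ge0.
by apply: ler_wpM2l; [exact: ltW|have [_ h2 _] := hpsi; apply: h2; lra].
Qed.

End realized_gaf.

(** * Rate of decay for the cumulants of the number of zeros *)

Section gaf_zeros.
Context d (T : measurableType d) (R : realType)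
  (P : probability T R) (Q : real_gaf P) (m : nat).
Hypothesis m0 : (0 < m)%N.

Let kap r := cumulant P m (real_zeros Q r).

(** Stated for each level [n] separately because the rate inherits the [psi] of that level. *)
Lemma zero_cumulants n : (m <= n)%N -> class_A_fin n Q ->
  [/\ forall r, 0 < r -> (\int[P]_w (real_zeros Q r w ^+ m) < +oo)%E,
      forall A : R, exists M, forall r, 0 < r <= A -> `|kap r| <= M &
      diff2_rate kap m n].
Proof.
move=> mn [hnd hst hcl]; have n0 : (0 < n)%N := leq_trans m0 mn. have [X [mX hX ra] [N [mN PN hN]]] := gaf_realization Q.
have n2 : (1 < 2 * n)%N by rewrite mul2n -addnn -[2%N]/(1 + 1)%N leq_add. have hV x := gfun_nondegenerate mX hX ra mN PN hN x hnd (ltnW n2).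
have [V0 hV0 V0_gt0] := coef_nondegenerate mX hX ra mN PN hN hnd (ltnW n2) (isT : 0 < 2)%N.
have [V1 hV1 V1_gt0] := coef_nondegenerate mX hX ra mN PN hN hnd n2 (isT : 1 < 2)%N.
have hfin s t (st : s < t) := zcount_finite_moment mX hX ra hV0 V0_gt0 hV1 V1_gt0 hV m st.
have hadd s u t (su : s < u) (ut : u < t) := zcount_additive mX hX ra hV0 V0_gt0 hV1 V1_gt0 hV su ut. have hstat s t j : s < t -> (0 < j)%N ->
    (\int[P]_w (zcount X (gaf_array Q) s t w ^+ j)%:E = \int[P]_w (zcount X (gaf_array Q) 0 (t - s) w ^+ j)%:E)%E.
  move=> st j0; have [Qx Qx0 hQ] := gaf_stationary mN PN hN hst s. have shift u v u' v' : u < v -> u' = u + s -> v' = v + s ->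
      (\int[P]_w (zcount X (gaf_array Q) u' v' w ^+ j)%:E = \int[P]_w (zcount X (gaf_array Q) u v w ^+ j)%:E)%E.
    by move=> uv -> ->; exact: esym (zcount_moment_shift mX hX ra hV0 V0_gt0 hV1 V1_gt0 hV Qx0 hQ uv j0).
  by apply: shift; rewrite ?subr_gt0 ?add0r ?subrK.
have [c [tau [psi [c0 tau0 [psi0 psi1 ipsi] hL]]]] := gaf_clustering mX hX ra mN PN hN hcl. have phi0 x : 2 * tau <= x -> 0 <= c * psi (x - tau).
  by move=> hx; rewrite mulr_ge0 ?(ltW c0)// psi0//; lra.
pose e (x : R) : R := 4 * (n%:R * 3 ^+ n) * (2 * (c * psi (x - tau))).
have e0 x : 2 * tau <= x -> 0 <= e x by move=> /phi0 h; rewrite /e; do !apply: mulr_ge0 => //; exact: exprn_ge0.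
have hclus s t C A dd st hd hAB CA CA' := @zcount_clustering _ _ _ _ _ _ mX hX ra _ _ hV0 V0_gt0 hV1 V1_gt0 hV
  n tau (fun x => c * psi (x - tau)) phi0 hL m s t C A dd mn st hd hAB CA CA'.
have kapE r : 0 < r -> (\int[P]_w (real_zeros Q r w ^+ m) < +oo)%E /\ kap r = kappa_fun P m (zcount X (gaf_array Q)) r.
  move=> r0; apply: (cumulant_real_zeros mN PN hN); last exact: hfin. refine (@zcount_counting _ _ _ _ _ _ mX hX ra _ _ hV0 V0_gt0 hV1 V1_gt0 hV _ r0).
split.
- by move=> r /kapE[].
- move=> A; have [M hM] := kappa_fun_bounded m0 hfin hadd hstat A; exists M => r hr. by have [_ ->] := kapE r ltac:(by case/andP: hr); exact: hM.
have [K K0 hK] := second_difference m0 hfin hadd hstat e0 hclus. exists (K * (4 * (n%:R * 3 ^+ n) * (2 * c))), tau, (2 * tau), psi; split => //.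
- by rewrite !mulr_ge0// ltW.
- exact: ltW.
- lra.
move=> a b r ha hb r0 hd; have r1 : 0 <= 1 + r by rewrite addr_ge0 ?(ltW r0). have /andP[a0 _] := ha; have /andP[b0 _] := hb.
have -> : diff2 kap a b r = diff2 (kappa_fun P m (zcount X (gaf_array Q))) a b r.
  by rewrite /diff2; congr (_ - _ - _ + _); apply: (kapE _ _).2; rewrite ?addr_gt0.
apply: (le_trans (ler_wpM2r r1 (hK a b r ha hb r0 hd))); rewrite /e. have : 0 <= psi (r / m%:R - tau) by apply: psi0; move: (r / _) hd => q; lra.
(* For m = 1 the bound on the second difference is 0; otherwise the factor 1 + r raises the exponent
   m - 2 to m - 1. *)
move: (psi _) => y y0. case: m m0 hd {hK hfin hclus} => [//|[|m']] _ hd /=.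
  by rewrite mul0r mulr0 mul0r !mulr_ge0// ltW.
by rewrite mul1r [_ ^+ m'.+1]exprS; move: (_ ^+ m') => z; rewrite le_eqVlt; apply/orP; left; apply/eqP; ring.
Qed.

End gaf_zeros.

Theorem theorem1p15 (d : measure_display) (T : measurableType d)
    (R : realType) (P : probability T R) (k : option nat) (Q : real_gaf P)
    (hk : le_index 1 k) (hQ : class_A k Q) (m : nat) (hm : (0 < m)%N)
    (hmk : le_index m k) :
  exists theta lambda : R -> R,
    [/\ bounded_nonneg theta,
        bounded_nonneg lambda,
        forall r : R, 0 < r ->
          (\int[P]_w (real_zeros Q r w ^+ m) < +oo)%E /\
          cumulant P m (real_zeros Q r) = r * theta r + lambda r &
        exists (theta_oo lambda_oo : R) (psi : R -> R),
          [/\ Psi k psi,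
              bigO_at_infinity (fun r : R => theta r - theta_oo)
                (tail_integral psi (m%:Z - 2)) &
              bigO_at_infinity (fun r : R => lambda r - lambda_oo)
                (tail_integral psi (m%:Z - 1))]].
Proof.
(* The level [n] serves to prove convergence; the slope, the constant and the envelope are
   determined by the cumulants. *)
have [n mn hn] : exists2 n, (m <= n)%N & class_A_fin n Q.
  case: k hk hmk hQ => [n|] _ /= hmk hQ; first by exists n.
  by exists m => //; apply: hQ.
have [fin kapb rate] := zero_cumulants hm mn hn.
set kap := fun r => cumulant P m (real_zeros Q r) in kapb rate.
have [th [L hL]] := linear_asymptotics hm kapb mn rate.
set psi := envelope1 kap m in hL; set E := tail_integral psi (m%:Z - 1) in hL.
have hE x : 1 <= x -> 0 <= E x <= E 1 := tail_integral_le1 hm kapb mn rate (x := x).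
have [M1 hM1] := kapb 1.
(* [theta] is the constant slope [th] and the whole remainder goes into [lambda], which is given the
   value 0 at r = 0, where no identity is claimed. *)
pose lam r := if 0 < r then kap r - r * th else 0.
have p2 : 0 <= 2 ^+ m.-1 :> R by rewrite exprn_ge0.
have M10 : 0 <= M1 by apply: le_trans (hM1 1 _); rewrite ?normr_ge0// ltr01 lexx.
have /andP[E10 _] := hE 1 (lexx _).
have pE : 0 <= 2 ^+ m.-1 * E 1 by rewrite mulr_ge0.
exists (fun=> th), lam; split.
- by exists `|th| => r _.
- exists (M1 + `|th| + `|L| + 2 ^+ m.-1 * E 1) => r r0; have t0 := normr_ge0 th; have l0 := normr_ge0 L.
  rewrite /lam; case: ifPn => [{}r0|_]; last by rewrite normr0 !addr_ge0.
  have [r1|/ltW r1] := leP r 1.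
    apply: (le_trans (ler_normB _ _)); have := hM1 r; rewrite r0 r1 => /(_ isT) hr.
    have : `|r * th| <= `|th| by rewrite normrM ger0_norm ?ler_piMl// ltW.
    by lra.
  have h := hL r r1; have /andP[_ h'] := hE r r1.
  have h3 := ler_wpM2l p2 h'; have h4 := ler_normD (kap r - r * th - L) L.
  by rewrite subrK in h4; lra.
- by move=> r r0; split; [exact: fin|rewrite /lam r0 addrC subrK].
exists th, L, psi; split.
(* The same envelope satisfies each moment condition thanks to the rate of the corresponding level;
   for [None], level max(m, n') covers both m and n'. *)
- case: k hk hmk hQ => [n'|] /= _ hmk hQ'.
    have [_ _ rate'] := zero_cumulants hm hmk hQ'; refine (Psi_fin_envelope1 hm kapb rate (leqnn _) rate').
  move=> n' n'0; have hmax : (m <= maxn m n')%N := leq_maxl _ _.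
  have [_ _ rate'] := zero_cumulants hm hmax (hQ' _ (leq_trans hm hmax)).
  refine (Psi_fin_envelope1 hm kapb rate (leq_maxr m n') rate').
- by exists 0; apply: nearW => r; rewrite subrr normr0 mul0r.
exists (2 ^+ m.-1); near=> r; have r1 : 1 <= r by near: r; exact: nbhs_pinfty_ge.
have /andP[Er _] := hE r r1.
by rewrite [X in _ * X]ger0_norm// /lam ifT ?(lt_le_trans ltr01 r1)//; exact: hL.
Unshelve. all: by end_near. Qed.
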